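(* Let $n\ge 1$ be an integer, let $2\le p<\infty$, $q=p/(p-1)$, and let $B,D\in GL(n,\mathbb{R})$. Let $$K_p(B,D)=\left\{(x,y)\in\mathbb{R}^{n}\times\mathbb{R}^n:\ \|Bx\|_p^p+\|Dy\|_p^p\le 1\right\}\subset\mathbb{R}^{2n}.$$ Then, with respect to the standard symplectic form $\omega=\sum_{j=1}^n dx_j\wedge dy_j$, $$c_{EHZ}(K_p(B,D))=c_Z(K_p(B,D))=\frac{c_0(p)}{\|BD^T\|_{\ell_q^n\to\ell_p^n}}=\frac{4\,\Gamma(1+1/p)^2}{\Gamma(1+2/p)\,\|BD^T\|_{\ell_q^n\to\ell_p^n}}.$$ Moreover, every normalized symplectic capacity $c$ satisfies $$c(K_p(B,D))\le c_Z(K_p(B,D))=\frac{c_0(p)}{\|BD^T\|_{\ell_q^n\to\ell_p^n}}.$$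
   Context: Coordinates on $\mathbb{R}^{2n}$ are ordered $(x_1,\ldots,x_n,y_1,\ldots,y_n)$, with $\omega=\sum_j dx_j\wedge dy_j$. $\|\cdot\|_p$ is the $\ell_p$ norm on $\mathbb{R}^n$, and for a real $n\times n$ matrix $C$, $\|C\|_{\ell_q^n\to\ell_p^n}=\max_{\xi\in\mathbb{R}^n\setminus\{0\}}\|C\xi\|_p/\|\xi\|_q$. $c_0(p)$ denotes the area of $B_p^2=\{(s,t)\in\mathbb{R}^2:|s|^p+|t|^p\le1\}$, which equals $4\Gamma(1+1/p)^2/\Gamma(1+2/p)$; $\Gamma$ is the Gamma function. A normalized symplectic capacity is a map $c$ from subsets of $\mathbb{R}^{2n}$ to $[0,\infty]$ such that: $c(U)\le c(V)$ whenever $U$ embeds symplectically into $V$ (an embedding of a subset meaning the restriction of a symplectic embedding of an open neighborhood of it); $c(\lambda U)=\lambda^2c(U)$ for $\lambda>0$; and $c$ of the Euclidean unit ball and $c$ of the cylinder $\{x_1^2+y_1^2<1\}$ both equal $\pi$. The cylindrical capacity $c_Z(K)$ is the infimum of $\pi R^2$ over all $R>0$ such that some open neighborhood of $K$ embeds symplectically into $Z_R=\{(x,y)\in\mathbb{R}^{2n}:x_1^2+y_1^2<R^2\}$. The Ekeland--Hofer--Zehnder capacity $c_{EHZ}(K)$ of a convex body $K$ with sufficiently smooth boundary is the minimum of $\left|\tfrac12\int\omega(\gamma,\dot\gamma)\,dt\right|$ over all closed characteristics $\gamma$ on $\partial K$, i.e. closed curves in $\partial K$ whose velocity spans, at each point,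 the kernel line of $\omega$ restricted to the tangent space of $\partial K$. *)

(* Defs.v *)
From HB Require Import structures.
From mathcomp Require Import all_boot all_order all_algebra.
From mathcomp Require Import all_classical all_reals all_analysis.

Set Implicit Arguments.
Unset Strict Implicit.
Unset Printing Implicit Defensive.

Import Order.TTheory GRing.Theory Num.Theory numFieldNormedType.Exports.

Local Open Scope classical_set_scope.
Local Open Scope ring_scope.

(* R^{2n}: the pair (x, y) stands for (x_1, ..., x_n, y_1, ..., y_n). *)
Notation phase R n := ('cV[R]_n * 'cV[R]_n)%type.

Section Lp.
Context {R : realType}.

Definition lpnorm (n : nat) (p : R) (x : 'cV[R]_n) : R :=
  (\sum_(i < n) `|x i ord0| `^ p) `^ p^-1.

(* For n > 0 the set is nonempty and the supremum is a maximum, by homogeneity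
   and compactness of the unit sphere. *)
Definition opnorm (n : nat) (q p : R) (C : 'M[R]_n) : R :=
  sup [set lpnorm p (C *m xi) / lpnorm q xi | xi in [set xi | xi != 0]].

Definition lp_disc (p : R) : set (R * R) :=
  [set st : R * R | `|st.1| `^ p + `|st.2| `^ p <= 1].

Definition c0 (p : R) : R :=
  fine ((@lebesgue_measure R \x @lebesgue_measure R)%E (lp_disc p)).

Definition Gamma (s : R) : R :=
  \int[@lebesgue_measure R]_(t in `]0, +oo[) (t `^ (s - 1) * expR (- t)).

Definition Kp (n : nat) (p : R) (B D : 'M[R]_n) : set (phase R n) :=
  [set z : phase R n | lpnorm p (B *m z.1) `^ p + lpnorm p (D *m z.2) `^ p <= 1].

End Lp.

Section Smooth.
Context {R : realType}.

(* Meaningful for U open. *)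
Fixpoint Ck (k : nat) (V W : normedModType R) (U : set V) (f : V -> W) : Prop :=
  match k with
  | 0 => forall x, U x -> {for x, continuous f}
  | k'.+1 => (forall x, U x -> differentiable f x) /\
             forall v : V, Ck k' U (fun x => 'd f x v)
  end.

Definition smooth (V W : normedModType R) (U : set V) (f : V -> W) : Prop :=
  forall k, Ck k U f.

End Smooth.

Section Symplectic.
Context {R : realType} {n : nat}.

Definition omega (u v : phase R n) : R :=
  \sum_(j < n) (u.1 j ord0 * v.2 j ord0 - u.2 j ord0 * v.1 j ord0).

(* phi is a total function of which only the restriction to O matters; the
   last conjunct says that this restriction is injective and a homeomorphism
   onto its image, and the preceding one forces its differential to be
   invertible. *)
Definition symplectic_embedding (O : set (phase R n))
    (phi : phase R n -> phase R n) : Prop :=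
  [/\ open O, smooth O phi,
      (forall z, O z -> forall u v, omega ('d phi z u) ('d phi z v) = omega u v) &
      exists psi : phase R n -> phase R n,
        (forall z, O z -> psi (phi z) = z) /\
        {within phi @` O, continuous psi}].

Definition embeds_symplectically (U V : set (phase R n)) : Prop :=
  exists (O : set (phase R n)) (phi : phase R n -> phase R n),
    [/\ U `<=` O, symplectic_embedding O phi & phi @` U `<=` V].

Definition unit_ball : set (phase R n) :=
  [set z : phase R n | \sum_(j < n) (z.1 j ord0 ^+ 2 + z.2 j ord0 ^+ 2) < 1].

Definition boundary (K : set (phase R n)) : set (phase R n) :=
  closure K `\` interior K.

(* Velocities at z of curves in S; for a C^1 hypersurface S this is the usual
   tangent space at z. *)
Definition tangent_space (S : set (phase R n)) (z : phase R n) :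
    set (phase R n) :=
  [set v | exists c : R -> phase R n,
     [/\ c 0 = z, \forall t \near 0, S (c t) & is_derive (0 : R) 1 c v]].

Definition omega_kernel (S : set (phase R n)) (z : phase R n) :
    set (phase R n) :=
  [set v | tangent_space S z v /\
           forall w, tangent_space S z w -> omega v w = 0].

(* A closed curve is a C^1 map g on the real line with period T > 0, not
   necessarily minimal. *)
Definition closed_characteristic (K : set (phase R n))
    (g : R -> phase R n) (T : R) : Prop :=
  [/\ 0 < T /\ (forall t, g (t + T) = g t),
      (forall t, derivable g t 1) /\ continuous (derive1 g),
      (forall t, boundary K (g t)) &
      forall t, derive1 g t != 0 /\
        omega_kernel (boundary K) (g t) = range (fun s : R => s *: derive1 g t)].

Definition action (g : R -> phase R n) (T : R) : R :=
  2^-1 * \int[@lebesgue_measure R]_(t in `[0, T]) omega (g t) (derive1 g t).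

Definition characteristic_actions (K : set (phase R n)) : set (\bar R) :=
  [set a | exists g T, closed_characteristic K g T /\ a = `|action g T|%:E].

(* This is the minimum of the actions exactly when it belongs to
   characteristic_actions K. *)
Definition cEHZ (K : set (phase R n)) : \bar R :=
  ereal_inf (characteristic_actions K).

End Symplectic.

(* The distinguished pair of coordinates (x_1, y_1) requires dimension n >= 1,
   written n.+1. *)
Section Capacities.
Context {R : realType} {n : nat}.

Definition cylinder (r : R) : set (phase R n.+1) :=
  [set z : phase R n.+1 | z.1 ord0 ord0 ^+ 2 + z.2 ord0 ord0 ^+ 2 < r ^+ 2].

Definition cZ (K : set (phase R n.+1)) : \bar R :=
  ereal_inf [set (pi * r ^+ 2)%:E | r in
    [set r | 0 < r /\ exists (O : set (phase R n.+1)) (phi : _ -> _),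
       [/\ K `<=` O, symplectic_embedding O phi & phi @` O `<=` cylinder r]]].

Record normalized_capacity (c : set (phase R n.+1) -> \bar R) : Prop := {
  capacity_ge0 : forall U, (0 <= c U)%E;
  capacity_mono : forall U V, embeds_symplectically U V -> (c U <= c V)%E;
  capacity_scale : forall (a : R) U, 0 < a ->
    c [set a *: z | z in U] = ((a ^+ 2)%:E * c U)%E;
  capacity_ball : c unit_ball = pi%:E;
  capacity_cylinder : c (cylinder 1) = pi%:E
}.

End Capacities.

(* Main.v *)
Require Import Defs.
From HB Require Import structures.
From mathcomp Require Import all_boot all_order all_algebra.
From mathcomp Require Import all_classical all_reals all_analysis.
From mathcomp Require Import measurable_realfun ring lra zify.

Set Implicit Arguments.
Unset Strict Implicit.
Unset Printing Implicit Defensive.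

Import Order.TTheory GRing.Theory Num.Theory numFieldNormedType.Exports.

Local Open Scope classical_set_scope.
Local Open Scope ring_scope.

(** Let [M] be the operator norm of [B D^T] and [c0] the area of
    [|s|^p + |t|^p <= 1].

    Closed curves on the boundary.  With [a = B x] and [b = D y], a closed
    characteristic is, up to its parametrisation, a periodic solution of
    [a' = l C phi(b)], [b' = - l C^T phi(a)], where [C = B D^T],
    [phi(v) = |v|^(p-2) v] and [l > 0], and its action is half the integral of
    [l].  In each coordinate a comparison of the curve [(a_i, G_i)] with the
    upper and lower arcs of the [l_p] circle gives a sharp isoperimetric
    inequality; the coordinates are summed with Minkowski's inequality and the
    two halves multiplied, which is where [2 <= p] enters.  Hence the action is
    at least [c0 / M], with equality in the plane spanned by a pair of vectors
    that maximise [<phi(u), C phi(v)>].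

    Non-squeezing.  If a neighbourhood of the body embeds into a cylinder with
    [pi r^2 < c0 / M], push a steep function of the gauge of the body forward
    and extend it by a quadratic form whose slope in the first plane slightly
    exceeds [2 pi].  The action functional is discretised on loops with
    positions on a grid and momenta on the half-integer grid, so that Fourier
    modes diagonalise its quadratic part.  It has a linking geometry, and the
    Poincare-Miranda theorem applied to a truncated gradient flow produces
    almost critical points; their limit is a periodic orbit of positive action.
    Such an orbit lies in the image of the body and pulls back to a closed
    curve which is too short for the isoperimetric inequality.

    Squeezing.  A pair of vectors attaining [M] provides two conjugate linear
    coordinates in which the body projects into [|x|^p + (M |y|)^p <= 1].  They
    extend to a linear symplectic map, after which a planar area-preserving map
    sends a slightly larger smooth region into a disc: [x] is mapped to
    [r sin (theta x)], where [theta] matches the areas to the left of [x].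

    The value of [c0] comes from integrating [exp (- |s|^p - |t|^p)] in two
    ways, as a product and by layers. *)

(** [capacity_bound] is stated for any periodic solution with positive speed [l], since it serves
    twice: it bounds closed characteristics, and it excludes the orbits produced by the variational
    argument. The constants 2 pi, 8 and 2 of that argument come from the discrete spectrum: on every
    grid the first positive eigenvalue lies in [4, 2 pi] and the second is at least 8. A slope in (2
    pi, 8) in the plane of the cylinder and at most 2 elsewhere therefore avoids the spectrum by a
    margin independent of the grid. This margin gives the bounds that survive the limit, and it
    makes the action negative along one positive mode, the extra direction of the linking box. The
    Hamiltonian of the body is a function of the power 2/p of the gauge, homogeneous of degree 2:
    rescaled to the unit level, a 1-periodic orbit has the absolute slope as its action, and the
    slopes stay below [c0 / M]. For general p the gauge has only finitely many derivatives, so the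
    dynamics is done with C^1 Hamiltonians, and smoothness of all orders is needed only for the
    explicit map into a cylinder. *)

Ltac positivity := repeat first
  [ done | assumption | lra | apply: mulr_gt0 | apply: mulr_ge0 | rewrite invr_gt0
  | rewrite invr_ge0 | apply: addr_gt0 | apply: addr_ge0 | apply: exprn_gt0
  | apply: exprn_ge0 | exact: sqr_ge0 | exact: powR_ge0 | exact: normr_ge0
  | by apply: ltW | by rewrite ltr0n ].

(** * The Poincare-Miranda theorem *)

Section GridChains.
Variables (T : eqType) (s : T -> (T -> nat) -> bool).
Implicit Types (u v : T -> nat) (A L ds : seq T).

Local Notation "\xsum_ ( i <- r ) F" := (\big[addb/false]_(i <- r) F)
  (at level 41, F at level 41, i, r at level 50).

Definition grid_upd j k u : T -> nat := fun i => if i == j then k else u i.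
Definition grid_bump j u : T -> nat := fun i => (u i + (i == j))%N.

(** An order of the directions is a Kuhn simplex of a grid cell: the path that takes the unit steps
    one by one. Sums over such orders count simplices modulo 2. *)
Fixpoint permsum k A (g : seq T -> bool) : bool :=
  if k is k'.+1 then \xsum_(j <- A) permsum k' (rem j A) (fun r => g (j :: r))
  else g [::].

(** The cup product modulo 2 of the coboundaries of the labels [s l], evaluated on the simplex that
    starts at [v] and follows [ds]. Surplus directions are ignored, so the same expression also
    stands for the face that omits the last vertex. *)
Fixpoint chain_prod L v ds : bool :=
  match L, ds with
  | l :: L', d :: ds' =>
      (s l (grid_bump d v) (+) s l v) && chain_prod L' (grid_bump d v) ds'
  | _, _ => true
  end.

Fixpoint cubesum K A (F : (T -> nat) -> bool) v : bool :=
  if A is a :: A' then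
    \big[addb/false]_(t < K) cubesum K A' F (grid_upd a t v)
  else F v.

Lemma xsum_add (I : Type) (r : seq I) (f g : I -> bool) :
  \xsum_(i <- r) (f i (+) g i) = (\xsum_(i <- r) f i) (+) \xsum_(i <- r) g i.
Proof. exact: big_split. Qed.

Lemma xsum_and (I : Type) (r : seq I) b (f : I -> bool) :
  \xsum_(i <- r) (b && f i) = b && \xsum_(i <- r) f i.
Proof. by rewrite big_distrr. Qed.

Lemma xsum_rem (A : seq T) j (f : T -> bool) : uniq A -> j \in A ->
  \xsum_(i <- A) f i = f j (+) \xsum_(i <- rem j A) f i.
Proof. by move=> uA jA; rewrite (perm_big _ (perm_to_rem jA)) big_cons. Qed.

Lemma remC (A : seq T) x y : uniq A -> rem x (rem y A) = rem y (rem x A).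
Proof.
move=> uA; rewrite !rem_filter ?filter_uniq // -!filter_predI.
by apply: eq_filter => z /=; rewrite andbC.
Qed.

Lemma eq_permsum k A g h :
  (forall r, size r = k -> {subset r <= A} -> g r = h r) ->
  permsum k A g = permsum k A h.
Proof.
elim: k A g h => [|k IH] A g h gh /=; first exact: gh.
apply: eq_big_seq => j jA; apply: IH => r rk rA.
apply: gh => [|x]; first by rewrite /= rk.
by rewrite inE => /predU1P[->//|/rA]; exact: mem_rem.
Qed.

Lemma permsumD k A g h :
  permsum k A (fun r => g r (+) h r) = permsum k A g (+) permsum k A h.
Proof.
elim: k A g h => [|k IH] A g h //=.
by rewrite -xsum_add; apply: eq_bigr => j _; rewrite IH.
Qed.

Lemma permsum_and k A b g : permsum k A (fun r => b && g r) = b && permsum k A g.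
Proof.
elim: k A g => [|k IH] A g //=.
by rewrite -xsum_and; apply: eq_bigr => j _; rewrite IH.
Qed.

(** Every unordered pair is met twice. *)
Lemma xsum_pairs (A : seq T) (h : T -> T -> bool) : uniq A ->
  (forall x y, h x y = h y x) ->
  \xsum_(i <- A) \xsum_(j <- rem i A) h i j = false.
Proof.
move=> uA hC.
have E : \xsum_(i <- A) \xsum_(j <- rem i A) h i j =
         \xsum_(i <- A) ((\xsum_(j <- A) h i j) (+) h i i).
  apply: eq_big_seq => i iA.
  by rewrite [X in _ = X (+) _](@xsum_rem _ i) // addbC addbA addbb.
rewrite E xsum_add; elim: A uA {E} => [|a A IH] uA; first by rewrite !big_nil.
rewrite !big_cons.
have -> : \xsum_(i <- A) \xsum_(j <- a :: A) h i j =
    (\xsum_(i <- A) h a i) (+) \xsum_(i <- A) \xsum_(j <- A) h i j.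
  by rewrite -xsum_add; apply: eq_bigr => i _; rewrite big_cons hC.
move: (IH (subseq_uniq (subseq_cons _ _) uA)).
by case: (h a a); case: (\xsum_(i <- A) h a i);
   case: (\xsum_(_ <- A) \xsum_(_ <- A) _); case: (\xsum_(i <- A) h i i).
Qed.

(** Exchanging the first two directions pairs off the terms. Geometrically, the face that omits the
    second vertex is shared by two Kuhn simplices of the cell. *)
Lemma permsum_swap k A (g : seq T -> bool) : uniq A ->
  (forall x y r, g [:: x, y & r] = g [:: y, x & r]) ->
  permsum k.+2 A g = false.
Proof.
move=> uA gC /=.
pose h x y := permsum k (rem y (rem x A)) (fun r => g [:: x, y & r]).
rewrite -[RHS](@xsum_pairs A h) // => x y.
rewrite /h remC //.
by apply: eq_permsum => r.
Qed.

Lemma permsum_rcons k A g : uniq A ->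
  permsum k.+1 A g =
  \xsum_(j <- A) permsum k (rem j A) (fun r => g (rcons r j)).
Proof.
elim: k A g => [|k IH] A g uA //.
rewrite -[LHS]/(\xsum_(j <- A) permsum k.+1 (rem j A) (fun r => g (j :: r))).
under eq_bigr do rewrite IH ?rem_uniq //.
pose h i j := permsum k (rem j (rem i A)) (fun r => g (i :: rcons r j)).
have E (f : T -> T -> bool) : \xsum_(i <- A) \xsum_(j <- rem i A) f i j =
    \xsum_(j <- A) \xsum_(i <- rem j A) f i j.
  transitivity (\xsum_(i <- A) ((\xsum_(j <- A) f i j) (+) f i i)).
    by apply: eq_big_seq => i iA; rewrite [X in _ = X (+) _](@xsum_rem _ i) // addbC addbA addbb.
  transitivity (\xsum_(j <- A) ((\xsum_(i <- A) f i j) (+) f j j)); last first.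
    by apply: eq_big_seq => i iA; rewrite [X in X (+) _](@xsum_rem _ i) // addbC addbA addbb.
  by rewrite !xsum_add exchange_big.
rewrite (E h); apply: eq_bigr => j _ /=; apply: eq_bigr => i _.
by rewrite /h remC.
Qed.


(** A cup product of coboundaries is closed. Summed over a cell, the faces that omit an intermediate
    vertex cancel; what remains equates the faces without the first vertex (left) with those without
    the last one (right). *)
Lemma chain_prod_coboundary L A v : uniq A ->
  permsum (size L).+1 A
    (fun ds => if ds is d :: ds' then chain_prod L (grid_bump d v) ds' else true) =
  permsum (size L).+1 A (chain_prod L v).
Proof.
elim: L A v => [|l L IH] A v uA; first by apply: eq_permsum => [[|d []]].
(* The face without the second vertex. Modulo 2 the middle value of [s l] cancels between the two
   sides, so their sum is [g], which is symmetric in [d1] and [d2]. *)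
pose g ds := if ds is [:: d1, d2 & r] then
  (s l (grid_bump d2 (grid_bump d1 v)) (+) s l v) &&
  chain_prod L (grid_bump d2 (grid_bump d1 v)) r else false.
have g0 : permsum (size L).+2 A g = false.
  apply: permsum_swap => // x y r /=.
  suff -> : grid_bump x (grid_bump y v) = grid_bump y (grid_bump x v) by [].
  by apply/funext => i; rewrite /grid_bump addnAC.
have -> : permsum (size (l :: L)).+1 A (chain_prod (l :: L) v) =
    permsum (size L).+2 A (fun ds => if ds is d1 :: r then
      (s l (grid_bump d1 v) (+) s l v) &&
      (if r is d2 :: r' then chain_prod L (grid_bump d2 (grid_bump d1 v)) r' else true)
      else true).
  rewrite [LHS]/= [RHS]/=; apply: eq_bigr => d1 _.
  have IHd := IH (rem d1 A) (grid_bump d1 v) (rem_uniq _ uA).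
  set b := s l _ (+) s l v.
  transitivity (b && permsum (size L).+1 (rem d1 A) (chain_prod L (grid_bump d1 v))).
    by rewrite -permsum_and.
  by rewrite -IHd -permsum_and.
set f1 := (X in permsum _ _ X = _); set f2 := (X in _ = permsum _ _ X).
suff : permsum (size L).+2 A f1 (+) permsum (size L).+2 A f2 = false.
  by rewrite /=; do 2 case: (\xsum_(_ <- _) _).
rewrite -permsumD -g0; apply: eq_permsum => -[|d1 [|d2 r]] //= _ _.
by case: (s l _); case: (s l _); case: (s l _); case: (chain_prod _ _ _).
Qed.

Lemma chain_prod_rcons L v r j : size r = size L ->
  chain_prod L v (rcons r j) = chain_prod L v r.
Proof. by elim: L v r => [|l L IH] v [|d r] //= [/IH->]. Qed.

Lemma chain_prod_face L v r j b : size r = size L -> j \in L -> j \notin r ->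
  (forall u, u j = v j -> s j u = b) -> chain_prod L v r = false.
Proof.
elim: L v r => [|l L IH] v [|d r] // [rL]; rewrite !inE negb_or => jL /andP[jd jr] sb.
have vd : grid_bump d v j = v j by rewrite /grid_bump (negPf jd) addn0.
move: jL => /predU1P[jl|jL] /=; first by rewrite -jl !sb // addbb.
by rewrite (IH _ _ rL jL jr) ?andbF // => u; rewrite vd; exact: sb.
Qed.

Lemma grid_updC a j x y v : a != j ->
  grid_upd a x (grid_upd j y v) = grid_upd j y (grid_upd a x v).
Proof.
move=> aj; apply/funext => i; rewrite /grid_upd.
by case: eqP => [->|//]; rewrite (negPf aj).
Qed.

Lemma eq_cubesum K A F G v :
  (forall u, (forall i, i \notin A -> u i = v i) -> F u = G u) ->
  cubesum K A F v = cubesum K A G v.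
Proof.
elim: A v => [|a A IH] v FG /=; first exact: FG.
apply: eq_bigr => t _; apply: IH => u uv; apply: FG => i.
by rewrite inE negb_or => /andP[ia /uv ->]; rewrite /grid_upd (negPf ia).
Qed.

Lemma cubesum_sum K A (r : seq T) (F : T -> (T -> nat) -> bool) v :
  cubesum K A (fun u => \xsum_(j <- r) F j u) v = \xsum_(j <- r) cubesum K A (F j) v.
Proof.
elim: A v => [|a A IH] v //=.
by rewrite exchange_big; apply: eq_bigr => t _; rewrite IH.
Qed.

Lemma cubesum_bump K A F j v : j \notin A ->
  cubesum K A (fun u => F (grid_bump j u)) v = cubesum K A F (grid_bump j v).
Proof.
elim: A v => [|a A IH] v //=; rewrite inE negb_or => /andP[ja jA].
apply: eq_bigr => t _; rewrite IH //; congr cubesum; apply/funext => i.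
rewrite /grid_bump /grid_upd; case: eqP => [->|//].
by rewrite eq_sym (negPf ja) addn0.
Qed.

Lemma cubesumD K A F G v :
  cubesum K A (fun u => F u (+) G u) v = cubesum K A F v (+) cubesum K A G v.
Proof.
elim: A v => [|a A IH] v //=.
by rewrite -big_split; apply: eq_bigr => t _; rewrite IH.
Qed.

(** The sum telescopes along the direction [j], and only the two faces orthogonal to it remain. *)
Lemma cubesum_stokes K A F j v : uniq A -> j \in A ->
  cubesum K A (fun u => F (grid_bump j u) (+) F u) v =
  cubesum K (rem j A) F (grid_upd j K v) (+) cubesum K (rem j A) F (grid_upd j 0%N v).
Proof.
elim: A v => [|a A IH] v //= /andP[aA uA]; rewrite inE eq_sym.
have [aj _|aj /= jA] := eqVneq a j; last first.
  rewrite -big_split; apply: eq_bigr => t _.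
  by rewrite IH // !(@grid_updC a j).
rewrite -aj; under eq_bigr => t _.
  rewrite cubesumD cubesum_bump //.
  have -> : grid_bump a (grid_upd a t v) = grid_upd a t.+1 v.
    apply/funext => i; rewrite /grid_bump /grid_upd; case: eqP => _; first by rewrite addn1.
    by rewrite addn0.
  over.
pose g t := cubesum K A F (grid_upd a t v).
suff /(_ K) : forall n, \big[addb/false]_(t < n) (g t.+1 (+) g t) = g n (+) g 0%N by [].
elim=> [|k IHk]; first by rewrite big_ord0 addbb.
by rewrite big_ord_recr /= IHk; case: (g k.+1); case: (g k); case: (g 0%N).
Qed.

(** Induction on the dimension. The product is the coboundary of [s a] times the product over the
    other labels, so the sum over the cube moves to its faces. A face orthogonal to another
    direction [j] contributes nothing, as [s j] is constant there. Of the two faces orthogonal to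
    [a], the lower one has [s a] false and the upper one is the same sum in one dimension less;
    freezing absent coordinates at [K] makes it an instance of the induction hypothesis. *)
Lemma grid_degree K A : uniq A ->
  (forall l u, u l = 0%N -> s l u = false) ->
  (forall l u, u l = K -> s l u = true) ->
  cubesum K A (fun v => permsum (size A) A (chain_prod A v)) (fun=> K) = true.
Proof.
move=> + s0 sK; elim: A => [|a L IH] // /[dup] uA /= /andP[aL uL].
pose f j u := permsum (size L) (rem j (a :: L)) (fun r => s a u && chain_prod L u r).
transitivity (cubesum K (a :: L)
    (fun v => \xsum_(j <- a :: L) (f j (grid_bump j v) (+) f j v)) (fun=> K)).
  apply: (@eq_cubesum K (a :: L)) => v _; rewrite xsum_add.
  have -> : \xsum_(j <- a :: L) f j v = s a v && permsum (size L).+1 (a :: L) (chain_prod L v).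
    rewrite permsum_rcons // -xsum_and; apply: eq_bigr => j _.
    rewrite /f permsum_and; congr (_ && _); apply: eq_permsum => r rL _.
    by rewrite chain_prod_rcons.
  rewrite -chain_prod_coboundary // -permsum_and.
  set S := (X in _ = X (+) _).
  have -> : S = permsum (size L).+1 (a :: L) (fun ds =>
      if ds is d :: r then s a (grid_bump d v) && chain_prod L (grid_bump d v) r else true).
    by [].
  rewrite -permsumD; apply: eq_bigr => j _; apply: eq_permsum => r _ _.
  exact: andb_addl.
rewrite cubesum_sum big_cons big1_seq => [|j /andP[_ jL]]; last first.
  have jaL : j \in a :: L by rewrite inE jL orbT.
  have ja : a != j by apply: contraNneq aL => ->.
  rewrite (@cubesum_stokes _ _ (f j)) //.
  have E k b : (forall u, u j = k -> s j u = b) ->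
      cubesum K (rem j (a :: L)) (f j) (grid_upd j k (fun=> K)) = false.
    move=> sb; rewrite (@eq_cubesum _ _ _ (fun=> false)); last first.
      move=> u /(_ j); rewrite mem_rem_uniqF // => /(_ isT).
      rewrite /grid_upd eqxx => uj.
      rewrite /f (@eq_permsum _ _ _ (fun=> false)).
        elim: (size L) (rem _ _) => [|k' IHk] A' //=; exact: big1.
      move=> r rL rA; rewrite (@chain_prod_face _ _ _ j b) ?andbF //.
        by apply: contraL (jL) => /rA; rewrite mem_rem_uniqF.
      by move=> w; rewrite uj; exact: sb.
    elim: (rem _ _) (grid_upd _ _ _) => [|i A' IHA] w //=; exact: big1.
  by rewrite (E K true) ?(E 0%N false) // => u; [exact: s0 | exact: sK].
rewrite addbF (@cubesum_stokes _ _ (f a)) ?inE ?eqxx //= eqxx.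
have -> : grid_upd a K (fun=> K) = fun=> K by apply/funext => i; rewrite /grid_upd; case: ifP.
rewrite -[RHS](IH uL) -[RHS]addbF; congr (_ (+) _).
  apply: eq_cubesum => u uK; rewrite /f /= eqxx; apply: eq_permsum => r _ _.
  by rewrite sK // uK.
rewrite (@eq_cubesum _ _ _ (fun=> false)).
  elim: (L) (grid_upd _ _ _) => [|i A' IHA] w //=; exact: big1.
move=> u /(_ a aL); rewrite /grid_upd eqxx => ua.
by rewrite /f permsum_and s0.
Qed.
End GridChains.

Lemma cont_comp (T U V : topologicalType) (f : U -> V) (g : T -> U) :
  continuous g -> continuous f -> continuous (fun x => f (g x)).
Proof. by move=> cg cf x; apply: continuous_comp; [exact: cg | exact: cf]. Qed.

Lemma cont_pair (T U V : topologicalType) (f : T -> U) (g : T -> V) :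
  continuous f -> continuous g -> continuous (fun x => (f x, g x)).
Proof. by move=> cf cg x; apply: cvg_pair; [exact: cf | exact: cg]. Qed.

Section ContinuousReal.
Context {R : realType} {T : topologicalType}.
Implicit Types f g : T -> R.

Lemma cont_add f g : continuous f -> continuous g -> continuous (fun x => f x + g x).
Proof. by move=> cf cg x; apply: cvgD; [exact: cf | exact: cg]. Qed.

Lemma cont_sub f g : continuous f -> continuous g -> continuous (fun x => f x - g x).
Proof. by move=> cf cg x; apply: cvgB; [exact: cf | exact: cg]. Qed.

Lemma cont_mul f g : continuous f -> continuous g -> continuous (fun x => f x * g x).
Proof. by move=> cf cg x; apply: cvgM; [exact: cf | exact: cg]. Qed.

Lemma cont_inv f : (forall x, f x != 0) -> continuous f -> continuous (fun x => (f x)^-1).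
Proof. by move=> f0 cf x; apply: cvgV; [exact: f0 | exact: cf]. Qed.

Lemma cont_sum (I : Type) (r : seq I) (P : pred I) (f : I -> T -> R) :
  (forall i, continuous (f i)) -> continuous (fun x => \sum_(i <- r | P i) f i x).
Proof.
move=> cf; elim: r => [|i r IH].
  by under eq_fun do rewrite big_nil; exact: cst_continuous.
under eq_fun do rewrite big_cons.
by case: (P i) => //; exact: cont_add.
Qed.

End ContinuousReal.

(** * From parities on a grid to zeros of continuous functions *)

Section Miranda.
Context {R : realType}.

Lemma continuous_mx (T : topologicalType) m n (f : T -> 'M[R]_(m, n)) :
  (forall i j, continuous (fun x => f x i j)) -> continuous f.
Proof.
move=> cf x A [P Pf PA].
have : \forall y \near x, forall i j, P i j (f y i j).
  by apply: filter_forall => i; apply: filter_forall => j; apply: cf; exact: Pf.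
by apply: filterS => y yP; apply: PA.
Qed.

Lemma continuous_row (T : topologicalType) m (f : T -> 'rV[R]_m) :
  (forall j, continuous (fun x => f x ord0 j)) -> continuous f.
Proof. by move=> cf; apply: continuous_mx => i j; rewrite (ord1 i). Qed.

Lemma xsum_true (I : eqType) (r : seq I) (f : I -> bool) :
  \big[addb/false]_(i <- r) f i = true -> exists2 i, i \in r & f i.
Proof.
elim: r => [|a r IH]; first by rewrite big_nil.
rewrite big_cons; case fa: (f a) => /=; first by exists a; rewrite ?mem_head.
by move=> /IH[i ir fi]; exists i; rewrite // inE ir orbT.
Qed.

Lemma cubesum_true (T : eqType) K (A : seq T) F v :
  uniq A -> cubesum K A F v = true ->
  exists2 u, F u & (forall i, i \in A -> (u i < K)%N) /\ (forall i, i \notin A -> u i = v i).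
Proof.
elim: A v => [|a A IH] v /=; first by exists v.
move=> /andP[aA uA] /xsum_true[t _ /(IH _ uA)[u Fu [uK uv]]].
exists u => //; split=> i.
  by rewrite inE => /predU1P[->|/uK//]; rewrite uv // /grid_upd eqxx.
by rewrite inE negb_or => /andP[ia /uv ->]; rewrite /grid_upd (negPf ia).
Qed.

Lemma permsum_true (T : eqType) k (A : seq T) g : uniq A -> permsum k A g = true ->
  exists2 r, g r & [/\ size r = k, uniq r & {subset r <= A}].
Proof.
elim: k A g => [|k IH] A g uA /=; first by exists [::].
move=> /xsum_true[j jA /(IH _ _ (rem_uniq _ uA))[r gr [rk ur rA]]].
exists (j :: r) => //; split => /=; rewrite ?rk ?ur ?andbT //.
  by apply/negP => /rA; rewrite mem_rem_uniqF.
by move=> i; rewrite inE => /predU1P[->//|/rA /mem_rem].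
Qed.

(** A nonzero product forces every label to change along the path, so both values of each label
    occur within one cell. *)
Lemma chain_prod_change (T : eqType) s (L : seq T) v r l :
  size r = size L -> uniq r -> l \in L -> chain_prod s L v r ->
  exists w w', [/\ s l w, ~~ s l w', forall i, (v i <= w i <= (v i).+1)%N &
    forall i, (v i <= w' i <= (v i).+1)%N].
Proof.
have W w : forall i : T, (w i <= w i <= (w i).+1)%N by move=> i; rewrite leqnn leqnSn.
have B w d : forall i : T, (w i <= grid_bump d w i <= (w i).+1)%N.
  by move=> i; rewrite /grid_bump leq_addr /= -addn1 leq_add2l leq_b1.
suff H : forall L' (v' : T -> nat) r', size r' = size L' -> uniq r' ->
    (forall i, (v i <= v' i <= (v i).+1)%N) ->
    (forall i, i \in r' -> v' i = v i) ->
    l \in L' -> chain_prod s L' v' r' ->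
    exists w w', [/\ s l w, ~~ s l w', forall i, (v i <= w i <= (v i).+1)%N &
    forall i, (v i <= w' i <= (v i).+1)%N].
  by move=> rL ur lL; exact: (H L v r).
elim=> [|a L' IH] v' [|d r'] //= [rL] /andP[dr ur] v'v v'r.
have bv i : (v i <= grid_bump d v' i <= (v i).+1)%N.
  rewrite /grid_bump; case: eqP => [->|_]; last by rewrite addn0.
  by rewrite v'r ?mem_head // addn1 leqnn leqnSn.
rewrite inE => /predU1P[-> /andP[+ _]|lL /andP[_]].
  case E1: (s a (grid_bump d v')); case E2: (s a v') => //= _.
    by exists (grid_bump d v'), v'; rewrite E1 E2.
  by exists v', (grid_bump d v'); rewrite E1 E2.
apply: IH => // i ir'; rewrite /grid_bump.
rewrite [i == d](_ : _ = false) ?addn0; last by apply: contraNF dr => /eqP <-.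
by apply: v'r; rewrite inE ir' orbT.
Qed.

Lemma cont_coord (T : topologicalType) m (f : T -> 'rV[R]_m) j :
  continuous f -> continuous (fun x => f x ord0 j).
Proof. by move=> cf; apply: (@cont_comp T _ _ (fun v : 'rV[R]_m => v ord0 j) f cf); exact: coord_continuous. Qed.

(** The signs of the [g i] at grid points serve as labels. The odd count yields a cell where all
    signs change, and by continuity a cluster point of such cells is a common zero. *)
Lemma miranda_unit m (g : 'I_m -> 'rV[R]_m -> R) :
  (forall i, continuous (g i)) ->
  (forall i (x : 'rV[R]_m), (forall j, 0 <= x ord0 j <= 1) -> x ord0 i = 0 -> g i x <= 0) ->
  (forall i (x : 'rV[R]_m), (forall j, 0 <= x ord0 j <= 1) -> x ord0 i = 1 -> 0 <= g i x) ->
  exists2 x : 'rV[R]_m, (forall j, 0 <= x ord0 j <= 1) & forall i, g i x = 0.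
Proof.
move=> cg g0 g1.
pose cube : set 'rV[R]_m := [set x | forall j, 0 <= x ord0 j <= 1].
pose pt K (u : 'I_m -> nat) : 'rV[R]_m := \row_i ((u i)%:R / K%:R).
have ptc K u : (0 < K)%N -> (forall i, (u i <= K)%N) -> cube (pt K u).
  move=> K0 uK j; rewrite mxE divr_ge0 //= ler_pdivrMr ?ltr0n // mul1r.
  by rewrite ler_nat uK.
(* The mesh is [1 / (k + 1)]; the radius exceeds it by the factor [(k + 2) / (k + 1)] because balls
   are open. *)
have grid k : exists x : 'rV[R]_m, cube x /\ forall l, exists y y' : 'rV[R]_m,
    [/\ 0 <= g l y, g l y' <= 0, ball x (k.+2%:R / k.+1%:R ^+ 2) y &
        ball x (k.+2%:R / k.+1%:R ^+ 2) y'].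
  pose K := k.+1.
  (* On the two faces the label is prescribed, and [g0] and [g1] make the prescription compatible
     with the weak sign of [g l]. *)
  pose s l (u : 'I_m -> nat) := if u l == 0%N then false else
    if (u l == K)%N then true else 0 < g l (pt K u).
  have GD : cubesum K (enum 'I_m) (fun v => permsum (size (enum 'I_m)) (enum 'I_m)
      (chain_prod s (enum 'I_m) v)) (fun=> K) = true.
    apply: grid_degree => [|l u ul|l u ul]; first exact: enum_uniq.
      by rewrite /s ul eqxx.
    by rewrite /s ul /= eqxx.
  have [v + [vK _]] := cubesum_true (enum_uniq _) GD.
  move=> /(permsum_true (enum_uniq _))[r cp [rs ur _]].
  have {}vK i : (v i < K)%N by apply: vK; rewrite mem_enum.
  exists (pt K v); split; first by apply: ptc => // i; exact: ltnW.
  move=> l; have lA : l \in enum 'I_m by rewrite mem_enum.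
  have [w [w' [sw sw' vw vw']]] := chain_prod_change rs ur lA cp.
  exists (pt K w), (pt K w').
  have wc u : (forall i, (v i <= u i <= (v i).+1)%N) -> cube (pt K u).
    by move=> vu; apply: ptc => // i; have /andP[_ /leq_trans] := vu i; apply.
  have wb u : (forall i, (v i <= u i <= (v i).+1)%N) ->
      ball (pt K v) (k.+2%:R / k.+1%:R ^+ 2) (pt K u).
    move=> vu; split=> [|i j]; first by rewrite divr_gt0 ?exprn_gt0.
    rewrite !mxE /ball /= -mulrBl normrM.
    rewrite [X in _ * X]ger0_norm ?invr_ge0 // expr2 invfM mulrA.
    rewrite ltr_pM2r ?invr_gt0 ?ltr0n //.
    apply: (@le_lt_trans _ _ 1); last by rewrite ltr_pdivlMr ?mul1r ?ltr0n // ltr_nat.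
    have /andP[vu1 vu2] := vu j; rewrite distrC ger0_norm ?subr_ge0 ?ler_nat //.
    by rewrite lerBlDl natr1 ler_nat.
  split; [| |exact: wb|exact: wb].
    move: sw; rewrite /s; case: eqP => // _; case: eqP => [wK _|_ /ltW //].
    by apply: g1; [exact: wc | rewrite mxE wK divff // pnatr_eq0].
  move: sw'; rewrite /s; case: eqP => [w0 _|_].
    by apply: g0; [exact: wc | rewrite mxE w0 mul0r].
  by case: eqP => // _; rewrite -leNgt.
have /choice[x xP] := grid.
have ccube : compact cube.
  have : compact [set v : 'rV[R]_m | forall i, v ord0 i \in `[0, 1]].
    exact (@rV_compact R m (fun=> `[0, 1]%classic) (fun i => @segment_compact R 0 1)).
  by congr compact; apply/seteqP; split => v /= vi j; have := vi j; rewrite in_itv.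
have [z [zc zcl]] : cube `&` cluster (x @ \oo) !=set0.
  by apply: (ccube (x @ \oo) _ _); exists 0%N => // k _; exact: (xP k).1.
exists z => // l.
have close e : 0 < e -> exists k : nat, ball z e (x k) /\ k.+2%:R / k.+1%:R ^+ 2 < e.
  move=> e0.
  have [n _ nP] : \forall k \near \oo, k.+2%:R / k.+1%:R ^+ 2 < e.
    near=> k; have ke : 4 / e <= k%:R by near: k; exact: nbhs_infty_ger.
    rewrite ltr_pdivrMr ?exprn_gt0 ?ltr0n //.
    rewrite ler_pdivrMr // in ke.
    apply: (@lt_le_trans _ _ (4 * k.+1%:R)); first by rewrite -natrM ltr_nat; lia.
    rewrite expr2 mulrA ler_pM2r ?ltr0n //; apply: (le_trans ke).
    by rewrite mulrC ler_wpM2l ?(ltW e0) // ler_nat.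
  have [||y [[k /= nk <-] zy]] := zcl [set x k | k in [set k | (n <= k)%N]] (ball z e).
  - by exists n => // k /= nk; exists k.
  - exact: nbhsx_ballx.
  - by exists k; split => //; exact: nP.
have sgn (P : set R) : open P -> P (g l z) -> exists k, forall y,
    ball (x k) (k.+2%:R / k.+1%:R ^+ 2) y -> P (g l y).
  move=> oP Pz; have /nbhs_ballP[e /= e0 eP] := cg l z _ (open_nbhs_nbhs (conj oP Pz)).
  have [k [zk ke]] := close (e / 2) (divr_gt0 e0 (ltr0n _ 2)).
  exists k => y xy; apply: eP; rewrite [e]splitr; apply: ball_triangle zk _.
  exact: le_ball (ltW ke) _ xy.
apply/eqP; rewrite eq_le !leNgt; apply/andP; split; apply/negP => gz.
  have [k kP] := sgn _ (@open_gt R 0) gz.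
  have [_ [y [_ gy _ yk]]] := (xP k).2 l.
  by have /= := kP y yk; rewrite ltNge gy.
have [k kP] := sgn _ (@open_lt R 0) gz.
have [y [_ [gy _ yk _]]] := (xP k).2 l.
by have /= := kP y yk; rewrite ltNge gy.
Unshelve. all: by end_near.
Qed.

Lemma miranda m (a b : 'I_m -> R) (g : 'I_m -> 'rV[R]_m -> R) :
  (forall i, a i < b i) ->
  (forall i, continuous (g i)) ->
  (forall i (x : 'rV[R]_m), (forall j, a j <= x ord0 j <= b j) -> x ord0 i = a i -> g i x <= 0) ->
  (forall i (x : 'rV[R]_m), (forall j, a j <= x ord0 j <= b j) -> x ord0 i = b i -> 0 <= g i x) ->
  exists2 x : 'rV[R]_m, (forall j, a j <= x ord0 j <= b j) & forall i, g i x = 0.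
Proof.
move=> ab cg ga gb.
pose f (x : 'rV[R]_m) : 'rV[R]_m := \row_i (a i + x ord0 i * (b i - a i)).
have fc (x : 'rV[R]_m) : (forall j, 0 <= x ord0 j <= 1) -> forall j, a j <= f x ord0 j <= b j.
  move=> xc j; have /andP[x0 x1] := xc j; have := ab j; rewrite mxE => abj.
  rewrite lerDl mulr_ge0 ?subr_ge0 ?(ltW abj) //= -lerBrDl.
  by rewrite ler_piMl ?subr_ge0 ?(ltW abj).
have cf : continuous f.
  apply: continuous_row => j.
  have -> : (fun x => f x ord0 j) = (fun x : 'rV[R]_m => a j + x ord0 j * (b j - a j)).
    by apply/funext => x; rewrite mxE.
  apply: cont_add; first exact: cst_continuous.
  by apply: cont_mul; [exact: coord_continuous | exact: cst_continuous].
have [|||x xc xP] := @miranda_unit m (fun i x => g i (f x)).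
- by move=> i x; apply: continuous_comp; [exact: cf | exact: cg].
- by move=> i x xc xi; apply: ga; [exact: fc | rewrite mxE xi mul0r addr0].
- by move=> i x xc xi; apply: gb; [exact: fc | rewrite mxE xi mul1r subrKC].
by exists (f x); [exact: fc | move=> i; exact: xP].
Qed.
End Miranda.

(** * A finite-dimensional linking theorem *)

Section Dot.
Context {R : realType} {d : nat}.
Implicit Types u v : 'rV[R]_d.

Definition dotv u v : R := \sum_i u ord0 i * v ord0 i.
Definition nrm2 u : R := Num.sqrt (dotv u u).

Lemma dotv_ge0 u : 0 <= dotv u u.
Proof. by apply: sumr_ge0 => i _; rewrite -expr2 sqr_ge0. Qed.

Lemma nrm2_ge0 u : 0 <= nrm2 u. Proof. exact: sqrtr_ge0. Qed.

Lemma nrm2_sqr u : nrm2 u ^+ 2 = dotv u u.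
Proof. by rewrite sqr_sqrtr ?dotv_ge0. Qed.

Lemma dotvZr a u v : dotv u (a *: v) = a * dotv u v.
Proof. by rewrite /dotv big_distrr; apply: eq_bigr => i _; rewrite !mxE /=; ring. Qed.

Lemma nrm2Z a u : nrm2 (a *: u) = `|a| * nrm2 u.
Proof.
rewrite /nrm2 dotvZr (_ : dotv _ u = a * dotv u u); last first.
  by rewrite /dotv big_distrr; apply: eq_bigr => i _; rewrite !mxE /=; ring.
by rewrite mulrA -expr2 sqrtrM ?sqr_ge0 // sqrtr_sqr.
Qed.

Lemma continuous_nrm2 (T : topologicalType) (f : T -> 'rV[R]_d) :
  continuous f -> continuous (fun x => nrm2 (f x)).
Proof.
move=> cf; apply: (@cont_comp T R R Num.sqrt (fun x => dotv (f x) (f x))); last exact: sqrt_continuous.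
have c1 i : continuous (fun x => f x ord0 i).
  exact: cont_coord.
by apply: cont_sum => i; apply: cont_mul.
Qed.
End Dot.

Section Linking.
Context {R : realType} {d : nat}.
Variables (neg : pred 'I_d) (i0 : 'I_d).
Variables (Phi Q : 'rV[R]_d -> R) (dPhi : 'rV[R]_d -> 'rV[R]_d) (z : 'rV[R]_d).
Variables (tau alpha rho S : R).

Definition linking_box (c : 'rV[R]_d) :=
  [/\ forall i, neg i -> - tau <= c ord0 i <= tau,
      0 <= c ord0 i0 <= tau &
      forall i, ~~ neg i -> i != i0 -> c ord0 i = 0].

Hypotheses (i0neg : ~~ neg i0) (tau_gt0 : 0 < tau) (alpha_gt0 : 0 < alpha).
Hypotheses (cPhi : continuous Phi) (cdPhi : continuous dPhi) (cQ : continuous Q).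
Hypothesis Phi_diff : forall e : R, 0 < e -> exists2 eta : R, 0 < eta & forall c v : 'rV[R]_d,
  nrm2 v <= eta -> Phi (c + v) <= Phi c + dotv (dPhi c) v + e * nrm2 v.
Hypothesis Phi_bdry : forall c : 'rV[R]_d, linking_box c ->
  [\/ c ord0 i0 = 0, c ord0 i0 = tau | exists2 i, neg i & `|c ord0 i| = tau] ->
  Phi c <= 0.
Hypothesis Phi_top : forall c, linking_box c -> Phi c <= S.
Hypothesis Phi_link : forall c : 'rV[R]_d,
  (forall i, neg i -> c ord0 i = z ord0 i) -> Q c = rho -> alpha <= Phi c.
Hypothesis z_box : forall i, neg i -> - tau <= z ord0 i <= tau.
Hypothesis Q_bot : forall c : 'rV[R]_d, linking_box c -> c ord0 i0 = 0 -> Q c <= rho.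
Hypothesis Q_tau : forall c : 'rV[R]_d, linking_box c -> c ord0 i0 = tau -> rho <= Q c.

(** Otherwise the gradient is bounded below wherever [Phi] is at least [alpha / 2]. An iterated
    descent step then brings the whole box below [alpha] while it fixes the boundary, where [Phi] is
    nonpositive. But Poincare-Miranda still finds a point of the box whose image lies in the linking
    set, where [Phi] is at least [alpha]. *)
Theorem linking delta : 0 < delta ->
  exists c, alpha / 2 <= Phi c /\ nrm2 (dPhi c) <= delta.
Proof.
move=> delta_gt0; have a0 := alpha_gt0; have t0 := tau_gt0.
apply: contrapT => nex.
have big_grad c : alpha / 2 <= Phi c -> delta < nrm2 (dPhi c).
  by move=> Pc; rewrite ltNge; apply/negP => le; apply: nex; exists c.
have [|eta eta0 etaP] := Phi_diff (e := delta / 2); first by rewrite divr_gt0.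
pose pos u : R := (u + `|u|) / 2.
have pos_ge0 u : 0 <= pos u by rewrite /pos; case: (ger0P u); lra.
(* A continuous cut-off with values in [[0, 1]] that turns the descent step into the identity where
   [Phi] is at most [alpha / 2]. *)
pose theta c := pos (Phi c - alpha / 2) / (pos (Phi c - alpha / 2) + 1).
have theta_ge0 c : 0 <= theta c by rewrite divr_ge0 // addr_ge0.
have theta_le1 c : theta c <= 1.
  rewrite /theta; move: (pos _) (pos_ge0 (Phi c - alpha / 2)) => w w0.
  by rewrite ler_pdivrMr ?mul1r; lra.
(* The step has length at most [eta], the range of [Phi_diff]; the added [delta] keeps the
   denominator positive at critical points. *)
pose G c := c - (eta * theta c / (nrm2 (dPhi c) + delta)) *: dPhi c.
have den_gt0 c : 0 < nrm2 (dPhi c) + delta by have := nrm2_ge0 (dPhi c); lra.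
have cG : continuous G.
  have cth : continuous theta.
    have cp : continuous (fun c => pos (Phi c - alpha / 2)).
      apply: cont_mul; last exact: cst_continuous.
      have c1 : continuous (fun c => Phi c - alpha / 2).
        by apply: cont_sub => //; exact: cst_continuous.
      by apply: cont_add => //; apply: cont_comp; [exact: c1 | exact: norm_continuous].
    apply: cont_mul => //; apply: cont_inv => [c|].
      by move: (pos _) (pos_ge0 (Phi c - alpha / 2)) => w w0; rewrite gt_eqF //; lra.
    by apply: cont_add => //; exact: cst_continuous.
  apply: continuous_row => j.
  have -> : (fun c => G c ord0 j) =
      (fun c => c ord0 j - eta * theta c / (nrm2 (dPhi c) + delta) * dPhi c ord0 j).
    by apply/funext => c; rewrite /G !mxE.
  apply: cont_sub; first exact: coord_continuous.
  apply: cont_mul; last exact: cont_coord.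
  apply: cont_mul; first by apply: cont_mul => //; exact: cst_continuous.
  apply: cont_inv => [c|]; first by rewrite gt_eqF.
  by apply: cont_add; [exact: continuous_nrm2 | exact: cst_continuous].
have Gid c : Phi c <= alpha / 2 -> G c = c.
  move=> Pc; rewrite /G /theta (_ : pos _ = 0) ?(mul0r, mulr0, scale0r, subr0) //.
  by rewrite /pos ler0_norm; lra.
have Gdec c : Phi (G c) <= Phi c - eta * delta / 4 * theta c.
  have [Pc|Pc] := leP (Phi c) (alpha / 2).
    rewrite Gid // /theta (_ : pos _ = 0) ?mul0r ?mulr0 ?subr0 //.
    by rewrite /pos ler0_norm; lra.
  have := big_grad c (ltW Pc); set N := nrm2 (dPhi c) => dN.
  have N0 : 0 < N by lra.
  have Nd : 0 < N + delta by lra.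
  pose k := eta * theta c / (N + delta).
  have k0 : 0 <= k by rewrite /k divr_ge0 ?(ltW Nd) // mulr_ge0 // ltW.
  have kE : k * (N + delta) = eta * theta c by rewrite divfK // gt_eqF.
  have vN : nrm2 (- k *: dPhi c) = k * N by rewrite nrm2Z normrN ger0_norm.
  have := etaP c (- k *: dPhi c); rewrite vN dotvZr -nrm2_sqr -/N => /(_ _)/wrap[].
    have : k * N <= k * (N + delta) by rewrite ler_wpM2l //; lra.
    rewrite kE => /le_trans; apply; have := theta_le1 c => t1; nra.
  have -> : G c = c + - k *: dPhi c by rewrite /G scaleNr.
  move=> /le_trans; apply.
  have -> : eta * delta / 4 * theta c = delta / 4 * (k * (N + delta)) by rewrite kE; field.
  have : 0 <= k * ((N - delta) * (N + delta / 4)) by positivity.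
  lra.
(* Above the level [3 alpha / 4] the cut-off is bounded below by its value there, so each step gains
   a fixed amount; below that level a step cannot climb. *)
have iterdec k c : Phi (iter k G c) <= Num.max (3 * alpha / 4)
    (Phi c - k%:R * (eta * delta / 4 * (alpha / 4 / (alpha / 4 + 1)))).
  set w := eta * delta / 4 * _.
  have w0 : 0 < w.
    by rewrite !mulr_gt0 ?invr_gt0 // ?addr_gt0 ?mulr_gt0 ?invr_gt0.
  have wE : w = eta * delta / 4 * (alpha / 4 / (alpha / 4 + 1)) by [].
  clearbody w; elim: k => [|k IH]; first by rewrite mul0r subr0 le_max lexx orbT.
  rewrite iterS; set c' := iter k G c in IH *.
  have := Gdec c'; have := theta_ge0 c'.
  have [Pc'|Pc'] := leP (Phi c') (3 * alpha / 4).
    move=> th0 dec; rewrite le_max; apply/orP; left; apply: (le_trans dec).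
    have : 0 <= eta * delta / 4 * theta c' by positivity.
    by lra.
  move: IH; rewrite le_max => /orP[|IH _ dec]; first by rewrite leNgt Pc'.
  rewrite le_max; apply/orP; right; apply: (le_trans dec).
  have : w <= eta * delta / 4 * theta c'.
    rewrite wE; apply: ler_wpM2l; first by positivity.
    rewrite /theta.
    have -> : pos (Phi c' - alpha / 2) = Phi c' - alpha / 2.
      by rewrite /pos ger0_norm; lra.
    rewrite ler_pdivrMr; last by positivity.
    rewrite mulrAC ler_pdivlMr; last by lra.
    by lra.
  rewrite -natr1; lra.
set w := eta * delta / 4 * (alpha / 4 / (alpha / 4 + 1)) in iterdec.
have w0 : 0 < w by rewrite !mulr_gt0 ?invr_gt0 // ?addr_gt0 ?mulr_gt0 ?invr_gt0.
clearbody w; have [k kP] : exists k : nat, S - k%:R * w < alpha.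
  exists (Num.truncn (`|S| / w)).+1.
  have : `|S| / w < (Num.truncn (`|S| / w)).+1%:R by rewrite truncnS_gt.
  rewrite ltr_pdivrMr // => h; have := ler_norm S; lra.
have cGk : continuous (iter k G).
  elim: (k) => [|k' IH]; first by move=> x; exact: cvg_id.
  by move=> x; apply: continuous_comp; [exact: IH | exact: cG].
have Gkid c : Phi c <= 0 -> iter k G c = c.
  move=> Pc; elim: (k) => [//|k' IH]; rewrite iterS IH Gid //.
  by apply: (le_trans Pc); rewrite divr_ge0 // ltW.
pose P (x : 'rV[R]_d) : 'rV[R]_d := \row_i (if neg i || (i == i0) then x ord0 i else 0).
have cP : continuous P.
  apply: continuous_row => j.
  have -> : (fun x => P x ord0 j) =
      (fun x => if neg j || (j == i0) then x ord0 j else 0).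
    by apply/funext => x; rewrite mxE.
  by case: (neg j || _); [exact: coord_continuous | exact: cst_continuous].
pose a i : R := if neg i then - tau else if i == i0 then 0 else -1.
pose b i : R := if neg i || (i == i0) then tau else 1.
(* Negative directions aim at [z] and [i0] aims at the level [rho] of [Q]. The other directions are
   erased by [P] and receive a trivial function on [[-1, 1]]. *)
pose g i (x : 'rV[R]_d) := if neg i then iter k G (P x) ord0 i - z ord0 i
   else if i == i0 then Q (iter k G (P x)) - rho else x ord0 i.
have cGP : continuous (fun x => iter k G (P x)) by exact: (cont_comp cP cGk).
have Pbox (x : 'rV[R]_d) : (forall j, a j <= x ord0 j <= b j) -> linking_box (P x).
  move=> xab; split=> [i ni||i ni ii0].
  - by have := xab i; rewrite /a /b mxE ni.
  - by have := xab i0; rewrite /a /b mxE (negPf i0neg) eqxx.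
  - by rewrite mxE (negPf ni) (negPf ii0).
have [||i x xab xi|i x xab xi|x xab xP] := @miranda R d a b g.
- by move=> i; rewrite /a /b; case: (neg i); case: (i == i0) => /=; lra.
- move=> i; rewrite /g; case: (neg i).
    apply: cont_sub; last exact: cst_continuous.
    exact: cont_coord.
  case: eqP => _; last exact: coord_continuous.
  by apply: cont_sub; [exact: (cont_comp cGP cQ) | exact: cst_continuous].
- have bx := Pbox x xab; rewrite /g; move: xi; rewrite /a.
  case ni: (neg i); first move=> xi.
    rewrite Gkid; last first.
      by apply: Phi_bdry => //; apply: Or33; exists i; rewrite // mxE ni /= xi normrN gtr0_norm.
    by rewrite mxE ni /= xi subr_le0; have /andP[] := z_box ni.
  case: eqP => [ii xi|_ ->]; last by lra.
  have Pi0 : P x ord0 i0 = 0 by rewrite mxE eqxx orbT -ii.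
  by rewrite Gkid; [rewrite subr_le0; exact: Q_bot | apply: Phi_bdry => //; exact: Or31].
- have bx := Pbox x xab; rewrite /g; move: xi; rewrite /b.
  case ni: (neg i) => /=; first move=> xi.
    rewrite Gkid; last first.
      by apply: Phi_bdry => //; apply: Or33; exists i; rewrite // mxE ni /= xi gtr0_norm.
    by rewrite mxE ni /= xi subr_ge0; have /andP[] := z_box ni.
  case: eqP => [ii xi|_ ->]; last by lra.
  have Pi0 : P x ord0 i0 = tau by rewrite mxE eqxx orbT -ii.
  by rewrite Gkid; [rewrite subr_ge0; exact: Q_tau | apply: Phi_bdry => //; exact: Or32].
have bx := Pbox x xab.
have : alpha <= Phi (iter k G (P x)).
  apply: Phi_link => [i ni|].
    by have := xP i; rewrite /g ni => /eqP; rewrite subr_eq0 => /eqP.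
  by have := xP i0; rewrite /g (negPf i0neg) eqxx => /eqP; rewrite subr_eq0 => /eqP.
have := iterdec k (P x); rewrite le_max => /orP[|]; first by lra.
have := Phi_top bx; lra.
Qed.
End Linking.

(** * Discrete loops and their Fourier modes *)

Section TrigSums.
Context {R : realType}.
Implicit Types (th ph x : R).

Lemma sin_periodn x a : sin (x + 2 * pi * a%:R) = sin x.
Proof.
elim: a => [|a IH]; first by rewrite mulr0 addr0.
have -> : x + 2 * pi * a.+1%:R = x + 2 * pi * a%:R + pi *+ 2.
  by rewrite -[a.+1%:R]natr1; ring.
by rewrite sinD2pi.
Qed.

(** Multiplied by [sin (th / 2)] the sum telescopes, and the periodicity hypothesis equates the two
    ends. *)
Lemma trig_sum N th ph : sin (th / 2) != 0 ->
  (forall x, sin (x + th * N%:R) = sin x) ->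
  \sum_(j < N) cos (th * j%:R + ph) = 0.
Proof.
move=> s0 per; apply: (mulfI s0); rewrite mulr0 mulr_sumr.
pose f (j : nat) := sin (th * j%:R + ph - th / 2) / 2.
have E (j : nat) : sin (th / 2) * cos (th * j%:R + ph) = f j.+1 - f j.
  rewrite /f -[j.+1%:R]natr1 (_ : th * (j%:R + 1) + ph - th / 2 = (th * j%:R + ph) + th / 2); last by field.
  by rewrite sinD sinB; field.
under eq_bigr do rewrite E.
rewrite -(big_mkord xpredT (fun j => f j.+1 - f j)) telescope_sumr //.
rewrite /f mulr0 add0r (_ : th * N%:R + ph - th / 2 = (ph - th / 2) + th * N%:R); last by ring.
by rewrite per subrr.
Qed.

Lemma trig_sum_freq (N a b : nat) ph : (a < b + N)%N -> (b < a + N)%N -> a != b ->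
  \sum_(j < N) cos (2 * pi * (a%:R - b%:R) / N%:R * j%:R + ph) = 0.
Proof.
move=> aN bN ab.
have N0 : (0 < N)%N by lia.
have NR : (0 : R) < N%:R by rewrite ltr0n.
apply: trig_sum; last first.
  move=> x; rewrite mulrVK ?unitfE ?gt_eqF // mulrBr addrA.
  by rewrite -(sin_periodn (_ - _) b) subrK sin_periodn.
have p0 := pi_gt0 R.
have spos (c : nat) : (0 < c)%N -> (c < N)%N -> 0 < sin (pi * c%:R / N%:R : R).
  move=> c0 cN; apply: sin_gt0_pi; rewrite !mulr_gt0 ?invr_gt0 ?ltr0n //=.
  by rewrite ltr_pdivrMr // ltr_pM2l // ltr_nat.
have -> : 2 * pi * (a%:R - b%:R) / N%:R / 2 = pi * (a%:R - b%:R) / N%:R :> R.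
  by field; rewrite gt_eqF.
move: ab; rewrite neq_ltn => /orP[ab|ab].
  rewrite -opprB mulrN mulNr sinN oppr_eq0 -natrB; last exact: ltnW.
  by rewrite gt_eqF //; apply: spos; lia.
rewrite -natrB; last exact: ltnW.
by rewrite gt_eqF //; apply: spos; lia.
Qed.

(** If Jordan's inequality failed at [x], the mean value theorem on both sides of [x] would make
    [cos - 2 / pi] first negative and later positive, although [cos] decreases. *)
Lemma sin_ge_linear x : 0 <= x <= pi / 2 -> 2 * x / pi <= sin x.
Proof.
have p0 := pi_gt0 R; have pn : pi != 0 :> R by rewrite gt_eqF.
move=> /andP[x0 xp]; rewrite leNgt; apply/negP => lt.
pose g (y : R) := sin y - 2 / pi * y.
have dg (y : R) : is_derive y 1 g (cos y - 2 / pi).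
  by apply: is_derive_eq; rewrite /GRing.scale /=; ring.
have cg (a b : R) : {within `[a, b], continuous g}.
  by apply: derivable_within_continuous => y _; have [] := dg y.
have gx : g x < 0 by rewrite /g; move: lt; rewrite (_ : 2 * x / pi = 2 / pi * x); [lra | ring].
have g0 : g 0 = 0 by rewrite /g sin0 mulr0 subrr.
have gp : g (pi / 2) = 0 by rewrite /g sin_pihalf -mulrA (mulrA pi^-1) mulVf // mul1r divff ?subrr.
have x0' : 0 < x by rewrite lt_neqAle x0 andbT eq_sym; apply: contraTneq gx => ->; rewrite g0 ltxx.
have xp' : x < pi / 2.
  by rewrite lt_neqAle xp andbT; apply: contraTneq gx => ->; rewrite gp ltxx.
have [y1 /andP[y10 y1x] E1] : exists2 y, 0 < y < x & g x - g 0 = (cos y - 2 / pi) * (x - 0).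
  by have [y] := MVT x0' (fun y _ => dg y) (cg _ _); rewrite in_itv /= => ? ?; exists y.
have [y2 /andP[y2x y2p] E2] : exists2 y, x < y < pi / 2 &
    g (pi / 2) - g x = (cos y - 2 / pi) * (pi / 2 - x).
  by have [y] := MVT xp' (fun y _ => dg y) (cg _ _); rewrite in_itv /= => ? ?; exists y.
have c12 : cos y2 < cos y1.
  rewrite ltr_cos ?in_itv /=; first by lra.
    by apply/andP; split; lra.
  by apply/andP; split; lra.
move: E1 E2; rewrite g0 gp subr0 subr0 sub0r => E1 E2.
have : cos y1 - 2 / pi < 0.
  by rewrite ltNge; apply/negP => h; move: gx; rewrite E1 ltNge mulr_ge0 // ltW.
have : 0 < cos y2 - 2 / pi.
  rewrite ltNge; apply/negP => h; have : 0 < - g x by lra.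
  have : (cos y2 - 2 / pi) * (pi / 2 - x) <= 0 by apply: mulr_le0_ge0; lra.
  by rewrite -E2; lra.
lra.
Qed.

Lemma sin_le_id x : 0 <= x -> sin x <= x.
Proof.
move=> x0; pose g (y : R) := y - sin y.
have dg (y : R) : is_derive y 1 g (1 - cos y) by apply: is_derive_eq.
rewrite -subr_ge0 -/(g x) (_ : 0 = g 0); last by rewrite /g sin0 subrr.
have [->//|xn] := eqVneq x 0.
have xp : 0 < x by rewrite lt_neqAle eq_sym xn x0.
have cg : {within `[0, x], continuous g}.
  by apply: derivable_within_continuous => y _; have [] := dg y.
have [y _] := MVT xp (fun y _ => dg y) cg.
move=> E; rewrite -subr_ge0 E; apply: mulr_ge0; last by rewrite subr0.
by rewrite subr_ge0 cos_le1.
Qed.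
End TrigSums.

Section Modes.
Context {R : realType}.
Variable l : nat.
Local Notation N := l.*2.+1.
Implicit Types (k : 'I_N) (t b : bool) (j : nat).

Definition freq k : R := 2 * pi * (k%:R - l%:R) / N%:R.
(** The eigenvalue of the staggered difference operator; it approximates [2 pi (k - l)]. With an odd
    number of points [freq k / 2] stays strictly between [- pi / 2] and [pi / 2], so the eigenvalues
    have the sign of [k - l] and only constant loops have eigenvalue 0. *)
Definition eigen k : R := 2 * N%:R * sin (freq k / 2).
(* [b] selects the momentum component, which lives on the half-integer grid. *)
Definition mode k t b j : R :=
  if b then (if t then cos (freq k * (j%:R + 2^-1)) else - sin (freq k * (j%:R + 2^-1)))
  else (if t then sin (freq k * j%:R) else cos (freq k * j%:R)).

Lemma mode_le1 k t b j : `|mode k t b j| <= 1.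
Proof. by case: t; case: b; rewrite /mode ?normrN ?cos_max ?sin_max. Qed.

Let N0 : (N%:R : R) != 0. Proof. by rewrite pnatr_eq0. Qed.

Let dblR : (l.*2)%:R = 2 * l%:R :> R. Proof. by rewrite -mul2n natrM. Qed.

Lemma freqD_sum k k' (ph : R) : freq k + freq k' != 0 ->
  \sum_(j < N) cos ((freq k + freq k') * j%:R + ph) = 0.
Proof.
move=> nz; have E : freq k + freq k' = 2 * pi * ((k + k')%:R - (l.*2)%:R) / N%:R.
  by rewrite /freq (natrD _ k k') dblR; field.
rewrite E; apply: trig_sum_freq; have := ltn_ord k; have := ltn_ord k'; try lia.
move=> _ _; apply: contraNneq nz => kk; rewrite E kk subrr; apply/eqP; ring.
Qed.

Lemma freqB_sum k k' (ph : R) : k != k' ->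
  \sum_(j < N) cos ((freq k - freq k') * j%:R + ph) = 0.
Proof.
move=> nz; have -> : freq k - freq k' = 2 * pi * (k%:R - k'%:R) / N%:R.
  by rewrite /freq; field.
apply: trig_sum_freq; have := ltn_ord k; have := ltn_ord k'; try lia.
by [].
Qed.

Lemma freqS_sum (x x' : 'I_N) (ph : R) : x != x' ->
  \sum_(k < N) cos (freq k * (x%:R - x'%:R) + ph) = 0.
Proof.
move=> xx.
under eq_bigr => k _.
  rewrite (_ : _ + ph = 2 * pi * (x%:R - x'%:R) / N%:R * k%:R +
    (ph - 2 * pi * (x%:R - x'%:R) / N%:R * l%:R)); last by rewrite /freq; field.
  over.
by apply: trig_sum_freq; have := ltn_ord x; have := ltn_ord x'; try lia.
Qed.

Lemma freq_rev k : freq (rev_ord k) = - freq k.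
Proof.
have : (rev_ord k)%:R + k%:R = 2 * l%:R :> R.
  by rewrite -dblR -natrD; congr (_%:R); have := ltn_ord k; rewrite /=; lia.
rewrite /freq => E; have -> : (rev_ord k)%:R = 2 * l%:R - k%:R :> R by lra.
by field.
Qed.

(** Products of modes split into cosines at the difference frequency [D] and the sum frequency [S].
    Nonzero frequencies sum to 0 over the grid. When [S = 0], the contributions of the integer and
    of the half-integer grid have opposite signs and cancel. *)
Lemma mode_orthonormal k t k' t' :
  \sum_(j < N) (mode k t false j * mode k' t' false j + mode k t true j * mode k' t' true j) =
  N%:R * ((k == k') && (t == t'))%:R.
Proof.
pose C (th ph : R) := \sum_(j < N) cos (th * j%:R + ph).
have CB ph : C (freq k - freq k') ph = (if k == k' then N%:R * cos ph else 0).
  case: eqP => [->|/eqP kk]; last exact: freqB_sum.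
  by rewrite /C subrr; under eq_bigr do rewrite mul0r add0r; rewrite sumr_const card_ord mulr_natl.
have CD ph : C (freq k + freq k') ph = (if freq k + freq k' == 0 then N%:R * cos ph else 0).
  case: eqP => [->|/eqP kk]; last exact: freqD_sum.
  by rewrite /C; under eq_bigr do rewrite mul0r add0r; rewrite sumr_const card_ord mulr_natl.
have sc (x : R) : sin x = cos (x - pi / 2) by rewrite cosBpihalf.
set D := freq k - freq k' in CB *; set S := freq k + freq k' in CD *.
have bS : cos (S / 2) = 1 \/ S != 0.
  by have [S0|] := eqVneq S 0; [left; rewrite S0 mul0r cos0 | right].
have bD : cos (D / 2) = 1 \/ k != k'.
  by have [kk|] := eqVneq k k'; [left; rewrite /D kk subrr mul0r cos0 | right].
transitivity (2^-1 * \sum_(j < N)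
   (cos (D * j%:R + (if t == t' then 0 else if t then - (pi / 2) else pi / 2)) +
    cos (D * j%:R + (D / 2 + (if t == t' then 0 else if t then - (pi / 2) else pi / 2))) +
    (-1) ^+ (t && t') * (
    cos (S * j%:R + (if t == t' then 0 else - (pi / 2))) -
    cos (S * j%:R + (S / 2 + (if t == t' then 0 else - (pi / 2))))))).
  rewrite mulr_sumr; apply: eq_bigr => j _.
  rewrite /mode.
  have -> : D * j%:R = freq k * j%:R - freq k' * j%:R by rewrite /D; ring.
  have -> : S * j%:R = freq k * j%:R + freq k' * j%:R by rewrite /S; ring.
  rewrite !addrA.
  have -> : freq k * j%:R - freq k' * j%:R + D / 2 =
    freq k * (j%:R + 2^-1) - freq k' * (j%:R + 2^-1) by rewrite /D; ring.
  have -> : freq k * j%:R + freq k' * j%:R + S / 2 =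
    freq k * (j%:R + 2^-1) + freq k' * (j%:R + 2^-1) by rewrite /S; ring.
  set x := freq k * j%:R; set y := freq k' * j%:R.
  set x' := freq k * _; set y' := freq k' * _.
  case: t; case: t' => /=; rewrite ?addr0 ?expr0 ?expr1 ?cosBpihalf ?cosDpihalf;
    rewrite ?cosB ?cosD ?sinB ?sinD; by field.
rewrite big_split /= -mulr_sumr big_split sumrB /=.
rewrite -/(C D _) -/(C D _) -/(C S _) -/(C S _) !CB !CD.
have c2 : cos (pi / 2) = 0 :> R := cos_pihalf R.
have [S0|S0] := eqVneq S 0; have [kk|kk] := eqVneq k k'; rewrite /= ?(S0, mul0r, add0r, subr0, subrr, mulr0, addr0) //;
  rewrite ?/D ?kk ?subrr ?mul0r ?add0r; case: t; case: t' => /=;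
  rewrite ?cosN ?c2 ?cos0 ?(mulr0, mulr1, addr0, subrr, mul0r) //; by field.
Qed.

(** Sums that mix positions and momenta are odd in the frequency and vanish under [rev_ord]; the
    others are sums of cosines over all frequencies. *)
Lemma mode_complete (x x' : 'I_N) b b' :
  \sum_k (mode k false b x * mode k false b' x' + mode k true b x * mode k true b' x') =
  N%:R * ((x == x') && (b == b'))%:R.
Proof.
have odd0 (y : R) : \sum_k sin (freq k * y) = 0.
  have E : \sum_k sin (freq k * y) = - \sum_k sin (freq k * y).
    rewrite [LHS](reindex_inj rev_ord_inj) -sumrN.
    by apply: eq_bigr => k _; rewrite freq_rev mulNr sinN.
  by move: E; lra.
have ev : \sum_k cos (freq k * (x%:R - x'%:R)) = N%:R * (x == x')%:R :> R.
  have [->|xx] := eqVneq x x'.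
    by under eq_bigr do rewrite subrr mulr0 cos0; rewrite sumr_const card_ord mulr1.
  by rewrite mulr0 -[RHS](freqS_sum 0 xx); apply: eq_bigr => k _; rewrite addr0.
case: b; case: b' => /=; rewrite ?andbT ?andbF ?mulr0.
- rewrite -ev; apply: eq_bigr => k _; rewrite /mode.
  rewrite (_ : freq k * (x%:R - x'%:R) = freq k * (x%:R + 2^-1) - freq k * (x'%:R + 2^-1)); last by ring.
  by rewrite cosB; ring.
- transitivity (\sum_k sin (freq k * (x'%:R - x%:R - 2^-1))); last exact: odd0.
  apply: eq_bigr => k _; rewrite /mode.
  rewrite (_ : freq k * (x'%:R - x%:R - 2^-1) = freq k * x'%:R - freq k * (x%:R + 2^-1)); last by ring.
  by rewrite sinB; ring.
- transitivity (\sum_k sin (freq k * (x%:R - x'%:R - 2^-1))); last exact: odd0.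
  apply: eq_bigr => k _; rewrite /mode.
  rewrite (_ : freq k * (x%:R - x'%:R - 2^-1) = freq k * x%:R - freq k * (x'%:R + 2^-1)); last by ring.
  by rewrite sinB; ring.
- rewrite -ev; apply: eq_bigr => k _; rewrite /mode.
  rewrite (_ : freq k * (x%:R - x'%:R) = freq k * x%:R - freq k * x'%:R); last by ring.
  by rewrite cosB; ring.
Qed.

Lemma mode_period k t b j : mode k t b (j + N) = mode k t b j.
Proof.
have E (y : R) : freq k * (j + N)%:R + y = freq k * j%:R + y + 2 * pi * k%:R - 2 * pi * l%:R.
  by rewrite natrD /freq; field.
have sP y : sin (freq k * (j + N)%:R + y) = sin (freq k * j%:R + y).
  by rewrite E -(sin_periodn (_ - _) l) subrK sin_periodn.
have cP y : cos (freq k * (j + N)%:R + y) = cos (freq k * j%:R + y).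
  by rewrite -!sinDpihalf -!addrA sP.
by rewrite /mode !mulrDr; case: t; case: b; rewrite ?sP ?cP // -[freq k * (_ + _)%:R]addr0 ?sP ?cP addr0.
Qed.

(** This is the purpose of the staggered grids: the difference of a position mode is centred at a
    half-integer, hence exactly a multiple of the momentum mode, and [mode_diff_p] has the same
    factor. *)
Lemma mode_diff_q k t j :
  N%:R * (mode k t false j.+1 - mode k t false j) = eigen k * mode k t true j.
Proof.
rewrite /mode /eigen -[j.+1%:R]natr1.
rewrite (_ : freq k * (j%:R + 1) = freq k * (j%:R + 2^-1) + freq k / 2); last by field.
rewrite (_ : freq k * j%:R = freq k * (j%:R + 2^-1) - freq k / 2); last by field.
by case: t; rewrite ?sinB ?cosB ?sinD ?cosD; ring.
Qed.

Lemma mode_diff_p k t j :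
  N%:R * (mode k t true j - mode k t true j.+1) = eigen k * mode k t false j.+1.
Proof.
rewrite /mode /eigen -[j.+1%:R]natr1.
rewrite (_ : freq k * (j%:R + 1 + 2^-1) = freq k * (j%:R + 1) + freq k / 2); last by field.
rewrite (_ : freq k * (j%:R + 2^-1) = freq k * (j%:R + 1) - freq k / 2); last by field.
by case: t; rewrite ?sinB ?cosB ?sinD ?cosD; ring.
Qed.

(** The estimate [2 x / pi <= sin x] costs a factor 4 in place of [2 pi] but holds on every grid. It
    is the origin of the bounds 4 and 8 for the first two positive eigenvalues. *)
Lemma eigen_ge k : (l < k)%N -> 4 * (k%:R - l%:R) <= eigen k.
Proof.
move=> lk; have p0 := pi_gt0 R.
have fE : freq k / 2 = pi * (k%:R - l%:R) / N%:R by rewrite /freq; field.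
have kl : (0 : R) <= k%:R - l%:R by rewrite subr_ge0 ler_nat ltnW.
have k2l : (k%:R - l%:R : R) <= l%:R.
  by rewrite lerBlDr -natrD ler_nat; have := ltn_ord k; lia.
have NE : (N%:R : R) = 2 * l%:R + 1 by rewrite -addn1 natrD -mul2n natrM.
have Np : 0 < (N%:R : R) by rewrite ltr0n.
have := @sin_ge_linear R (freq k / 2); rewrite fE => /(_ _)/wrap[].
  rewrite divr_ge0 ?mulr_ge0 ?(ltW p0) //= ler_pdivrMr // NE.
  rewrite (_ : pi / 2 * (2 * l%:R + 1) = pi * (l%:R + 2^-1)); last by field.
  by rewrite ler_pM2l //; lra.
rewrite /eigen fE => h.
have : 2 * N%:R * (2 * (pi * (k%:R - l%:R) / N%:R) / pi) <= (2 * N%:R * sin (pi * (k%:R - l%:R) / N%:R) : R).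
  by rewrite ler_pM2l // mulr_gt0.
have pn : pi != 0 :> R by rewrite gt_eqF.
have F (u w y : R) : u != 0 -> w != 0 -> 2 * u * (2 * (w * y / u) / w) = 4 * y.
  by move=> u0 w0; field; rewrite ?u0 ?w0.
by rewrite F.
Qed.

Lemma eigen_rev k : eigen (rev_ord k) = - eigen k.
Proof. by rewrite /eigen freq_rev mulNr sinN mulrN. Qed.

Lemma eigen0 k : k = l :> nat -> eigen k = 0.
Proof. by move=> kl; rewrite /eigen /freq kl subrr mulr0 mul0r mul0r sin0 mulr0. Qed.

Lemma eigen_le0 k : (k <= l)%N -> eigen k <= 0.
Proof.
rewrite leq_eqVlt => /orP[/eqP/eigen0 ->//|kl].
rewrite -oppr_ge0 -eigen_rev; apply: le_trans (eigen_ge _).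
  by rewrite mulr_ge0 // subr_ge0 ler_nat /=; lia.
by rewrite /=; lia.
Qed.

Lemma eigen1_le k : k = l.+1 :> nat -> eigen k <= 2 * pi.
Proof.
move=> kl; have p0 := pi_gt0 R; rewrite /eigen.
have -> : freq k / 2 = pi / N%:R by rewrite /freq kl -natr1; field.
have := @sin_le_id R (pi / N%:R); rewrite divr_ge0 ?(ltW p0) // => /(_ isT) h.
rewrite -mulrA ler_pM2l // mulrC -ler_pdivlMr ?ltr0n //.
Qed.
End Modes.
Arguments mode : simpl never.
Arguments eigen : simpl never.
Arguments freq : simpl never.

(** * The discrete action functional and its a priori bounds *)

Section DiscreteAction.
Context {R : realType}.
Variables n l : nat.
Local Notation N := l.*2.+1.
Local Notation K := ('I_N * bool)%type.
Local Notation dim := #|{: K * 'I_n}|.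
Implicit Types (c v : 'rV[R]_dim) (k x : K) (i : 'I_n) (j : nat) (b : bool) (z : phase R n).

Definition dftk k x : R := mode k.1 k.2 x.2 x.1.
Definition pcoord z b i : R := if b then z.2 i ord0 else z.1 i ord0.
Definition ip (u v : phase R n) : R := \sum_b \sum_i pcoord u b i * pcoord v b i.
Definition coef c k i : R := c ord0 (enum_rank (k, i)).
Definition loop c b j i : R := \sum_k coef c k i * mode k.1 k.2 b j.
Definition loopz c j : phase R n := (\col_i loop c false j i, \col_i loop c true j i).

Let NR0 : (N%:R : R) != 0. Proof. by rewrite pnatr_eq0. Qed.
Let NRp : 0 < (N%:R : R). Proof. by rewrite ltr0n. Qed.

Lemma comp_loopz c j b i : pcoord (loopz c j) b i = loop c b j i.
Proof. by case: b; rewrite /pcoord /loopz /= mxE. Qed.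

Lemma sum_coef (F : 'I_dim -> R) : \sum_s F s = \sum_i \sum_k F (enum_rank (k, i)).
Proof.
rewrite (reindex enum_rank) /=; last by apply: onW_bij; exact: enum_rank_bij.
by rewrite exchange_big pair_bigA /=; apply: eq_bigr => -[].
Qed.

Lemma kernel_orthonormal k k' : \sum_x dftk k x * dftk k' x = N%:R * (k == k')%:R.
Proof.
rewrite -(pair_bigA _ (fun (j : 'I_N) b => dftk k (j, b) * dftk k' (j, b))) /=.
rewrite (eq_bigr (fun j : 'I_N => mode k.1 k.2 false j * mode k'.1 k'.2 false j +
  mode k.1 k.2 true j * mode k'.1 k'.2 true j)) => [|j _]; last by rewrite big_bool addrC.
by rewrite mode_orthonormal; case: k k' => [? ?] [? ?].
Qed.

Lemma kernel_complete x x' : \sum_k dftk k x * dftk k x' = N%:R * (x == x')%:R.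
Proof.
rewrite -(pair_bigA _ (fun (k : 'I_N) t => dftk (k, t) x * dftk (k, t) x')) /=.
rewrite (eq_bigr (fun k : 'I_N => mode k false x.2 x.1 * mode k false x'.2 x'.1 +
  mode k true x.2 x.1 * mode k true x'.2 x'.1)) => [|j _]; last by rewrite big_bool addrC.
by rewrite mode_complete; case: x x' => [? ?] [? ?].
Qed.

Lemma kernel_parseval (F G : K -> R) :
  \sum_x (\sum_k F k * dftk k x) * (\sum_k G k * dftk k x) = N%:R * \sum_k F k * G k.
Proof.
transitivity (\sum_k \sum_k' F k * G k' * \sum_x dftk k x * dftk k' x).
  under eq_bigr do rewrite big_distrlr /=.
  rewrite exchange_big; apply: eq_bigr => k _ /=; rewrite exchange_big; apply: eq_bigr => k' _ /=.
  by rewrite big_distrr; apply: eq_bigr => x _ /=; ring.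
rewrite big_distrr; apply: eq_bigr => k _ /=.
rewrite (bigD1 k) //= kernel_orthonormal eqxx /= big1 => [|k' kk]; first by ring.
by rewrite kernel_orthonormal eq_sym (negPf kk) !mulr0.
Qed.

Lemma kernel_parseval_dual (F : K -> R) :
  \sum_k (\sum_x F x * dftk k x) ^+ 2 = N%:R * \sum_x F x ^+ 2.
Proof.
transitivity (\sum_x \sum_x' F x * F x' * \sum_k dftk k x * dftk k x').
  under eq_bigr do rewrite expr2 big_distrlr /=.
  rewrite exchange_big; apply: eq_bigr => k _ /=; rewrite exchange_big; apply: eq_bigr => k' _ /=.
  by rewrite big_distrr; apply: eq_bigr => x _ /=; ring.
rewrite big_distrr; apply: eq_bigr => k _ /=.
rewrite (bigD1 k) //= kernel_complete eqxx /= big1 => [|k' kk]; first by ring.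
by rewrite kernel_complete eq_sym (negPf kk) !mulr0.
Qed.

Lemma kernel_inversion (F : K -> R) x :
  \sum_k (N%:R^-1 * \sum_y F y * dftk k y) * dftk k x = F x.
Proof.
transitivity (N%:R^-1 * \sum_y F y * \sum_k dftk k y * dftk k x).
  rewrite big_distrr /=.
  under eq_bigr do rewrite big_distrr big_distrl /=.
  rewrite exchange_big; apply: eq_bigr => y _ /=; rewrite !big_distrr /=.
  by apply: eq_bigr => k _ /=; ring.
rewrite (bigD1 x) //= kernel_complete eqxx /= big1 => [|y yx]; first by field.
by rewrite kernel_complete (negPf yx) !mulr0.
Qed.

Lemma loop_period c b j i : loop c b (j + N) i = loop c b j i.
Proof. by apply: eq_bigr => k _; rewrite mode_period. Qed.

Lemma loopz_period c j : loopz c (j + N) = loopz c j.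
Proof. by congr (_, _); apply/colP => i; rewrite !mxE loop_period. Qed.

Lemma loopD c v b j i : loop (c + v) b j i = loop c b j i + loop v b j i.
Proof. by rewrite -big_split; apply: eq_bigr => k _; rewrite /coef mxE mulrDl. Qed.

Lemma loopzD c v j : loopz (c + v) j = loopz c j + loopz v j.
Proof. by congr (_, _); apply/colP => i; rewrite !mxE loopD. Qed.

Lemma coef_le c k i : `|coef c k i| <= nrm2 c.
Proof.
rewrite -(@ler_pXn2r _ 2) ?nnegrE ?normr_ge0 ?nrm2_ge0 // nrm2_sqr real_normK ?num_real //.
rewrite /dotv (bigD1 (enum_rank (k, i))) //= -expr2 lerDl sumr_ge0 // => s _.
by rewrite -expr2 sqr_ge0.
Qed.

Lemma loop_le c b j i : `|loop c b j i| <= (N.*2)%:R * nrm2 c.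
Proof.
apply: (le_trans (ler_norm_sum _ _ _)).
rewrite (_ : N.*2%:R * nrm2 c = \sum_(k : K) nrm2 c); last first.
  rewrite sumr_const (_ : #|_| = N.*2) ?mulr_natl //.
  by rewrite card_prod card_bool card_ord muln2.
apply: ler_sum => k _; rewrite normrM -[leRHS]mulr1.
by rewrite ler_pM ?normr_ge0 ?coef_le ?mode_le1.
Qed.

Lemma loop_diff_q c j i :
  N%:R * (loop c false j.+1 i - loop c false j i) =
  \sum_k eigen k.1 * coef c k i * mode k.1 k.2 true j.
Proof.
rewrite -sumrB big_distrr; apply: eq_bigr => k _ /=.
by rewrite -mulrBr mulrCA mode_diff_q; ring.
Qed.

Lemma loop_diff_p c j i :
  N%:R * (loop c true j i - loop c true j.+1 i) =
  \sum_k eigen k.1 * coef c k i * mode k.1 k.2 false j.+1.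
Proof.
rewrite -sumrB big_distrr; apply: eq_bigr => k _ /=.
by rewrite -mulrBr mulrCA mode_diff_p; ring.
Qed.

Lemma loop_parseval c i :
  \sum_(j < N) \sum_b loop c b j i ^+ 2 = N%:R * \sum_k coef c k i ^+ 2.
Proof.
rewrite pair_bigA /=.
transitivity (\sum_x (\sum_k coef c k i * dftk k x) * (\sum_k coef c k i * dftk k x)).
  by apply: eq_bigr => x _; rewrite expr2.
by rewrite kernel_parseval; congr (_ * _); apply: eq_bigr => k _; rewrite expr2.
Qed.

Lemma continuous_coef k i : continuous (fun c => coef c k i).
Proof. exact: coord_continuous. Qed.

Lemma continuous_loopz j : continuous (fun c => loopz c j).
Proof.
have cl b i : continuous (fun c => loop c b j i).
  by apply: cont_sum => k; apply: cont_mul; [exact: continuous_coef | exact: cst_continuous].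
have c1 b : continuous (fun c => \col_i loop c b j i : 'cV[R]_n).
  apply: continuous_mx => i k.
  by have -> : (fun c => (\col_i0 loop c b j i0 : 'cV[R]_n) i k) = (fun c => loop c b j i)
    by apply/funext => c; rewrite mxE.
exact: cont_pair.
Qed.

Variables (a : 'I_n -> R) (h : phase R n -> R) (gh : phase R n -> phase R n).

(** The discretised action of the Hamiltonian with quadratic part given by [a] and remainder [h]. By
    Parseval the quadratic part merely shifts the eigenvalues, so only [h] is sampled on the
    grid. *)
Definition act c : R :=
  2^-1 * (\sum_i \sum_k (eigen k.1 - a i) * coef c k i ^+ 2) -
  N%:R^-1 * \sum_(j < N) h (loopz c j).

Definition gcoef c k i : R :=
  N%:R^-1 * \sum_(x : K) pcoord (gh (loopz c x.1)) x.2 i * dftk k x.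

Definition dact c : 'rV[R]_dim := \row_s
  ((eigen (enum_val s).1.1 - a (enum_val s).2) * coef c (enum_val s).1 (enum_val s).2
   - gcoef c (enum_val s).1 (enum_val s).2).

Lemma coef_dact c k i : coef (dact c) k i = (eigen k.1 - a i) * coef c k i - gcoef c k i.
Proof. by rewrite /coef mxE enum_rankK. Qed.

Hypotheses (ch : continuous h) (cgh : continuous gh).
Hypothesis h_diff : forall e : R, 0 < e -> exists2 eta : R, 0 < eta & forall z w : phase R n,
  (forall b i, `|pcoord w b i| <= eta) ->
  `|h (z + w) - h z - ip (gh z) w| <= e * \sum_b \sum_i `|pcoord w b i|.

Lemma continuous_comp_phase b i : continuous (fun z => pcoord z b i).
Proof.
case: b.
  by apply: (@cont_comp _ _ _ (fun v : 'cV[R]_n => v i ord0) snd); [by move=> x; exact: cvg_snd | exact: coord_continuous].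
by apply: (@cont_comp _ _ _ (fun v : 'cV[R]_n => v i ord0) fst); [by move=> x; exact: cvg_fst | exact: coord_continuous].
Qed.

Lemma continuous_act : continuous act.
Proof.
apply: cont_sub; apply: cont_mul; try exact: cst_continuous.
  apply: cont_sum => i; apply: cont_sum => k; apply: cont_mul; first exact: cst_continuous.
  under eq_fun do rewrite expr2.
  by apply: cont_mul; exact: continuous_coef.
by apply: cont_sum => j; apply: (cont_comp (@continuous_loopz j)).
Qed.

Lemma continuous_dact : continuous dact.
Proof.
apply: continuous_row => s.
have -> : (fun c => dact c ord0 s) = (fun c =>
   (eigen (enum_val s).1.1 - a (enum_val s).2) * coef c (enum_val s).1 (enum_val s).2
   - gcoef c (enum_val s).1 (enum_val s).2) by apply/funext => c; rewrite mxE.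
apply: cont_sub; apply: cont_mul; try exact: cst_continuous.
  exact: continuous_coef.
apply: cont_sum => x; apply: cont_mul; last exact: cst_continuous.
apply: (cont_comp _ (@continuous_comp_phase _ _)).
exact: (cont_comp (@continuous_loopz _) cgh).
Qed.

Lemma dot_dact c v : dotv (dact c) v =
  (\sum_i \sum_k (eigen k.1 - a i) * coef c k i * coef v k i) -
  N%:R^-1 * \sum_(j < N) ip (gh (loopz c j)) (loopz v j).
Proof.
rewrite /dotv sum_coef.
transitivity (\sum_i \sum_k ((eigen k.1 - a i) * coef c k i * coef v k i
  - N%:R^-1 * \sum_(x : K) pcoord (gh (loopz c x.1)) x.2 i * (coef v k i * dftk k x))).
  apply: eq_bigr => i _; apply: eq_bigr => k _.
  rewrite -/(coef (dact c) k i) coef_dact mulrBl; congr (_ - _).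
  rewrite -/(coef v k i) /gcoef -mulrA big_distrl /=; congr (_ * _); apply: eq_bigr => x _; ring.
under eq_bigr do rewrite sumrB; rewrite sumrB; congr (_ - _).
under eq_bigr do rewrite -mulr_sumr; rewrite -mulr_sumr; congr (_ * _).
transitivity (\sum_i \sum_(x : K) pcoord (gh (loopz c x.1)) x.2 i * loop v x.2 x.1 i).
  apply: eq_bigr => i _; rewrite exchange_big; apply: eq_bigr => x _.
  by rewrite -mulr_sumr.
rewrite exchange_big -(pair_bigA _ (fun (j : 'I_N) b =>
  \sum_i pcoord (gh (loopz c j)) b i * loop v b j i)) /=.
apply: eq_bigr => j _; apply: eq_bigr => b _; apply: eq_bigr => i _.
by rewrite comp_loopz.
Qed.

(** The remainder is a fixed quadratic form in [v] plus the Taylor remainders of [h]; both are small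
    uniformly in [c], as the descent argument requires. *)
Lemma act_diff e : 0 < e -> exists2 eta : R, 0 < eta & forall c v,
  nrm2 v <= eta -> act (c + v) <= act c + dotv (dact c) v + e * nrm2 v.
Proof.
move=> e0.
pose L := \sum_i \sum_(k : K) `|eigen k.1 - a i| + 1.
have L0 : 0 < L by rewrite ltr_wpDl // sumr_ge0 // => i _; rewrite sumr_ge0.
pose M : R := (N.*2)%:R + 1.
have M0 : 0 < M by rewrite ltr_wpDl.
pose M' : R := (2 * n)%:R * M + 1.
have M'0 : 0 < M' by rewrite ltr_wpDl // mulr_ge0 // ltW.
have [eta eta0 etaP] := h_diff (divr_gt0 (divr_gt0 e0 (ltr0n R 2)) M'0).
exists (Num.min (e / L) (eta / M)); first by rewrite lt_min !divr_gt0.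
move=> c v; rewrite le_min => /andP[vL vM].
have q0 : 0 <= nrm2 v by exact: nrm2_ge0.
have loopM b j i : `|pcoord (loopz v j) b i| <= M * nrm2 v.
  rewrite comp_loopz; apply: (le_trans (loop_le _ _ _ _)).
  by rewrite ler_wpM2r // lerDl.
have E : act (c + v) - act c - dotv (dact c) v =
   2^-1 * (\sum_i \sum_k (eigen k.1 - a i) * coef v k i ^+ 2) -
   N%:R^-1 * \sum_(j < N) (h (loopz c j + loopz v j) - h (loopz c j) - ip (gh (loopz c j)) (loopz v j)).
  rewrite dot_dact /act.
  under [\sum_(j < N) h (loopz (c + v) j)]eq_bigr do rewrite loopzD.
  rewrite !sumrB.
  have -> : \sum_i \sum_k (eigen k.1 - a i) * coef (c + v) k i ^+ 2 =
    (\sum_i \sum_k (eigen k.1 - a i) * coef c k i ^+ 2) +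
    2 * (\sum_i \sum_k (eigen k.1 - a i) * coef c k i * coef v k i) +
    \sum_i \sum_k (eigen k.1 - a i) * coef v k i ^+ 2.
    rewrite mulr_sumr -!big_split; apply: eq_bigr => i _ /=.
    rewrite mulr_sumr -!big_split; apply: eq_bigr => k _ /=.
    by rewrite /coef mxE; ring.
  by field.
have B1 : \sum_i \sum_k (eigen k.1 - a i) * coef v k i ^+ 2 <= L * nrm2 v ^+ 2.
  rewrite /L mulrDl mul1r ler_wpDr ?sqr_ge0 // mulr_suml; apply: ler_sum => i _.
  rewrite mulr_suml; apply: ler_sum => k _.
  apply: (le_trans (ler_norm _)); rewrite normrM ler_wpM2l //.
  rewrite ger0_norm ?sqr_ge0 // -[coef v k i ^+ 2]real_normK ?num_real //.
  by rewrite ler_pXn2r ?nnegrE ?normr_ge0 ?coef_le.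
have B2 j : `|h (loopz c j + loopz v j) - h (loopz c j) - ip (gh (loopz c j)) (loopz v j)|
     <= e * nrm2 v / 2.
  apply: (le_trans (etaP _ _ _)) => [b i|].
    by apply: (le_trans (loopM _ _ _)); rewrite mulrC -ler_pdivlMr.
  rewrite mulrAC -mulrA [leRHS]mulrAC ler_wpM2l //; first by lra.
  rewrite -ler_pdivlMr ?invr_gt0 // invrK mulrC.
  apply: (@le_trans _ _ (\sum_(b : bool) \sum_(i < n) M * nrm2 v)).
    by apply: ler_sum => b _; apply: ler_sum => i _; exact: loopM.
  rewrite !sumr_const card_bool card_ord -mulrnA -mulr_natl (mulnC n) mulrA.
  by rewrite ler_wpM2r // /M' lerDl.
have B3 : `|N%:R^-1 * \sum_(j < N) (h (loopz c j + loopz v j) - h (loopz c j) -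
    ip (gh (loopz c j)) (loopz v j))| <= e * nrm2 v / 2.
  rewrite normrM ger0_norm ?invr_ge0 // mulrC ler_pdivrMr //.
  apply: (le_trans (ler_norm_sum _ _ _)).
  apply: (@le_trans _ _ (\sum_(j < N) e * nrm2 v / 2)); first by apply: ler_sum.
  by rewrite sumr_const card_ord mulr_natr.
have B4 : L * nrm2 v ^+ 2 <= e * nrm2 v.
  by rewrite expr2 mulrA ler_wpM2r // mulrC -ler_pdivlMr.
move: E B3; set S := N%:R^-1 * _ => E; rewrite ler_norml => /andP[B3 _].
lra.
Qed.

(** The quadratic part is homogeneous of degree 2, so pairing with the loop itself doubles it. At an
    almost critical loop the action is thus nearly the mean of half of [ip (gh z) z] minus [h z]. *)
Lemma dact_dot_id c : dotv (dact c) c =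
  2 * act c + N%:R^-1 * \sum_(j < N) (2 * h (loopz c j) - ip (gh (loopz c j)) (loopz c j)).
Proof.
rewrite dot_dact /act sumrB -mulr_sumr.
rewrite (eq_bigr (fun i => \sum_k (eigen k.1 - a i) * coef c k i ^+ 2)) => [|i _].
  by field.
by apply: eq_bigr => k _; ring.
Qed.

Lemma dact_inversion c (x : K) i :
  \sum_k coef (dact c) k i * dftk k x =
  \sum_k eigen k.1 * coef c k i * dftk k x - a i * loop c x.2 x.1 i - pcoord (gh (loopz c x.1)) x.2 i.
Proof.
rewrite -[X in _ - X](kernel_inversion (fun x : K => pcoord (gh (loopz c x.1)) x.2 i)).
rewrite /loop mulr_sumr -!sumrB; apply: eq_bigr => k _.
by rewrite coef_dact -/(gcoef c k i) -/(dftk k x); ring.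
Qed.

Variables (A G gam : R).
Hypotheses (a_le : forall i, `|a i| <= A) (gam_gt0 : 0 < gam).
Hypothesis gap : forall (k : 'I_N) i, gam <= `|eigen k - a i|.
Hypothesis gh_le : forall z b i, `|pcoord (gh z) b i| <= G.

Lemma gcoef_sqr c i : \sum_k gcoef c k i ^+ 2 <= 2 * G ^+ 2.
Proof.
under eq_bigr do rewrite /gcoef exprMn.
rewrite -mulr_sumr kernel_parseval_dual; set S := \sum_x _.
have -> : N%:R^-1 ^+ 2 * (N%:R * S) = S / N%:R by field.
rewrite ler_pdivrMr //.
apply: (@le_trans _ _ (\sum_(x : K) G ^+ 2)).
  apply: ler_sum => x _; rewrite -real_normK ?num_real //.
  by rewrite ler_pXn2r ?nnegrE ?normr_ge0 // (le_trans _ (gh_le (loopz c x.1) x.2 i)).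
rewrite sumr_const (_ : #|_| = (2 * N)%N); last by rewrite card_prod card_bool card_ord mulnC.
rewrite mulrnA -[_ *+ N]mulr_natr -[G ^+ 2 *+ 2]mulr_natl.
by [].
Qed.

Lemma dact_sqr_le c i : \sum_k coef (dact c) k i ^+ 2 <= nrm2 (dact c) ^+ 2.
Proof.
rewrite nrm2_sqr /dotv sum_coef (bigD1 i) //=.
apply: ler_wpDr; last by apply: ler_sum => k _; rewrite -expr2.
by apply: sumr_ge0 => i' _; apply: sumr_ge0 => k _; rewrite -expr2 sqr_ge0.
Qed.

Let B := 2 + 4 * G ^+ 2.

(** In Fourier coordinates [(eigen - a) * coef] is a gradient component plus a coefficient of the
    bounded field [gh]. Division by the spectral gap bounds the loop and its difference quotients in
    mean square, with constants free of the grid. *)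
Lemma coef_bound c i : nrm2 (dact c) <= 1 ->
  \sum_k coef c k i ^+ 2 <= B / gam ^+ 2 /\
  \sum_k (eigen k.1 * coef c k i) ^+ 2 <= 2 * B + 2 * A ^+ 2 * (B / gam ^+ 2).
Proof.
move=> d1.
have S : \sum_k ((eigen k.1 - a i) * coef c k i) ^+ 2 <= B.
  have h1 := gcoef_sqr c i; have h2 := dact_sqr_le c i.
  have h3 : nrm2 (dact c) ^+ 2 <= 1 by rewrite expr_le1 // nrm2_ge0.
  apply: (@le_trans _ _ (2 * (\sum_k coef (dact c) k i ^+ 2) + 2 * \sum_k gcoef c k i ^+ 2)).
    rewrite !mulr_sumr -big_split; apply: ler_sum => k _ /=.
    have -> : (eigen k.1 - a i) * coef c k i = coef (dact c) k i + gcoef c k i.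
      by rewrite coef_dact; ring.
    rewrite -subr_ge0; set u := coef _ _ _; set w := gcoef _ _ _.
    rewrite (_ : _ - _ = (u - w) ^+ 2); [exact: sqr_ge0 | ring].
  by rewrite /B; lra.
have S1 : \sum_k coef c k i ^+ 2 <= B / gam ^+ 2.
  rewrite ler_pdivlMr ?exprn_gt0 //; apply: le_trans S; rewrite mulr_suml.
  apply: ler_sum => k _; rewrite exprMn mulrC ler_wpM2r ?sqr_ge0 //.
  rewrite -[leRHS]real_normK ?num_real // ler_pXn2r ?nnegrE ?normr_ge0 //.
  exact: ltW.
split=> //.
apply: (@le_trans _ _ (2 * (\sum_k ((eigen k.1 - a i) * coef c k i) ^+ 2) +
   2 * A ^+ 2 * \sum_k coef c k i ^+ 2)).
  rewrite !mulr_sumr -big_split; apply: ler_sum => k _ /=.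
  apply: (@le_trans _ _ (2 * ((eigen k.1 - a i) * coef c k i) ^+ 2 + 2 * (a i) ^+ 2 * coef c k i ^+ 2)).
    rewrite -subr_ge0; set u := coef _ _ _; set w := eigen _.
    rewrite (_ : _ - _ = ((w - a i) * u - a i * u) ^+ 2); [exact: sqr_ge0 | ring].
  rewrite lerD2l ler_wpM2r ?sqr_ge0 // ler_pM2l // -real_normK ?num_real //.
  by rewrite ler_pXn2r ?nnegrE ?normr_ge0 // (le_trans _ (a_le i)).
have : 0 <= A ^+ 2 by exact: sqr_ge0.
move=> A0; apply: lerD; first by rewrite ler_pM2l.
by rewrite ler_wpM2l // mulr_ge0.
Qed.

(** Parseval for the differentiated modes. The momentum difference at [j] lives at the position
    point [j + 1], so that case needs a cyclic shift of the sum. *)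
Lemma loop_diff_sqr c b i :
  \sum_(j < N) (N%:R * (loop c b j.+1 i - loop c b j i)) ^+ 2 <=
  N%:R * \sum_k (eigen k.1 * coef c k i) ^+ 2.
Proof.
pose f b j := \sum_k eigen k.1 * coef c k i * mode k.1 k.2 b j.
have P : \sum_(j < N) \sum_b f b j ^+ 2 = N%:R * \sum_k (eigen k.1 * coef c k i) ^+ 2.
  rewrite pair_bigA /= -(eq_bigr _ (fun k _ => esym (expr2 (eigen k.1 * coef c k i)))) -kernel_parseval.
  by apply: eq_bigr => x _; rewrite expr2.
have P1 b' : \sum_(j < N) f b' j ^+ 2 <= N%:R * \sum_k (eigen k.1 * coef c k i) ^+ 2.
  rewrite -P; apply: ler_sum => j _; rewrite big_bool /=.
  by case: b'; rewrite ?lerDl ?lerDr sqr_ge0.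
case: b.
  apply: le_trans (P1 false).
  have -> : \sum_(j < N) (N%:R * (loop c true j.+1 i - loop c true j i)) ^+ 2 =
      \sum_(j < N) f false j.+1 ^+ 2.
    by apply: eq_bigr => j _; rewrite /f -loop_diff_p -[RHS]sqrrN -mulrN opprB.
  have fN : f false N = f false 0%N.
    by apply: eq_bigr => k _; have := mode_period k.1 k.2 false 0; rewrite add0n => ->.
  have E1 : \sum_(j < N.+1) f false j ^+ 2 = \sum_(j < N) f false j ^+ 2 + f false N ^+ 2.
    by rewrite big_ord_recr.
  have E2 : \sum_(j < N.+1) f false j ^+ 2 = f false 0%N ^+ 2 + \sum_(j < N) f false j.+1 ^+ 2.
    by rewrite big_ord_recl.
  by move: E1; rewrite E2 fN; lra.
apply: le_trans (P1 true); apply: ler_sum => j _.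
by rewrite loop_diff_q.
Qed.

(** A discrete Sobolev inequality: some grid point has its square below the mean, and the variation
    from there on is controlled by the mean square of the difference quotients. *)
Lemma loop_bound c b j i : nrm2 (dact c) <= 1 ->
  `|loop c b j i| <= 2 + B / gam ^+ 2 + (2 * B + 2 * A ^+ 2 * (B / gam ^+ 2)).
Proof.
move=> /coef_bound -/(_ i)[S1 S2].
set X := B / gam ^+ 2 in S1 *; set Y := 2 * B + _ in S2 *.
wlog jN : j / (j < N)%N => [W|].
  have -> : loop c b j i = loop c b (j %% N) i.
    rewrite {1}(divn_eq j N) addnC; elim: (j %/ N)%N => [|m IH]; first by rewrite mul0n addn0.
    by rewrite mulSn (addnC N) addnA loop_period.
  by apply: W; rewrite ltn_mod.
(* This stands in for the Cauchy-Schwarz inequality and explains the shape of the final constant. *)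
have half (x : R) : `|x| <= (1 + x ^+ 2) / 2.
  have := sqr_ge0 (`|x| - 1); rewrite sqrrB real_normK ?num_real // mulr1 expr1n; lra.
have [j0 j0P] : exists j0 : 'I_N, loop c b j0 i ^+ 2 <= X.
  apply: contrapT => /forallNP nX.
  have : \sum_(j < N) \sum_b loop c b j i ^+ 2 <= N%:R * X.
    by rewrite loop_parseval ler_pM2l.
  apply/negP; rewrite -ltNge.
  have -> : N%:R * X = \sum_(j < N) X by rewrite sumr_const card_ord mulr_natl.
  apply: ltr_sum => [|j' _]; first by apply/hasP; exists ord0; rewrite ?mem_index_enum.
  have /negP := nX j'; rewrite -ltNge => /lt_le_trans; apply.
  by rewrite big_bool; case: (b); rewrite ?lerDl ?lerDr sqr_ge0.
have tv (u w : nat) : (u <= w)%N -> (w <= N)%N ->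
    `|loop c b w i - loop c b u i| <= (1 + Y) / 2.
  move=> uw wN; apply: (@le_trans _ _ (\sum_(m < N) `|loop c b m.+1 i - loop c b m i|)).
    rewrite -(telescope_sumr (fun m => loop c b m i)) // (le_trans (ler_norm_sum _ _ _)) //.
    rewrite -(big_mkord xpredT (fun m => `|loop c b m.+1 i - loop c b m i|)).
    rewrite (@big_cat_nat _ _ _ u 0%N N) ?leq0n ?(leq_trans uw wN) //=.
    rewrite [X in _ <= _ + X](@big_cat_nat _ _ _ w u N) ?uw ?wN //=.
    by rewrite ler_wpDl ?lerDl ?sumr_ge0.
  apply: (@le_trans _ _ (N%:R^-1 * \sum_(m < N) ((1 + (N%:R * (loop c b m.+1 i - loop c b m i)) ^+ 2) / 2))).
    rewrite mulr_sumr; apply: ler_sum => m _.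
    rewrite -ler_pdivrMl ?invr_gt0 // invrK -[X in X * `|_|]ger0_norm // -normrM.
    exact: half.
  rewrite mulrC ler_pdivrMr // -mulr_suml big_split /= sumr_const card_ord.
  have := loop_diff_sqr c b i; have := NRp => Np.
  have : N%:R * \sum_k (eigen k.1 * coef c k i) ^+ 2 <= N%:R * Y by rewrite ler_pM2l.
  lra.
have : `|loop c b j i - loop c b j0 i| <= (1 + Y) / 2.
  by case: (leqP j0 j) => jj; [|rewrite distrC]; apply: tv => //; exact: ltnW.
have := ler_distD (loop c b j0 i) (loop c b j i) 0; rewrite !subr0.
have := half (loop c b j0 i).
have X0 : 0 <= X by apply: le_trans S1; apply: sumr_ge0 => k _; exact: sqr_ge0.
have Y0 : 0 <= Y by apply: le_trans S2; apply: sumr_ge0 => k _; exact: sqr_ge0.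
lra.
Qed.
End DiscreteAction.

(** There are [M + 1] frequencies with two modes each, whatever the size of the grid. *)
Lemma card_window (N l M : nat) :
  (#|[pred k : 'I_N * bool | (l < k.1)%N && (k.1 <= l + M.+1)%N]| <= 2 * M.+1)%N.
Proof.
set A := [pred k : 'I_N * bool | _].
pose f (k : 'I_N * bool) : 'I_M.+1 * bool := (inord (k.1 - l.+1), k.2).
have fA : {in A &, injective f}.
  move=> [[k kN] t] [[k' k'N] t'] /=; rewrite !inE /= => /andP[k0 kM] /andP[k0' kM'].
  rewrite /f /= => -[/(congr1 (@nat_of_ord _)) E ->].
  have {}E : (k - l.+1 = k' - l.+1)%N.
    by move: E; rewrite inordK ?inordK //; clear -k0 kM k0' kM'; lia.
  have kk : k = k' by clear -E k0 k0'; lia.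
  by congr (_, _); apply: val_inj.
rewrite -(card_in_image fA); apply: (leq_trans (max_card _)).
by rewrite card_prod card_bool card_ord mulnC.
Qed.

Lemma window_gt (l k M : nat) : (l + M < k)%N -> (l < k)%N.
Proof. lia. Qed.

Lemma window_out (l k M : nat) : (l < k)%N && ~~ (k <= l + M)%N = (l + M < k)%N.
Proof. by rewrite -ltnNge; apply: andb_idl; exact: window_gt. Qed.

(** * Almost critical points of the discrete action *)

Section DiscreteOrbit.
Context {R : realType}.
Variables (n : nat) (i0 : 'I_n) (a : 'I_n -> R) (h : phase R n -> R) (gh : phase R n -> phase R n).
Variables (z0 : phase R n) (am G Ch r0 C1 : R).

Definition sq (z : phase R n) : R := \sum_b \sum_i pcoord z b i ^+ 2.
Definition ham z : R := 2^-1 * (\sum_b \sum_i a i * pcoord z b i ^+ 2) + h z.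
(** The integrand of the action along a critical loop: the quadratic part of the Hamiltonian has
    cancelled by homogeneity. *)
Definition wfun z : R := 2^-1 * ip (gh z) z - h z.

Hypotheses (am_gt0 : 0 < am) (a_ge : forall i, am <= a i).
Hypotheses (a0_gt : 2 * pi < a i0) (a0_lt : a i0 < 8).
Hypothesis a_le2 : forall i, i != i0 -> a i <= 2.
Hypotheses (ch : continuous h) (cgh : continuous gh).
Hypothesis h_diff : forall e : R, 0 < e -> exists2 eta : R, 0 < eta & forall z w : phase R n,
  (forall b i, `|pcoord w b i| <= eta) ->
  `|h (z + w) - h z - ip (gh z) w| <= e * \sum_b \sum_i `|pcoord w b i|.
Hypothesis gh_le : forall z b i, `|pcoord (gh z) b i| <= G.
Hypothesis h_ge : forall z, - Ch <= h z.
Hypothesis ham_ge0 : forall z, 0 <= ham z.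
Hypotheses (r0_gt0 : 0 < r0) (C1_gt0 : 0 < C1).
Hypothesis ham_near : forall z, sq (z - z0) <= r0 ^+ 2 -> ham z = 0.
Hypothesis ham_le : forall z, ham z <= C1 * sq (z - z0).

Lemma comp_add (u v : phase R n) b i : pcoord (u + v) b i = pcoord u b i + pcoord v b i.
Proof. by case: b; rewrite /pcoord /= mxE. Qed.

Lemma sqr_sum_le (I : finType) (P : pred I) (x : I -> R) m : (#|P| <= m)%N ->
  (\sum_(i | P i) x i) ^+ 2 <= m%:R * \sum_(i | P i) x i ^+ 2.
Proof.
move=> Pm; set S := \sum_(i | P i) x i ^+ 2.
have S0 : 0 <= S by apply: sumr_ge0 => i _; exact: sqr_ge0.
apply: (@le_trans _ _ (#|P|%:R * S)); last by rewrite ler_wpM2r // ler_nat.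
apply: (@le_trans _ _ (\sum_(i | P i) \sum_(j | P j) ((x i ^+ 2 + x j ^+ 2) / 2))).
  rewrite expr2 big_distrlr /=; apply: ler_sum => i _; apply: ler_sum => j _.
  by have := sqr_ge0 (x i - x j); rewrite sqrrB mulr2n; lra.
rewrite le_eqVlt; apply/orP; left; apply/eqP.
rewrite (eq_bigr (fun i => #|P|%:R * x i ^+ 2 / 2 + S / 2)) => [|i _].
  by rewrite big_split /= -mulr_suml -mulr_sumr -/S sumr_const -mulr_natl; field.
by rewrite -mulr_suml big_split /= sumr_const -mulr_natl -/S; ring.
Qed.

Section FixedGrid.
Variable l' : nat.
Local Notation l := l'.+1.
Local Notation N := l.*2.+1.
Local Notation K := ('I_N * bool)%type.
Local Notation dim := #|{: K * 'I_n}|.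
Implicit Types (c : 'rV[R]_dim) (k : K) (i : 'I_n).

Let NRp : 0 < (N%:R : R). Proof. by rewrite ltr0n. Qed.
Let NR0 : (N%:R : R) != 0. Proof. by rewrite pnatr_eq0. Qed.

Let gam : R := Num.min am (Num.min (a i0 - 2 * pi) (Num.min (8 - a i0) 2)).

Lemma gam_gt0 : 0 < gam.
Proof. by rewrite !lt_min am_gt0 !subr_gt0 a0_gt a0_lt ltr0n. Qed.

(** Nonpositive eigenvalues are at distance at least [am]. The first positive one lies in
    [[4, 2 pi]], below [a i0] and above the other [a i]; all further ones are at least 8, above
    every [a i]. *)
Lemma eigen_gap (k : 'I_N) i : gam <= `|eigen k - a i|.
Proof.
have ai := a_ge i; have am0 := am_gt0.
have [kl|lk] := leqP k l.
  rewrite /gam ge_min; apply/orP; left.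
  have e0 : (eigen k : R) <= 0 by exact: eigen_le0.
  by rewrite distrC ger0_norm; lra.
have e4 : 4 * (k%:R - l%:R) <= (eigen k : R) by exact: eigen_ge.
have [kl1|kl1] := eqVneq (k : nat) l.+1.
  have e2 : (eigen k : R) <= 2 * pi by exact: eigen1_le.
  move: e4; rewrite kl1 -[l.+1%:R]natr1 => e4.
  have [ii|/a_le2 a2] := eqVneq i i0.
    rewrite /gam !ge_min; apply/orP; right; apply/orP; left; rewrite ii.
    by rewrite distrC ler_normr; apply/orP; left; lra.
  by rewrite /gam !ge_min; do 3!(apply/orP; right); rewrite ler_normr; apply/orP; left; lra.
have : l.+2%:R <= (k%:R : R) by rewrite ler_nat; lia.
rewrite -[l.+2%:R]natr1 -[l.+1%:R]natr1 => k2.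
have [ii|/a_le2 a2] := eqVneq i i0.
  rewrite /gam !ge_min; do 2!(apply/orP; right); apply/orP; left; rewrite ii.
  by rewrite ler_normr; apply/orP; left; lra.
by rewrite /gam !ge_min; do 3!(apply/orP; right); rewrite ler_normr; apply/orP; left; lra.
Qed.

Lemma act_ham c : act a h c =
  2^-1 * (\sum_i \sum_k eigen k.1 * coef c k i ^+ 2) - N%:R^-1 * \sum_(j < N) ham (loopz c j).
Proof.
have P : N%:R^-1 * \sum_(j < N) 2^-1 * (\sum_b \sum_i a i * pcoord (loopz c j) b i ^+ 2) =
    2^-1 * \sum_i \sum_k a i * coef c k i ^+ 2.
  rewrite -mulr_sumr mulrCA; congr (_ * _).
  transitivity (N%:R^-1 * \sum_i a i * \sum_(j < N) \sum_b loop c b j i ^+ 2).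
    congr (_ * _); rewrite (eq_bigr (fun j : 'I_N => \sum_i \sum_b a i * loop c b j i ^+ 2)).
      by rewrite exchange_big; apply: eq_bigr => i _; rewrite mulr_sumr; apply: eq_bigr => j _; rewrite mulr_sumr.
    by move=> j _; rewrite exchange_big; apply: eq_bigr => i _; apply: eq_bigr => b _; rewrite comp_loopz.
  rewrite mulr_sumr; apply: eq_bigr => i _; rewrite loop_parseval -mulr_sumr.
  by field.
rewrite /act /ham; under [in RHS]eq_bigr do rewrite -/(ham _).
rewrite big_split /= mulrDr P.
rewrite (eq_bigr (fun i => \sum_k eigen k.1 * coef c k i ^+ 2 - \sum_k a i * coef c k i ^+ 2)) => [|i _].
  by rewrite sumrB; ring.
by rewrite -sumrB; apply: eq_bigr => k _; ring.
Qed.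

(** Data for the linking theorem: the negative directions are the modes of frequency at most 0, the
    extra direction [s0] is a mode of the first positive frequency in the coordinate [i0], and [zv]
    is the constant loop at [z0]. *)
Let neg : pred 'I_dim := fun s : 'I_dim => ((enum_val s).1.1 <= l)%N.
Let k1 : 'I_N := inord l.+1.
Let s0 : 'I_dim := enum_rank ((k1, false), i0).
Let zv : 'rV[R]_dim := \row_(s < dim) (if (enum_val s).1.1 == l :> nat then pcoord z0 (enum_val s).1.2 (enum_val s).2 else 0).
Let Qp c : R := 2^-1 * \sum_i \sum_(k : K | (l < k.1)%N) eigen k.1 * coef c k i ^+ 2.
(** The number of positive frequencies counted as low. Each coordinate has at most [2 Mm] low modes,
    and [rho] is so small that together they displace a loop by at most [r0 / 2] at every grid
    point. Beyond them the eigenvalues are at least [4 Mm], enough to beat the growth constant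
    [C1]. *)
Let Mm := (Num.truncn (4 * C1)).+1.
Let rho := r0 ^+ 2 / (8 * Mm%:R).
Let mu := Num.min am (a i0 - 2 * pi).
Let tau : R := `|Ch| / mu * 2 + 1 + sq z0 + rho.

Let k1E : k1 = l.+1 :> nat. Proof. by rewrite inordK //; lia. Qed.
Let Mm4 : 4 * C1 <= Mm%:R. Proof. by rewrite ltW // truncnS_gt. Qed.
Let Mm0 : 0 < (Mm%:R : R). Proof. by rewrite ltr0n. Qed.
Let rho_gt0 : 0 < rho. Proof. by rewrite divr_gt0 ?exprn_gt0 ?mulr_gt0. Qed.
Let mu_gt0 : 0 < mu. Proof. by rewrite lt_min am_gt0 subr_gt0. Qed.
Lemma sq_ge0 z : 0 <= sq z.
Proof. by apply: sumr_ge0 => b _; apply: sumr_ge0 => i _; exact: sqr_ge0. Qed.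
Let tau_ge1 : 1 <= tau.
Proof.
have := sq_ge0 z0; have := rho_gt0; have : 0 <= `|Ch| / mu by rewrite divr_ge0 // ltW.
by rewrite /tau; lra.
Qed.

Lemma neg_rank k i : neg (enum_rank (k, i)) = (k.1 <= l)%N.
Proof. by rewrite /neg enum_rankK. Qed.

(** On the box only nonpositive eigenvalues and that of [s0] occur, and the latter is at most
    [2 pi], below [a i0]. *)
Lemma box_coef c k i : linking_box neg s0 tau c ->
  (eigen k.1 - a i) * coef c k i ^+ 2 <= - mu * coef c k i ^+ 2.
Proof.
move=> [_ _ c0]; have [kl|lk] := leqP k.1 l.
  rewrite ler_wpM2r ?sqr_ge0 //.
  have : (eigen k.1 : R) <= 0 by exact: eigen_le0.
  have : mu <= am by rewrite ge_min lexx.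
  by have := a_ge i; lra.
have [E|ne] := eqVneq (enum_rank (k, i)) s0; last first.
  by rewrite /coef c0 // ?neg_rank -?ltnNge // expr0n !mulr0.
have [kk ii] : k = (k1, false) /\ i = i0 by move/enum_rank_inj: E => [-> ->].
rewrite ler_wpM2r ?sqr_ge0 // kk ii /=.
have : mu <= a i0 - 2 * pi by rewrite ge_min lexx orbT.
by have : (eigen k1 : R) <= 2 * pi by [exact: eigen1_le]; lra.
Qed.

Lemma act_box c s : linking_box neg s0 tau c ->
  act a h c <= - (mu / 2) * c ord0 s ^+ 2 + Ch.
Proof.
move=> bc.
have E : \sum_i \sum_k (eigen k.1 - a i) * coef c k i ^+ 2 =
    \sum_s (eigen (enum_val s).1.1 - a (enum_val s).2) * c ord0 s ^+ 2.
  by rewrite sum_coef; apply: eq_bigr => i _; apply: eq_bigr => k _; rewrite enum_rankK.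
have le0 s' : (eigen (enum_val s').1.1 - a (enum_val s').2) * c ord0 s' ^+ 2 <= - mu * c ord0 s' ^+ 2.
  have := box_coef (enum_val s').1 (enum_val s').2 bc.
  by rewrite /coef -surjective_pairing enum_valK.
rewrite /act E (bigD1 s) //=.
have : \sum_(s' | s' != s) (eigen (enum_val s').1.1 - a (enum_val s').2) * c ord0 s' ^+ 2 <= 0.
  apply: sumr_le0 => s' _; apply: (le_trans (le0 s')).
  by rewrite mulNr oppr_le0 mulr_ge0 ?sqr_ge0 // ltW.
have : - Ch <= N%:R^-1 * \sum_(j < N) h (loopz c j).
  rewrite mulrC ler_pdivlMr // mulr_natr.
  apply: (@le_trans _ _ (\sum_(j < N) - Ch)); first by rewrite sumr_const card_ord.
  by apply: ler_sum => j _; exact: h_ge.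
have key (T Y X u m C : R) : T <= - m * u -> - C <= X -> Y <= 0 ->
  2^-1 * (T + Y) - X <= - (m / 2) * u + C by move=> *; lra.
by move=> hX hY; apply: key => //; exact: le0.
Qed.

Lemma loop_zv c b j i : (forall s, neg s -> c ord0 s = zv ord0 s) ->
  loop c b j i = pcoord z0 b i + \sum_(k : K | (l < k.1)%N) coef c k i * mode k.1 k.2 b j.
Proof.
move=> cz; rewrite /loop (bigID (fun k : K => (l < k.1)%N)) /= addrC; congr (_ + _).
have lN : (l < N)%N by rewrite ltnS -addnn leq_addr.
rewrite (bigD1 (Ordinal lN, b)) /= ?ltnn // big1 => [|k /andP[kl kn]].
  rewrite /coef cz ?neg_rank //= /zv mxE enum_rankK /= eqxx addr0.
  rewrite /mode /freq /= subrr mulr0 !mul0r.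
  by case: (b); rewrite cos0 mulr1.
rewrite -leqNgt in kl; rewrite /coef cz ?neg_rank // /zv mxE enum_rankK /=.
case: eqP => [E|_]; last by rewrite mul0r.
have kb : k.2 != b.
  apply: contraNneq kn => kb; case: k E kb {kl} => k t /= E ->.
  by apply/eqP; congr (_, _); apply: val_inj.
rewrite /mode /freq E subrr mulr0 !mul0r sin0 oppr0.
by case: (k.2) kb; case: (b) => // _; rewrite mulr0.
Qed.

Lemma card_low : (#|[pred k : K | (l < k.1)%N && (k.1 <= l + Mm)%N]| <= 2 * Mm)%N.
Proof. exact: card_window. Qed.

(** The level of [Qp] bounds loops only on average, so high frequencies may carry a loop away from
    [z0]. At each grid point either the loop is within [r0] of [z0] and the Hamiltonian vanishes, or
    the high part dominates the low part and the Hamiltonian is at most [4 C1] times its square. The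
    mean of the latter is at most [rho / 2]. *)
Lemma act_link c : (forall s, neg s -> c ord0 s = zv ord0 s) -> Qp c = rho ->
  rho / 2 <= act a h c.
Proof.
move=> cz Qc.
have eig_pos k : (l < k.1)%N -> (4 : R) <= eigen k.1.
  move=> lk; apply: le_trans (eigen_ge lk); rewrite -[leLHS]mulr1 ler_pM2l //.
  by rewrite lerBrDl natr1 ler_nat.
have QE : 2^-1 * (\sum_i \sum_k eigen k.1 * coef c k i ^+ 2) = rho.
  rewrite -Qc /Qp; congr (_ * _); apply: eq_bigr => i _.
  rewrite (bigID (fun k : K => (l < k.1)%N)) /= [X in _ + X]big1 ?addr0 // => k kl.
  rewrite -leqNgt in kl; rewrite /coef cz ?neg_rank // /zv mxE enum_rankK.
  case: eqP => [E|_]; last by rewrite expr0n mulr0.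
  by rewrite eigen0 // mul0r.
rewrite act_ham QE.
pose low : pred K := fun k => (l < k.1)%N && (k.1 <= l + Mm)%N.
pose high : pred K := fun k => (l + Mm < k.1)%N.
pose u b (j : nat) i : R := \sum_(k | low k) coef c k i * mode k.1 k.2 b j.
pose v b (j : nat) i : R := \sum_(k | high k) coef c k i * mode k.1 k.2 b j.
have loopE b j i : pcoord (loopz c j - z0) b i = u b j i + v b j i.
  have -> : pcoord (loopz c j - z0) b i = loop c b j i - pcoord z0 b i.
    rewrite -comp_loopz -[loopz c j in RHS](subrK z0) [in RHS]comp_add; ring.
  rewrite loop_zv // addrAC subrr add0r (bigID (fun k : K => (k.1 <= l + Mm)%N)) /=.
  congr (_ + _); apply: eq_bigl => k; rewrite /high.
  exact: window_out.
have coefS : \sum_i \sum_(k | low k) coef c k i ^+ 2 <= rho / 2.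
  have : 4 * (\sum_i \sum_(k | low k) coef c k i ^+ 2) <= 2 * rho.
    rewrite -Qc /Qp mulrA divff ?mul1r ?pnatr_eq0 // mulr_sumr.
    apply: ler_sum => i _; rewrite [leRHS](bigID (fun k : K => (k.1 <= l + Mm)%N)) /=.
    apply: ler_wpDr.
      by apply: sumr_ge0 => k /andP[/eig_pos k4 _]; rewrite mulr_ge0 ?sqr_ge0 //; lra.
    rewrite mulr_sumr; apply: ler_sum => k /andP[/eig_pos k4 _].
    by rewrite ler_wpM2r ?sqr_ge0.
  lra.
have usmall j : \sum_b \sum_i u b j i ^+ 2 <= r0 ^+ 2 / 4.
  apply: (@le_trans _ _ (\sum_(b : bool) (2 * Mm)%:R * (rho / 2))); last first.
    rewrite sumr_const card_bool -mulr_natl natrM /rho le_eqVlt; apply/orP; left; apply/eqP.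
    by have := Mm0 => M0; field; rewrite ?gt_eqF.
  apply: ler_sum => b _; apply: (@le_trans _ _ ((2 * Mm)%:R * (\sum_i \sum_(k | low k) coef c k i ^+ 2))).
    rewrite mulr_sumr; apply: ler_sum => i _.
    apply: (le_trans (sqr_sum_le _ card_low)); rewrite ler_wpM2l //.
    apply: ler_sum => k _; rewrite exprMn -[leRHS]mulr1 ler_wpM2l ?sqr_ge0 //.
    by rewrite -real_normK ?num_real // expr_le1 // mode_le1.
  by rewrite ler_wpM2l.
have hamv j : ham (loopz c j) <= 4 * C1 * \sum_b \sum_i v b j i ^+ 2.
  have v0 : 0 <= \sum_b \sum_i v b j i ^+ 2.
    by apply: sumr_ge0 => b _; apply: sumr_ge0 => i _; exact: sqr_ge0.
  have C10 := C1_gt0.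
  have [le|gt] := leP (sq (loopz c j - z0)) (r0 ^+ 2).
    by rewrite ham_near // mulr_ge0 //; lra.
  apply: (le_trans (ham_le _)); rewrite -mulrA mulrCA ler_pM2l //.
  have : sq (loopz c j - z0) <= 2 * (\sum_b \sum_i u b j i ^+ 2) + 2 * \sum_b \sum_i v b j i ^+ 2.
    rewrite !mulr_sumr -big_split; apply: ler_sum => b _ /=.
    rewrite !mulr_sumr -big_split; apply: ler_sum => i _ /=.
    by rewrite loopE; have := sqr_ge0 (u b j i - v b j i); rewrite sqrrB sqrrD !mulr2n; lra.
  by have := usmall j; lra.
have vsum : N%:R^-1 * \sum_(j < N) \sum_b \sum_i v b j i ^+ 2 <= rho / (2 * Mm%:R).
  have -> : N%:R^-1 * \sum_(j < N) \sum_b \sum_i v b j i ^+ 2 =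
      \sum_i \sum_(k | high k) coef c k i ^+ 2.
    rewrite (eq_bigr (fun j : 'I_N => \sum_i \sum_b v b j i ^+ 2)) => [|j _]; last by rewrite exchange_big.
    rewrite exchange_big mulr_sumr; apply: eq_bigr => i _; rewrite pair_bigA /=.
    pose F k : R := if high k then coef c k i else 0.
    transitivity (N%:R^-1 * \sum_(x : K) (\sum_(k : K) F k * dftk k x) * (\sum_(k : K) F k * dftk k x)).
      congr (_ * _); apply: eq_bigr => x _; rewrite -expr2; congr (_ ^+ 2).
      by rewrite /v [LHS]big_mkcond; apply: eq_bigr => k _; rewrite /F; case: ifP => // _; rewrite mul0r.
    rewrite kernel_parseval mulrA mulVf // mul1r [RHS]big_mkcond.
    by apply: eq_bigr => k _; rewrite /F; case: ifP => _; rewrite ?mul0r // expr2.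
  have M0 := Mm0; rewrite ler_pdivlMr ?mulr_gt0 // mulrA -ler_pdivlMr //.
  have : 4 * Mm%:R * (\sum_i \sum_(k | high k) coef c k i ^+ 2) <= 2 * rho.
    rewrite -Qc /Qp mulrA divff ?mul1r ?pnatr_eq0 // mulr_sumr.
    apply: ler_sum => i _; rewrite [leRHS](bigID high) /=.
    apply: ler_wpDr.
      by apply: sumr_ge0 => k /andP[/eig_pos k4 _]; rewrite mulr_ge0 ?sqr_ge0 //; lra.
    rewrite mulr_sumr [leRHS](eq_bigl high) => [|k]; last by rewrite /high; apply: andb_idl; exact: window_gt.
    apply: ler_sum => k kh; rewrite ler_wpM2r ?sqr_ge0 //.
    apply: le_trans (eigen_ge _); last exact: window_gt kh.
    rewrite ler_pM2l // lerBrDl -natrD ler_nat; exact: ltnW.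
  by rewrite ler_pdivlMr //; lra.
have : N%:R^-1 * \sum_(j < N) ham (loopz c j) <= 4 * C1 * (rho / (2 * Mm%:R)).
  apply: (@le_trans _ _ (4 * C1 * (N%:R^-1 * \sum_(j < N) \sum_b \sum_i v b j i ^+ 2))).
    rewrite mulrCA ler_pM2l ?invr_gt0 // mulr_sumr.
    by apply: ler_sum => j _; exact: hamv.
  by rewrite ler_wpM2l // mulr_ge0 // ltW.
have : 4 * C1 * (rho / (2 * Mm%:R)) <= rho / 2.
  have M0 := Mm0; rewrite mulrA ler_pdivrMr ?mulr_gt0 //.
  rewrite (_ : rho / 2 * (2 * Mm%:R) = Mm%:R * rho); last by field.
  by rewrite ler_pM2r.
move=> h1 h2; have key (e f : R) : f <= e / 2 -> e / 2 <= e - f by move=> ?; lra.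
exact: key (le_trans h2 h1).
Qed.

Lemma eigen_k1 : (4 : R) <= eigen k1.
Proof.
have : 4 * (k1%:R - l%:R) <= (eigen k1 : R) by apply: eigen_ge; rewrite k1E.
by rewrite k1E -[l.+1%:R]natr1; lra.
Qed.

Lemma box_Qp c : linking_box neg s0 tau c -> Qp c = 2^-1 * (eigen k1 * c ord0 s0 ^+ 2).
Proof.
move=> [_ _ c0]; rewrite /Qp; congr (_ * _).
rewrite (bigD1 i0) //= [X in _ + X]big1 ?addr0 => [|i ii]; last first.
  apply: big1 => k lk; rewrite /coef c0 ?neg_rank -?ltnNge // ?expr0n ?mulr0 //.
  by apply: contra_neq ii => /enum_rank_inj [].
rewrite (bigD1 (k1, false)) /= ?k1E // [X in _ + X]big1 ?addr0 // => k /andP[lk kn].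
rewrite /coef c0 ?neg_rank -?ltnNge // ?expr0n ?mulr0 //.
by apply: contra_neq kn => /enum_rank_inj [].
Qed.

(** On the bottom face of the box the quadratic part is nonpositive and [ham] is nonnegative. On the
    other faces [tau] is so large that the form shifted by [a], bounded by [- mu], beats the
    constant [Ch]. *)
Lemma crit_sequence delta : 0 < delta ->
  exists c, rho / 4 <= act a h c /\ nrm2 (dact a gh c) <= delta.
Proof.
move=> d0.
have mu0 := mu_gt0; have t1 := tau_ge1; have rh0 := rho_gt0.
have tauS : 2 * `|Ch| / mu <= tau ^+ 2.
  apply: (@le_trans _ _ tau); last by rewrite expr2 ler_peMl //; lra.
  have := sq_ge0 z0; rewrite /tau mulrAC; lra.
have nb s : s = s0 \/ neg s -> forall c, linking_box neg s0 tau c -> `|c ord0 s| = tau -> act a h c <= 0.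
  move=> _ c bc cs; apply: (le_trans (act_box s bc)).
  rewrite -[c ord0 s ^+ 2]real_normK ?num_real // cs.
  have : `|Ch| <= mu / 2 * tau ^+ 2.
    by move: tauS; rewrite ler_pdivrMr //; lra.
  by have := ler_norm Ch; lra.
have s0n : ~~ neg s0 by rewrite neg_rank /= k1E -ltnNge.
have [||||||||||||c [c1 c2]] := @linking R dim neg s0 (act a h) Qp (dact a gh) zv tau (rho / 2) rho Ch s0n _ _ _ _ _ _ _ _ _ _ _ _ delta d0.
- by lra.
- by lra.
- exact: continuous_act.
- exact: continuous_dact.
- apply: cont_mul; first exact: cst_continuous.
  apply: cont_sum => i; apply: cont_sum => k; apply: cont_mul; first exact: cst_continuous.
  have -> : (fun c => coef c k i ^+ 2) = (fun c => coef c k i * coef c k i).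
    by apply/funext => c; rewrite expr2.
  by apply: cont_mul; exact: continuous_coef.
- by move=> e e0; exact: act_diff.
- move=> c bc [c0|ct|[s ns cs]].
  + rewrite act_ham subr_le0; apply: (@le_trans _ _ 0); last first.
      by rewrite mulr_ge0 ?invr_ge0 // sumr_ge0 // => j _; exact: ham_ge0.
    rewrite pmulr_rle0 ?invr_gt0 //; apply: sumr_le0 => i _; apply: sumr_le0 => k _.
    have [kl|lk] := leqP k.1 l.
      by rewrite mulr_le0_ge0 ?sqr_ge0 //; exact: eigen_le0.
    have [E|ne] := eqVneq (enum_rank (k, i)) s0.
      by rewrite /coef E c0 expr0n mulr0.
    by case: bc => _ _ b0; rewrite /coef b0 ?neg_rank -?ltnNge // expr0n mulr0.
  + by apply: (nb s0) => //; [left | rewrite ct ger0_norm //; lra].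
  + by apply: (nb s) => //; right.
- move=> c bc; apply: (le_trans (act_box s0 bc)).
  by have := sqr_ge0 (c ord0 s0) => ?; have : 0 <= mu / 2 * c ord0 s0 ^+ 2 by [positivity]; lra.
- exact: act_link.
- move=> s _; rewrite -ler_norml mxE; case: ifP => _; last by rewrite normr0; lra.
  have z1 b i : `|pcoord z0 b i| <= sq z0 + 1.
    have : pcoord z0 b i ^+ 2 <= sq z0.
      rewrite /sq (bigD1 b) //= (bigD1 i) //= -addrA lerDl addr_ge0 ?sumr_ge0 //.
        by move=> ? _; exact: sqr_ge0.
      by move=> b' _; apply: sumr_ge0 => ? _; exact: sqr_ge0.
    have := sqr_ge0 (`|pcoord z0 b i| - 1); rewrite sqrrB real_normK ?num_real // mulr1 expr1n mulr2n.
    by have := normr_ge0 (pcoord z0 b i); lra.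
  apply: (le_trans (z1 _ _)); have : 0 <= `|Ch| / mu by rewrite divr_ge0 // ltW.
  by rewrite /tau; lra.
- by move=> c bc c0; rewrite box_Qp // c0 expr0n !mulr0 ltW.
- move=> c bc ct; rewrite box_Qp // ct; have e4 := eigen_k1.
  have : rho <= tau by rewrite /tau; have := sq_ge0 z0; have : 0 <= `|Ch| / mu by [rewrite divr_ge0 // ltW]; lra.
  have : tau <= tau ^+ 2 by rewrite expr2 ler_peMl //; lra.
  have : 4 * tau ^+ 2 <= eigen k1 * tau ^+ 2 by rewrite ler_wpM2r ?sqr_ge0.
  by have := sqr_ge0 tau; lra.
by exists c; split => //; lra.
Qed.

Lemma mode_mod (k : 'I_N) t b j : mode k t b (j %% N) = mode k t b j :> R.
Proof.
rewrite [in RHS](divn_eq j N) addnC; elim: (j %/ N)%N => [|m IH]; first by rewrite mul0n addn0.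
by rewrite mulSn (addnC N) addnA mode_period.
Qed.

Lemma loopz_mod c j : loopz c (j %% N) = loopz c j.
Proof.
by congr (_, _); apply/colP => i; rewrite !mxE; apply: eq_bigr => k _; rewrite mode_mod.
Qed.

Lemma dact_inversion_nat c j b i :
  \sum_k coef (dact a gh c) k i * mode k.1 k.2 b j =
  \sum_k eigen k.1 * coef c k i * mode k.1 k.2 b j - a i * loop c b j i
  - pcoord (gh (loopz c j)) b i.
Proof.
have jN : (j %% N < N)%N by rewrite ltn_mod.
have := dact_inversion a gh c (Ordinal jN, b) i; rewrite /dftk /= loopz_mod -!comp_loopz loopz_mod.
rewrite (eq_bigr (fun k => coef (dact a gh c) k i * mode k.1 k.2 b j)) => [->|k _]; last by rewrite mode_mod.
by congr (_ - _ - _); apply: eq_bigr => k _; rewrite mode_mod.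
Qed.

Let B := 2 + 4 * G ^+ 2.
Definition loop_radius : R := 2 + B / gam ^+ 2 + (2 * B + 2 * 8 ^+ 2 * (B / gam ^+ 2)).
Definition gham z b i : R := a i * pcoord z b i + pcoord (gh z) b i.

Lemma dact_mode_le c j b i :
  `|\sum_k coef (dact a gh c) k i * mode k.1 k.2 b j| <= (N.*2)%:R * nrm2 (dact a gh c).
Proof. exact: loop_le. Qed.

(** The last clause is an averaging argument: the mean of [wfun] along the loop is the action, at
    least [rho / 4], minus half the pairing of gradient and loop, so it cannot stay below
    [rho / 8]. *)
Lemma discrete_orbit_grid delta : 0 < delta -> exists z : nat -> phase R n,
  [/\ forall j, z (j + N)%N = z j,
      forall j b i, `|pcoord (z j) b i| <= loop_radius,
      forall j i,
        `|N%:R * (pcoord (z j.+1) false i - pcoord (z j) false i) - gham (z j) true i| <= delta /\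
        `|N%:R * (pcoord (z j) true i - pcoord (z j.+1) true i) - gham (z j.+1) false i| <= delta &
      exists j, rho / 8 <= wfun (z j)].
Proof.
move=> d0; have rh0 := rho_gt0; have g0 := gam_gt0.
have B0 : 0 <= B / gam ^+ 2.
  by rewrite divr_ge0 ?exprn_ge0 ?(ltW g0) // addr_ge0 // mulr_ge0 // sqr_ge0.
pose D : R := dim%:R + 1.
have D0 : 0 < D by rewrite ltr_wpDl.
pose X : R := 1 + B / gam ^+ 2.
have X0 : 0 < X by rewrite /X; lra.
(* The bound 1 gives access to the a priori estimates, the second entry turns a small gradient into
   a small defect at every grid point, and the third makes the pairing of gradient and loop small
   against [rho]. *)
have e0 : 0 < Num.min 1 (Num.min (delta / (N.*2)%:R) (rho / (8 * D * X))).
  by rewrite !lt_min ltr01 !divr_gt0 ?mulr_gt0 // ltr0n.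
have [c [act_c dc]] := crit_sequence e0.
move: dc; rewrite !le_min => /and3P[d1 d2 d3].
have aA i : `|a i| <= 8.
  have := am_gt0; have := a_ge i => ? ?; rewrite ger0_norm; last by lra.
  have [->|/a_le2] := eqVneq i i0; [exact: ltW | lra].
exists (loopz c); split.
- by move=> j; rewrite loopz_period.
- move=> j b i; rewrite comp_loopz.
  exact: (loop_bound aA g0 eigen_gap gh_le).
- have mode_small j b i : `|\sum_k coef (dact a gh c) k i * mode k.1 k.2 b j| <= delta.
    apply: (le_trans (dact_mode_le c j b i)).
    by rewrite mulrC -ler_pdivlMr // ltr0n.
  move=> j i; split.
    have := mode_small j true i; rewrite dact_inversion_nat -loop_diff_q.
    by rewrite /gham !comp_loopz opprD addrA.
  have := mode_small j.+1 false i; rewrite dact_inversion_nat -loop_diff_p.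
  by rewrite /gham !comp_loopz opprD addrA.
- apply: contrapT => /forallNP nW.
  have dotE := dact_dot_id a h gh c.
  have dotB : `|dotv (dact a gh c) c| <= rho / 8.
    apply: (le_trans (ler_norm_sum _ _ _)).
    apply: (@le_trans _ _ (\sum_(s < dim) (rho / (8 * D * X)) * X)); last first.
      rewrite sumr_const card_ord -[_ *+ _]mulr_natl.
      rewrite (_ : rho / (8 * D * X) * X = rho / 8 / D); last by field; rewrite ?gt_eqF.
      rewrite mulrA ler_pdivrMr // mulrC; apply: ler_wpM2l; first by rewrite divr_ge0 // ltW.
      by rewrite /D lerDl.
    apply: ler_sum => s _; rewrite normrM ler_pM //.
      apply: le_trans d3; rewrite -[s](enum_valK s) [enum_val s]surjective_pairing.
      exact: coef_le.
    have [k [i sE]] : exists k i, s = enum_rank (k, i).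
      by exists (enum_val s).1, (enum_val s).2; rewrite -surjective_pairing enum_valK.
    have [S1 _] := coef_bound aA g0 eigen_gap gh_le i d1.
    have : coef c k i ^+ 2 <= B / gam ^+ 2.
      apply: le_trans S1; rewrite (bigD1 k) //= lerDl sumr_ge0 // => k' _; exact: sqr_ge0.
    rewrite sE -/(coef c k i); have := sqr_ge0 (`|coef c k i| - 1).
    rewrite sqrrB real_normK ?num_real // mulr1 expr1n mulr2n /X.
    by have := normr_ge0 (coef c k i); lra.
  have : N%:R^-1 * \sum_(j < N) wfun (loopz c j) <= rho / 8.
    rewrite mulrC ler_pdivrMr // mulr_natr.
    apply: (@le_trans _ _ (\sum_(j < N) rho / 8)); last by rewrite sumr_const card_ord.
    by apply: ler_sum => j _; rewrite leNgt; apply/negP => W; apply: (nW j); exact: ltW.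
  have E : N%:R^-1 * \sum_(j < N) wfun (loopz c j) = act a h c - 2^-1 * dotv (dact a gh c) c.
    rewrite dotE; rewrite (eq_bigr (fun j : 'I_N => - 2^-1 * (2 * h (loopz c j) -
      ip (gh (loopz c j)) (loopz c j)))) => [|j _]; last by rewrite /wfun; field.
    by rewrite -mulr_sumr; field.
  rewrite E => WB.
  move: dotB; rewrite ler_norml => /andP[_ dB].
  have act_gt : rho / 8 < act a h c - 2^-1 * dotv (dact a gh c) c by lra.
  by move: WB; rewrite leNgt act_gt.
Qed.
End FixedGrid.
End DiscreteOrbit.

(** * From discrete loops to periodic orbits *)

Section UltraLimit.
Context {R : realType}.

(** One ultrafilter selects the limits for all times and all coordinates at once, in place of a
    diagonal extraction. *)
Lemma ultra_limit (U : set_system nat) (u : nat -> R) M : UltraFilter U ->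
  (forall m, `|u m| <= M) -> exists x : R, u @ U --> x.
Proof.
move=> UU uM.
have [x [_ xcl]] : (`[(- M), M] : set R) `&` cluster (u @ U) !=set0.
  apply: segment_compact; apply: (@filterE _ U) => m.
  by rewrite /= in_itv /= -ler_norml.
exists x => B xB.
have [//|nB] := in_ultra_setVsetC (u @^-1` B) UU.
by have [y [ny By]] := xcl (~` B) B nB xB.
Qed.

Lemma is_derive_estimate (f : R -> R) t v :
  (forall e, 0 < e -> exists2 eta, 0 < eta & forall d, `|d| < eta ->
    `|f (t + d) - f t - d * v| <= e * `|d|) ->
  is_derive t 1 f v.
Proof.
move=> H.
suff C : (fun d => d^-1 *: ((f \o shift t) (d *: 1) - f t)) @ 0^' --> v.
  by apply: DeriveDef; [apply/cvg_ex; exists v | exact: cvg_lim].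
apply/cvgrPdist_le => e e0; have [eta eta0 etaP] := H e e0.
near=> d.
have d0 : d != 0 by near: d; exact: nbhs_dnbhs_neq.
have deta : `|d| < eta.
  near: d; apply: nbhs_dnbhs; apply/nbhs_ballP; exists eta => //= d.
  by rewrite /ball /= sub0r normrN.
rewrite /= [d%:A]mulr1 [d + t]addrC /GRing.scale /= -normrN opprB.
rewrite (_ : _ - v = d^-1 * (f (t + d) - f t - d * v)); last by field.
by rewrite normrM normfV mulrC ler_pdivrMr ?normr_gt0 // etaP.
Unshelve. all: by end_near.
Qed.
End UltraLimit.

Lemma le_dist3 (R : realDomainType) (x y z d e e' : R) :
  `|x - y| <= d -> `|y - z| <= e -> d + e <= e' -> `|x - z| <= e'.
Proof. by move=> xy yz; apply: le_trans; apply: le_trans (ler_distD y _ _) _; exact: lerD. Qed.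

Section OrbitLimit.
Context {R : realType} {n : nat}.
Variables (g : phase R n -> bool -> 'I_n -> R) (W : phase R n -> R) (Cb Cg al : R).
Implicit Types (z w : phase R n) (b : bool) (i : 'I_n).

Definition vel z b i : R := if b then - g z false i else g z true i.

Hypothesis g_uc : forall e : R, 0 < e -> exists2 eta : R, 0 < eta & forall z w,
  (forall b i, `|pcoord z b i - pcoord w b i| <= eta) ->
  forall b i, `|g z b i - g w b i| <= e.
Hypothesis W_cont : forall z (e : R), 0 < e -> exists2 eta : R, 0 < eta & forall w,
  (forall b i, `|pcoord w b i - pcoord z b i| <= eta) -> `|W w - W z| <= e.
Hypothesis g_le : forall z, (forall b i, `|pcoord z b i| <= Cb) -> forall b i, `|g z b i| <= Cg.

Local Notation N m := (m.+1).*2.+1.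

Hypothesis orbits : forall m, exists z : nat -> phase R n,
  [/\ forall j, z (j + N m)%N = z j,
      forall j b i, `|pcoord (z j) b i| <= Cb,
      forall j i,
        `|(N m)%:R * (pcoord (z j.+1) false i - pcoord (z j) false i) - g (z j) true i| <= m.+1%:R^-1 /\
        `|(N m)%:R * (pcoord (z j) true i - pcoord (z j.+1) true i) - g (z j.+1) false i| <= m.+1%:R^-1 &
      exists j, al <= W (z j)].

(** Each discrete loop is rotated so that its point of large [W] has index 0; the limit then
    inherits the bound at time 0. *)
Lemma orbits_shift : exists zz : nat -> nat -> phase R n, forall m,
  [/\ forall j, zz m (j + N m)%N = zz m j,
      forall j b i, `|pcoord (zz m j) b i| <= Cb,
      forall j i,
        `|(N m)%:R * (pcoord (zz m j.+1) false i - pcoord (zz m j) false i) - g (zz m j) true i| <= m.+1%:R^-1 /\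
        `|(N m)%:R * (pcoord (zz m j) true i - pcoord (zz m j.+1) true i) - g (zz m j.+1) false i| <= m.+1%:R^-1 &
      al <= W (zz m 0%N)].
Proof.
have /choice : forall m, exists z : nat -> phase R n,
  [/\ forall j, z (j + N m)%N = z j,
      forall j b i, `|pcoord (z j) b i| <= Cb,
      forall j i,
        `|(N m)%:R * (pcoord (z j.+1) false i - pcoord (z j) false i) - g (z j) true i| <= m.+1%:R^-1 /\
        `|(N m)%:R * (pcoord (z j) true i - pcoord (z j.+1) true i) - g (z j.+1) false i| <= m.+1%:R^-1 &
      al <= W (z 0%N)].
  move=> m; have [z [z1 z2 z3 [j0 z4]]] := orbits m.
  exists (fun j => z (j + j0)%N); split => //.
  - by move=> j; rewrite addnAC z1.
  - by move=> j i; rewrite addSn; exact: z3.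
by case=> zz zzP; exists zz.
Qed.

Section Sequence.
Variable zz : nat -> nat -> phase R n.
Hypothesis zz_period : forall m j, zz m (j + N m)%N = zz m j.
Hypothesis zz_le : forall m j b i, `|pcoord (zz m j) b i| <= Cb.
Hypothesis zz_step : forall m j i,
  `|(N m)%:R * (pcoord (zz m j.+1) false i - pcoord (zz m j) false i) - g (zz m j) true i| <= m.+1%:R^-1 /\
  `|(N m)%:R * (pcoord (zz m j) true i - pcoord (zz m j.+1) true i) - g (zz m j.+1) false i| <= m.+1%:R^-1.

Let NR0 m : 0 < ((N m)%:R : R). Proof. by rewrite ltr0n. Qed.

Lemma zz_lip m j k b i :
  `|pcoord (zz m (j + k)%N) b i - pcoord (zz m j) b i| <= k%:R * (Cg + 1) / (N m)%:R.
Proof.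
elim: k => [|k IH]; first by rewrite addn0 subrr normr0 !mul0r.
rewrite addnS -[k.+1%:R]natr1 !mulrDl mul1r.
apply: le_trans (ler_distD (pcoord (zz m (j + k)%N) b i) _ _) _.
rewrite addrC; apply: lerD => //.
have m1 : m.+1%:R^-1 <= 1 :> R by rewrite invf_le1 ?ltr0n // ler1n.
rewrite ler_pdivlMr // mulrC -[X in X * _]gtr0_norm // -normrM.
have [s1 s2] := zz_step m (j + k) i.
have g1 := g_le (zz_le m (j + k)) true i; have g2 := g_le (zz_le m (j + k).+1) false i.
case: b {IH}; rewrite -[X in `|X|]subr0.
  rewrite distrC sub0r -mulrN opprB -[X in `|X|]subr0.
  by apply: (le_dist3 s2 _ (e := Cg)); rewrite ?subr0 // addrC lerD2l.
by apply: (le_dist3 s1 _ (e := Cg)); rewrite ?subr0 // addrC lerD2l.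
Qed.

Lemma Cg_ge0 : 0 <= Cg \/ (forall i : 'I_n, False).
Proof.
have [i _|n0] := pickP 'I_n; last by right => i; have := n0 i.
by left; apply: le_trans (g_le (zz_le 0 0) true i); exact: normr_ge0.
Qed.

(** Over a short stretch the points stay close, the speed being at most [Cg + 1]. Uniform continuity
    then replaces each velocity by the initial one, and the errors of the single steps add up
    linearly. *)
Lemma zz_estimate e : 0 < e -> exists2 eta : R, 0 < eta & exists m0 : nat, forall m, (m0 <= m)%N ->
  forall j k, k%:R / (N m)%:R <= eta -> forall b i,
  `|pcoord (zz m (j + k)%N) b i - pcoord (zz m j) b i - k%:R / (N m)%:R * vel (zz m j) b i|
    <= e * (k%:R / (N m)%:R).
Proof.
move=> e0; have [Cg0|n0] := Cg_ge0; last by exists 1 => //; exists 0%N => m _ j k _ b i; case: (n0 i).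
have [eta1 eta10 eta1P] := g_uc (divr_gt0 e0 (ltr0n R 2)).
have C0 : 0 < Cg + 1 by lra.
exists (eta1 / (2 * (Cg + 1))); first by rewrite divr_gt0 // mulr_gt0.
have [m0 m0P] : exists m0 : nat, forall m, (m0 <= m)%N ->
    m.+1%:R^-1 <= e / 2 /\ (Cg + 1) / (N m)%:R <= eta1 / 2.
  exists (Num.truncn (2 / e + 2 * (Cg + 1) / eta1)).+1 => m mm.
  have h : 2 / e + 2 * (Cg + 1) / eta1 <= m.+1%:R.
    apply: ltW; apply: lt_le_trans (truncnS_gt _) _; rewrite ler_nat; exact: leqW.
  have h1 : 0 <= 2 / e by rewrite divr_ge0 // ltW.
  have h2 : 0 <= 2 * (Cg + 1) / eta1 by rewrite divr_ge0 ?ltW // mulr_gt0.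
  split.
    rewrite -[leRHS]invrK lef_pV2 ?posrE ?invr_gt0 ?divr_gt0 // invf_div; lra.
  rewrite ler_pdivrMr // mulrC -ler_pdivrMr ?divr_gt0 // invf_div mulrA [_ * 2]mulrC.
  by apply: (@le_trans _ _ m.+1%:R); [lra | rewrite ler_nat; lia].
exists m0 => m /m0P[d1 d2] j k; elim: k => [_ b i|k IH keta b i].
  by rewrite addn0 subrr !mul0r subrr normr0 mulr0.
have kN : k%:R / (N m)%:R <= eta1 / (2 * (Cg + 1)) :> R.
  by apply: le_trans keta; rewrite ler_pM2r ?invr_gt0 // ler_nat.
have close k' : (k' <= k.+1)%N -> forall b i, `|pcoord (zz m (j + k')%N) b i - pcoord (zz m j) b i| <= eta1.
  move=> k'k b' i'; apply: (le_trans (zz_lip _ _ _ _ _)).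
  apply: (@le_trans _ _ (k.+1%:R * (Cg + 1) / (N m)%:R)).
    by rewrite ler_pM2r ?invr_gt0 // ler_pM2r // ler_nat.
  move: keta; rewrite ler_pdivlMr ?mulr_gt0 // => keta.
  have : 0 <= k.+1%:R * (Cg + 1) / (N m)%:R by rewrite divr_ge0 ?mulr_ge0 // ltW.
  have -> : k.+1%:R * (Cg + 1) / (N m)%:R = k.+1%:R / (N m)%:R * (Cg + 1) by rewrite mulrAC.
  have key (u C e' : R) : u * (2 * C) <= e' -> 0 <= u * C -> u * C <= e' by move=> *; lra.
  exact: key.
have [s1 s2] := zz_step m (j + k) i.
have v1 := eta1P _ _ (close k (leqnSn k)) true i.
have v2 := eta1P _ _ (close k.+1 (leqnn _)) false i.
rewrite addnS in v2.
have step : `|(N m)%:R * (pcoord (zz m (j + k).+1) b i - pcoord (zz m (j + k)%N) b i) - vel (zz m j) b i| <= e.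
  have e2 : m.+1%:R^-1 + e / 2 <= e by rewrite [leRHS]splitr lerD2r.
  rewrite /vel; case: (b); last exact: le_dist3 s1 v1 e2.
  have -> : (N m)%:R * (pcoord (zz m (j + k).+1) true i - pcoord (zz m (j + k)%N) true i)
     - - g (zz m j) false i =
    - ((N m)%:R * (pcoord (zz m (j + k)%N) true i - pcoord (zz m (j + k).+1) true i) - g (zz m j) false i).
    by ring.
  by rewrite normrN; exact: le_dist3 s2 v2 e2.
have {step} : `|pcoord (zz m (j + k).+1) b i - pcoord (zz m (j + k)%N) b i - (N m)%:R^-1 * vel (zz m j) b i|
    <= e * (N m)%:R^-1.
  rewrite -(ler_pM2l (NR0 m)) -[X in X * `|_|]gtr0_norm // -normrM mulrBr mulrA.
  by rewrite divff ?gt_eqF // mul1r [leRHS]mulrCA divff ?gt_eqF // mulr1.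
have := IH kN b i; rewrite addnS -[k.+1%:R]natr1 mulrDl mul1r !ler_norml.
move: ((N m)%:R^-1) => u /andP[? ?] /andP[? ?].
by apply/andP; split; lra.
Qed.

Variable U : set_system nat.
Hypotheses (UU : UltraFilter U) (Uoo : \oo `<=` U).

Let idx m (t : R) : nat := Num.truncn (t * (N m)%:R).

Lemma limit_ex t b i : exists x : R, (fun m => pcoord (zz m (idx m t)) b i) @ U --> x.
Proof. by apply: (@ultra_limit _ _ _ Cb UU) => m; exact: zz_le. Qed.

Let y t b i : R := projT1 (cid (limit_ex t b i)).
Let yP t b i : (fun m => pcoord (zz m (idx m t)) b i) @ U --> y t b i.
Proof. exact: projT2 (cid (limit_ex t b i)). Qed.
Let Y t : phase R n := (\col_i y t false i, \col_i y t true i).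
Let YE t b i : pcoord (Y t) b i = y t b i.
Proof. by case: b; rewrite /pcoord /= mxE. Qed.

Lemma near_Y t eta : 0 < eta ->
  \forall m \near U, forall b i, `|pcoord (zz m (idx m t)) b i - pcoord (Y t) b i| <= eta.
Proof.
move=> eta0; apply: filter_forall => b; apply: filter_forall => i; rewrite YE.
by have /cvgrPdist_le := @yP t b i => /(_ _ eta0); apply: filterS => m; rewrite distrC.
Qed.

Lemma vel_uc e : 0 < e -> exists2 eta : R, 0 < eta & forall z w,
  (forall b i, `|pcoord z b i - pcoord w b i| <= eta) ->
  forall b i, `|vel z b i - vel w b i| <= e.
Proof.
move=> /g_uc[eta eta0 etaP]; exists eta => // z w zw b i; rewrite /vel.
by case: b; [rewrite opprK addrC distrC | ]; exact: etaP.
Qed.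

Lemma vel_cvg t b i : (fun m => vel (zz m (idx m t)) b i) @ U --> vel (Y t) b i.
Proof.
apply/cvgrPdist_le => e /vel_uc[eta eta0 etaP].
by apply: filterS (near_Y t eta0) => m h; rewrite distrC; exact: etaP.
Qed.

Lemma idx_le m s t : 0 <= s -> s <= t ->
  (idx m s <= idx m t)%N /\
  `|(idx m t - idx m s)%:R / (N m)%:R - (t - s)| <= m.+1%:R^-1.
Proof.
move=> s0 st; have t0 : 0 <= t := le_trans s0 st.
have le : (idx m s <= idx m t)%N by apply: le_truncn; rewrite ler_wpM2r // ltW.
split=> //; apply: (@le_trans _ _ (N m)%:R^-1); last first.
  by rewrite lef_pV2 ?posrE ?ltr0n // ler_nat; lia.
have /andP[s1 s2] := truncn_itv (mulr_ge0 s0 (ltW (NR0 m))).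
have /andP[t1 t2] := truncn_itv (mulr_ge0 t0 (ltW (NR0 m))).
have s2' : s * (N m)%:R < (idx m s)%:R + 1 by rewrite natr1.
have t2' : t * (N m)%:R < (idx m t)%:R + 1 by rewrite natr1.
rewrite natrB //; move: s1 s2' t1 t2'; rewrite -/(idx m s) -/(idx m t) {s2 t2}.
move: (idx m s)%:R (idx m t)%:R => a1 a2 s1 s2 t1 t2.
have NN := NR0 m; rewrite -(ler_pM2l NN) divff ?gt_eqF // -[X in X * `|_|]gtr0_norm // -normrM.
rewrite mulrBr mulrCA divff ?gt_eqF // mulr1 ler_norml mulrC.
move: s1 s2 t1 t2; move: ((N m)%:R) => u *; apply/andP; split; lra.
Qed.

Lemma Y_estimate e : 0 < e -> exists2 eta : R, 0 < eta & forall s t, 0 <= s -> s <= t ->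
  t - s < eta -> forall b i,
  `|pcoord (Y t) b i - pcoord (Y s) b i - (t - s) * vel (Y s) b i| <= e * (t - s).
Proof.
move=> /zz_estimate[eta eta0 [m0 H]]; exists (eta / 2); first by rewrite divr_gt0.
move=> s t s0 st ts b i.
pose r m : R := (idx m t - idx m s)%:R / (N m)%:R.
have inv_small d : 0 < d -> \forall m \near U, m.+1%:R^-1 <= d :> R.
  move=> d0; apply: Uoo; exists (Num.truncn d^-1) => // m /= dm.
  rewrite -[leRHS]invrK lef_pV2 ?posrE ?invr_gt0 ?ltr0n //.
  by apply: ltW; apply: lt_le_trans (truncnS_gt _) _; rewrite ler_nat.
have rP : r @ U --> t - s.
  apply/cvgrPdist_le => d /inv_small; apply: filterS => m; apply: le_trans.
  by rewrite distrC; exact: (idx_le m s0 st).2.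
have near_le : \forall m \near U,
   `|pcoord (zz m (idx m t)) b i - pcoord (zz m (idx m s)) b i - r m * vel (zz m (idx m s)) b i|
   <= e * r m.
  have nm0 : \forall m \near U, (m0 <= m)%N by apply: Uoo; exists m0.
  apply: filterS2 nm0 (inv_small _ (divr_gt0 eta0 (ltr0n R 2))) => m m0m md.
  have [le dist] := idx_le m s0 st.
  have := H m m0m (idx m s) (idx m t - idx m s)%N; rewrite subnKC // -/(r m); apply.
  move: dist; rewrite -/(r m) ler_norml => /andP[_ rd]; move: rd md; move: (m.+1%:R^-1) => u; lra.
have cL : (fun m => `|pcoord (zz m (idx m t)) b i - pcoord (zz m (idx m s)) b i -
    r m * vel (zz m (idx m s)) b i|) @ U -->
  `|pcoord (Y t) b i - pcoord (Y s) b i - (t - s) * vel (Y s) b i|.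
  rewrite !YE; apply: cvg_norm; apply: cvgB; first by apply: cvgB; exact: yP.
  by apply: cvgM => //; exact: vel_cvg.
have cR : (fun m => e * r m) @ U --> e * (t - s) by apply: cvgM => //; exact: cvg_cst.
exact: (ler_cvg_to cL cR near_le).
Qed.

Lemma Y_period t : 0 <= t -> Y (t + 1) = Y t.
Proof.
move=> t0.
have E b i : y (t + 1) b i = y t b i.
  suff C : (fun m => pcoord (zz m (idx m (t + 1))) b i) = (fun m => pcoord (zz m (idx m t)) b i).
    have := @yP (t + 1) b i; rewrite C => h; exact: (cvg_unique _ h (@yP t b i)).
  apply/funext => m; rewrite -[in RHS]zz_period; congr (pcoord (zz m _) b i).
  rewrite /idx mulrDl mul1r; apply: truncn_def.
  have /andP[t1 t2] := truncn_itv (mulr_ge0 t0 (ltW (NR0 m))).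
  by rewrite -addSn !natrD lerD2r ltrD2r t1 t2.
by congr (_, _); apply/colP => i; rewrite !mxE E.
Qed.

Lemma Y0_W : (forall m, al <= W (zz m 0%N)) -> al <= W (Y 0).
Proof.
move=> alW; rewrite leNgt; apply/negP => lt.
have [eta eta0 etaP] := W_cont (Y 0) (divr_gt0 (etrans (subr_gt0 _ _) lt) (ltr0n R 2)).
have [m mP] := filter_ex (near_Y 0 eta0).
have := etaP _ mP; have := alW m; rewrite {1}/idx mul0r truncn0 => h1.
by rewrite ler_norml => /andP[_]; lra.
Qed.

(** [Num.truncn] is 0 on negative numbers, so [Y] describes the limit only for nonnegative times.
    Shifting by an integer beyond the absolute value of [t] extends it periodically to the whole
    line. *)
Let K (t : R) : nat := (Num.truncn `|t|).+1.
Let X t : phase R n := Y (t + (K t)%:R).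

Lemma Y_periodn t k : 0 <= t -> Y (t + k%:R) = Y t.
Proof.
move=> t0; elim: k => [|k IH]; first by rewrite addr0.
by rewrite -natr1 addrA Y_period ?IH // addr_ge0.
Qed.

Lemma X_shift t k : 0 <= t + k%:R -> X t = Y (t + k%:R).
Proof.
have tK : 0 <= t + (K t)%:R.
  have : `|t| < (K t)%:R by exact: truncnS_gt.
  by have := ler_norm (- t); rewrite normrN; lra.
move=> tk; rewrite /X -(Y_periodn k tK) -[RHS](Y_periodn (K t) tk).
by rewrite addrAC.
Qed.

Lemma X_period t : X (t + 1) = X t.
Proof.
have tK : 0 <= t + 1 + (K (t + 1))%:R.
  have : `|t + 1| < (K (t + 1))%:R by exact: truncnS_gt.
  by have := ler_norm (- (t + 1)); rewrite normrN; lra.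
have -> : X t = Y (t + (K (t + 1)).+1%:R).
  by apply: X_shift; rewrite -natr1; lra.
by rewrite /X -natr1 addrAC addrA addrAC.
Qed.

Lemma X_estimate e : 0 < e -> exists2 eta : R, 0 < eta & forall s t, s <= t ->
  t - s < eta -> forall b i,
  `|pcoord (X t) b i - pcoord (X s) b i - (t - s) * vel (X s) b i| <= e * (t - s).
Proof.
move=> /Y_estimate[eta eta0 etaP]; exists eta => // s t st ts b i.
have sk : 0 <= s + (K s)%:R.
  have : `|s| < (K s)%:R by exact: truncnS_gt.
  by have := ler_norm (- s); rewrite normrN; lra.
have tk : 0 <= t + (K s)%:R by lra.
rewrite (X_shift sk) (X_shift tk).
have -> : t - s = t + (K s)%:R - (s + (K s)%:R) by ring.
by apply: etaP => //; [rewrite lerD2r | lra].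
Qed.

Lemma vel_X_le t b i : `|vel (X t) b i| <= Cg.
Proof.
suff : forall b i, `|g (X t) b i| <= Cg by rewrite /vel; case: (b) => h; rewrite ?normrN.
apply: g_le => b' i'; rewrite /X YE.
have h : (fun m => `|pcoord (zz m (idx m (t + (K t)%:R))) b' i'|) @ U --> `|y (t + (K t)%:R) b' i'|.
  by apply: cvg_norm; exact: yP.
apply: (ler_cvg_to h (cvg_cst Cb)); apply: filterE => m; exact: zz_le.
Qed.

(** The available estimate goes forward in time. For a negative increment [d] it starts at [t + d],
    and uniform continuity moves the velocity from there to [t]. *)
Lemma X_derive (t : R) b i : is_derive t 1 (fun s => pcoord (X s) b i) (vel (X t) b i).
Proof.
have Cg0 : 0 <= Cg by apply: le_trans (vel_X_le t b i); exact: normr_ge0.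
apply: is_derive_estimate => e e0.
have [eta1 eta10 E1] := X_estimate (divr_gt0 e0 (ltr0n R 2)).
have [eta2 eta20 E2] := vel_uc (divr_gt0 e0 (ltr0n R 2)).
have [eta3 eta30 E3] := X_estimate (@ltr01 R).
have C0 : 0 < Cg + 1 by lra.
exists (Num.min eta1 (Num.min eta3 (eta2 / (Cg + 1)))); first by rewrite !lt_min eta10 eta30 divr_gt0.
move=> d; rewrite !lt_min => /and3P[d1 d2 d3].
have [d0|d0] := leP 0 d.
  rewrite ger0_norm // in d1 *.
  have := E1 t (t + d); rewrite lerDl (addrC t d) addrK => /(_ d0 d1 b i) /le_trans; apply.
  by rewrite ler_wpM2r //; lra.
rewrite ltr0_norm // in d1 d2 d3 *; set s := t + d.
have st : s <= t by rewrite /s; lra.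
have ts : t - s = - d by rewrite /s; ring.
have := E1 s t st; rewrite ts => /(_ d1 b i) h1.
have Lip b' i' : `|pcoord (X t) b' i' - pcoord (X s) b' i'| <= eta2.
  have := E3 s t st; rewrite ts => /(_ d2 b' i') h3.
  have v1 := vel_X_le s b' i'.
  apply: (@le_trans _ _ (- d * (Cg + 1))); last first.
    by move: d3; rewrite ltr_pdivlMr // => /ltW.
  have h4 : `|- d * vel (X s) b' i'| <= - d * Cg.
    by rewrite normrM ger0_norm ?ler_wpM2l //; lra.
  rewrite -[X in `|X|]subr0; apply: (le_dist3 h3); first by rewrite subr0; exact: h4.
  by rewrite mulrDr mulr1 mul1r addrC.
have h5 : `|- d * (vel (X t) b i - vel (X s) b i)| <= - d * (e / 2).
  rewrite normrM (@ger0_norm _ (- d)); last by lra.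
  by apply: ler_wpM2l; [lra | exact: E2].
rewrite (_ : _ - _ - _ = - (pcoord (X t) b i - pcoord (X s) b i - - d * vel (X s) b i) +
   - d * (vel (X t) b i - vel (X s) b i)); last by ring.
apply: le_trans (ler_normD _ _) _; rewrite normrN.
by move: h1 h5; lra.
Qed.

Lemma X_W : (forall m, al <= W (zz m 0%N)) -> al <= W (X 0).
Proof. by move=> /Y0_W; rewrite (@X_shift 0 0) addr0. Qed.
End Sequence.

Theorem periodic_orbit : exists X : R -> phase R n,
  [/\ forall t, X (t + 1) = X t,
      forall (t : R) b i, is_derive t 1 (fun s => pcoord (X s) b i) (vel (X t) b i) &
      al <= W (X 0)].
Proof.
have [zz zzP] := orbits_shift.
have [U [UU Uoo]] := ultraFilterLemma (@eventually_filter).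
have p1 m j : zz m (j + N m)%N = zz m j by have [] := zzP m.
have p2 m j b i : `|pcoord (zz m j) b i| <= Cb by have [_ h] := zzP m.
have p3 m j i :
  `|(N m)%:R * (pcoord (zz m j.+1) false i - pcoord (zz m j) false i) - g (zz m j) true i| <= m.+1%:R^-1 /\
  `|(N m)%:R * (pcoord (zz m j) true i - pcoord (zz m j.+1) true i) - g (zz m j.+1) false i| <= m.+1%:R^-1.
  by have [_ _ h] := zzP m.
have p4 m : al <= W (zz m 0%N) by have [] := zzP m.
eexists; split.
- by move=> t; apply: (@X_period _ p1 p2 U UU).
- by move=> t b i; apply: (@X_derive _ p1 p2 p3 U UU Uoo).
- by apply: (@X_W _ p1 p2 U UU).
Qed.
End OrbitLimit.

(** * The sharp isoperimetric inequality *)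

Lemma powR_div {R : realType} (m v r : R) : 0 <= m -> 0 < v ->
  (m / v) `^ r = m `^ r / v `^ r.
Proof.
move=> m0 v0; rewrite powRM ?invr_ge0 ?(ltW v0) //; congr (_ * _).
by rewrite -powR_inv1 ?(ltW v0) // -powRrM mulN1r powRN.
Qed.

Lemma hoelder_sum {R : realType} (I : finType) (p q : R) (x a : I -> R) :
  0 < p -> 0 < q -> p^-1 + q^-1 = 1 ->
  \sum_i x i * a i <= (\sum_i `|x i| `^ p) `^ p^-1 * (\sum_i `|a i| `^ q) `^ q^-1.
Proof.
move=> p0 q0 pq.
set S := \sum_i `|x i| `^ p; set T := \sum_i `|a i| `^ q.
have S0 : 0 <= S by apply: sumr_ge0 => i _; exact: powR_ge0.
have T0 : 0 <= T by apply: sumr_ge0 => i _; exact: powR_ge0.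
have nul (r : R) (y : I -> R) i : \sum_i `|y i| `^ r = 0 -> y i = 0.
  move=> /eqP; rewrite psumr_eq0 => [/allP /(_ i (mem_index_enum _)) /= /eqP /powR_eq0_eq0 /normr0_eq0 //|j _].
  exact: powR_ge0.
have [Sz|Sn] := eqVneq S 0.
  by rewrite big1 ?mulr_ge0 ?powR_ge0 // => i _; rewrite (nul _ _ i Sz) mul0r.
have [Tz|Tn] := eqVneq T 0.
  by rewrite big1 ?mulr_ge0 ?powR_ge0 // => i _; rewrite (nul _ _ i Tz) mulr0.
set s := S `^ p^-1; set t := T `^ q^-1.
have s0 : 0 < s by apply: powR_gt0; rewrite lt_neqAle eq_sym Sn.
have t0 : 0 < t by apply: powR_gt0; rewrite lt_neqAle eq_sym Tn.
have sp : s `^ p = S by rewrite -powRrM mulVf ?gt_eqF // powRr1.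
have tq : t `^ q = T by rewrite -powRrM mulVf ?gt_eqF // powRr1.
have eS : \sum_i `|x i| `^ p = S by [].
have eT : \sum_i `|a i| `^ q = T by [].
clearbody s t S T.
suff : (\sum_i x i * a i) / (s * t) <= 1 by rewrite ler_pdivrMr ?mulr_gt0 // mul1r.
rewrite mulr_suml.
apply: (@le_trans _ _ (\sum_i (`|x i| `^ p / S / p + `|a i| `^ q / T / q))); last first.
  by rewrite big_split /= -!mulr_suml eS eT !divff // !mul1r pq.
apply: ler_sum => i _; rewrite invfM mulrACA.
apply: (le_trans (ler_norm _)); rewrite !normrM !normfV (gtr0_norm s0) (gtr0_norm t0).
apply: (le_trans (conjugate_powR _ _ p0 q0 pq)); rewrite ?divr_ge0 // ?(ltW s0) ?(ltW t0) //.
by rewrite !powR_div // sp tq.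
Qed.

Section Powers.
Context {R : realType}.
Variables (p q : R).
Hypotheses (hp : 2 <= p) (hq : q = p / (p - 1)).

Lemma p_gt1 : 1 < p. Proof. by have := hp => ?; lra. Qed.
Lemma pB1_neq0 : p - 1 != 0. Proof. by have := hp => ?; rewrite gt_eqF //; lra. Qed.
Lemma p_gt0 : 0 < p. Proof. by have := hp => ?; lra. Qed.
Lemma q_gt1 : 1 < q.
Proof. by have := hp => ?; rewrite hq ltr_pdivlMr ?mul1r; lra. Qed.
Lemma q_gt0 : 0 < q. Proof. by apply: lt_trans q_gt1. Qed.
Lemma conj_pq : p^-1 + q^-1 = 1.
Proof.
by have := hp => ?; rewrite hq invf_div; field; rewrite gt_eqF //; lra.
Qed.

(** The derivative of the [p]-th power of the absolute value, divided by [p]; it is the duality map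
    from [l_p] to [l_q] in each coordinate. *)
Definition dpow (s : R) : R := Num.sg s * `|s| `^ (p - 1).

Lemma mul_dpow s : s * dpow s = `|s| `^ p.
Proof.
by rewrite /dpow mulrA [s * _]mulrC -normrEsg mulr_powRB1 // p_gt0.
Qed.

Lemma dpow_norm s : `|dpow s| = `|s| `^ (p - 1).
Proof.
have [->|s0] := eqVneq s 0; last by rewrite normrM normr_sg s0 mul1r ger0_norm ?powR_ge0.
by rewrite /dpow sgr0 mul0r normr0 powR0 // pB1_neq0.
Qed.

Lemma dpow_norm_q s : `|dpow s| `^ q = `|s| `^ p.
Proof.
rewrite dpow_norm -powRrM; congr (_ `^ _); rewrite hq.
by have := p_gt1 => p1; field; rewrite gt_eqF //; lra.
Qed.

Lemma dpow0 : dpow 0 = 0. Proof. by rewrite /dpow sgr0 mul0r. Qed.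

Lemma dpowZ a s : 0 <= a -> dpow (a * s) = a `^ (p - 1) * dpow s.
Proof.
move=> a0; have [->|an] := eqVneq a 0.
  by rewrite mul0r dpow0 powR0 ?mul0r // pB1_neq0.
have ap : 0 < a by rewrite lt_neqAle eq_sym an.
by rewrite /dpow sgrM gtr0_sg // mul1r normrM gtr0_norm // powRM //; ring.
Qed.

Lemma young (x y : R) : 0 <= x -> 0 <= y -> x * y <= x `^ p / p + y `^ q / q.
Proof. by move=> x0 y0; apply: conjugate_powR => //; [exact: p_gt0 | exact: q_gt0 | exact: conj_pq]. Qed.

(* The tangent line at [c] of the concave function [u |-> u^(1/q)]. *)
Lemma tangent_root (c u : R) : 0 < c -> 0 <= u -> u `^ q^-1 <= c `^ q^-1 * (p^-1 + u / (q * c)).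
Proof.
move=> c0 u0.
have cq : 0 < c `^ q^-1 by exact: powR_gt0.
rewrite -ler_pdivrMl // mulrC.
have -> : u `^ q^-1 / c `^ q^-1 = 1 * (u / c) `^ q^-1.
  by rewrite mul1r powR_div.
apply: (le_trans (young ler01 (powR_ge0 _ _))).
rewrite powR1 -powRrM mulVf ?gt_eqF ?q_gt0 // powRr1 ?divr_ge0 // ?(ltW c0) //.
by rewrite mul1r invfM mulrA mulrAC.
Qed.

Lemma hoelder_pair (x y a b : R) :
  x * a + y * b <= (`|x| `^ p + `|y| `^ p) `^ p^-1 * (`|a| `^ q + `|b| `^ q) `^ q^-1.
Proof.
have := @hoelder_sum R bool p q (fun i => if i then x else y) (fun i => if i then a else b)
  p_gt0 q_gt0 conj_pq.
by rewrite !big_bool.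
Qed.
End Powers.

Lemma cont_powabs {R : realType} (r : R) : 0 < r -> continuous (fun x : R => `|x| `^ r).
Proof.
move=> r0 x; have [->|xn] := eqVneq x 0.
  rewrite /continuous_at normr0 powR0 ?gt_eqF //; apply/cvgrPdist_lt => e e0.
  near=> y; rewrite sub0r normrN ger0_norm ?powR_ge0 //.
  have : `|y| < e `^ r^-1.
    near: y; apply: (cvgr0_norm_lt); first exact: cvg_id.
    exact: powR_gt0.
  move=> ylt; have -> : e = (e `^ r^-1) `^ r by rewrite -powRrM mulVf ?gt_eqF // powRr1 ?(ltW e0).
  by rewrite gt0_ltr_powR // nnegrE ?powR_ge0.
have nx : 0 < `|x| by rewrite normr_gt0.
apply: (@continuous_comp _ _ _ (fun x : R => `|x|) (fun y => y `^ r)).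
  exact: norm_continuous.
apply: differentiable_continuous; apply/derivable1_diffP.
by have [] := is_derive1_powR r nx.
Unshelve. all: by end_near.
Qed.

Lemma cont_powR {T : topologicalType} {R : realType} (f : T -> R) (r : R) : 0 < r ->
  (forall x, 0 <= f x) -> continuous f -> continuous (fun x => f x `^ r).
Proof.
move=> r0 f0 cf; have -> : (fun x => f x `^ r) = (fun x => `|f x| `^ r).
  by apply/funext => x; rewrite ger0_norm.
move=> x; apply: (@continuous_comp T R R f (fun y : R => `|y| `^ r)); first exact: cf.
exact: cont_powabs.
Qed.

Lemma cont_dpow {R : realType} (p : R) : 2 <= p -> continuous (dpow p).
Proof.
move=> hp x; have p1 : 0 < p - 1 by lra.
have c := cont_powabs p1.
have [->|xn] := eqVneq x 0.
  rewrite /continuous_at dpow0; apply/cvgr0Pnorm_lt => e e0.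
  have := c 0; rewrite /continuous_at normr0 powR0 ?gt_eqF // => /cvgr0Pnorm_lt /(_ e e0).
  by apply: filterS => y; rewrite dpow_norm // ger0_norm ?powR_ge0.
have -> : dpow p = (fun s => Num.sg s * `|s| `^ (p - 1)) by [].
apply: cvgM; last exact: c.
apply: (@near_cst_continuous _ _ (Num.sg x)).
have : \forall y \near x, `|x - y| < `|x| by apply: nbhsx_ballx; rewrite normr_gt0.
apply: filterS => y; have [x0|x0|x0] := ltgtP x 0; last by rewrite x0 eqxx in xn.
  rewrite (ltr0_norm x0) (ltr0_sg x0) ltr_norml => h; rewrite ltr0_sg //; lra.
rewrite (gtr0_norm x0) (gtr0_sg x0) ltr_norml => h; rewrite gtr0_sg //; lra.
Qed.

Lemma is_derive_powabs {R : realType} (p : R) (x : R) : 2 <= p ->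
  is_derive x (1 : R) (fun s : R => `|s| `^ p) (p * dpow p x).
Proof.
move=> hp; have p0 : 0 < p by lra.
have pos (y : R) : 0 < y -> is_derive y (1 : R) (fun s : R => `|s| `^ p) (p * dpow p y).
  move=> y0; rewrite /dpow gtr0_sg // mul1r gtr0_norm //.
  apply: near_eq_is_derive (is_derive1_powR p y0).
  near=> z; rewrite gtr0_norm //; near: z.
  exact: lt_nbhsr.
have [x0|x0|->] := ltgtP x 0; last 2 first.
- exact: pos.
- rewrite dpow0 mulr0.
  have lim : (fun h : R => h^-1 *: ((fun s : R => `|s| `^ p) (h *: (1 : R) + 0) - (fun s : R => `|s| `^ p) 0)) h
      @[h --> 0^'] --> (0 : R).
    have : dpow p h @[h --> 0^'] --> (0 : R).
      by rewrite -[X in _ --> X](dpow0 p); apply: cvg_within_filter; exact: (cont_dpow hp).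
    apply: cvg_trans; apply: near_eq_cvg; near=> h.
    have h0 : h != 0 by near: h; exact: nbhs_dnbhs_neq.
    rewrite /= normr0 powR0 ?gt_eqF // subr0 addr0 /GRing.scale /= mulr1 -mul_dpow //.
    by rewrite mulKf.
  apply: DeriveDef; first by apply/cvg_ex; exists 0; exact: lim.
  exact: cvg_lim lim.
have nx : 0 < - x by rewrite oppr_gt0.
have := @is_derive1_comp R (fun s : R => `|s| `^ p) -%R x _ _ (pos _ nx) (is_deriveN (is_derive_id x (1 : R))).
rewrite /dpow sgrN normrN mulrN1 mulNr mulrN opprK.
have -> : (fun s : R => `|s| `^ p) \o -%R = (fun s : R => `|s| `^ p).
  by apply/funext => s /=; rewrite normrN.
by [].
Unshelve. all: by end_near.
Qed.

(** * Primitives of continuous functions *)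

Section Primitives.
Context {R : realType}.
Notation mu := (@lebesgue_measure R).
Implicit Types (f g F G : R -> R) (a b x : R).

Lemma continuous_integrable f a b : continuous f -> mu.-integrable `[a, b] (EFin \o f).
Proof.
move=> cf; apply: continuous_compact_integrable; first exact: segment_compact.
exact: continuous_subspaceT.
Qed.

Lemma primitive_ex f : continuous f -> exists F, forall x : R, is_derive x (1 : R) F (f x).
Proof.
move=> cf.
pose Fa a x := \int[mu]_(t in `[a, x]) f t - \int[mu]_(t in `[a, 0]) f t.
have indep a a' x : a <= a' -> a' <= x -> a' <= 0 -> Fa a x = Fa a' x.
  move=> aa' a'x a'0.
  have S y : a' <= y -> \int[mu]_(t in `[a, y]) f t =
      \int[mu]_(t in `[a, a']) f t + \int[mu]_(t in `[a', y]) f t.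
    move=> a'y.
    have := @Rintegral_itvB R f (BLeft a) (BRight y) a' (continuous_integrable _ _ cf).
    rewrite !bnd_simp => /(_ aa' a'y).
    rewrite Rintegral_itv_obnd_cbnd; first by move=> <-; rewrite addrC subrK.
    by apply: integrableS (continuous_integrable a' y cf) => //; exact: subset_itv_oc_cc.
  by rewrite /Fa (S _ a'x) (S _ a'0); ring.
(* The integral is differentiated only to the right of its base point, so the base point moves with
   [x]; by [indep] this does not change the function. *)
pose k x : R := - (`|x| + 1).
exists (fun x => Fa (k x) x) => x0.
have dF : is_derive x0 (1 : R) (Fa (k x0 - 1)) (f x0).
  have ax : k x0 - 1 < x0 by rewrite /k; have := ler_norm (- x0); rewrite normrN; lra.
  have [|d1 d2] := @continuous_FTC1_closed R f (k x0 - 1) x0 (x0 + 1) _ (continuous_integrable _ _ cf) ax (cf x0).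
    by rewrite ltrDl.
  have -> : Fa (k x0 - 1) = (fun x => \int[mu]_(t in `[k x0 - 1, x]) f t) - cst (\int[mu]_(t in `[k x0 - 1, 0]) f t).
    by [].
  rewrite -[f x0]subr0; apply: is_deriveB.
  by apply: DeriveDef; [exact: d1 | rewrite -derive1E; exact: d2].
apply: near_eq_is_derive dF.
near=> y.
have : `|x0 - y| < 1 by near: y; exact: nbhsx_ballx.
move=> xy; have h1 := ler_norm (- y); have h2 := ler_norm y.
have h3 : `|y| <= `|x0| + 1.
  by have := ler_distD x0 y 0; rewrite !subr0 distrC => h; apply: (le_trans h); rewrite addrC lerD2l ltW.
rewrite normrN in h1.
by have y0 := normr_ge0 y; apply: indep; rewrite /k; lra.
Unshelve. all: by end_near.
Qed.

Lemma primitive_le f g F G a b : a <= b ->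
  (forall x : R, is_derive x (1 : R) F (f x)) -> (forall x : R, is_derive x (1 : R) G (g x)) ->
  (forall x, a <= x <= b -> f x <= g x) -> F b - F a <= G b - G a.
Proof.
move=> ab dF dG fg.
have dH (x : R) : is_derive x (1 : R) (G - F) (g x - f x) by exact: is_deriveB.
have cH : {within `[a, b], continuous (G - F)}.
  by apply: derivable_within_continuous => x _; have [] := dH x.
have [c cab E] := MVT_segment ab (fun x _ => dH x) cH.
have : 0 <= (G - F) b - (G - F) a.
  by rewrite E mulr_ge0 ?subr_ge0 // fg //; rewrite in_itv in cab.
by rewrite !fctE /=; lra.
Qed.

Lemma primitive_eq f F G a b :
  (forall x : R, is_derive x (1 : R) F (f x)) -> (forall x : R, is_derive x (1 : R) G (f x)) ->
  F b - F a = G b - G a.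
Proof.
move=> dF dG; wlog ab : a b / a <= b => [W|].
  have [/W//|/ltW/W E] := leP a b.
  by apply: oppr_inj; rewrite !opprB.
by apply/eqP; rewrite eq_le; apply/andP; split; apply: (primitive_le ab) => // x _.
Qed.

Lemma primitive_Rintegral f F a b : continuous f -> a < b ->
  (forall x : R, is_derive x (1 : R) F (f x)) -> \int[mu]_(x in `[a, b]) f x = F b - F a.
Proof.
move=> cf ab dF.
have cF : continuous F.
  by move=> x; apply: differentiable_continuous; apply/derivable1_diffP; have [] := dF x.
rewrite /Rintegral (@continuous_FTC2 R f F a b ab) //.
- exact: continuous_subspaceT.
- split => [x _||]; first by have [] := dF x.
    by apply: cvg_at_right_filter; exact: cF.
  by apply: cvg_at_left_filter; exact: cF.
- by move=> x _; rewrite derive1E; have [] := dF x.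
Qed.

Lemma primitive_shift f F T a b : (forall x, f (x + T) = f x) ->
  (forall x : R, is_derive x (1 : R) F (f x)) -> F (b + T) - F (a + T) = F b - F a.
Proof.
move=> fT dF; apply: (@primitive_eq f (fun x => F (x + T))) => // x.
have h : is_derive (x + T) (1 : R) F (f x) by rewrite -fT.
have s : is_derive x (1 : R) (fun y => y + T) 1.
  by apply: is_derive_eq; rewrite addr0.
by have := @is_derive1_comp R F (fun y => y + T) x _ _ h s; rewrite mulr1.
Qed.
End Primitives.

(** The arithmetic-geometric mean inequality for [P] and [2 nu r^2 k]; the half-width [r] of the
    curve disappears. *)
Lemma quadratic_bound {R : realType} (S k P r nu : R) : 0 <= k -> 0 <= P -> 0 < r -> 0 <= nu ->
  P + 2 * nu * r ^+ 2 * k <= r * S -> 8 * P * k * nu <= S ^+ 2.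
Proof.
move=> k0 P0 r0 nu0 key.
have h : 0 <= P + 2 * nu * r ^+ 2 * k by rewrite addr_ge0 // !mulr_ge0 // ltW.
have : (P + 2 * nu * r ^+ 2 * k) ^+ 2 <= (r * S) ^+ 2 by rewrite lerXn2r ?nnegrE // (le_trans h).
have e : (P + 2 * nu * r ^+ 2 * k) ^+ 2 = (P - 2 * nu * r ^+ 2 * k) ^+ 2 + r ^+ 2 * (8 * P * k * nu) by ring.
rewrite e exprMn => h2.
rewrite -(ler_pM2l (exprn_gt0 2 r0)); apply: le_trans h2; rewrite lerDr; exact: sqr_ge0.
Qed.

(** The useful [nu] equalises [P] and [nu^q F]. If [F] vanishes, a large [nu] contradicts the
    hypothesis unless the left side is 0. *)
Lemma optimize_parameter {R : realType} (p q k P F L : R) : 2 <= p -> q = p / (p - 1) ->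
  0 <= k -> 0 <= P -> 0 <= F -> 0 < L ->
  (forall nu, 0 < nu -> 8 * P * k * nu <= ((P + nu `^ q * F) `^ q^-1 * L `^ p^-1) ^+ 2) ->
  4 * (2 * k) `^ p * P <= L ^+ 2 * F `^ (p - 1).
Proof.
move=> hp hq k0 P0 F0 L0 iso; have p0 := p_gt0 hp; have q0 := q_gt0 hp hq.
have trivial : 0 <= L ^+ 2 * F `^ (p - 1) by rewrite mulr_ge0 ?powR_ge0 // sqr_ge0.
have [Pz|Pn] := eqVneq P 0; first by rewrite Pz mulr0.
have [kz|kn] := eqVneq k 0; first by rewrite kz mulr0 powR0 ?gt_eqF // mulr0 mul0r.
have Pp : 0 < P by rewrite lt_neqAle eq_sym Pn.
have kp : 0 < k by rewrite lt_neqAle eq_sym kn.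
move: F0 Pp kp L0 iso; rewrite le_eqVlt => /predU1P[Fz|Fp] Pp kp L0 iso.
  pose X := ((P + 0) `^ q^-1 * L `^ p^-1) ^+ 2.
  have d0 : 0 < 8 * P * k by rewrite !mulr_gt0.
  have nu0 : 0 < X / (8 * P * k) + 1 by rewrite ltr_wpDl // divr_ge0 ?sqr_ge0 ?ltW.
  have := iso _ nu0; rewrite -Fz mulr0 -/X mulrDr mulr1 mulrC divfK ?gt_eqF // => h.
  by move: d0; rewrite ltNge => /negP; case; move: h; rewrite gerDl.
have x0 : 0 < (P / F) `^ q^-1 by rewrite powR_gt0 // divr_gt0.
have := iso _ x0; rewrite -[((P / F) `^ _) `^ q]powRrM mulVf ?gt_eqF // powRr1 ?divr_ge0 ?(ltW Pp) ?(ltW Fp) //.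
rewrite divfK ?gt_eqF // -mulr2n -[P *+ 2]mulr_natl => h.
have h8 : 0 <= 8 * P * k by rewrite !mulr_ge0 ?ltW.
have qp : q^-1 * p = p - 1 by rewrite hq; have := p_gt1 hp => p1; field; rewrite !gt_eqF //; lra.
have : (8 * P * k * (P / F) `^ q^-1) `^ p <= (((2 * P) `^ q^-1 * L `^ p^-1) ^+ 2) `^ p.
  by rewrite ge0_ler_powR ?nnegrE ?(ltW p0) ?sqr_ge0 // mulr_ge0 // ltW.
have sqrp (x : R) : 0 <= x -> (x ^+ 2) `^ p = (x `^ p) ^+ 2.
  by move=> xx; rewrite !expr2 powRM.
rewrite sqrp ?mulr_ge0 ?powR_ge0 // [((2 * P) `^ _ * _) `^ p]powRM ?powR_ge0 // -!powRrM mulVf ?gt_eqF //.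
rewrite qp powRr1 ?(ltW L0) // [(8 * _ * _ * _) `^ p]powRM ?powR_ge0 // -powRrM qp.
rewrite [(8 * P * _) `^ p]powRM ?mulr_ge0 ?(ltW Pp) // [(8 * P) `^ p]powRM ?(ltW Pp) //.
rewrite powR_div ?(ltW Pp) // [(2 * P) `^ _]powRM ?(ltW Pp) //.
have Pe : P `^ p = P * P `^ (p - 1) by rewrite -{2}(powRr1 (ltW Pp)) -powRD ?(gt_eqF Pp) ?implybT // addrC subrK.
have t0 : 0 < (2 : R) by [].
have e8 : (8 : R) `^ p = 2 `^ p * (2 `^ p) ^+ 2.
  by rewrite -sqrp // -powRM //; congr (_ `^ _); rewrite ?expr2; ring.
have e2 : (2 : R) `^ p = 2 * 2 `^ (p - 1) by rewrite -{2}(powRr1 (ltW t0)) -powRD ?(gt_eqF t0) ?implybT // addrC subrK.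
rewrite [(2 * k) `^ p]powRM ?(ltW kp) // Pe e8.
have Fp' : 0 < F `^ (p - 1) by rewrite powR_gt0.
have Pp' : 0 < P `^ (p - 1) by rewrite powR_gt0.
have tp : 0 < (2 : R) `^ (p - 1) by rewrite powR_gt0.
move: (F `^ (p - 1)) (P `^ (p - 1)) Fp' Pp' => f' g' f0 g0.
rewrite e2; move: (2 `^ (p - 1)) tp => a a0 H.
have c0 : 0 < (a * g') ^+ 2 / f' by rewrite divr_gt0 // exprn_gt0 // mulr_gt0.
rewrite -(ler_pM2l c0); apply: le_trans (le_trans H _); rewrite le_eqVlt; apply/orP; left; apply/eqP; field; by rewrite gt_eqF.
Qed.

(** * One coordinate: comparison with the arcs of the [l_p] circle *)

Section ScalarIsoperimetric.
Context {R : realType}.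
Notation mu := (@lebesgue_measure R).
Variables (p q : R).
Hypotheses (hp : 2 <= p) (hq : q = p / (p - 1)).

(** The upper arc of the unit [l_p] circle, continued by 0; [half_area] is therefore half of
    [c0 p]. *)
Definition wcirc (s : R) : R := Num.max 0 (1 - `|s| `^ p) `^ p^-1.

Definition half_area : R := \int[mu]_(s in `[-1, 1]) wcirc s.

Lemma wcirc_ge0 s : 0 <= wcirc s. Proof. exact: powR_ge0. Qed.

Lemma cont_wcirc : continuous wcirc.
Proof.
apply: cont_powR; first by rewrite invr_gt0 (p_gt0 hp).
  by move=> s; rewrite le_max lexx.
have -> : (fun s : R => Num.max 0 (1 - `|s| `^ p)) =
    (fun s : R => (1 - `|s| `^ p + `|1 - `|s| `^ p|) / 2).
  apply/funext => s; move: (1 - _) => u.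
  by have [h|h] := leP 0 u; [rewrite ger0_norm | rewrite ltr0_norm]; lra.
have c1 : continuous (fun s : R => 1 - `|s| `^ p).
  apply: cont_sub; [exact: cst_continuous | exact: cont_powabs (p_gt0 hp)].
apply: cont_mul; last exact: cst_continuous.
apply: cont_add => [|s]; first exact: c1.
by apply: (@continuous_comp R R R (fun s : R => 1 - `|s| `^ p) Num.norm); [exact: c1 | exact: norm_continuous].
Qed.

Lemma wcirc_eq (s : R) : `|s| <= 1 -> `|s| `^ p + `|wcirc s| `^ p = 1.
Proof.
move=> s1; have p0 := p_gt0 hp; rewrite [`|wcirc s|]ger0_norm ?wcirc_ge0 // /wcirc -powRrM mulVf ?gt_eqF //.
have : `|s| `^ p <= 1 `^ p by rewrite ge0_ler_powR ?nnegrE // ltW.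
rewrite powR1.
by move=> h; rewrite powRr1 ?le_max ?lexx // max_r; lra.
Qed.

(** Hoelder's inequality for the pairs [(f - m, e r wcirc)] and [(dpow p f, nu G)]. The first lies
    on the [l_p] circle of radius [r] and has constant norm; the norm of the second is linearised by
    [tangent_root]. The sign [e] selects the upper or the lower arc. *)
Lemma iso_pointwise (f G l m r nu c e : R) : 0 < r -> 0 <= l -> 0 < nu -> 0 < c -> `|e| = 1 ->
  `|f - m| <= r ->
  l * `|f| `^ p - m * (l * dpow p f) + e * nu * r * (wcirc ((f - m) / r) * (l * G)) <=
  r * c `^ q^-1 * (p^-1 * l + (q * c)^-1 * (l * `|f| `^ p + nu `^ q * (l * `|G| `^ q))).
Proof.
move=> r0 l0 nu0 c0 e1 fm.
have p0 := p_gt0 hp; have q0 := q_gt0 hp hq.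
set s := (f - m) / r.
have s1 : `|s| <= 1 by rewrite normrM normfV (gtr0_norm r0) ler_pdivrMr ?mul1r.
have H := hoelder_pair hp hq (f - m) (e * r * wcirc s) (dpow p f) (nu * G).
have E1 : `|f - m| `^ p + `|e * r * wcirc s| `^ p = r `^ p.
  have -> : f - m = r * s by rewrite /s mulrC divfK ?gt_eqF.
  clearbody s; rewrite !normrM e1 mul1r (gtr0_norm r0) !powRM ?(ltW r0) //.
  by rewrite -mulrDr wcirc_eq // mulr1.
have E2 : `|dpow p f| `^ q + `|nu * G| `^ q = `|f| `^ p + nu `^ q * `|G| `^ q.
  by rewrite dpow_norm_q // normrM powRM // (gtr0_norm nu0).
rewrite E1 E2 -powRrM mulfV ?gt_eqF // powRr1 ?(ltW r0) // in H.
have u0 : 0 <= `|f| `^ p + nu `^ q * `|G| `^ q by rewrite addr_ge0 ?mulr_ge0 ?powR_ge0.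
have T := tangent_root hp hq c0 u0.
have := ler_wpM2l l0 (le_trans H (ler_wpM2l (ltW r0) T)).
rewrite -(mul_dpow hp f).
set w := wcirc s; set C := c `^ q^-1; set N := nu `^ q; set g := `|G| `^ q; set d := dpow p f.
move=> h; apply: (le_trans _ (le_trans h _)); rewrite le_eqVlt; apply/orP; left; apply/eqP.
  by ring.
by field; rewrite !gt_eqF.
Qed.

Variables (f G l : R -> R) (T : R).
Hypotheses (T0 : 0 < T) (fT : forall t, f (t + T) = f t) (GT : forall t, G (t + T) = G t)
  (lT : forall t, l (t + T) = l t) (cG : continuous G) (cl : continuous l)
  (l0 : forall t, 0 < l t) (df : forall t : R, is_derive t (1 : R) f (l t * G t)).

Let tint (g : R -> R) : R := \int[mu]_(t in `[0, T]) g t.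
Let Lam := tint l.
Let P := tint (fun t => l t * `|f t| `^ p).
Let F := tint (fun t => l t * `|G t| `^ q).
Hypothesis mean0 : tint (fun t => l t * dpow p (f t)) = 0.

Lemma tint_period (g H : R -> R) (s : R) : continuous g -> (forall t, g (t + T) = g t) ->
  (forall t : R, is_derive t (1 : R) H (g t)) -> H (s + T) - H s = tint g.
Proof.
move=> cg gT dH; rewrite /tint (primitive_Rintegral cg T0 dH).
by have := primitive_shift 0 s gT dH; rewrite add0r; lra.
Qed.

(** [iso_pointwise] is integrated over a period, from a minimum of [f] to a maximum with the upper
    arc and back with the lower one. The arc terms add up to the area of an [l_p] disc as wide as
    the range of [f], and the midpoint [m] drops out because [dpow p f] has weighted mean 0. *)
Lemma iso_parameter (nu : R) : 0 < nu ->
  8 * P * half_area * nu <= ((P + nu `^ q * F) `^ q^-1 * Lam `^ p^-1) ^+ 2.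
Proof.
move=> nu0; have p0 := p_gt0 hp; have q0 := q_gt0 hp hq.
have cf : continuous f.
  by move=> x; apply: differentiable_continuous; apply/derivable1_diffP; have [] := df x.
have cgP : continuous (fun t => l t * `|f t| `^ p).
  apply: cont_mul cl _ => x.
  by apply: (@continuous_comp R R R f (fun y => `|y| `^ p)); [exact: cf | exact: cont_powabs].
have cgF : continuous (fun t => l t * `|G t| `^ q).
  apply: cont_mul cl _ => x.
  by apply: (@continuous_comp R R R G (fun y => `|y| `^ q)); [exact: cG | exact: cont_powabs].
have cgd : continuous (fun t => l t * dpow p (f t)).
  apply: cont_mul cl _ => x.
  by apply: (@continuous_comp R R R f (dpow p)); [exact: cf | exact: cont_dpow].
have [IL dL] := primitive_ex cl.
have [IP dP] := primitive_ex cgP.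
have [IF dF] := primitive_ex cgF.
have [ID dD] := primitive_ex cgd.
have [W dW] := primitive_ex cont_wcirc.
have WE : W 1 - W (-1) = half_area.
  by rewrite /half_area (primitive_Rintegral cont_wcirc _ dW) //; lra.
have eL s : IL (s + T) - IL s = Lam by exact: tint_period.
have eP s : IP (s + T) - IP s = P by apply: tint_period => // t; rewrite lT fT.
have eF s : IF (s + T) - IF s = F by apply: tint_period => // t; rewrite lT GT.
have eD s : ID (s + T) - ID s = 0 by rewrite -mean0; apply: tint_period => // t; rewrite lT fT.
have L0 : 0 < Lam.
  have [c _ E] := MVT_segment (ltW T0) (fun x _ => dL x)
    (derivable_within_continuous (fun x _ => (dL x).(ex_derive))).
  by have := eL 0; rewrite add0r => <-; rewrite E subr0 mulr_gt0.
have P0 : 0 <= P by apply: Rintegral_ge0 => t _; rewrite mulr_ge0 ?powR_ge0 // ltW.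
have F0 : 0 <= F by apply: Rintegral_ge0 => t _; rewrite mulr_ge0 ?powR_ge0 // ltW.
have cfs : {within `[0, T], continuous f} by exact: continuous_subspaceT.
have [t0 t0T min0] := EVT_min (ltW T0) cfs.
have [t1 t1T max1] := EVT_max (ltW T0) cfs.
rewrite in_itv /= in t0T; rewrite in_itv /= in t1T.
have [t2 t2T max2] : exists2 t2, t0 <= t2 <= t0 + T & f t2 = f t1.
  case: (leP t0 t1) => h; [exists t1 | exists (t1 + T)] => //; lra.
pose m := (f t0 + f t1) / 2; pose r := (f t1 - f t0) / 2.
have bnd t : t0 <= t <= t0 + T -> `|f t - m| <= r.
  move=> ht; have [s sT <-] : exists2 s, 0 <= s <= T & f s = f t.
    case: (leP t T) => h; first by exists t => //; lra.
    by exists (t - T); [lra | rewrite -(fT (t - T)) subrK].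
  have := min0 s; have := max1 s; rewrite in_itv /= => /(_ sT) h1 /(_ sT) h2.
  by rewrite ler_norml /m /r; lra.
have r0 : 0 <= r by apply: le_trans (bnd t0 _); [|lra].
have NF0 : 0 <= nu `^ q * F by rewrite mulr_ge0 ?powR_ge0.
(* Here [f] is constant, and the mean condition makes [P] vanish. *)
have [rz|rn] := eqVneq r 0.
  suff : P <= 0 by move=> h; rewrite (_ : P = 0) ?mulr0 ?mul0r ?sqr_ge0 //; lra.
  have dA (t : R) : is_derive t (1 : R) (fun t => IP t - m * ID t) (l t * `|f t| `^ p - m * (l t * dpow p (f t))).
    by apply: is_derive_eq; rewrite /GRing.scale /=; ring.
  have dB (t : R) : is_derive t (1 : R) (fun _ : R => 0 : R) 0 by exact: is_derive_cst.
  have := @primitive_le R _ _ _ _ t0 (t0 + T) _ dA dB; rewrite lerDl (ltW T0) => /(_ isT) h.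
  suff : (IP (t0 + T) - m * ID (t0 + T)) - (IP t0 - m * ID t0) <= 0 - 0.
    by have := eP t0; have := eD t0 => e1 e2; rewrite subrr -e2 (_ : ID (t0 + T) = ID t0); lra.
  apply: h => t /bnd; rewrite rz normr_le0 subr_eq0 => /eqP <-.
  by rewrite -(mul_dpow hp); lra.
have rp : 0 < r by rewrite lt_neqAle eq_sym rn.
have [Cz|Cn] := eqVneq (P + nu `^ q * F) 0.
  by rewrite (_ : P = 0) ?mulr0 ?mul0r ?sqr_ge0 //; lra.
have Cp : 0 < P + nu `^ q * F by rewrite lt_neqAle eq_sym Cn addr_ge0.
(* The tangent is taken at the weighted mean of the quantity under the root, so the two terms of the
   bound recombine by [1/p + 1/q = 1] after integration. *)
pose c := (P + nu `^ q * F) / Lam.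
have c0 : 0 < c by rewrite divr_gt0.
pose A e t := IP t - m * ID t + e * nu * r ^+ 2 * W ((f t - m) / r).
pose Bd t := r * c `^ q^-1 * (p^-1 * IL t + (q * c)^-1 * (IP t + nu `^ q * IF t)).
have dA e (t : R) : is_derive t (1 : R) (A e)
    (l t * `|f t| `^ p - m * (l t * dpow p (f t)) + e * nu * r * (wcirc ((f t - m) / r) * (l t * G t))).
  have ds : is_derive t (1 : R) (fun t => (f t - m) / r) (l t * G t / r).
    by apply: is_derive_eq; rewrite /GRing.scale /=; field; rewrite gt_eqF.
  have dWs := @is_derive1_comp R W (fun t => (f t - m) / r) t _ _ (dW _) ds.
  rewrite /A; apply: is_derive_eq; rewrite /GRing.scale /=; field; rewrite gt_eqF //.
have dB (t : R) : is_derive t (1 : R) Bd (r * c `^ q^-1 * (p^-1 * l t +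
    (q * c)^-1 * (l t * `|f t| `^ p + nu `^ q * (l t * `|G t| `^ q)))).
  by rewrite /Bd; apply: is_derive_eq; rewrite /GRing.scale /=; ring.
have S1 : A 1 t2 - A 1 t0 <= Bd t2 - Bd t0.
  apply: (primitive_le _ (dA 1) dB); first by lra.
  move=> t ht; apply: iso_pointwise => //; rewrite ?normr1 ?(ltW (l0 t)) //.
  by apply: bnd; lra.
have S2 : A (-1) (t0 + T) - A (-1) t2 <= Bd (t0 + T) - Bd t2.
  apply: (primitive_le _ (dA (-1)) dB); first by lra.
  move=> t ht; apply: iso_pointwise => //; rewrite ?normrN ?normr1 ?(ltW (l0 t)) //.
  by apply: bnd; lra.
have s0 : (f t0 - m) / r = -1 by rewrite /m /r in rn *; field; lra.
have s2 : (f t2 - m) / r = 1 by rewrite max2 /m /r in rn *; field; lra.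
have SB : Bd (t0 + T) - Bd t0 = r * (c `^ q^-1 * Lam).
  rewrite /Bd; have := eL t0; have := eP t0; have := eF t0.
  move=> /eqP; rewrite subr_eq => /eqP ->; move=> /eqP; rewrite subr_eq => /eqP ->; move=> /eqP; rewrite subr_eq => /eqP ->.
  have cE : P + nu `^ q * F = c * Lam by rewrite /c divfK ?gt_eqF.
  rewrite (_ : _ - _ = r * c `^ q^-1 * (p^-1 * Lam + (q * c)^-1 * (P + nu `^ q * F))); last by ring.
  rewrite cE (_ : (q * c)^-1 * _ = q^-1 * Lam); last by field; rewrite !gt_eqF.
  by rewrite -mulrDl (conj_pq hp hq) mul1r mulrA.
have key : P + 2 * nu * r ^+ 2 * half_area <= r * (c `^ q^-1 * Lam).
  rewrite -SB -WE; move: S1 S2; rewrite /A fT s0 s2.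
  have := eP t0; have := eD t0 => eD0 eP0.
  have -> : ID (t0 + T) = ID t0 by lra.
  by rewrite -eP0; lra.
have SE : c `^ q^-1 * Lam = (P + nu `^ q * F) `^ q^-1 * Lam `^ p^-1.
  rewrite /c powR_div ?(ltW Cp) // -mulrA; congr (_ * _).
  rewrite -powRN -{2}(powRr1 (ltW L0)) -powRD ?(gt_eqF L0) ?implybT //; congr (_ `^ _).
  by have := conj_pq hp hq; lra.
rewrite -SE.
have h0 : 0 <= half_area by apply: Rintegral_ge0 => s _; exact: wcirc_ge0.
by apply: quadratic_bound key; rewrite ?(ltW nu0).
Qed.

Lemma scalar_isoperimetric : 0 < Lam -> 4 * (2 * half_area) `^ p * P <= Lam ^+ 2 * F `^ (p - 1).
Proof.
move=> L0; apply: (optimize_parameter hp hq _ _ _ L0 iso_parameter).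
- by apply: Rintegral_ge0 => s _; exact: wcirc_ge0.
- by apply: Rintegral_ge0 => t _; rewrite mulr_ge0 ?powR_ge0 // ltW.
- by apply: Rintegral_ge0 => t _; rewrite mulr_ge0 ?powR_ge0 // ltW.
Qed.

End ScalarIsoperimetric.

Lemma hoelder_power {R : realType} (I : finType) (s : R) (x y : I -> R) : 1 <= s ->
  (forall i, 0 <= x i) -> (forall i, 0 <= y i) ->
  \sum_i x i * y i `^ (s - 1) <= (\sum_i x i `^ s) `^ s^-1 * (\sum_i y i `^ s) `^ (1 - s^-1).
Proof.
rewrite le_eqVlt => /predU1P[<-|s1] x0 y0.
  rewrite invr1 subrr powRr0 mulr1 powRr1; last by apply: sumr_ge0 => i _; exact: powR_ge0.
  by apply: ler_sum => i _; rewrite powRr0 mulr1 powRr1.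
have s0 : 0 < s by lra.
have sB : 0 < s - 1 by lra.
have q0 : 0 < s / (s - 1) by rewrite divr_gt0.
have pq : s^-1 + (s / (s - 1))^-1 = 1 by field; rewrite ?gt_eqF.
apply: (le_trans (hoelder_sum x (fun i => y i `^ (s - 1)) s0 q0 pq)).
have -> : \sum_i `|x i| `^ s = \sum_i x i `^ s by apply: eq_bigr => i _; rewrite ger0_norm.
have -> : \sum_i `|y i `^ (s - 1)| `^ (s / (s - 1)) = \sum_i y i `^ s.
  apply: eq_bigr => i _; rewrite ger0_norm ?powR_ge0 // -powRrM; congr (_ `^ _).
  by field; rewrite gt_eqF.
have -> : (s / (s - 1))^-1 = 1 - s^-1 by apply/eqP; rewrite eq_sym subr_eq addrC pq.
by [].
Qed.

Lemma is_derive_bigsum {R : numFieldType} {V W : normedModType R} (I : finType) (f : I -> V -> W)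
    (x v : V) (df : I -> W) :
  (forall i, is_derive x v (f i) (df i)) -> is_derive x v (\sum_i f i) (\sum_i df i).
Proof.
by move=> d; elim/big_ind2 : _ => // [|*]; [exact: is_derive_cst | exact: is_deriveD].
Qed.

Section PeriodIntegral.
Context {R : realType}.
Notation mu := (@lebesgue_measure R).
Variable T : R.
Hypothesis T0 : 0 < T.
Notation tint g := (\int[mu]_(t in `[0, T]) g t).

Lemma period_sum (I : finType) (c : I -> R) (g : I -> R -> R) : (forall i, continuous (g i)) ->
  tint (fun t => \sum_i c i * g i t) = \sum_i c i * tint (g i).
Proof.
move=> cg; have /choice[H dH] i := primitive_ex (cg i).
have dS (t : R) : is_derive t (1 : R) (fun t => \sum_i c i * H i t) (\sum_i c i * g i t).
  rewrite (_ : (fun t => _) = \sum_i (c i \*: H i)); last by apply/funext => s; rewrite fct_sumE.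
  by apply: is_derive_bigsum => i; apply: is_deriveZ.
have cS : continuous (fun t => \sum_i c i * g i t).
  by apply: cont_sum => i; apply: cont_mul; [exact: cst_continuous | exact: cg].
rewrite (primitive_Rintegral cS T0 dS) -sumrB; apply: eq_bigr => i _.
by rewrite (primitive_Rintegral (cg i) T0 (dH i)) mulrBr.
Qed.

Lemma period_le (f g : R -> R) : continuous f -> continuous g -> (forall t, f t <= g t) ->
  tint f <= tint g.
Proof.
move=> cf cg fg; have [F dF] := primitive_ex cf; have [G dG] := primitive_ex cg.
rewrite (primitive_Rintegral cf T0 dF) (primitive_Rintegral cg T0 dG).
by apply: (primitive_le (ltW T0) dF dG) => t _.
Qed.

Lemma period_scale (c : R) (f : R -> R) : continuous f -> tint (fun t => c * f t) = c * tint f.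
Proof.
by move=> cf; have := @period_sum 'I_1 (fun=> c) (fun=> f) (fun=> cf); rewrite !big_ord1;
   under eq_Rintegral do rewrite big_ord1.
Qed.

Lemma period_gt0 (f : R -> R) : continuous f -> (forall t, 0 < f t) -> 0 < tint f.
Proof.
move=> cf f0; have [F dF] := primitive_ex cf; rewrite (primitive_Rintegral cf T0 dF).
have [c _ ->] := MVT_segment (ltW T0) (fun x _ => dF x)
    (derivable_within_continuous (fun x _ => (dF x).(ex_derive))).
by rewrite subr0 mulr_gt0.
Qed.
End PeriodIntegral.

(** * Summation over the coordinates *)

Section VectorIsoperimetric.
Context {R : realType}.
Notation mu := (@lebesgue_measure R).
Variables (p q : R) (n : nat).
Hypotheses (hp : 2 <= p) (hq : q = p / (p - 1)).

Definition lp_bound (M : R) (C : 'I_n -> 'I_n -> R) := forall w : 'I_n -> R,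
  \sum_i `|\sum_j C i j * w j| `^ p <= (M * (\sum_j `|w j| `^ q) `^ q^-1) `^ p.

Variables (l : R -> R) (T M : R).
Hypotheses (T0 : 0 < T) (M0 : 0 <= M) (lT : forall t, l (t + T) = l t)
  (cl : continuous l) (l0 : forall t, 0 < l t).
Notation tint g := (\int[mu]_(t in `[0, T]) g t).

Lemma cont_abs_pow (f : R -> R) r : 0 < r -> continuous f -> continuous (fun t => `|f t| `^ r).
Proof. by move=> r0 cf x; apply: (@continuous_comp R R R f (fun y => `|y| `^ r)); [exact: cf | exact: cont_powabs]. Qed.

Lemma derive_cont (f df : R -> R) : (forall t : R, is_derive t (1 : R) f (df t)) -> continuous f.
Proof. by move=> d x; apply: differentiable_continuous; apply/derivable1_diffP; have [] := d x. Qed.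

(** The scalar inequalities leave a sum of powers [F i] to the [p - 1], with [F i] a time integral.
    Minkowski's inequality is obtained by duality: one factor [F i] is opened as an integral,
    Hoelder's inequality and the operator bound are applied at each time, and a power of the sum is
    divided out. This needs [p - 1] to be at least 1. *)
Lemma half_isoperimetric (C : 'I_n -> 'I_n -> R) (a v : 'I_n -> R -> R) :
  lp_bound M C -> (forall i t, a i (t + T) = a i t) -> (forall i t, v i (t + T) = v i t) ->
  (forall i, continuous (v i)) ->
  (forall i (t : R), is_derive t (1 : R) (a i) (l t * \sum_j C i j * v j t)) ->
  (forall i, tint (fun t => l t * dpow p (a i t)) = 0) ->
  4 * (2 * half_area p) `^ p * tint (fun t => l t * \sum_i `|a i t| `^ p) <=
  tint l ^+ 2 * (M `^ p * tint (fun t => l t * \sum_j `|v j t| `^ q) `^ (p - 1)).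
Proof.
move=> MC aT vT cv da mean0; have hp' := hp; have p0 := p_gt0 hp; have q0 := q_gt0 hp hq.
have ca i : continuous (a i) by exact: derive_cont (da i).
pose G i t := \sum_j C i j * v j t.
have cG i : continuous (G i).
  by apply: cont_sum => j; apply: cont_mul; [exact: cst_continuous | exact: cv].
have GT i t : G i (t + T) = G i t by apply: eq_bigr => j _; rewrite vT.
pose P i := tint (fun t => l t * `|a i t| `^ p).
pose F i := tint (fun t => l t * `|G i t| `^ q).
have cF i : continuous (fun t => l t * `|G i t| `^ q) by apply: cont_mul => //; exact: cont_abs_pow.
have F0 i : 0 <= F i by apply: Rintegral_ge0 => t _; rewrite mulr_ge0 ?powR_ge0 // ltW.
have L0 : 0 < tint l by exact: period_gt0.
have one i : 4 * (2 * half_area p) `^ p * P i <= tint l ^+ 2 * F i `^ (p - 1).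
  exact: (scalar_isoperimetric hp hq T0 (aT i) (GT i) lT (cG i) cl l0 (da i) (mean0 i) L0).
have -> : tint (fun t => l t * \sum_i `|a i t| `^ p) = \sum_i P i.
  transitivity (\sum_i 1 * P i); last by apply: eq_bigr => i _; rewrite mul1r.
  rewrite -period_sum // => [|i]; last by apply: cont_mul => //; exact: cont_abs_pow.
  by apply: eq_Rintegral => t _; rewrite mulr_sumr; apply: eq_bigr => i _; rewrite mul1r.
set Q := tint (fun t => _ * \sum_j `|v j t| `^ q).
rewrite mulr_sumr; apply: (le_trans (ler_sum _ (fun i _ => one i))).
rewrite -mulr_sumr; apply: ler_wpM2l; first exact: sqr_ge0.
have Q0 : 0 <= Q.
  by apply: Rintegral_ge0 => t _; rewrite mulr_ge0 ?(ltW (l0 t)) // sumr_ge0 // => j _; exact: powR_ge0.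
set N := \sum_i _; pose s := p - 1.
have s1 : 1 <= s by rewrite /s; have := hp; lra.
have s0 : 0 < s by lra.
have N0 : 0 <= N by apply: sumr_ge0 => i _; exact: powR_ge0.
have cV : continuous (fun t => l t * \sum_j `|v j t| `^ q).
  by apply: cont_mul => //; apply: cont_sum => j; exact: cont_abs_pow.
have key : N <= N `^ (1 - s^-1) * M `^ q * Q.
  rewrite [leLHS](_ : N = \sum_i F i `^ (s - 1) * F i); last first.
    apply: eq_bigr => i _; have [->|Fn] := eqVneq (F i) 0; first by rewrite mulr0 powR0 // gt_eqF.
    by rewrite -{3}(powRr1 (F0 i)) -powRD ?Fn ?implybT // subrK.
  rewrite -period_sum // -period_scale //.
  apply: period_le => //.
  - by apply: cont_sum => i; apply: cont_mul; [exact: cst_continuous | exact: cF].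
  - by apply: cont_mul; [exact: cst_continuous | exact: cV].
  move=> t; rewrite (eq_bigr (fun i => l t * (`|G i t| `^ q * F i `^ (s - 1)))) => [|i _]; last by ring.
  rewrite -mulr_sumr mulrCA; apply: ler_wpM2l; first exact: ltW.
  have H := hoelder_power s1 (fun i => powR_ge0 `|G i t| q) F0.
  apply: (le_trans H); rewrite -/N [leLHS]mulrC -mulrA; apply: ler_wpM2l; first exact: powR_ge0.
  have -> : \sum_i (`|G i t| `^ q) `^ s = \sum_i `|G i t| `^ p.
    apply: eq_bigr => i _; rewrite -powRrM; congr (_ `^ _).
    by rewrite hq /s divfK // gt_eqF.
  have := MC (v ^~ t); set V := \sum_j `|v j t| `^ q => h.
  have V0 : 0 <= V by apply: sumr_ge0 => j _; exact: powR_ge0.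
  have := @ge0_ler_powR _ s^-1 _ _ _ _ _ h; rewrite invr_ge0 (ltW s0) => /(_ isT).
  rewrite !nnegrE powR_ge0 sumr_ge0 => [/(_ isT isT) h2|i _]; last exact: powR_ge0.
  apply: (le_trans h2); rewrite -powRrM -/s -hq powRM ?powR_ge0 // -powRrM mulVf ?gt_eqF //.
  by rewrite powRr1.
have [Nz|Nn] := eqVneq N 0; first by rewrite Nz mulr_ge0 ?powR_ge0.
have Np : 0 < N by rewrite lt_neqAle eq_sym Nn.
have {}key : N `^ s^-1 <= M `^ q * Q.
  have e : N = N `^ (1 - s^-1) * N `^ s^-1 by rewrite -powRD ?Nn ?implybT // subrK powRr1.
  by rewrite -(ler_pM2l (powR_gt0 (1 - s^-1) Np)) -e mulrA.
have := @ge0_ler_powR _ s _ _ _ _ _ key; rewrite (ltW s0) => /(_ isT).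
rewrite !nnegrE powR_ge0 mulr_ge0 ?powR_ge0 // => /(_ isT isT).
rewrite -powRrM mulVf ?gt_eqF // powRr1 // powRM ?powR_ge0 // -powRrM.
by rewrite hq divfK // gt_eqF.
Qed.

(** If one half vanished, so would the other, against [P + Q = L]. Otherwise the product of the two
    inequalities, divided by [P Q], carries [(P Q)^(p-2)] on the right; the exponent is nonnegative,
    so [P Q <= (L / 2)^2] bounds it. *)
Lemma combine_halves (P Q L k : R) : 0 <= P -> 0 <= Q -> 0 < L -> 0 <= k -> P + Q = L ->
  4 * (2 * k) `^ p * P <= L ^+ 2 * (M `^ p * Q `^ (p - 1)) ->
  4 * (2 * k) `^ p * Q <= L ^+ 2 * (M `^ p * P `^ (p - 1)) ->
  4 * k <= M * L.
Proof.
move=> P0 Q0 L0; have p0 := p_gt0 hp; have p1 := p_gt1 hp; have M0' := M0; have hp' := hp.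
rewrite le_eqVlt => /predU1P[<- _ _ _|k0 PQ h1 h2]; first by rewrite mulr0 mulr_ge0 // ltW.
have E0 : 0 < 4 * (2 * k) `^ p by rewrite mulr_gt0 // powR_gt0 // mulr_gt0.
have nz x y : 4 * (2 * k) `^ p * x <= L ^+ 2 * (M `^ p * y `^ (p - 1)) -> 0 <= x -> y = 0 -> x = 0.
  move=> h x0 yz; move: h; rewrite yz powR0 ?gt_eqF ?subr_gt0 // !mulr0 pmulr_rle0 // => h.
  by apply/eqP; rewrite eq_le h.
have Pp : 0 < P.
  rewrite lt_neqAle P0 andbT; apply/eqP => e; have := nz _ _ h2 Q0 (esym e) => Qz.
  by move: PQ; rewrite -e Qz addr0 => Lz; rewrite -Lz ltxx in L0.
have Qp : 0 < Q.
  rewrite lt_neqAle Q0 andbT; apply/eqP => e; have := nz _ _ h1 P0 (esym e) => Pz.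
  by rewrite Pz ltxx in Pp.
have pB x : 0 < x -> x `^ (p - 1) = x * x `^ (p - 2).
  by move=> x0; rewrite -{2}(powRr1 (ltW x0)) -powRD ?(gt_eqF x0) ?implybT //; congr (_ `^ _); ring.
have L2 : 0 < L / 2 by rewrite divr_gt0.
have pq4 : P * Q <= (L / 2) ^+ 2.
  by rewrite -PQ; have := sqr_ge0 (P - Q); rewrite !expr2; lra.
have mono : (P * Q) `^ (p - 2) <= ((L / 2) `^ (p - 2)) ^+ 2.
  rewrite expr2 -powRM ?(ltW L2) // -expr2 ge0_ler_powR ?nnegrE ?sqr_ge0 ?mulr_ge0 //; lra.
have e2 : (4 * (2 * k) `^ p) ^+ 2 <= (L ^+ 2 * M `^ p * (L / 2) `^ (p - 2)) ^+ 2.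
  have h := ler_pM (mulr_ge0 (ltW E0) P0) (mulr_ge0 (ltW E0) Q0) h1 h2.
  rewrite !pB // in h; move: mono; rewrite powRM // => mono.
  rewrite -(ler_pM2l (mulr_gt0 Pp Qp)).
  apply: (@le_trans _ _ (P * Q * ((L ^+ 2 * M `^ p) ^+ 2 * (P `^ (p - 2) * Q `^ (p - 2))))).
    apply: (le_trans _ (le_trans h _)); rewrite le_eqVlt; apply/orP; left; apply/eqP; ring.
  rewrite ler_pM2l ?mulr_gt0 // [leRHS]exprMn; apply: ler_wpM2l mono; exact: sqr_ge0.
have Lp : L ^+ 2 * (L / 2) `^ (p - 2) = 4 * (L / 2) `^ p.
  have -> : L ^+ 2 = 4 * (L / 2) ^+ 2 by field.
  rewrite -mulrA -powR_mulrn ?(ltW L2) // -powRD ?(gt_eqF L2) ?implybT //.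
  by congr (_ * _ `^ _); ring.
have {e2} : 4 * (2 * k) `^ p <= 4 * (M * (L / 2)) `^ p.
  rewrite [(M * _) `^ p]powRM ?(ltW L2) // mulrCA -Lp mulrCA mulrA.
  have y0 : 0 <= L ^+ 2 * M `^ p * (L / 2) `^ (p - 2) by exact: (mulr_ge0 (mulr_ge0 (sqr_ge0 _) (powR_ge0 _ _)) (powR_ge0 _ _)).
  by rewrite -ler_sqr ?nnegrE // ltW.
rewrite ler_pM2l // => h3; have : 2 * k <= M * (L / 2); last by lra.
rewrite leNgt; apply/negP => /(gt0_ltr_powR p0).
have z0 : 0 <= M * (L / 2) by rewrite mulr_ge0 // ltW.
have k20 : 0 <= 2 * k by rewrite mulr_ge0 // ltW.
rewrite !nnegrE z0 k20 => /(_ isT isT).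
by rewrite ltNge h3.
Qed.
End VectorIsoperimetric.

Section CapacityBound.
Context {R : realType}.
Notation mu := (@lebesgue_measure R).
Variables (p q : R) (n : nat).
Hypotheses (hp : 2 <= p) (hq : q = p / (p - 1)).

Theorem capacity_bound (C : 'M[R]_n) (l : R -> R) (T M : R) (a b : 'I_n -> R -> R) :
  0 < T -> 0 <= M -> (forall t, l (t + T) = l t) -> continuous l -> (forall t, 0 < l t) ->
  C \in unitmx -> lp_bound p q M C -> lp_bound p q M C^T ->
  (forall i t, a i (t + T) = a i t) -> (forall i t, b i (t + T) = b i t) ->
  (forall i (t : R), is_derive t (1 : R) (a i) (l t * \sum_j C i j * dpow p (b j t))) ->
  (forall j (t : R), is_derive t (1 : R) (b j) (- (l t * \sum_i C i j * dpow p (a i t)))) ->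
  (forall t, \sum_i `|a i t| `^ p + \sum_i `|b i t| `^ p = 1) ->
  4 * half_area p <= M * \int[mu]_(t in `[0, T]) l t.
Proof.
move=> T0 M0 lT cl l0 uC MC MCT aT bT da db ab.
have p0 := p_gt0 hp; have q0 := q_gt0 hp hq.
have ca i : continuous (a i) by exact: derive_cont (da i).
have cb i : continuous (b i) by exact: derive_cont (db i).
have cda i : continuous (fun t => dpow p (a i t)).
  by move=> x; apply: (@continuous_comp R R R (a i) (dpow p)); [exact: ca | exact: cont_dpow].
have cdb i : continuous (fun t => dpow p (b i t)).
  by move=> x; apply: (@continuous_comp R R R (b i) (dpow p)); [exact: cb | exact: cont_dpow].
have clda i : continuous (fun t => l t * dpow p (a i t)) by exact: cont_mul.
have cldb i : continuous (fun t => l t * dpow p (b i t)) by exact: cont_mul.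
(* The row of these means times [C] is minus the increment of [b] over a period, hence 0, and [C] is
   invertible. *)
have meana i : \int[mu]_(t in `[0, T]) (l t * dpow p (a i t)) = 0.
  pose w := \row_i \int[mu]_(t in `[0, T]) (l t * dpow p (a i t)).
  suff w0 : w = 0 by have := congr1 (fun u : 'rV_n => u ord0 i) w0; rewrite !mxE.
  suff wC : w *m C = 0 by rewrite -[w]mulmx1 -(mulmxV uC) mulmxA wC mul0mx.
  apply/rowP => j; rewrite !mxE.
  rewrite (eq_bigr (fun i => C i j * \int[mu]_(t in `[0, T]) (l t * dpow p (a i t)))) => [|i' _]; last by rewrite mxE mulrC.
  rewrite -period_sum //.
  have d (t : R) : is_derive t (1 : R) (fun t => - b j t) (\sum_i C i j * (l t * dpow p (a i t))).
    apply: is_derive_eq; rewrite opprK mulr_sumr; apply: eq_bigr => i' _; ring.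
  rewrite (primitive_Rintegral _ T0 d); first by have := bT j 0; rewrite add0r => ->; ring.
  by apply: cont_sum => i'; apply: cont_mul; [exact: cst_continuous | exact: clda].
have meanb i : \int[mu]_(t in `[0, T]) (l t * dpow p (b i t)) = 0.
  pose w := \col_i \int[mu]_(t in `[0, T]) (l t * dpow p (b i t)).
  suff w0 : w = 0 by have := congr1 (fun u : 'cV_n => u i ord0) w0; rewrite !mxE.
  suff wC : C *m w = 0 by rewrite -[w]mul1mx -(mulVmx uC) -mulmxA wC mulmx0.
  apply/colP => j; rewrite !mxE.
  rewrite (eq_bigr (fun i => C j i * \int[mu]_(t in `[0, T]) (l t * dpow p (b i t)))) => [|i' _]; last by rewrite mxE.
  rewrite -period_sum //.
  have d (t : R) : is_derive t (1 : R) (a j) (\sum_i C j i * (l t * dpow p (b i t))).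
    apply: is_derive_eq; rewrite mulr_sumr; apply: eq_bigr => i' _; ring.
  rewrite (primitive_Rintegral _ T0 d); first by have := aT j 0; rewrite add0r => ->; ring.
  by apply: cont_sum => i'; apply: cont_mul; [exact: cst_continuous | exact: cldb].
have qn (f : 'I_n -> R -> R) t : \sum_j `|dpow p (f j t)| `^ q = \sum_j `|f j t| `^ p.
  by apply: eq_bigr => j _; rewrite dpow_norm_q.
have h1 := half_isoperimetric hp hq T0 M0 lT cl l0 MC aT
  (fun i t => congr1 (dpow p) (bT i t)) cdb da meana.
(* The same half inequality, with [b], [C^T] and [- dpow p a] in the roles of [a], [C] and
   [dpow p b]. *)
have h2 : 4 * (2 * half_area p) `^ p * \int[mu]_(t in `[0, T]) (l t * \sum_i `|b i t| `^ p) <=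
  (\int[mu]_(t in `[0, T]) l t) ^+ 2 * (M `^ p * (\int[mu]_(t in `[0, T]) (l t * \sum_j `|- dpow p (a j t)| `^ q)) `^ (p - 1)).
  apply: (half_isoperimetric hp hq T0 M0 lT cl l0 MCT bT) => //.
  - by move=> i t; rewrite aT.
  - by move=> i x; apply: cvgN; exact: cda.
  - move=> i t; rewrite (_ : _ * _ = - (l t * \sum_i0 C i0 i * dpow p (a i0 t))) //.
    by rewrite -mulrN -sumrN; congr (_ * _); apply: eq_bigr => j _; rewrite mxE mulrN.
have e1 : \int[mu]_(t in `[0, T]) (l t * \sum_j `|dpow p (b j t)| `^ q) =
    \int[mu]_(t in `[0, T]) (l t * \sum_j `|b j t| `^ p).
  by apply: eq_Rintegral => t _; rewrite qn.
have e2 : \int[mu]_(t in `[0, T]) (l t * \sum_j `|- dpow p (a j t)| `^ q) =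
    \int[mu]_(t in `[0, T]) (l t * \sum_j `|a j t| `^ p).
  by apply: eq_Rintegral => t _; rewrite -qn; congr (_ * _); apply: eq_bigr => j _; rewrite normrN.
rewrite e1 in h1; rewrite e2 in h2.
have cP (f : 'I_n -> R -> R) : (forall i, continuous (f i)) -> continuous (fun t => l t * \sum_i `|f i t| `^ p).
  by move=> cf; apply: cont_mul; [exact: cl | apply: cont_sum => j; exact: cont_abs_pow].
have := combine_halves hp M0 _ _ _ _ _ h1 h2; apply.
- by apply: Rintegral_ge0 => t _; apply: mulr_ge0; [exact: ltW | apply: sumr_ge0 => j _; exact: powR_ge0].
- by apply: Rintegral_ge0 => t _; apply: mulr_ge0; [exact: ltW | apply: sumr_ge0 => j _; exact: powR_ge0].
- exact: period_gt0.
- by apply: Rintegral_ge0 => s _; exact: wcirc_ge0.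
- rewrite -RintegralD; [|exact: measurable_itv|exact: continuous_integrable (cP _ _)|exact: continuous_integrable (cP _ _)].
  by apply: eq_Rintegral => t _; rewrite -mulrDr ab mulr1.
Qed.
End CapacityBound.

(** * Calculus on the phase space *)

Lemma chain_derive {R : realType} (V W : normedModType R) (f : V -> W) (c : R -> V) (t : R) (v : V) :
  differentiable f (c t) -> is_derive t (1 : R) c v ->
  is_derive t (1 : R) (fun s => f (c s)) ('d f (c t) v).
Proof.
move=> df [dc <-]; have dc' : differentiable c t by apply/derivable1_diffP.
have dfc : differentiable (f \o c) t by exact: differentiable_comp.
apply: DeriveDef; first by apply/derivable1_diffP.
by rewrite deriveE // [in LHS]diff_comp //= deriveE.
Qed.

Lemma is_derive_line {R : realType} (V : normedModType R) (z v : V) (t : R) :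
  is_derive t (1 : R) (fun s => z + s *: v) v.
Proof.
have d : is_diff t (fun s : R => s *: v) (fun s : R => s *: v) by exact: is_diff_scalel.
have dd : differentiable (fun s : R => s *: v) t by exact: ex_diff.
have : is_derive t (1 : R) (fun s : R => s *: v) v.
  apply: DeriveDef; first by apply/derivable1_diffP.
  by rewrite deriveE // diff_val scale1r.
move=> h; rewrite -[X in is_derive _ _ _ X]add0r.
by apply: (@is_deriveD _ _ _ (cst z) (fun s : R => s *: v)); exact: is_derive_cst.
Qed.

Lemma is_derive_scalel {R : realType} (V : normedModType R) (f : R -> R) (t df : R) (v : V) :
  is_derive t (1 : R) f df -> is_derive t (1 : R) (fun s => f s *: v) (df *: v).
Proof.
move=> d; have dd : differentiable (fun s : R => s *: v) (f t) by exact: ex_diff.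
have := chain_derive dd d; rewrite (_ : 'd _ _ _ = df *: v) //.
by rewrite diff_val.
Qed.

Section Phase.
Context {R : realType} {n : nat}.
Local Notation E := (phase R n).
Implicit Types (z w u v : E) (b : bool) (i : 'I_n).

Lemma pcoordD u v b i : pcoord (u + v) b i = pcoord u b i + pcoord v b i.
Proof. by case: b; rewrite /pcoord /= mxE. Qed.

Lemma pcoordZ a v b i : pcoord (a *: v) b i = a * pcoord v b i.
Proof. by case: b; rewrite /pcoord /= mxE. Qed.

Lemma pcoordN v b i : pcoord (- v) b i = - pcoord v b i.
Proof. by rewrite -scaleN1r pcoordZ mulN1r. Qed.

Lemma pcoordB u v b i : pcoord (u - v) b i = pcoord u b i - pcoord v b i.
Proof. by rewrite pcoordD pcoordN. Qed.

Lemma pcoord0 b i : pcoord (0 : E) b i = 0.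
Proof. by rewrite -(scale0r (0 : E)) pcoordZ mul0r. Qed.

Lemma phase_ext z w : (forall b i, pcoord z b i = pcoord w b i) -> z = w.
Proof.
case: z w => [z1 z2] [w1 w2] h; congr pair; apply/colP => i.
  exact: (h false i).
exact: (h true i).
Qed.

Lemma pcoord_sum (I : Type) (r : seq I) (P : pred I) (f : I -> E) b i :
  pcoord (\sum_(j <- r | P j) f j) b i = \sum_(j <- r | P j) pcoord (f j) b i.
Proof.
elim: r => [|j r IH]; first by rewrite !big_nil pcoord0.
by rewrite !big_cons; case: ifP => _; rewrite ?pcoordD IH.
Qed.

Definition eb b i : E := if b then (0, delta_mx i ord0) else (delta_mx i ord0, 0).

Lemma pcoord_eb b i b' i' : pcoord (eb b i) b' i' = ((b' == b) && (i' == i))%:R.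
Proof. by case: b b' => -[]; rewrite /pcoord /eb /= mxE //= eqxx andbT. Qed.

Lemma phase_expand z : z = \sum_b \sum_i pcoord z b i *: eb b i.
Proof.
apply: phase_ext => b i; rewrite pcoord_sum (bigD1 b) //= [X in _ + X]big1 ?addr0; last first.
  move=> b' /negPf nb; rewrite pcoord_sum big1 // => i' _.
  by rewrite pcoordZ pcoord_eb eq_sym nb mulr0.
rewrite pcoord_sum (bigD1 i) //= big1 ?addr0 => [|i' /negPf ni]; rewrite pcoordZ pcoord_eb eqxx.
  by rewrite eqxx mulr1.
by rewrite eq_sym ni mulr0.
Qed.

Lemma pcoord_continuous b i : continuous (fun z : E => pcoord z b i).
Proof.
case: b; rewrite /pcoord.
  apply: (@cont_comp _ _ _ (fun x : 'cV[R]_n => x i ord0) snd) => [z|]; first exact: cvg_snd.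
  exact: coord_continuous.
apply: (@cont_comp _ _ _ (fun x : 'cV[R]_n => x i ord0) fst) => [z|]; first exact: cvg_fst.
exact: coord_continuous.
Qed.

Lemma continuous_phase (T : topologicalType) (f : T -> E) :
  (forall b i, continuous (fun x => pcoord (f x) b i)) -> continuous f.
Proof.
move=> cf; have -> : f = (fun x => ((f x).1, (f x).2)) by apply/funext => x; case: (f x).
apply: cont_pair; apply: continuous_mx => i j; rewrite (ord1 j); [exact: (cf false i) | exact: (cf true i)].
Qed.

Lemma pcoord_le_norm z b i : `|pcoord z b i| <= `|z|.
Proof.
have col (x : 'cV[R]_n) : `|x i ord0| <= `|x|.
  by rewrite [leRHS]mx_normrE; apply: (le_bigmax_cond _ (fun k : 'I_n * 'I_1 => `|x k.1 k.2|) (j := (i, ord0))).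
by rewrite prod_normE le_max /pcoord; case: b; rewrite col ?orbT.
Qed.

Lemma norm_le_pcoord z (e : R) : 0 <= e -> (forall b i, `|pcoord z b i| <= e) -> `|z| <= e.
Proof.
move=> e0 h; rewrite prod_normE ge_max [`|z.1|]mx_normrE [`|z.2|]mx_normrE; apply/andP; split; apply: bigmax_le => // -[i j] _;
  rewrite (ord1 j); [exact: (h false i) | exact: (h true i)].
Qed.

Lemma is_derive_pcoord (c : R -> E) (t : R) v b i :
  is_derive t (1 : R) c v -> is_derive t (1 : R) (fun s => pcoord (c s) b i) (pcoord v b i).
Proof.
move=> d; have lin : linear (fun z : E => pcoord z b i).
  by move=> a x y; rewrite pcoordD pcoordZ.
pose L := GRing.isLinear.Build _ _ _ _ (fun z : E => pcoord z b i) lin.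
pose f : {linear E -> R} := HB.pack (fun z : E => pcoord z b i) L.
have cf : continuous f by exact: pcoord_continuous.
have df : differentiable f (c t) by exact: linear_differentiable.
by have := chain_derive df d; rewrite diff_lin.
Qed.

Lemma is_derive_phase (c : R -> E) (t : R) v :
  (forall b i, is_derive t (1 : R) (fun s => pcoord (c s) b i) (pcoord v b i)) ->
  is_derive t (1 : R) c v.
Proof.
move=> d; rewrite (_ : c = \sum_(b : bool) \sum_i (fun s => pcoord (c s) b i *: eb b i)); last first.
  by apply/funext => s; rewrite fct_sumE {1}(phase_expand (c s)); apply: eq_bigr => b _; rewrite fct_sumE.
rewrite [X in is_derive _ _ _ X](phase_expand v).
rewrite !big_bool; apply: is_deriveD; elim/big_ind2 : _ => // [|*|i _];
  by [exact: is_derive_cst | exact: is_deriveD | exact: is_derive_scalel].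
Qed.

Definition box (r : R) : set E := [set z | forall b i, `|pcoord z b i| <= r].

Lemma box_compact r : compact (box r).
Proof.
pose I := (bool * 'I_n)%type.
pose g (x : 'rV[R]_#|{: I}|) : E := (\col_i x ord0 (enum_rank (false, i)), \col_i x ord0 (enum_rank (true, i))).
have gE x b i : pcoord (g x) b i = x ord0 (enum_rank (b, i)) by case: b; rewrite /pcoord /g /= mxE.
have cg : continuous g.
  apply: continuous_phase => b i; rewrite (_ : (fun x => _) = fun x : 'rV[R]_#|{: I}| => x ord0 (enum_rank (b, i))).
    exact: coord_continuous.
  by apply/funext => x; rewrite gE.
have -> : box r = g @` [set x : 'rV[R]_#|{: I}| | forall j, x ord0 j \in `[(- r), r]].
  apply/seteqP; split => [z zr|_ [x xr <-]]; last first.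
    by move=> b i; rewrite gE; have := xr (enum_rank (b, i)); rewrite in_itv /= ler_norml.
  exists (\row_j pcoord z (enum_val j).1 (enum_val j).2).
    by move=> j; rewrite mxE in_itv /= -ler_norml.
  by apply: phase_ext => b i; rewrite gE mxE enum_rankK.
apply: continuous_compact.
  by apply: continuous_subspaceT.
exact (@rV_compact R #|{: I}| (fun=> `[(- r), r]%classic) (fun=> @segment_compact R (- r) r)).
Qed.

Lemma phase_compact (A : set E) r : closed A -> A `<=` box r -> compact A.
Proof. by move=> cA Ar; exact: (subclosed_compact cA (@box_compact r) Ar). Qed.

Lemma compact_box (A : set E) : compact A -> exists2 r : R, 0 < r & A `<=` box r.
Proof.
move=> /compact_bounded [M [_ h]]; exists (`|M| + 1); first by rewrite ltr_wpDl.
move=> z Az b i; apply: (le_trans (pcoord_le_norm z b i)); apply: h Az.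
by have := ler_norm M; lra.
Qed.

Lemma nbhs_box z (P : set E) : nbhs z P ->
  exists2 e : R, 0 < e & forall w, (forall b i, `|pcoord (w - z) b i| <= e) -> P w.
Proof.
move=> /nbhs_ballP [e /= e0 eP]; exists (e / 2); first by rewrite divr_gt0.
move=> w wz; apply: eP; rewrite -ball_normE /= -opprB normrN.
apply: (@le_lt_trans _ _ (e / 2)); last by lra.
by apply: norm_le_pcoord => //; lra.
Qed.

Lemma ipC u v : ip u v = ip v u.
Proof. by apply: eq_bigr => b _; apply: eq_bigr => i _; rewrite mulrC. Qed.

Lemma ipDl u v w : ip (u + v) w = ip u w + ip v w.
Proof.
rewrite /ip -big_split; apply: eq_bigr => b _; rewrite -big_split; apply: eq_bigr => i _.
by rewrite pcoordD mulrDl.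
Qed.

Lemma ipZl a u w : ip (a *: u) w = a * ip u w.
Proof.
rewrite /ip mulr_sumr; apply: eq_bigr => b _; rewrite mulr_sumr; apply: eq_bigr => i _.
by rewrite pcoordZ mulrA.
Qed.

Lemma ipDr u v w : ip w (u + v) = ip w u + ip w v.
Proof. by rewrite ipC ipDl !(ipC w). Qed.

Lemma ipZr a u w : ip w (a *: u) = a * ip w u.
Proof. by rewrite ipC ipZl (ipC w). Qed.

Lemma ip_eb u b i : ip u (eb b i) = pcoord u b i.
Proof.
rewrite /ip (bigD1 b) //= [X in _ + X]big1 ?addr0; last first.
  by move=> b' /negPf nb; rewrite big1 // => i' _; rewrite pcoord_eb nb mulr0.
rewrite (bigD1 i) //= big1 ?addr0 => [|i' /negPf ni]; rewrite pcoord_eb eqxx.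
  by rewrite eqxx mulr1.
by rewrite ni mulr0.
Qed.

Lemma ip_ge0 u : 0 <= ip u u.
Proof. by apply: sumr_ge0 => b _; apply: sumr_ge0 => i _; rewrite -expr2 sqr_ge0. Qed.

Lemma ip_eq0 u : ip u u = 0 -> u = 0.
Proof.
move=> h; apply: phase_ext => b i; rewrite pcoord0; apply/eqP; rewrite -sqrf_eq0; apply/eqP.
apply: le_anti; rewrite sqr_ge0 andbT -h /ip (bigD1 b) //= (bigD1 i) //= -expr2 -addrA lerDl.
by rewrite addr_ge0 // !sumr_ge0 // => [j _|b' _]; rewrite ?sumr_ge0 // => *; rewrite -expr2 sqr_ge0.
Qed.

(** Applied to the gradient of [H], it gives the Hamiltonian field with [x' = dH/dy] and
    [y' = - dH/dx]; equivalently, [omega (Jm u)] is the inner product with [u]. *)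
Definition Jm (g : E) : E := (g.2, - g.1).

Lemma Jm2 u : Jm (Jm u) = - u. Proof. by case: u. Qed.

Lemma JmD u v : Jm (u + v) = Jm u + Jm v.
Proof. by rewrite /Jm /= opprD. Qed.

Lemma JmZ a u : Jm (a *: u) = a *: Jm u.
Proof. by rewrite /Jm /= -scalerN. Qed.

Lemma pcoord_Jm g b i : pcoord (Jm g) b i = if b then - pcoord g false i else pcoord g true i.
Proof. by case: b; rewrite /pcoord /Jm //= mxE. Qed.

Lemma omega_Jm u w : omega (Jm u) w = ip u w.
Proof.
rewrite /omega /ip big_bool -big_split /=; apply: eq_bigr => i _.
by rewrite /pcoord mxE mulNr opprK.
Qed.

Lemma omegaE u w : omega u w = - ip (Jm u) w.
Proof. 
have -> : omega u w = omega (Jm (- Jm u)) w by rewrite -[- Jm u]scaleN1r JmZ Jm2 scaleN1r opprK.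
by rewrite omega_Jm -[- Jm u]scaleN1r ipZl mulN1r. Qed.

Lemma omega_antisym u w : omega u w = - omega w u.
Proof. by rewrite /omega -sumrN; apply: eq_bigr => i _; ring. Qed.

Lemma omegaDr u v w : omega w (u + v) = omega w u + omega w v.
Proof. by rewrite !omegaE ipDr opprD. Qed.

Lemma omegaZr a v w : omega w (a *: v) = a * omega w v.
Proof. by rewrite !omegaE ipZr mulrN. Qed.

Lemma omegaDl u v w : omega (u + v) w = omega u w + omega v w.
Proof. by rewrite !omegaE JmD ipDl opprD. Qed.

Lemma omegaZl a v w : omega (a *: v) w = a * omega v w.
Proof. by rewrite !omegaE JmZ ipZl mulrN. Qed.

Lemma omega_nondeg u : (forall w, omega u w = 0) -> u = 0.
Proof.
move=> h; have : Jm u = 0 by apply: ip_eq0; apply/eqP; rewrite -oppr_eq0 -omegaE h.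
by move=> /(congr1 Jm); rewrite Jm2 /Jm /= oppr0 => /eqP; rewrite oppr_eq0 => /eqP.
Qed.

Lemma omega_eb u b i : omega u (eb b i) = - pcoord (Jm u) b i.
Proof. by rewrite omegaE ip_eb. Qed.

Lemma ip_le u w (a : R) : (forall b i, `|pcoord u b i| <= a) ->
  `|ip u w| <= a * \sum_b \sum_i `|pcoord w b i|.
Proof.
move=> ua; apply: (le_trans (ler_norm_sum _ _ _)); rewrite mulr_sumr; apply: ler_sum => b _.
apply: (le_trans (ler_norm_sum _ _ _)); rewrite mulr_sumr; apply: ler_sum => i _.
by rewrite normrM ler_wpM2r.
Qed.
End Phase.

(** * Periodic orbits of compactly perturbed quadratic Hamiltonians *)

Section CompactPerturbation.
Context {R : realType} {n : nat}.
Local Notation E := (phase R n).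

Lemma unif_cont_box (f : E -> R) (r : R) : continuous f -> (forall z, ~ box r z -> f z = 0) ->
  forall e : R, 0 < e -> exists2 eta : R, 0 < eta & forall z w,
    (forall b i, `|pcoord z b i - pcoord w b i| <= eta) -> `|f z - f w| <= e.
Proof.
move=> cf f0 e e0.
pose Pr (d : R) (z : E) := forall w : E, (forall b i, `|pcoord (w - z) b i| <= d) -> `|f z - f w| <= e.
have cov : near_covering (@box R n (r + 1)) by apply/compact_near_coveringP; exact: box_compact.
have [z _|d0 /= d0p d0P] := cov R (0^'+) Pr _.
  have e2 : 0 < e / 2 by rewrite divr_gt0.
  have /cvgrPdist_le /(_ _ e2) /nbhs_box [d d0 dP] := cf z.
  have d2 : 0 < d / 2 by rewrite divr_gt0.
  exists ([set z' | ball z (d / 2) z'], [set t : R | t < d / 2]) => /=.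
    split; first exact: nbhsx_ballx.
    exact: nbhs_right_lt.
  move=> [z' t] /= [zz' td] w wz'.
  have cz' b i : `|pcoord (z' - z) b i| <= d / 2.
    apply: (le_trans (pcoord_le_norm _ _ _)); move: zz'.
    by rewrite -ball_normE /= -opprB normrN => /ltW.
  have h1 : `|f z - f z'| <= e / 2 by apply: dP => b i; apply: (le_trans (cz' b i)); lra.
  have h2 : `|f z - f w| <= e / 2.
    apply: dP => b i; have -> : w - z = (w - z') + (z' - z) by rewrite addrA subrK.
    rewrite pcoordD; apply: (le_trans (ler_normD _ _)).
    by have := cz' b i; have := wz' b i; lra.
  have -> : f z' - f w = - (f z - f z') + (f z - f w) by ring.
  by apply: (le_trans (ler_normD _ _)); rewrite normrN; lra.
pose eta := Num.min 1 (d0 / 2).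
have eta0 : 0 < eta by rewrite lt_min ltr01 divr_gt0.
exists eta => // z w zw.
have P1 u v : box (r + 1) u -> (forall b i, `|pcoord u b i - pcoord v b i| <= eta) -> `|f u - f v| <= e.
  move=> ub uv; have := d0P eta; rewrite /= sub0r normrN gtr0_norm // => h.
  have {}h := h _ eta0 u ub v; apply: h => [|b i].
    by rewrite gt_min [_ / 2 < _]ltr_pdivrMr // ltr_pMr // ltr1n orbT.
  by rewrite pcoordB -normrN opprB.
have [zb|zb] := pselect (box (r + 1) z); first exact: P1.
have [wb|wb] := pselect (box (r + 1) w).
  by rewrite -normrN opprB; apply: P1 => // b i; rewrite -normrN opprB.
have out u : ~ box (r + 1) u -> f u = 0.
  by move=> h; apply: f0 => h'; apply: h => b i; apply: (le_trans (h' b i)); rewrite lerDl.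
by rewrite !out // subrr normr0 ltW.
Qed.

Lemma bounded_box (f : E -> R) (r : R) : continuous f -> (forall z, ~ box r z -> f z = 0) ->
  exists2 G : R, 0 <= G & forall z, `|f z| <= G.
Proof.
move=> cf f0.
have : compact (f @` box r).
  by apply: continuous_compact; [exact: continuous_subspaceT | exact: box_compact].
move=> /compact_bounded [M [_ h]]; exists (`|M| + 1); first by rewrite addr_ge0.
move=> z; have [zb|zb] := pselect (box r z); last by rewrite f0 // normr0 addr_ge0.
by apply: h; [have := ler_norm M; lra | exists z].
Qed.

Variables (i0 : 'I_n) (a : 'I_n -> R) (h : E -> R) (gh : E -> E) (z0 : E) (am r0 C1 rs : R).
Hypotheses (am_gt0 : 0 < am) (a_ge : forall i, am <= a i)
  (a0_gt : 2 * pi < a i0) (a0_lt : a i0 < 8) (a_le2 : forall i, i != i0 -> a i <= 2)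
  (ch : continuous h) (cgh : continuous gh)
  (dh : forall z w, is_derive (0 : R) (1 : R) (fun s => h (z + s *: w)) (ip (gh z) w))
  (h_supp : forall z, ~ box rs z -> h z = 0) (gh_supp : forall z, ~ box rs z -> gh z = 0)
  (ham_ge0 : forall z, 0 <= ham a h z) (r0_gt0 : 0 < r0) (C1_gt0 : 0 < C1)
  (ham_near : forall z, sq (z - z0) <= r0 ^+ 2 -> ham a h z = 0)
  (ham_le : forall z, ham a h z <= C1 * sq (z - z0)).

Lemma cont_ip (T : topologicalType) (f g : T -> E) : continuous f -> continuous g ->
  continuous (fun x => ip (f x) (g x)).
Proof.
move=> cf cg; apply: cont_sum => b; apply: cont_sum => i; apply: cont_mul.
  exact: (cont_comp cf (@pcoord_continuous _ _ b i)).
exact: (cont_comp cg (@pcoord_continuous _ _ b i)).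
Qed.

(** Compact support supplies the bounds and the uniform continuity that the discrete orbits and the
    limit both need; the radius and the lower bound for [wfun] are the same on all grids. *)
Theorem hamiltonian_orbit : exists X : R -> E,
  [/\ forall t, X (t + 1) = X t,
      forall (t : R) b i, is_derive t (1 : R) (fun s => pcoord (X s) b i)
        (vel (gham a gh) (X t) b i) &
      0 < wfun h gh (X 0)].
Proof.
have cgc b i : continuous (fun z => pcoord (gh z) b i).
  exact: (cont_comp cgh (@pcoord_continuous _ _ b i)).
have gc0 b i z : ~ box rs z -> pcoord (gh z) b i = 0 by move=> /gh_supp ->; rewrite pcoord0.
have bounds bi : exists2 G : R, 0 <= G & forall z, `|pcoord (gh z) bi.1 bi.2| <= G.
  exact: (bounded_box (cgc bi.1 bi.2) (gc0 bi.1 bi.2)).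
have [G_ G0 G_le] : exists2 G_ : bool * 'I_n -> R, forall bi, 0 <= G_ bi & forall bi z, `|pcoord (gh z) bi.1 bi.2| <= G_ bi.
  have /choice[G_ GP] : forall bi, exists G, 0 <= G /\ forall z, `|pcoord (gh z) bi.1 bi.2| <= G.
    by move=> bi; have [G ? ?] := bounds bi; exists G.
  by exists G_ => bi; have [] := GP bi.
pose G := \sum_bi G_ bi.
have gh_le z b i : `|pcoord (gh z) b i| <= G.
  apply: (le_trans (G_le (b, i) z)); rewrite /G (bigD1 (b, i)) //= lerDl; exact: sumr_ge0.
have [Ch Ch0 h_le] := bounded_box ch h_supp.
have h_ge z : - Ch <= h z by have := h_le z; rewrite ler_norml => /andP[].
have uc e : 0 < e -> exists2 eta : R, 0 < eta & forall z w,
    (forall b i, `|pcoord z b i - pcoord w b i| <= eta) ->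
    forall b i, `|pcoord (gh z) b i - pcoord (gh w) b i| <= e.
  move=> e0.
  have /choice[eta etaP] : forall bi : bool * 'I_n, exists eta : R, 0 < eta /\ forall z w,
      (forall b i, `|pcoord z b i - pcoord w b i| <= eta) ->
      `|pcoord (gh z) bi.1 bi.2 - pcoord (gh w) bi.1 bi.2| <= e.
    by move=> [b i]; have [eta ? ?] := unif_cont_box (cgc b i) (gc0 b i) e0; exists eta.
  exists (\big[Num.min/1]_bi eta bi).
    by apply: lt_bigmin => [|bi _]; [exact: ltr01 | have [] := etaP bi].
  move=> z w zw b i; have [_] := etaP (b, i); apply => b' i'.
  by apply: (le_trans (zw b' i')); exact: bigmin_le.
have dline z w (t : R) : is_derive t (1 : R) (fun s => h (z + s *: w)) (ip (gh (z + t *: w)) w).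
  have d := dh (z + t *: w) w.
  have s : is_derive t (1 : R) (fun x : R => x - t) 1 by apply: is_derive_eq; rewrite subr0.
  have d' : is_derive (t - t) (1 : R) (fun s => h (z + t *: w + s *: w)) (ip (gh (z + t *: w)) w).
    by rewrite subrr.
  have := @is_derive1_comp R (fun s => h (z + t *: w + s *: w)) (fun x => x - t) t _ _ d' s.
  rewrite mulr1 (_ : _ \o _ = (fun s => h (z + s *: w))) //.
  by apply/funext => x /=; rewrite -addrA -scalerDl [t + _]addrC subrK.
have h_diff e : 0 < e -> exists2 eta : R, 0 < eta & forall z w : E,
    (forall b i, `|pcoord w b i| <= eta) ->
    `|h (z + w) - h z - ip (gh z) w| <= e * \sum_b \sum_i `|pcoord w b i|.
  move=> e0; have [eta eta0 etaP] := uc _ e0; exists eta => // z w weta.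
  have [c c01 E1] := MVT_segment ler01 (fun x _ => dline z w x)
    (derivable_within_continuous (fun x _ => (dline z w x).(ex_derive))).
  move: E1; rewrite scale1r scale0r addr0 subr0 mulr1 => ->.
  rewrite -[- ip _ _]mulN1r -ipZl -ipDl scaleN1r; apply: ip_le => b i; rewrite pcoordB.
  apply: etaP => b' i'; rewrite pcoordD addrC addKr pcoordZ normrM.
  rewrite in_itv /= in c01; case/andP: c01 => c0 c1.
  by rewrite ger0_norm //; apply: le_trans (weta b' i'); exact: ler_piMl.
have al0 : 0 < r0 ^+ 2 / (8 * (Num.truncn (4 * C1)).+1%:R) / 8.
  by rewrite !divr_gt0 ?mulr_gt0 ?exprn_gt0 // ltr0n.
have aA i : `|a i| <= 8.
  rewrite ger0_norm; last by have := am_gt0; have := a_ge i; lra.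
  by have [->|/a_le2] := eqVneq i i0; [exact: ltW | lra].
have [|||| X [X1 X2 X3]] := @periodic_orbit R n (gham a gh) (wfun h gh)
  (loop_radius i0 a am G) (8 * loop_radius i0 a am G + G)
  (r0 ^+ 2 / (8 * (Num.truncn (4 * C1)).+1%:R) / 8).
- move=> e e0; have e2 : 0 < e / 2 by rewrite divr_gt0.
  have [eta eta0 etaP] := uc _ e2.
  exists (Num.min eta (e / 16)); first by rewrite lt_min eta0 divr_gt0.
  move=> z w zw b i; rewrite /gham.
  have h1 : `|pcoord (gh z) b i - pcoord (gh w) b i| <= e / 2.
    by apply: etaP => b' i'; apply: (le_trans (zw b' i')); rewrite ge_min lexx.
  have h2 : `|a i * (pcoord z b i - pcoord w b i)| <= e / 2.
    rewrite normrM; apply: (le_trans (ler_pM _ _ (aA i) (zw b i))) => //.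
    apply: (@le_trans _ _ (8 * (e / 16))); last by lra.
    by rewrite ler_pM2l // ge_min lexx orbT.
  rewrite (_ : _ - _ = a i * (pcoord z b i - pcoord w b i) + (pcoord (gh z) b i - pcoord (gh w) b i)); last by ring.
  by apply: (le_trans (ler_normD _ _)); lra.
- move=> z e e0.
  have cw : continuous (wfun h gh).
    apply: cont_sub ch; apply: cont_mul; first exact: cst_continuous.
    by apply: (@cont_ip E gh id cgh) => x; exact: cvg_id.
  have /cvgrPdist_le /(_ _ e0) /nbhs_box [d d0 dP] := cw z.
  exists d => // w wz; rewrite -normrN opprB; apply: dP => b i; rewrite pcoordB; exact: wz.
- move=> z zc b i; rewrite /gham; apply: (le_trans (ler_normD _ _)); apply: lerD => //.
  by rewrite normrM ler_pM.
- move=> m; have m0 : 0 < m.+1%:R^-1 :> R by rewrite invr_gt0 ltr0n.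
  have [z [z1 z2 z3 z4]] := discrete_orbit_grid am_gt0 a_ge a0_gt a0_lt a_le2 ch cgh h_diff gh_le
    h_ge ham_ge0 r0_gt0 C1_gt0 ham_near ham_le m m0.
  by exists z.
by exists X; split => //; exact: lt_le_trans X3.
Qed.
End CompactPerturbation.

(** * Symplectic embeddings *)

Lemma is_derive_shift {R : realType} (V : normedModType R) (c : R -> V) (t : R) (v w : V) :
  is_derive t (1 : R) c v -> is_derive t (1 : R) (fun s => c s - w) v.
Proof.
move=> dc; rewrite -[X in is_derive _ _ _ X]subr0.
by apply: (@is_deriveB _ _ _ c (cst w)); exact: is_derive_cst.
Qed.

Section Embedding.
Context {R : realType} {n : nat}.
Local Notation E := (phase R n).

Lemma is_derive_ip (c d : R -> E) (t : R) u v :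
  is_derive t (1 : R) c u -> is_derive t (1 : R) d v ->
  is_derive t (1 : R) (fun s => ip (c s) (d s)) (ip u (d t) + ip (c t) v).
Proof.
move=> dc dd.
rewrite (_ : (fun s => _) = \sum_b \sum_i (fun s => pcoord (c s) b i * pcoord (d s) b i)); last first.
  by apply/funext => s; rewrite fct_sumE; apply: eq_bigr => b _; rewrite fct_sumE.
rewrite /ip -big_split; apply: is_derive_bigsum => b; rewrite -big_split; apply: is_derive_bigsum => i.
have h1 := is_derive_pcoord b i dc; have h2 := is_derive_pcoord b i dd.
by apply: is_derive_eq; rewrite /GRing.scale /=; ring.
Qed.

Definition symp_map (A : E -> E) := forall u v, omega (A u) (A v) = omega u v.

(** Up to sign the coordinates of [v] are values [omega v e] on basis vectors, and
    [omega v e = omega (A v) (A e)] bounds them by [A v]. *)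
Lemma symp_map_bound (A : E -> E) : symp_map A ->
  exists2 C : R, 0 < C & forall v, `|v| <= C * `|A v|.
Proof.
move=> sA; pose S := \sum_b \sum_i \sum_b' \sum_i' `|pcoord (A (eb b i)) b' i'|.
have S0 : 0 <= S by do 4 (apply: sumr_ge0 => ? _).
have S_ge b i : \sum_b' \sum_i' `|pcoord (A (eb b i)) b' i'| <= S.
  apply: (@le_trans _ _ (\sum_i0 \sum_b' \sum_i' `|pcoord (A (eb b i0)) b' i'|)).
    by rewrite [leRHS](bigD1 i) //= lerDl; do 3 (apply: sumr_ge0 => ? _).
  by rewrite /S [leRHS](bigD1 b) //= lerDl; do 4 (apply: sumr_ge0 => ? _).
exists (S + 1); first by rewrite ltr_wpDl.
move=> v; apply: norm_le_pcoord; first by rewrite mulr_ge0 // addr_ge0.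
move=> b i; have [b' hb] : exists b', `|pcoord v b i| = `|omega v (eb b' i)|.
  exists (~~ b); rewrite omega_eb normrN pcoord_Jm; case: b => //=.
  by rewrite normrN.
rewrite hb -sA omegaE normrN.
apply: (@le_trans _ _ (`|A v| * \sum_b0 \sum_i0 `|pcoord (A (eb b' i)) b0 i0|)).
  apply: ip_le => b0 i0; rewrite pcoord_Jm; case: b0; rewrite ?normrN; exact: pcoord_le_norm.
rewrite mulrC; apply: ler_wpM2r => //; apply: (le_trans (S_ge b' i)); rewrite lerDl //.
Qed.

Lemma symp_map_surj (A : {linear E -> E}) : symp_map A -> forall e, exists v, A v = e.
Proof.
move=> sA e; pose f := linfun A.
have kf : lker f == 0%VS.
  apply/lker0P => u v; rewrite !lfunE /= => uv; apply/eqP; rewrite -subr_eq0; apply/eqP.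
  by apply: omega_nondeg => w; rewrite -sA linearB /= uv subrr -(scale0r (0 : E)) omegaZl mul0r.
have : e \in limg f by rewrite lker0_limgf // memvf.
by move=> /memv_imgP[v _ ->]; exists v; rewrite lfunE.
Qed.

Variables (O : set E) (phi psi : E -> E).
Hypotheses (oO : open O) (dphi : forall z, O z -> differentiable phi z)
  (sphi : forall z, O z -> symp_map ('d phi z))
  (psiK : forall z, O z -> psi (phi z) = z).

Lemma cont_norm_dist (z : E) : continuous (fun w : E => `|w - z|).
Proof.
apply: (@cont_comp E E R Num.norm (fun w : E => w - z)); last exact: norm_continuous.
by move=> w; apply: cvgB; [exact: cvg_id | exact: cvg_cst].
Qed.

Lemma cont_dist_to (w x : E) : {for x, continuous phi} ->
  {for x, continuous (fun x => ip (phi x - w) (phi x - w))}.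
Proof.
move=> cp; have cB : {for x, continuous (fun x => phi x - w)} by apply: cvgB; [exact: cp | exact: cvg_cst].
apply: (@continuous_comp E E R (fun x => phi x - w) (fun u => ip u u)); first exact: cB.
by apply: (@cont_ip R n E id id) => y; exact: cvg_id.
Qed.

Lemma ball_phase_compact (z : E) (e : R) : compact [set w : E | `|w - z| <= e].
Proof.
apply: (@phase_compact R n _ (e + `|z|)).
  exact: (closed_comp (fun w _ => @cont_norm_dist z w) (@closed_le R e)).
move=> w we b i; rewrite -(subrK z w) pcoordD.
apply: (le_trans (ler_normD _ _)); apply: lerD; last exact: pcoord_le_norm.
exact: le_trans (pcoord_le_norm _ _ _) we.
Qed.

Lemma sphere_separation (z : E) (e : R) : 0 < e -> (forall w, `|w - z| <= e -> O w) ->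
  exists2 m : R, 0 < m & forall w, `|w - z| = e -> m <= ip (phi w - phi z) (phi w - phi z).
Proof.
move=> e0 eO; pose S := [set w : E | `|w - z| = e].
have cS : compact S.
  apply: (@subclosed_compact _ S [set w : E | `|w - z| <= e]).
  - exact: (closed_comp (fun w _ => @cont_norm_dist z w) (@closed_eq R e)).
  - exact: ball_phase_compact.
  - by move=> w /= ->.
have [[w0 Sw0]|Sn] := pselect (S !=set0); last first.
  by exists 1 => // w h; exfalso; apply: Sn; exists w.
have cf : {within S, continuous (fun w => ip (phi w - phi z) (phi w - phi z))}.
  apply: continuous_in_subspaceT => w; rewrite inE => wb; apply: cont_dist_to.
  by apply: differentiable_continuous; apply: dphi; apply: eO; rewrite wb.
have [c cS' cmin] := compact_EVT_min (ex_intro _ w0 Sw0) cS cf.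
rewrite inE /S /= in cS'.
exists (ip (phi c - phi z) (phi c - phi z)); last by move=> w h; apply: cmin; rewrite inE.
rewrite lt_neqAle ip_ge0 andbT eq_sym; apply/eqP => /ip_eq0 /eqP; rewrite subr_eq0 => /eqP pcz.
have Oz : O z by apply: eO; rewrite subrr normr0 ltW.
have Oc : O c by apply: eO; rewrite cS'.
by move: e0; rewrite -cS' -(psiK Oc) pcz psiK // subrr normr0 ltxx.
Qed.

(** The first variation of the squared distance vanishes in every direction, and a symplectic
    differential is onto, so [phi x - w] is orthogonal to itself. *)
Lemma critical_point (w x : E) (V : set E) : O x -> nbhs x V ->
  (forall y, V y -> ip (phi x - w) (phi x - w) <= ip (phi y - w) (phi y - w)) -> phi x = w.
Proof.
move=> Ox Vx xmin.
suff h v : ip (phi x - w) ('d phi x v) = 0.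
  have [v Av] := symp_map_surj (sphi Ox) (phi x - w).
  by apply/eqP; rewrite -subr_eq0; apply/eqP/ip_eq0; rewrite -{2}Av.
pose g (s : R) := ip (phi (x + s *: v) - w) (phi (x + s *: v) - w).
have OVx : nbhs x (O `&` V) by apply: filterI => //; exact: open_nbhs_nbhs.
have [d d0 dOV] : exists2 d : R, 0 < d & forall s, `|s| < d -> (O `&` V) (x + s *: v).
  have cl : {for 0, continuous (fun s : R => x + s *: v)}.
    have dl := is_derive_line x v 0.
    by apply: differentiable_continuous; apply/derivable1_diffP; have [] := dl.
  have : nbhs (0 : R) (fun s => (O `&` V) (x + s *: v)).
    by apply: cl; rewrite scale0r addr0.
  move=> /nbhs_ballP [d /= d0 dP]; exists d => // s sd; apply: dP.
  by rewrite /ball /= sub0r normrN.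
have dg (s : R) : `|s| < d -> is_derive s (1 : R) g
    (ip ('d phi (x + s *: v) v) (phi (x + s *: v) - w) + ip (phi (x + s *: v) - w) ('d phi (x + s *: v) v)).
  move=> sd; have [Os _] := dOV s sd.
  have dc : is_derive s (1 : R) (fun s => phi (x + s *: v) - w) ('d phi (x + s *: v) v).
    apply: is_derive_shift.
    apply: (@chain_derive _ _ _ phi (fun s => x + s *: v)); first exact: dphi.
    exact: is_derive_line.
  exact: is_derive_ip.
have in_d (t : R) : t \in `](- d), d[ -> `|t| < d by rewrite in_itv /= ltr_norml.
have d1 := @derive1_at_min R g (- d) d 0 _ (fun t td => (dg t (in_d t td)).(ex_derive)) _ _.
have {}d1 : is_derive (0 : R) (1 : R) g 0.
  apply: d1; first by lra.
    by rewrite in_itv /= oppr_lt0 d0.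
  by move=> t /in_d /dOV [_ Vt]; rewrite /g scale0r addr0; exact: xmin.
have d2 : is_derive (0 : R) (1 : R) g _ := dg 0 (eq_ind_r (fun u => u < d) d0 (normr0 _)).
have := @derive_val _ _ _ _ _ _ _ d1; rewrite (@derive_val _ _ _ _ _ _ _ d2) scale0r addr0 => e.
by move: e; rewrite ipC; lra.
Qed.

(** A variational form of the inverse function theorem: for [w] near [phi z] the distance from
    [phi x] to [w] is minimised over a closed ball. By [sphere_separation] the minimum is not on the
    sphere, so [critical_point] shows that [w] is attained. *)
Lemma embedding_open (z : E) (V : set E) : O z -> nbhs z V -> nbhs (phi z) (phi @` (V `&` O)).
Proof.
move=> Oz Vz; have : nbhs z (V `&` O) by apply: filterI => //; exact: open_nbhs_nbhs.
move=> /nbhs_box [e e0 eP'].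
have eP w : `|w - z| <= e -> (V `&` O) w.
  by move=> we; apply: eP' => b i; apply: le_trans we; exact: pcoord_le_norm.
have eO w : `|w - z| <= e -> O w by move=> /eP [].
have [m m0 mP] := sphere_separation e0 eO.
have cq : continuous (fun w : E => 4 * ip (w - phi z) (w - phi z)).
  apply: cont_mul; first exact: cst_continuous.
  have cB : continuous (fun w : E => w - phi z) by move=> w; apply: cvgB; [exact: cvg_id | exact: cvg_cst].
  exact: (@cont_ip R n E (fun w => w - phi z) (fun w => w - phi z) cB cB).
have : \forall w \near phi z, 4 * ip (w - phi z) (w - phi z) < m.
  apply: (cvgr_lt _ (cq (phi z))).
  by rewrite subrr -(scale0r (0 : E)) ipZl mul0r mulr0.
apply: filterS => w wm.
pose Bx := [set x : E | `|x - z| <= e].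
have cBx : compact Bx by exact: ball_phase_compact.
have cf : {within Bx, continuous (fun x => ip (phi x - w) (phi x - w))}.
  apply: continuous_in_subspaceT => x; rewrite inE => xb; apply: cont_dist_to.
  by apply: differentiable_continuous; apply: dphi; exact: eO.
have Bz : Bx z by rewrite /Bx /= subrr normr0 ltW.
have [x Bxx xmin] := compact_EVT_min (ex_intro _ z Bz) cBx cf.
rewrite inE /Bx /= in Bxx.
have xin : `|x - z| < e.
  rewrite lt_neqAle Bxx andbT; apply/eqP => eq_e.
  have h1 := mP x eq_e.
  have h2 : ip (phi x - w) (phi x - w) <= ip (phi z - w) (phi z - w) by apply: xmin; rewrite inE.
  (* The parallelogram law replaces a triangle inequality for [ip]; it accounts for the factor 4 in
     the neighbourhood of [phi z]. *)
  have split_id : ip (phi x - phi z) (phi x - phi z) + ip ((phi x - w) + (phi z - w)) ((phi x - w) + (phi z - w)) =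
      2 * ip (phi x - w) (phi x - w) + 2 * ip (phi z - w) (phi z - w).
    have -> : phi x - phi z = (phi x - w) + (-1) *: (phi z - w) by rewrite scaleN1r opprB addrA subrK.
    by move: (phi x - w) (phi z - w) => u v; rewrite !ipDl !ipDr !ipZl !ipZr; ring.
  have h3 := ip_ge0 ((phi x - w) + (phi z - w)).
  have h4 : ip (w - phi z) (w - phi z) = ip (phi z - w) (phi z - w).
    have -> : w - phi z = (-1) *: (phi z - w) by rewrite scaleN1r opprB.
    by rewrite ipZl ipZr; ring.
  by rewrite h4 in wm; lra.
exists x; first exact: (eP x Bxx).
apply: (@critical_point w x Bx (eO x Bxx)); last by move=> y By; apply: xmin; rewrite inE.
have : \forall y \near x, `|y - z| < e by exact: (cvgr_lt _ (@cont_norm_dist z x)).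
by apply: filterS => y; exact: ltW.
Qed.

Lemma inverse_continuous (z : E) : O z -> {for phi z, continuous psi}.
Proof.
move=> Oz V; rewrite psiK // => Vz; apply: filterS (embedding_open Oz Vz) => _ [x [Vx Ox] <-].
by rewrite /= psiK.
Qed.
End Embedding.

(** * Transport of a Hamiltonian by an embedding *)

Section PushForward.
Context {R : realType} {n : nat}.
Local Notation E := (phase R n).
Variables (O : set E) (phi psi : E -> E).
Hypotheses (oO : open O) (dphi : forall z, O z -> differentiable phi z)
  (cdphi : forall v z, O z -> {for z, continuous (fun y => 'd phi y v)})
  (sphi : forall z, O z -> symp_map ('d phi z))
  (psiK : forall z, O z -> psi (phi z) = z).

Lemma diff_remainder (V W : normedModType R) (f : V -> W) (y : V) (e : R) : differentiable f y -> 0 < e ->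
  \forall v \near (0 : V), `|f (v + y) - f y - 'd f y v| <= e * `|v|.
Proof.
move=> /diff_locallyP[_] /eqaddoP H e0; apply: filterS (H e e0) => v.
by rewrite /= opprD addrA.
Qed.

Lemma line_continuous (z w : E) : continuous (fun s : R => z + s *: w).
Proof.
move=> s; have dl := is_derive_line z w s.
by apply: differentiable_continuous; apply/derivable1_diffP; have [] := dl.
Qed.

Lemma near_line (z w : E) (P : set E) : nbhs z P -> \forall s \near (0 : R), P (z + s *: w).
Proof.
move=> zP; have := @line_continuous z w 0; rewrite /continuous_at scale0r addr0 => h.
exact: (h P zP).
Qed.

Lemma continuous_at_sum (I : Type) (r : seq I) (f : I -> E -> E) (y : E) :
  (forall i, {for y, continuous (f i)}) -> {for y, continuous (fun x => \sum_(i <- r) f i x)}.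
Proof.
move=> cf; elim: r => [|i r IH].
  have -> : (fun x => \sum_(i <- [::]) f i x) = cst 0 by apply/funext => x; rewrite big_nil.
  exact: cvg_cst.
have -> : (fun x => \sum_(j <- i :: r) f j x) = (fun x => f i x + \sum_(j <- r) f j x).
  by apply/funext => x; rewrite big_cons.
by apply: cvgD; [exact: cf | exact: IH].
Qed.

Lemma image_near (y : E) : O y -> \forall z \near phi y, (phi @` O) z.
Proof.
move=> Oy; apply: filterS (embedding_open oO dphi sphi psiK Oy filterT).
by move=> _ [x [_ Ox] <-]; exists x.
Qed.

Lemma inverse_curve_near (y w : E) : O y ->
  \forall s \near (0 : R), (phi @` O) (phi y + s *: w).
Proof. by move=> Oy; apply: near_line; exact: image_near. Qed.

(** [symp_map_bound] controls the deviation of the inverse curve from [d *: u] by its image under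
    the differential. The remainder of [phi] is [eps] times the unknown increment [v], and a small
    [eps] absorbs it. *)
Lemma inverse_curve (c : R -> E) (t : R) (y u w : E) : O y -> c t = phi y ->
  is_derive t (1 : R) c w -> 'd phi y u = w -> is_derive t (1 : R) (fun s => psi (c s)) u.
Proof.
move=> Oy ct dc uw; apply: is_derive_phase => b i; apply: is_derive_estimate => e e0.
have [C C0 CP] := symp_map_bound (sphi Oy).
have u1 : 0 < `|u| + 1 by rewrite ltr_wpDl.
(* The first entry lets half of the norm of [v] absorb the remainder; the second keeps the resulting
   error below [e / 2] times the increment of time. [e1] splits in the same way. *)
pose eps := Num.min (1 / (2 * C)) (e / (4 * C * (`|u| + 1))).
have eps0 : 0 < eps by rewrite lt_min !divr_gt0 // !mulr_gt0.
pose e1 := Num.min (1 / C) (e / (2 * C)).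
have e10 : 0 < e1 by rewrite lt_min !divr_gt0 // mulr_gt0.
have near1 := diff_remainder (dphi Oy) eps0.
have dct : differentiable c t by apply/derivable1_diffP; have [] := dc.
have dcE d : 'd c t d = d *: w.
  have -> : 'd c t d = d *: 'd c t 1 by rewrite -[in LHS](mulr1 d); exact: linearZ.
  by rewrite -deriveE //; case: dc => _ ->.
have near2 := diff_remainder dct e10.
have cc : {for t, continuous c} by exact: differentiable_continuous.
have cv : {for t, continuous (fun s : R => psi (c s) - y)}.
  apply: cvgB; last exact: cvg_cst.
  apply: (@continuous_comp R E E c psi); first exact: cc.
  by rewrite ct; exact: (inverse_continuous oO dphi sphi psiK Oy).
have : nbhs t (fun s : R => `|phi (psi (c s) - y + y) - phi y - 'd phi y (psi (c s) - y)| <=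
     eps * `|psi (c s) - y| /\ (phi @` O) (c s)).
  apply: filterI; last first.
    have nO : nbhs (c t) (phi @` O) by rewrite ct; exact: image_near.
    exact: (cc _ nO).
  pose Pn := [set v : E | `|phi (v + y) - phi y - 'd phi y v| <= eps * `|v|].
  have nP : nbhs (psi (c t) - y) Pn by rewrite ct psiK // subrr.
  exact: (cv Pn nP).
move=> /nbhs_ballP [eta /= eta0 etaP]; move: near2 => /nbhs_ballP [eta2 /= eta20 eta2P].
exists (Num.min eta eta2); first by rewrite lt_min eta0.
move=> d; rewrite lt_min => /andP[dl dl2].
have [|h1 [x Ox xE]] := etaP (t + d); first by rewrite /ball /= opprD addrA subrr sub0r normrN.
have hc : `|c (t + d) - c t - d *: w| <= e1 * `|d|.
  by rewrite -dcE [t + d]addrC; apply: eta2P; rewrite /ball /= sub0r normrN.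
rewrite ct psiK //.
move: h1; rewrite subrK -xE psiK //; set v := x - y => h1.
rewrite -xE ct in hc.
have eZ : 'd phi y (d *: u) = d *: 'd phi y u by exact: linearZ.
have eB : 'd phi y (d *: u - v) = 'd phi y (d *: u) - 'd phi y v by exact: linearB.
have rE : 'd phi y (d *: u - v) = (phi x - phi y - 'd phi y v) - (phi x - phi y - d *: w).
  by rewrite eB eZ uw; move: (phi x - phi y) => P; rewrite opprB [RHS]addrC addrA subrK.
have h2 : `|d *: u - v| <= C * (eps * `|v| + e1 * `|d|).
  apply: (le_trans (CP _)); rewrite ler_pM2l // rE.
  by apply: (le_trans (ler_normB _ _)); exact: lerD.
have Ceps1 : C * eps <= 1 / 2.
  apply: (@le_trans _ _ (C * (1 / (2 * C)))); first by rewrite ler_pM2l // ge_min lexx.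
  by rewrite le_eqVlt; apply/orP; left; apply/eqP; field; rewrite gt_eqF.
have Ceps2 : C * eps * (2 * (`|u| + 1)) <= e / 2.
  apply: (@le_trans _ _ (C * (e / (4 * C * (`|u| + 1))) * (2 * (`|u| + 1)))).
    by rewrite ler_pM2r ?mulr_gt0 // ler_pM2l // ge_min lexx orbT.
  by rewrite le_eqVlt; apply/orP; left; apply/eqP; field; rewrite !gt_eqF.
have Ce1 : C * e1 <= 1.
  apply: (@le_trans _ _ (C * (1 / C))); first by rewrite ler_pM2l // ge_min lexx.
  by rewrite mul1r divff // gt_eqF.
have Ce2 : C * e1 <= e / 2.
  apply: (@le_trans _ _ (C * (e / (2 * C)))); first by rewrite ler_pM2l // ge_min lexx orbT.
  by rewrite le_eqVlt; apply/orP; left; apply/eqP; field; rewrite gt_eqF.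
have h3 : `|v| <= `|d| * (2 * (`|u| + 1)).
  have : `|v| <= `|d| * `|u| + C * (eps * `|v| + e1 * `|d|).
    have -> : v = d *: u - (d *: u - v) by rewrite opprB addrC subrK.
    by apply: (le_trans (ler_normB _ _)); rewrite normrZ; apply: lerD => //; rewrite subKr.
  have : C * eps * `|v| <= 1 / 2 * `|v| by rewrite ler_wpM2r.
  have : C * e1 * `|d| <= 1 * `|d| by rewrite ler_wpM2r.
  by rewrite mulrDr !mulrA; lra.
have -> : pcoord x b i - pcoord y b i - d * pcoord u b i = - pcoord (d *: u - v) b i.
  by rewrite -pcoordZ -pcoordB -pcoordB -pcoordN; congr pcoord; rewrite opprB.
rewrite normrN; apply: (le_trans (pcoord_le_norm _ _ _)); apply: (le_trans h2).
have h4 : C * eps * `|v| <= C * eps * (`|d| * (2 * (`|u| + 1))).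
  by apply: ler_wpM2l h3; rewrite mulr_ge0 // ltW.
have h5 : C * eps * (2 * (`|u| + 1)) * `|d| <= e / 2 * `|d| by rewrite ler_wpM2r.
have h6 : C * e1 * `|d| <= e / 2 * `|d| by rewrite ler_wpM2r.
rewrite mulrDr !mulrA; rewrite !mulrA in h4 h5.
have h7 : C * eps * `|d| * 2 * (`|u| + 1) = C * eps * 2 * (`|u| + 1) * `|d| by ring.
by rewrite h7 in h4; lra.
Qed.

Variables (K : E -> R) (Y : E -> E) (C : set E).
Hypotheses (cC : compact C) (CO : C `<=` O) (K0 : forall y, ~ C y -> K y = 0)
  (Y0 : forall y, ~ C y -> Y y = 0)
  (dK : forall y, O y -> differentiable K y)
  (YK : forall y, O y -> forall v, 'd K y v = omega (Y y) v)
  (cY : forall y, O y -> {for y, continuous Y}).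

(** Extension by 0 stays continuous across the edge of the image of [O], because the image of the
    compact support [C] is closed. *)
Definition push_fun z : R := if `[< (phi @` O) z >] then K (psi z) else 0.
Definition push_field z : E := if `[< (phi @` O) z >] then 'd phi (psi z) (Y (psi z)) else 0.

Lemma push_funE y : O y -> push_fun (phi y) = K y.
Proof.
move=> Oy; have h : (phi @` O) (phi y) by exists y.
by rewrite /push_fun; case: asboolP => // _; rewrite psiK.
Qed.

Lemma push_fieldE y : O y -> push_field (phi y) = 'd phi y (Y y).
Proof.
move=> Oy; have h : (phi @` O) (phi y) by exists y.
by rewrite /push_field; case: asboolP => // _; rewrite psiK.
Qed.

Lemma push_out z : ~ (phi @` C) z -> push_fun z = 0 /\ push_field z = 0.
Proof.
move=> zC; rewrite /push_fun /push_field; case: asboolP => // -[y Oy yz].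
have nC : ~ C y by move=> Cy; apply: zC; exists y.
by rewrite -yz psiK // K0 // Y0 // linear0.
Qed.

Lemma image_support_compact : compact (phi @` C).
Proof.
apply: continuous_compact => //; apply: continuous_in_subspaceT => y; rewrite inE => Cy.
by apply: differentiable_continuous; apply: dphi; exact: CO.
Qed.

Lemma image_support_near z : ~ (phi @` C) z -> \forall y \near z, ~ (phi @` C) y.
Proof.
move=> zC; have cl : closed (phi @` C).
  by apply: compact_closed image_support_compact; exact: norm_hausdorff.
by apply: open_nbhs_nbhs; split => //; exact: closed_openC.
Qed.

(** On the image of [C], write [w] as the differential of [phi] applied to some [u]; since the
    differential is symplectic, [omega (Y y) u] equals [omega] of the two images. *)
Lemma push_fun_derive z w :
  is_derive (0 : R) (1 : R) (fun s => push_fun (z + s *: w)) (omega (push_field z) w).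
Proof.
have [[y Cy <-]|nC] := pselect ((phi @` C) z); last first.
  have [_ ->] := push_out nC; rewrite -(scale0r (0 : E)) omegaZl mul0r.
  have nq : \forall s \near (0 : R), cst 0 s = push_fun (z + s *: w).
    have : \forall s \near (0 : R), ~ (phi @` C) (z + s *: w).
      exact: (near_line w (image_support_near nC)).
    by apply: filterS => s h; have [-> _] := push_out h.
  exact: (near_eq_is_derive nq (is_derive_cst (0 : R) (0 : R) (1 : R))).
have Oy := CO Cy; have [u uw] := symp_map_surj (sphi Oy) w.
rewrite push_fieldE // -uw sphi // uw.
have nq : \forall s \near (0 : R), K (psi (phi y + s *: w)) = push_fun (phi y + s *: w).
  apply: filterS (inverse_curve_near w Oy) => s h.
  by rewrite /push_fun; case: asboolP.
have c0 : phi y + (0 : R) *: w = phi y by rewrite scale0r addr0.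
have dc := inverse_curve Oy c0 (is_derive_line (phi y) w 0) uw.
have dKy : differentiable K (psi (phi y + (0 : R) *: w)) by rewrite scale0r addr0 psiK //; exact: dK.
have := chain_derive dKy dc.
have e0 : psi (phi y + (0 : R) *: w) = y by rewrite scale0r addr0 psiK.
rewrite e0 YK // => dKc.
exact: (near_eq_is_derive nq dKc).
Qed.

Lemma push_fun_continuous : continuous push_fun.
Proof.
move=> z; have [[y Cy <-]|nC] := pselect ((phi @` C) z); last first.
  apply: (@near_cst_continuous _ _ 0); apply: filterS (image_support_near nC) => x h.
  by have [-> _] := push_out h.
have Oy := CO Cy; rewrite /continuous_at push_funE //.
apply: (@cvg_trans _ ((fun z => K (psi z)) @ phi y)).
  apply: near_eq_cvg; apply: filterS (image_near Oy) => x h.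
  by rewrite /push_fun; case: asboolP.
have : {for phi y, continuous (fun z => K (psi z))}.
  apply: (@continuous_comp E E R psi K); first exact: (inverse_continuous oO dphi sphi psiK Oy).
  by rewrite psiK //; apply: differentiable_continuous; exact: dK.
by rewrite /prop_for /continuous_at psiK.
Qed.

Lemma push_field_continuous : continuous push_field.
Proof.
move=> z; have [[y Cy <-]|nC] := pselect ((phi @` C) z); last first.
  apply: (@near_cst_continuous _ _ (0 : E)); apply: filterS (image_support_near nC) => x h.
  by have [_ ->] := push_out h.
have Oy := CO Cy; rewrite /continuous_at push_fieldE //.
pose F y' := 'd phi y' (Y y').
apply: (@cvg_trans _ ((fun z => F (psi z)) @ phi y)).
  apply: near_eq_cvg; apply: filterS (image_near Oy) => x h.
  by rewrite /push_field; case: asboolP.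
have cF : {for y, continuous F}.
  pose S y' := \sum_b \sum_i pcoord (Y y') b i *: 'd phi y' (eb b i).
  have -> : F = S.
    apply/funext => y'; rewrite /F /S {1}(phase_expand (Y y')) linear_sum; apply: eq_bigr => b _.
    by rewrite linear_sum; apply: eq_bigr => i _; exact: linearZ.
  apply: continuous_at_sum => b; apply: continuous_at_sum => i; apply: cvgZ; last exact: cdphi.
  apply: (@continuous_comp E E R Y (fun u => pcoord u b i)); first exact: cY.
  exact: pcoord_continuous.
have : {for phi y, continuous (fun z => F (psi z))}.
  apply: (@continuous_comp E E E psi F); first exact: (inverse_continuous oO dphi sphi psiK Oy).
  by rewrite psiK.
by rewrite /prop_for /continuous_at psiK.
Qed.
End PushForward.

(** * The body and its gauge *)

Lemma is_diff_of_derive {R : realType} (g : R -> R) (s dg : R) :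
  is_derive s (1 : R) g dg -> is_diff s g (fun h : R => h * dg).
Proof.
move=> [dg1 dgE]; have dd : differentiable g s by apply/derivable1_diffP.
apply: DiffDef => //; apply/funext => h.
have -> : 'd g s h = h *: 'd g s 1 by rewrite -[in LHS](mulr1 h); exact: linearZ.
by rewrite -deriveE // dgE.
Qed.

Section Body.
Context {R : realType} {n : nat}.
Local Notation E := (phase R n).
Variables (p : R) (B D : 'M[R]_n).
Hypotheses (hp : 2 <= p) (uB : B \in unitmx) (uD : D \in unitmx).

Definition lpform b (z : E) (i : 'I_n) : R := if b then (D *m z.2) i ord0 else (B *m z.1) i ord0.
Definition gauge (z : E) : R := \sum_b \sum_i `|lpform b z i| `^ p.
Definition dpowv (v : 'cV[R]_n) : 'cV[R]_n := \col_i dpow p (v i ord0).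
Definition grad_gauge (z : E) : E :=
  (p *: (B^T *m dpowv (B *m z.1)), p *: (D^T *m dpowv (D *m z.2))).

Lemma lpformD b z w i : lpform b (z + w) i = lpform b z i + lpform b w i.
Proof. by case: b; rewrite /lpform /= mulmxDr mxE. Qed.

Lemma lpformZ b a z i : lpform b (a *: z) i = a * lpform b z i.
Proof. by case: b; rewrite /lpform /= -scalemxAr mxE. Qed.

Lemma lpform_eq0 z : (forall b i, lpform b z i = 0) -> z = 0.
Proof.
move=> h; have h2 : D *m z.2 = 0 by apply/colP => i; rewrite [LHS](h true) mxE.
have h1 : B *m z.1 = 0 by apply/colP => i; rewrite [LHS](h false) mxE.
apply: phase_ext => b i; rewrite pcoord0 /pcoord; case: b.
  by rewrite -[z.2](mulKmx uD) h2 mulmx0 mxE.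
by rewrite -[z.1](mulKmx uB) h1 mulmx0 mxE.
Qed.

Lemma lpform_expand b z i : lpform b z i = \sum_j (if b then D i j else B i j) * pcoord z b j.
Proof. by case: b; rewrite /lpform mxE. Qed.

Lemma lpform_continuous b i : continuous (fun z : E => lpform b z i).
Proof.
rewrite (_ : (fun z => _) = (fun z => \sum_j (if b then D i j else B i j) * pcoord z b j)).
  by apply: cont_sum => j; apply: cont_mul; [exact: cst_continuous | exact: pcoord_continuous].
by apply/funext => z; rewrite lpform_expand.
Qed.

Lemma is_diff_lpform b i (z : E) : is_diff z (fun z => lpform b z i) (fun v => lpform b v i).
Proof.
have lin : linear (fun z : E => lpform b z i : R^o) by move=> a x y; rewrite lpformD lpformZ.
pose L := GRing.isLinear.Build _ _ _ _ (fun z : E => lpform b z i : R^o) lin.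
pose f : {linear E -> R^o} := HB.pack (fun z : E => lpform b z i : R^o) L.
have cf : continuous f by exact: lpform_continuous.
apply: DiffDef; first exact: (linear_differentiable z cf).
exact: (diff_lin z cf).
Qed.

Lemma is_diff_bigsum (V : normedModType R) (I : finType) (f : I -> V -> R) (df : I -> V -> R) (x : V) :
  (forall i, is_diff x (f i) (df i)) ->
  is_diff x (\sum_i f i) (\sum_i df i).
Proof. by move=> d; elim/big_ind2 : _ => // [|*]; [exact: is_diff_cst | exact: is_diffD]. Qed.

Lemma ip_grad_gauge z v : ip (grad_gauge z) v = \sum_b \sum_i p * dpow p (lpform b z i) * lpform b v i.
Proof.
have tr (A : 'M[R]_n) (x y : 'cV[R]_n) : \sum_i (p *: (A^T *m dpowv x)) i ord0 * y i ord0 =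
    \sum_i p * dpow p (x i ord0) * (A *m y) i ord0.
  under eq_bigr do rewrite !mxE mulr_sumr mulr_suml.
  under [RHS]eq_bigr do rewrite mxE mulr_sumr.
  rewrite exchange_big; apply: eq_bigr => i _; apply: eq_bigr => j _; rewrite !mxE; ring.
by rewrite /ip !big_bool; congr (_ + _); rewrite /pcoord /= tr.
Qed.

Lemma is_diff_gauge z : is_diff z gauge (fun v => ip (grad_gauge z) v).
Proof.
rewrite (_ : gauge = \sum_b \sum_i (fun z => `|lpform b z i| `^ p)); last first.
  by apply/funext => w; rewrite fct_sumE; apply: eq_bigr => b _; rewrite fct_sumE.
rewrite (_ : (fun v => ip _ v) = \sum_b \sum_i (fun v => lpform b v i * (p * dpow p (lpform b z i)))); last first.
  apply/funext => w; rewrite fct_sumE ip_grad_gauge; apply: eq_bigr => b _.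
  by rewrite fct_sumE; apply: eq_bigr => i _; rewrite mulrC.
apply: is_diff_bigsum => b; apply: is_diff_bigsum => i.
have d1 := is_diff_lpform b i z.
have d2 := is_diff_of_derive (is_derive_powabs (lpform b z i) hp).
exact: (@is_diff_comp R E R R (fun z => lpform b z i) _ (fun s => `|s| `^ p) _ z d1 d2).
Qed.

Lemma gauge_differentiable z : differentiable gauge z.
Proof. by have d := is_diff_gauge z; exact: ex_diff. Qed.

Lemma diff_gauge z v : 'd gauge z v = ip (grad_gauge z) v.
Proof. by have d := is_diff_gauge z; rewrite diff_val. Qed.

Lemma gauge_continuous : continuous gauge.
Proof. by move=> z; apply: differentiable_continuous; exact: gauge_differentiable. Qed.

Lemma grad_gauge_continuous : continuous grad_gauge.
Proof.
have cd b i : continuous (fun z => dpow p (lpform b z i)).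
  exact: (cont_comp (@lpform_continuous b i) (cont_dpow hp)).
apply: continuous_phase => b i.
rewrite (_ : (fun x => _) = (fun z => p * \sum_j (if b then D j i else B j i) * dpow p (lpform b z j))).
  apply: cont_mul; first exact: cst_continuous.
  by apply: cont_sum => j; apply: cont_mul; [exact: cst_continuous | exact: cd].
apply/funext => z; case: b; rewrite /pcoord /grad_gauge /= !mxE; congr (_ * _); apply: eq_bigr => j _;
  by rewrite ?mxE /lpform ?mxE.
Qed.

Lemma gauge_ge0 z : 0 <= gauge z.
Proof. by apply: sumr_ge0 => b _; apply: sumr_ge0 => i _; exact: powR_ge0. Qed.

Lemma gauge_eq0 z : gauge z = 0 -> z = 0.
Proof.
move=> h; apply: lpform_eq0 => b i; apply/normr0_eq0/(@powR_eq0_eq0 _ _ p); apply: le_anti.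
rewrite powR_ge0 andbT -h /gauge (bigD1 b) //= (bigD1 i) //= -addrA lerDl.
by rewrite addr_ge0 // !sumr_ge0 // => *; rewrite ?sumr_ge0 // => *; exact: powR_ge0.
Qed.

Lemma gaugeZ a z : gauge (a *: z) = `|a| `^ p * gauge z.
Proof.
rewrite /gauge mulr_sumr; apply: eq_bigr => b _; rewrite mulr_sumr; apply: eq_bigr => i _.
by rewrite lpformZ normrM powRM.
Qed.

Lemma gauge0 : gauge 0 = 0.
Proof. by rewrite -(scale0r (0 : E)) gaugeZ normr0 powR0 ?mul0r // gt_eqF // (p_gt0 hp). Qed.

Lemma euler_gauge z : ip (grad_gauge z) z = p * gauge z.
Proof.
rewrite ip_grad_gauge /gauge mulr_sumr; apply: eq_bigr => b _; rewrite mulr_sumr; apply: eq_bigr => i _.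
by rewrite -mulrA [dpow _ _ * _]mulrC mul_dpow.
Qed.

Lemma KpE : Kp p B D = [set z | gauge z <= 1].
Proof.
have e (v : 'cV[R]_n) : lpnorm p v `^ p = \sum_i `|v i ord0| `^ p.
  rewrite /lpnorm -powRrM mulVf ?gt_eqF ?(p_gt0 hp) // powRr1 // sumr_ge0 // => i _; exact: powR_ge0.
have ge (z : E) : gauge z = lpnorm p (B *m z.1) `^ p + lpnorm p (D *m z.2) `^ p.
  rewrite /gauge big_bool [LHS]addrC; congr (_ + _); apply/esym; exact: e.
by apply/seteqP; split => z; rewrite /Kp /mkset ge.
Qed.

Lemma Kp_compact : compact (Kp p B D).
Proof.
pose S := \sum_i \sum_j (`|invmx B i j| + `|invmx D i j|).
apply: (@phase_compact R n _ S).
  rewrite KpE; apply: (@preimage_closed E R gauge [set x | x <= 1]); last exact: closed_le.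
  by move=> w _; exact: gauge_continuous.
rewrite KpE => z /= z1.
have f1 b i : `|lpform b z i| <= 1.
  rewrite leNgt; apply/negP => h.
  have : 1 `^ p < `|lpform b z i| `^ p by rewrite gt0_ltr_powR ?nnegrE // (p_gt0 hp).
  rewrite powR1 ltNge => /negP; apply; apply: le_trans z1.
  rewrite /gauge (bigD1 b) //= (bigD1 i) //= -addrA lerDl.
  by rewrite addr_ge0 // !sumr_ge0 // => *; rewrite ?sumr_ge0 // => *; exact: powR_ge0.
move=> b i.
have eS : \sum_j (`|invmx B i j| + `|invmx D i j|) <= S.
  by rewrite /S [leRHS](bigD1 i) //= lerDl; do 2 (apply: sumr_ge0 => ? _); rewrite addr_ge0.
apply: le_trans eS; case: b; rewrite /pcoord.
  rewrite -[z.2](mulKmx uD) mxE; apply: (le_trans (ler_norm_sum _ _ _)); apply: ler_sum => j _.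
  rewrite normrM; apply: (@le_trans _ _ `|invmx D i j|); last by rewrite lerDr.
  by rewrite ler_piMr //; exact: (f1 true j).
rewrite -[z.1](mulKmx uB) mxE; apply: (le_trans (ler_norm_sum _ _ _)); apply: ler_sum => j _.
rewrite normrM; apply: (@le_trans _ _ `|invmx B i j|); last by rewrite lerDl.
by rewrite ler_piMr //; exact: (f1 false j).
Qed.
End Body.

(** * Cut-off profiles *)

Section Ramp.
Context {R : realType}.
Implicit Types (s t u d : R).

Definition pos u : R := (u + `|u|) / 2.

Lemma pos_ge0 u : 0 <= pos u.
Proof. by rewrite /pos; case: (ger0P u); lra. Qed.

Lemma pos_id u : 0 <= u -> pos u = u.
Proof. by move=> h; rewrite /pos ger0_norm //; lra. Qed.

Lemma pos_neg u : u <= 0 -> pos u = 0.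
Proof. by move=> h; rewrite /pos ler0_norm //; lra. Qed.

Lemma pos_mono u t : u <= t -> pos u <= pos t.
Proof. by move=> h; rewrite /pos; case: (ger0P u); case: (ger0P t); lra. Qed.

Lemma pos_lip u t : u <= t -> pos t - pos u <= t - u.
Proof. by move=> h; rewrite /pos; case: (ger0P u); case: (ger0P t); lra. Qed.

Lemma is_derive_pos2 t : is_derive t (1 : R) (fun u => pos u ^+ 2) (2 * pos t).
Proof.
apply: is_derive_estimate => e e0; exists e => // d de.
apply: (@le_trans _ _ (d ^+ 2)); last first.
  by rewrite -real_normK ?num_real // expr2 ler_wpM2r // ltW.
have [d0|d0] := leP 0 d.
  have h1 := @pos_lip t (t + d); have h2 := @pos_mono t (t + d).
  rewrite lerDl in h1 h2; have {}h1 := h1 d0; have {}h2 := h2 d0.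
  have a1 : pos (t + d) <= pos t + d by lra.
  rewrite ler_norml; apply/andP; split; last first.
    have : pos (t + d) ^+ 2 <= (pos t + d) ^+ 2 by rewrite lerXn2r ?nnegrE ?pos_ge0 // addr_ge0 ?pos_ge0.
    by rewrite sqrrD mulr2n; lra.
  rewrite /pos; case: (ger0P t) => t0; case: (ger0P (t + d)) => td; rewrite ?(addrN, mul0r, mulr0, expr0n) /=; nra.
rewrite /pos; case: (ger0P t) => t0; case: (ger0P (t + d)) => td; rewrite ler_norml; apply/andP; split; nra.
Qed.

Lemma cont_pos : continuous pos.
Proof.
apply: cont_mul; last exact: cst_continuous.
by apply: cont_add; [move=> x; exact: cvg_id | exact: norm_continuous].
Qed.

(** A C^1 rounding of the positive part: 0 up to [- d], the identity from [d] on, and slope in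
    [[0, 1]] throughout. *)
Definition ramp d s : R := (pos (s + d) ^+ 2 - pos (s - d) ^+ 2) / (4 * d).
Definition dramp d s : R := (pos (s + d) - pos (s - d)) / (2 * d).

Variable d : R.
Hypothesis d0 : 0 < d.

Lemma is_derive_ramp s : is_derive s (1 : R) (ramp d) (dramp d s).
Proof.
have s1 : is_derive s (1 : R) (fun x : R => x + d) 1 by apply: is_derive_eq; rewrite addr0.
have s2 : is_derive s (1 : R) (fun x : R => x - d) 1 by apply: is_derive_eq; rewrite subr0.
have h1 := @is_derive1_comp R (fun u => pos u ^+ 2) (fun x => x + d) s _ _ (is_derive_pos2 (s + d)) s1.
have h2 := @is_derive1_comp R (fun u => pos u ^+ 2) (fun x => x - d) s _ _ (is_derive_pos2 (s - d)) s2.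
have h : is_derive s (1 : R) (((fun u => pos u ^+ 2) \o (fun x => x + d)) - ((fun u => pos u ^+ 2) \o (fun x => x - d)))
    (2 * pos (s + d) * 1 - 2 * pos (s - d) * 1) by exact: is_deriveB.
have -> : ramp d = (4 * d)^-1 \*: (((fun u => pos u ^+ 2) \o (fun x => x + d)) - ((fun u => pos u ^+ 2) \o (fun x => x - d))).
  by apply/funext => x; rewrite /ramp mulrC.
have -> : dramp d s = (4 * d)^-1 *: (2 * pos (s + d) * 1 - 2 * pos (s - d) * 1).
  by rewrite /dramp /GRing.scale /=; field; rewrite gt_eqF.
exact: is_deriveZ.
Qed.

Lemma cont_dramp : continuous (dramp d).
Proof.
apply: cont_mul; last exact: cst_continuous.
apply: cont_sub; apply: cont_comp cont_pos.
  by apply: cont_add; [move=> x; exact: cvg_id | exact: cst_continuous].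
by apply: cont_sub; [move=> x; exact: cvg_id | exact: cst_continuous].
Qed.

Lemma cont_ramp : continuous (ramp d).
Proof. exact: derive_cont is_derive_ramp. Qed.

Lemma dramp_ge0 s : 0 <= dramp d s.
Proof. by have := d0 => d0'; rewrite divr_ge0 ?subr_ge0 ?pos_mono //; lra. Qed.

Lemma dramp_le1 s : dramp d s <= 1.
Proof.
have := d0 => d0'; rewrite ler_pdivrMr ?mulr_gt0 // mul1r.
by have := @pos_lip (s - d) (s + d); lra.
Qed.

Lemma dramp_mono s t : s <= t -> dramp d s <= dramp d t.
Proof.
have := d0 => d0' st; rewrite ler_pM2r ?invr_gt0 ?mulr_gt0 // /pos.
by case: (ger0P (s + d)); case: (ger0P (s - d)); case: (ger0P (t + d)); case: (ger0P (t - d)); lra.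
Qed.

Lemma ramp_low s : s <= - d -> ramp d s = 0.
Proof. by have := d0 => d0' h; rewrite /ramp !pos_neg; [rewrite subrr mul0r | lra | lra]. Qed.

Lemma dramp_low s : s <= - d -> dramp d s = 0.
Proof. by have := d0 => d0' h; rewrite /dramp !pos_neg; [rewrite subrr mul0r | lra | lra]. Qed.

Lemma ramp_high s : d <= s -> ramp d s = s.
Proof. by have := d0 => d0' h; rewrite /ramp !pos_id; [field; rewrite gt_eqF | lra | lra]. Qed.

Lemma dramp_high s : d <= s -> dramp d s = 1.
Proof. by have := d0 => d0' h; rewrite /dramp !pos_id; [field; rewrite gt_eqF | lra | lra]. Qed.

Lemma ramp_incr s t : s <= t -> 0 <= ramp d t - ramp d s <= t - s.
Proof.
move=> st; have [c _ ->] := MVT_segment st (fun x _ => is_derive_ramp x)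
  (derivable_within_continuous (fun x _ => (is_derive_ramp x).(ex_derive))).
by rewrite mulr_ge0 ?dramp_ge0 ?subr_ge0 //= ler_piMl ?subr_ge0 ?dramp_le1.
Qed.

Lemma ramp_ge0 s : 0 <= ramp d s.
Proof.
have [h|h] := leP s (- d); first by rewrite ramp_low.
by have := ramp_incr (ltW h); rewrite (ramp_low (lexx _)) subr0 => /andP[].
Qed.

End Ramp.

Section Profile.
Context {R : realType}.
Variables (c m : R).
Hypotheses (m0 : 0 < m) (mc : m < c).

(** A descent from [m] to 0 with slope [- c] occupies a length [m / c < 1]; the remaining length
    [4 d] of the unit interval pays for two rounded corners and two flat ends. *)
Let d : R := (1 - m / c) / 4.
Lemma c_gt0 : 0 < c. Proof. by have := m0; have := mc; lra. Qed.
Let mc1 : m / c < 1. Proof. by rewrite ltr_pdivrMr ?c_gt0 // mul1r. Qed.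
Let d0 : 0 < d. Proof. by have := mc1; rewrite /d; lra. Qed.

Definition profile (u : R) : R := c * (ramp d (2 * d + m / c - u) - ramp d (2 * d - u)).
Definition dprofile (u : R) : R := - (c * (dramp d (2 * d + m / c - u) - dramp d (2 * d - u))).

Lemma is_derive_profile u : is_derive u (1 : R) profile (dprofile u).
Proof.
have s1 (a : R) : is_derive u (1 : R) (fun x : R => a - x) (-1).
  by rewrite -[X in is_derive _ _ _ X]sub0r; apply: (@is_deriveB _ _ _ (cst a) id).
have h a := @is_derive1_comp R (ramp d) (fun x => a - x) u _ _ (is_derive_ramp d0 (a - u)) (s1 a).
have -> : profile = c \*: ((ramp d \o (fun x => 2 * d + m / c - x)) - (ramp d \o (fun x => 2 * d - x))) by [].
have -> : dprofile u = c *: (dramp d (2 * d + m / c - u) * -1 - dramp d (2 * d - u) * -1).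
  by rewrite /dprofile /GRing.scale /=; ring.
by apply: is_deriveZ; apply: is_deriveB.
Qed.

Lemma cont_dprofile : continuous dprofile.
Proof.
have s1 (a : R) : continuous (fun x : R => a - x).
  by apply: cont_sub; [exact: cst_continuous | move=> x; exact: cvg_id].
have h a : continuous (fun x => dramp d (a - x)) by exact: (cont_comp (s1 a) (cont_dramp (d := d))).
have cg : continuous (fun u => c * (dramp d (2 * d + m / c - u) - dramp d (2 * d - u))).
  by apply: cont_mul; [exact: cst_continuous | apply: cont_sub; exact: h].
by move=> x; apply: cvgN; exact: cg.
Qed.

Definition profile_gap := d.
Lemma profile_gap_gt0 : 0 < profile_gap. Proof. exact: d0. Qed.

Lemma profile_low u : u <= profile_gap -> profile u = m /\ dprofile u = 0.
Proof.
move=> h; have h' : u <= d := h; have := d0; have := mc1 => m1 dp.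
have mp : 0 < m / c by rewrite divr_gt0 // c_gt0.
have l1 : d <= 2 * d + m / c - u by lra.
have l2 : d <= 2 * d - u by lra.
rewrite /profile /dprofile !(ramp_high d0, dramp_high d0) //.
rewrite subrr mulr0 oppr0; split => //; field; exact: lt0r_neq0 c_gt0.
Qed.

Lemma profile_high u : 1 - profile_gap <= u -> profile u = 0 /\ dprofile u = 0.
Proof.
move=> h; have h' : 1 - d <= u := h; have dp := d0; have m1 := mc1.
have mp : 0 < m / c by rewrite divr_gt0 // c_gt0.
have e : 4 * d = 1 - m / c by rewrite /d; field; rewrite gt_eqF ?c_gt0.
have l1 : 2 * d + m / c - u <= - d by lra.
have l2 : 2 * d - u <= - d by lra.
by rewrite /profile /dprofile !(ramp_low d0, dramp_low d0) // subrr mulr0 oppr0.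
Qed.

Lemma profile_bounds u : 0 <= profile u <= m.
Proof.
have mp : 0 < m / c by rewrite divr_gt0 // c_gt0.
have st : 2 * d - u <= 2 * d + m / c - u by lra.
have /andP[h1 h2] := ramp_incr d0 st; have cp := c_gt0.
have h3 : c * (ramp d (2 * d + m / c - u) - ramp d (2 * d - u)) <= c * (m / c).
  by apply: ler_wpM2l; [exact: ltW | lra].
by rewrite /profile mulr_ge0 ?(ltW cp) //=; move: h3; rewrite [c * (m / c)]mulrC divfK ?gt_eqF.
Qed.

Lemma dprofile_bounds u : - c <= dprofile u <= 0.
Proof.
have mp : 0 < m / c by rewrite divr_gt0 // c_gt0.
have st : 2 * d - u <= 2 * d + m / c - u by lra.
have h1 := dramp_mono d0 st; have cp := c_gt0.
have h2 := dramp_ge0 d0 (2 * d - u); have h3 := dramp_le1 d0 (2 * d + m / c - u).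
rewrite /dprofile lerN2 oppr_le0 mulr_ge0 ?subr_ge0 ?(ltW cp) // andbT.
by rewrite ler_piMr ?(ltW cp) //; lra.
Qed.
End Profile.

Lemma Jm_continuous {R : realType} {n : nat} : continuous (@Jm R n).
Proof.
apply: continuous_phase => -[] i.
  rewrite (_ : (fun x => _) = (fun x => - pcoord x false i)); last by apply/funext => x; rewrite pcoord_Jm.
  by move=> x; apply: cvgN; exact: pcoord_continuous.
rewrite (_ : (fun x => _) = (fun x => pcoord x true i)); last by apply/funext => x; rewrite pcoord_Jm.
exact: pcoord_continuous.
Qed.

Section GaugeProfile.
Context {R : realType} {n : nat}.
Local Notation E := (phase R n).
Variables (p c m : R) (B D : 'M[R]_n).
Hypotheses (hp : 2 <= p) (uB : B \in unitmx) (uD : D \in unitmx) (m0 : 0 < m) (mc : m < c).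

(** The gauge has degree [p], so this power of it has degree 2, and the period of the flow on a
    level depends only on the slope of the profile. The power may be singular at 0, but the profile
    is constant there. *)
Definition kap (s : R) : R := profile c m (`|s| `^ (2 / p)).
Definition dkap (s : R) : R := dprofile c m (`|s| `^ (2 / p)) * (2 / p * `|s| `^ (2 / p - 1)).

Let tp0 : 0 < 2 / p. Proof. by rewrite divr_gt0 // (p_gt0 hp). Qed.

Lemma near_small (s : R) : `|s| `^ (2 / p) < profile_gap c m ->
  \forall t \near s, `|t| `^ (2 / p) <= profile_gap c m.
Proof.
move=> h; have cc := @cont_powabs R (2 / p) tp0 s.
by apply: filterS (cvgr_lt _ cc _ h) => t; exact: ltW.
Qed.

Lemma is_derive_kap (s : R) : 0 <= s -> is_derive s (1 : R) kap (dkap s).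
Proof.
move=> s0; have [h|h] := ltP (`|s| `^ (2 / p)) (profile_gap c m).
  have [_ e] := profile_low m0 mc (ltW h).
  rewrite /dkap e mul0r.
  have nq : \forall t \near s, cst m t = kap t.
    by apply: filterS (near_small h) => t /(profile_low m0 mc) [].
  exact: (near_eq_is_derive nq (is_derive_cst m s (1 : R))).
have sp : 0 < s.
  rewrite lt_neqAle s0 andbT; apply/eqP => e; move: h.
  by rewrite -e normr0 powR0 ?gt_eqF // leNgt profile_gap_gt0.
have nq : \forall t \near s, (profile c m \o (@powR R)^~ (2 / p)) t = kap t.
  have : \forall t \near s, 0 < t by exact: lt_nbhsr.
  by apply: filterS => t t0; rewrite /kap /= gtr0_norm.
apply: (near_eq_is_derive nq).
have es : `|s| = s by exact: gtr0_norm.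
rewrite /dkap es.
have h1 := is_derive_profile m0 mc (s `^ (2 / p)).
have h2 := is_derive1_powR (2 / p) sp.
exact: (@is_derive1_comp R (profile c m) ((@powR R)^~ (2 / p)) s _ _ h1 h2).
Qed.

Lemma cont_dkap : continuous dkap.
Proof.
move=> s; have [h|h] := ltP (`|s| `^ (2 / p)) (profile_gap c m).
  apply: (@near_cst_continuous _ _ (0 : R)); apply: filterS (near_small h) => t.
  by move=> /(profile_low m0 mc) [_ e]; rewrite /dkap e mul0r.
have sn : s != 0.
  apply/eqP => e; move: h; by rewrite e normr0 powR0 ?gt_eqF // leNgt profile_gap_gt0.
have c1 : continuous (fun s : R => dprofile c m (`|s| `^ (2 / p))).
  exact: (cont_comp (@cont_powabs R (2 / p) tp0) (@cont_dprofile R c m)).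
apply: cvgM; first exact: c1.
apply: cvgM; first exact: cvg_cst.
apply: (@continuous_comp R R R (fun x : R => `|x|) (fun y => y `^ (2 / p - 1))).
  exact: norm_continuous.
apply: differentiable_continuous; apply/derivable1_diffP.
have ns : 0 < `|s| by rewrite normr_gt0.
by have [] := is_derive1_powR (2 / p - 1) ns.
Qed.

Definition kfun (z : E) : R := kap (gauge p B D z).
Definition kfield (z : E) : E := dkap (gauge p B D z) *: Jm (grad_gauge p B D z).

Lemma is_diff_kfun z : is_diff z kfun (fun v => omega (kfield z) v).
Proof.
have d1 := is_diff_gauge B D hp z.
have d2 := is_diff_of_derive (is_derive_kap (gauge_ge0 p B D z)).
have := @is_diff_comp R E R R (gauge p B D) _ kap _ z d1 d2.
rewrite (_ : _ \o (fun v => ip _ v) = (fun v => omega (kfield z) v)) //.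
by apply/funext => v /=; rewrite /kfield omegaZl omega_Jm mulrC.
Qed.

Lemma kfield_continuous : continuous kfield.
Proof.
move=> z; apply: cvgZ.
  apply: (@continuous_comp E R R (gauge p B D) dkap); [exact: gauge_continuous | exact: cont_dkap].
apply: (@continuous_comp E E E (grad_gauge p B D) (@Jm R n)); [exact: grad_gauge_continuous | exact: Jm_continuous].
Qed.

Lemma kfun_out z : ~ Kp p B D z -> kfun z = 0 /\ kfield z = 0.
Proof.
rewrite KpE // => /negP; rewrite -ltNge => z1.
have : 1 - profile_gap c m <= `|gauge p B D z| `^ (2 / p).
  apply: (@le_trans _ _ 1); first by rewrite gerBl ltW // profile_gap_gt0.
  have h : 1 `^ (2 / p) <= gauge p B D z `^ (2 / p).
    by rewrite ge0_ler_powR ?nnegrE ?(ltW tp0) ?gauge_ge0 // ltW.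
  by rewrite ger0_norm ?gauge_ge0 //; rewrite powR1 in h.
move=> /(profile_high m0 mc) [e1 e2].
by rewrite /kfun /kfield /kap /dkap e1 e2 mul0r scale0r.
Qed.
End GaugeProfile.

(** * Non-squeezing *)

Lemma is_derive_lpform {R : realType} {n : nat} (B D : 'M[R]_n) (y : R -> phase R n) (t : R) v b i :
  is_derive t (1 : R) y v -> is_derive t (1 : R) (fun s => lpform B D b (y s) i) (lpform B D b v i).
Proof.
move=> dy; have d := is_diff_lpform B D b i (y t).
have dd : differentiable (fun z => lpform B D b z i) (y t) by exact: ex_diff.
by have := chain_derive dd dy; rewrite diff_val.
Qed.

Section LevelOrbit.
Context {R : realType} {n : nat}.
Local Notation E := (phase R n).
Variables (p q : R) (B D : 'M[R]_n) (M : R).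
Hypotheses (hp : 2 <= p) (hq : q = p / (p - 1)) (uB : B \in unitmx) (uD : D \in unitmx) (M0 : 0 < M)
  (bC : lp_bound p q M (B *m D^T)) (bCT : lp_bound p q M (B *m D^T)^T).

(** In the coordinates [B x] and [D y] the Hamiltonian field depends on [B] and [D] only through
    [B D^T]. *)
Lemma lpform_Jm_grad (y : E) b i : lpform B D b (Jm (grad_gauge p B D y)) i =
  if b then - (p * \sum_j (B *m D^T) j i * dpow p (lpform B D false y j))
  else p * \sum_j (B *m D^T) i j * dpow p (lpform B D true y j).
Proof.
have e1 : B *m (p *: (D^T *m dpowv p (D *m y.2))) = p *: (B *m D^T *m dpowv p (D *m y.2)).
  by rewrite -scalemxAr mulmxA.
have e2 : D *m (- (p *: (B^T *m dpowv p (B *m y.1)))) = - (p *: ((B *m D^T)^T *m dpowv p (B *m y.1))).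
  by rewrite mulmxN -scalemxAr mulmxA trmx_mul trmxK.
case: b; rewrite /lpform /Jm /grad_gauge /=.
  rewrite e2 !mxE; congr (- (_ * _)); apply: eq_bigr => j _; by rewrite !mxE.
rewrite e1 !mxE; congr (_ * _); apply: eq_bigr => j _; by rewrite !mxE.
Qed.

Theorem level_orbit_bound (y : R -> E) (T : R) (l : R -> R) :
  0 < T -> (forall t, l (t + T) = l t) -> continuous l -> (forall t, 0 < l t) ->
  (forall t, y (t + T) = y t) -> (forall t, gauge p B D (y t) = 1) ->
  (forall t : R, is_derive t (1 : R) y (l t *: Jm (grad_gauge p B D (y t)))) ->
  4 * half_area p <= M * (p * \int[@lebesgue_measure R]_(t in `[0, T]) l t).
Proof.
move=> T0 lT cl l0 yT y1 dy; have p0 := p_gt0 hp.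
have uC : B *m D^T \in unitmx by rewrite unitmx_mul uB unitmx_tr.
rewrite -(@period_scale R T T0 p l cl).
apply: (@capacity_bound R p q n hp hq (B *m D^T) (fun t => p * l t) T M
  (fun i t => lpform B D false (y t) i) (fun i t => lpform B D true (y t) i) T0 (ltW M0)) => //.
- by move=> t; rewrite lT.
- by apply: cont_mul => //; exact: cst_continuous.
- by move=> t; rewrite mulr_gt0.
- by move=> i t; rewrite yT.
- by move=> i t; rewrite yT.
- move=> i t; apply: is_derive_eq; first exact: (is_derive_lpform B D false i (dy t)).
  by rewrite lpformZ lpform_Jm_grad mulrA [l t * p]mulrC.
- move=> i t; apply: is_derive_eq; first exact: (is_derive_lpform B D true i (dy t)).
  by rewrite lpformZ lpform_Jm_grad mulrN mulrA [l t * p]mulrC.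
- by move=> t; rewrite -(y1 t) /gauge big_bool addrC.
Qed.

Variables (c m : R).
Hypotheses (m0 : 0 < m) (mc : m < c) (cM : c * M < 2 * half_area p).

(** Rescaled to the level 1, where the powers of [s0] cancel, the orbit of period 1 has action equal
    to minus the slope of the profile. This is at most [c], and [c M < 2 half_area] contradicts
    [level_orbit_bound]. *)
Lemma no_slow_orbit (y : R -> E) (s0 : R) :
  (forall t, y (t + 1) = y t) -> (forall t, gauge p B D (y t) = s0) ->
  (forall t : R, is_derive t (1 : R) y (- kfield p c m B D (y t))) ->
  kfield p c m B D (y 0) != 0 -> False.
Proof.
move=> y1 gs dy nz; have p0 := p_gt0 hp.
have s00 : 0 <= s0 by rewrite -(gs 0); exact: gauge_ge0.
pose nu := - dkap p c m s0.
have dyE (t : R) : is_derive t (1 : R) y (nu *: Jm (grad_gauge p B D (y t))).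
  by have := dy t; rewrite /kfield gs /nu scaleNr.
have s0p : 0 < s0.
  rewrite lt_neqAle s00 andbT eq_sym; apply: contra nz => /eqP sz.
  have -> : y 0 = 0 by apply: (gauge_eq0 uB uD (p := p)); rewrite gs.
  rewrite /kfield (_ : Jm _ = 0) ?scaler0 //.
  have -> : grad_gauge p B D (0 : E) = 0.
    rewrite /grad_gauge /= !mulmx0 (_ : dpowv p 0 = 0) ?mulmx0 ?scaler0 //.
    by apply/colP => i; rewrite !mxE dpow0.
  by rewrite /Jm /= oppr0.
have [dl dh] := andP (dprofile_bounds m0 mc (`|s0| `^ (2 / p))).
have nu_ge : 0 <= nu.
  by rewrite /nu /dkap oppr_ge0 mulr_le0_ge0 // mulr_ge0 ?powR_ge0 // divr_ge0 // ltW.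
have nu0 : 0 < nu.
  rewrite lt_neqAle nu_ge andbT eq_sym; apply: contra nz => /eqP nz.
  by rewrite /kfield gs -[dkap _ _ _ _]opprK -/nu nz oppr0 scale0r.
pose sg := s0 `^ (- p^-1).
have sg0 : 0 < sg by exact: powR_gt0.
pose lam := nu * sg `^ (2 - p).
have lam0 : 0 < lam by rewrite mulr_gt0 // powR_gt0.
have gradZ (z : E) : grad_gauge p B D (sg *: z) = sg `^ (p - 1) *: grad_gauge p B D z.
  have dv (v : 'cV[R]_n) : dpowv p (sg *: v) = sg `^ (p - 1) *: dpowv p v.
    by apply/colP => i; rewrite !mxE dpowZ // ltW.
  by rewrite /grad_gauge /= -!scalemxAr !dv -!scalemxAr; congr pair; rewrite scalerA mulrC -scalerA.
have h := @level_orbit_bound (fun t => sg *: y t) 1 (fun=> lam) ltr01 (fun=> erefl) (@cst_continuous _ _ lam) (fun=> lam0).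
have {h} : 4 * half_area p <= M * (p * lam).
  have := h; rewrite Rintegral_cst // => {}h.
  have mu1 : fine ((@lebesgue_measure R) `[0, 1]%classic) = 1.
    by rewrite lebesgue_measure_itv /= lte_fin ltr01 /= subr0.
  rewrite mu1 mulr1 in h; apply: h.
  - by move=> t; rewrite y1.
  - move=> t; rewrite gaugeZ gs gtr0_norm // -powRrM mulNr mulVf ?gt_eqF // powRN powRr1 //.
    by rewrite mulVf // gt_eqF.
  - move=> t; have -> : lam *: Jm (grad_gauge p B D (sg *: y t)) = sg *: (nu *: Jm (grad_gauge p B D (y t))).
      rewrite gradZ JmZ !scalerA; congr (_ *: _).
      rewrite /lam -mulrA -powRD ?(gt_eqF sg0) ?implybT //.
      rewrite (_ : 2 - p + (p - 1) = 1); last by ring.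
      by rewrite powRr1 ?(ltW sg0) // mulrC.
    exact: is_deriveZ.
have lamE : p * lam = - (2 * dprofile c m (`|s0| `^ (2 / p))).
  have -> : lam = nu * s0 `^ (1 - 2 / p).
    by rewrite /lam /sg -powRrM; congr (_ * _ `^ _); field; rewrite gt_eqF.
  have e : s0 `^ (2 / p - 1) * s0 `^ (1 - 2 / p) = 1.
    rewrite -powRD ?(gt_eqF s0p) ?implybT // (_ : 2 / p - 1 + (1 - 2 / p) = 0) ?powRr0 //; ring.
  rewrite /nu /dkap [`|s0|]gtr0_norm //; move: (dprofile c m _) => d.
  rewrite (_ : p * _ = - (2 * d * (s0 `^ (2 / p - 1) * s0 `^ (1 - 2 / p)))); first by rewrite e mulr1.
  by field; rewrite gt_eqF.
rewrite lamE; move: dl dh cM M0; move: (dprofile _ _ _) (half_area p) => d h dl dh cM' M0'.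
have : M * (- (2 * d)) <= M * (2 * c) by rewrite ler_pM2l //; lra.
by move: cM'; rewrite [c * M]mulrC; lra.
Qed.
End LevelOrbit.

Section NonSqueezing.
Context {R : realType} {n : nat}.
Local Notation E := (phase R n.+1).
Variables (p q : R) (B D : 'M[R]_n.+1) (M : R) (O : set E) (phi psi : E -> E) (r : R).
Hypotheses (hp : 2 <= p) (hq : q = p / (p - 1)) (uB : B \in unitmx) (uD : D \in unitmx) (M0 : 0 < M)
  (bC : lp_bound p q M (B *m D^T)) (bCT : lp_bound p q M (B *m D^T)^T).
Hypotheses (oO : open O) (dphi : forall z, O z -> differentiable phi z)
  (cdphi : forall v z, O z -> {for z, continuous (fun y => 'd phi y v)})
  (sphi : forall z, O z -> symp_map ('d phi z))
  (psiK : forall z, O z -> psi (phi z) = z) (KO : Kp p B D `<=` O) (r0 : 0 < r)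
  (cyl : forall y, Kp p B D y -> pcoord (phi y) false ord0 ^+ 2 + pcoord (phi y) true ord0 ^+ 2 <= r ^+ 2).

Variables (kappa gap am : R).
(** [kappa] is the value of [Q] on the boundary of the disc of radius [r] in the first plane, by the
    choice of [a ord0]. On the image of the body [Q] stays below [kappa + gap / 2 = m - delta]; [m]
    is the height of the transplanted profile, and the slope bound [c] must exceed [m]. The bounds
    on [kappa] say that [a ord0] lies between [2 pi] and 8. *)
Let m := kappa + gap.
Let c := kappa + 2 * gap.
Let delta := gap / 2.
Let a (i : 'I_n.+1) : R := if i == ord0 then 2 * kappa / r ^+ 2 else am.
Hypotheses (gap0 : 0 < gap) (kappa_gt : pi * r ^+ 2 < kappa) (kappa_lt : kappa < 4 * r ^+ 2)
  (cM : c * M < 2 * half_area p) (am0 : 0 < am) (am1 : am <= 1).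
Hypothesis am_small : forall y, Kp p B D y ->
  2^-1 * (am * \sum_b \sum_i pcoord (phi y) b i ^+ 2) <= gap / 2.

Let kappa0 : 0 < kappa.
Proof. by apply: lt_trans kappa_gt; rewrite mulr_gt0 ?pi_gt0 ?exprn_gt0. Qed.
Let m0 : 0 < m. Proof. exact: addr_gt0. Qed.
Let mc : m < c. Proof. by have := gap0; rewrite /m /c; lra. Qed.
Let delta0 : 0 < delta. Proof. by rewrite divr_gt0. Qed.
Let r20 : 0 < r ^+ 2. Proof. exact: exprn_gt0. Qed.

Let a_gt : 2 * pi < a ord0.
Proof. by rewrite /a eqxx ltr_pdivlMr // -mulrA ltr_pM2l. Qed.
Let a_lt : a ord0 < 8.
Proof. by rewrite /a eqxx ltr_pdivrMr //; have := kappa_lt; lra. Qed.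
Let a_ge i : am <= a i.
Proof.
rewrite /a; case: eqP => // _; apply: (@le_trans _ _ (2 * pi)); last by rewrite ltW // -[X in _ < X]/(2 * kappa / r ^+ 2) ltr_pdivlMr // -mulrA ltr_pM2l.
by have := @pi_ge2 R; have := am1; lra.
Qed.
Let a_le2 i : i != ord0 -> a i <= 2.
Proof. by rewrite /a => /negPf ->; have := am1; lra. Qed.
Let a_gt0 i : 0 < a i. Proof. exact: lt_le_trans (a_ge i). Qed.
Let a_le8 i : a i <= 8.
Proof. by have [->|/a_le2] := eqVneq i ord0; [exact: ltW | lra]. Qed.

Let az (z : E) : E := (\col_i (a i * z.1 i ord0), \col_i (a i * z.2 i ord0)).
Let Q (z : E) : R := 2^-1 * (\sum_b \sum_i a i * pcoord z b i ^+ 2).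
Let pf := push_fun O phi psi (kfun p c m B D).
Let pF := push_field O phi psi (kfield p c m B D).
(** Added to [Q], this gives a smoothed maximum of [Q] and [m], minus the push-forward: equal to
    [m - pf] on the image of the body, to [Q] far away, and to 0 near the image of the centre, where
    [pf] is [m]. *)
Let h z := ramp delta (m - Q z) - pf z.
Let gh z : E := - dramp delta (m - Q z) *: az z + Jm (pF z).

Let pcoord_az z b i : pcoord (az z) b i = a i * pcoord z b i.
Proof. by case: b; rewrite /pcoord /az /= mxE. Qed.

Let ip_az z : ip (az z) z = 2 * Q z.
Proof.
rewrite /Q mulrA mulfV // mul1r; apply: eq_bigr => b _; apply: eq_bigr => i _.
by rewrite pcoord_az -mulrA -expr2.
Qed.

Let Q_ge0 z : 0 <= Q z.
Proof.
rewrite /Q mulr_ge0 // !sumr_ge0 // => b _; rewrite sumr_ge0 // => i _.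
by rewrite mulr_ge0 ?sqr_ge0 // ltW.
Qed.

Let Q_cont : continuous Q.
Proof.
apply: cont_mul; first exact: cst_continuous.
apply: cont_sum => b; apply: cont_sum => i; apply: cont_mul; first exact: cst_continuous.
have cp := @pcoord_continuous R n.+1 b i.
rewrite (_ : (fun x => _) = (fun x => pcoord x b i * pcoord x b i)); first exact: cont_mul.
by apply/funext => x; rewrite expr2.
Qed.

Let az_cont : continuous az.
Proof.
apply: continuous_phase => b i.
rewrite (_ : (fun x => _) = (fun x => a i * pcoord x b i)).
  by apply: cont_mul; [exact: cst_continuous | exact: pcoord_continuous].
by apply/funext => x; rewrite pcoord_az.
Qed.

Let dKf y (_ : O y) : differentiable (kfun p c m B D) y.
Proof. by have d := is_diff_kfun B D hp m0 mc y; exact: ex_diff. Qed.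
Let dKfE y (_ : O y) v : 'd (kfun p c m B D) y v = omega (kfield p c m B D y) v.
Proof. by have d := is_diff_kfun B D hp m0 mc y; rewrite diff_val. Qed.
Let cKf y (_ : O y) : {for y, continuous (kfield p c m B D)}.
Proof. exact: (kfield_continuous hp m0 mc). Qed.
Let Kc : compact (Kp p B D). Proof. exact: Kp_compact. Qed.
Let kf0 y (_ : ~ Kp p B D y) : kfun p c m B D y = 0.
Proof. by have [] := @kfun_out R n.+1 p c m B D hp m0 mc y. Qed.
Let kF0 y (_ : ~ Kp p B D y) : kfield p c m B D y = 0.
Proof. by have [] := @kfun_out R n.+1 p c m B D hp m0 mc y. Qed.

Let pf_cont : continuous pf.
Proof. exact: (push_fun_continuous oO dphi sphi psiK Kc KO kf0 kF0 dKf). Qed.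
Let pF_cont : continuous pF.
Proof. exact: (push_field_continuous oO dphi cdphi sphi psiK Kc KO kf0 kF0 cKf). Qed.
Let pf_der z w : is_derive (0 : R) (1 : R) (fun s => pf (z + s *: w)) (omega (pF z) w).
Proof. exact: (push_fun_derive oO dphi sphi psiK Kc KO kf0 kF0 dKf dKfE). Qed.
Let pf_out z : ~ (phi @` Kp p B D) z -> pf z = 0 /\ pF z = 0.
Proof. exact: (push_out psiK kf0 kF0). Qed.
Let pf_in y : Kp p B D y -> pf (phi y) = kfun p c m B D y.
Proof. by move=> /KO Oy; exact: push_funE. Qed.
Let pF_in y : Kp p B D y -> pF (phi y) = 'd phi y (kfield p c m B D y).
Proof. by move=> /KO Oy; exact: push_fieldE. Qed.

Let Q_in y : Kp p B D y -> Q (phi y) <= m - delta.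
Proof.
move=> Ky; have h1 := am_small Ky; have h2 := cyl Ky.
rewrite /m /delta.
have : Q (phi y) <= 2^-1 * (2 * kappa / r ^+ 2 * r ^+ 2) + 2^-1 * (am * \sum_b \sum_i pcoord (phi y) b i ^+ 2).
  rewrite /Q -mulrDr ler_pM2l ?invr_gt0 //.
  apply: (@le_trans _ _ (2 * kappa / r ^+ 2 * (pcoord (phi y) false ord0 ^+ 2 + pcoord (phi y) true ord0 ^+ 2) +
      am * \sum_b \sum_i pcoord (phi y) b i ^+ 2)); last first.
    rewrite lerD2r ler_wpM2l // ?divr_ge0 ?mulr_ge0 // ?(ltW kappa0) // ltW //.
  have st b : \sum_i a i * pcoord (phi y) b i ^+ 2 <=
      2 * kappa / r ^+ 2 * pcoord (phi y) b ord0 ^+ 2 + am * \sum_i pcoord (phi y) b i ^+ 2.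
    rewrite (bigD1 ord0) //= {1}/a eqxx lerD2l mulr_sumr [leRHS](bigD1 ord0) //= -[leLHS]add0r lerD //.
      by rewrite mulr_ge0 ?sqr_ge0 // ltW.
    by apply: ler_sum => i /negPf i0; rewrite /a i0.
  have bb (F : bool -> R) : \sum_b F b = F true + F false by rewrite big_bool.
  rewrite !bb; apply: (le_trans (lerD (st true) (st false))).
  by rewrite le_eqVlt; apply/orP; left; apply/eqP; ring.
by rewrite divfK ?gt_eqF //; lra.
Qed.

Let Qder z w : is_derive (0 : R) (1 : R) (fun s => Q (z + s *: w)) (ip (az z) w).
Proof.
rewrite (_ : (fun s => _) = 2^-1 \*: (\sum_b \sum_i (fun s => a i * pcoord (z + s *: w) b i ^+ 2))); last first.
  by apply/funext => s; rewrite /Q /= !fct_sumE; congr (_ * _); apply: eq_bigr => b _; rewrite fct_sumE.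
have -> : ip (az z) w = 2^-1 *: (\sum_b \sum_i 2 * (a i * pcoord z b i) * pcoord w b i).
  rewrite /GRing.scale /= mulr_sumr; apply: eq_bigr => b _; rewrite mulr_sumr; apply: eq_bigr => i _.
  by rewrite pcoord_az; field.
apply: is_deriveZ; apply: is_derive_bigsum => b; apply: is_derive_bigsum => i.
have d := is_derive_pcoord b i (is_derive_line z w 0).
pose f (s : R) := pcoord (z + s *: w) b i.
have df : is_derive (0 : R) (1 : R) f (pcoord w b i) := d.
have f0 : f 0 = pcoord z b i by rewrite /f scale0r addr0.
rewrite -f0; change (is_derive (0 : R) (1 : R) (fun s => a i * f s ^+ 2) (2 * (a i * f 0) * pcoord w b i)).
by apply: is_derive_eq; rewrite /GRing.scale /=; ring.
Qed.

Let h_der z w : is_derive (0 : R) (1 : R) (fun s => h (z + s *: w)) (ip (gh z) w).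
Proof.
have s1 : is_derive (0 : R) (1 : R) (fun s : R => m - Q (z + s *: w)) (- ip (az z) w).
  rewrite -[X in is_derive _ _ _ X]sub0r.
  by apply: (@is_deriveB _ _ _ (cst m) (fun s : R => Q (z + s *: w))); exact: Qder.
have s2 := @is_derive1_comp R (ramp delta) (fun s => m - Q (z + s *: w)) 0 _ _ (is_derive_ramp delta0 _) s1.
have -> : (fun s => h (z + s *: w)) = (ramp delta \o (fun s => m - Q (z + s *: w))) - (fun s => pf (z + s *: w)) by [].
have -> : ip (gh z) w = dramp delta (m - Q (z + (0 : R) *: w)) * (- ip (az z) w) - omega (pF z) w.
  by rewrite scale0r addr0 /gh ipDl ipZl omegaE opprK mulNr mulrN.
by apply: is_deriveB; exact: pf_der.
Qed.

(** The pushed-forward terms vanish here, and both remaining ones are nonpositive. A point with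
    positive [wfun] therefore lies in the image of the body. *)
Let h_out z : ~ (phi @` Kp p B D) z -> wfun h gh z <= 0.
Proof.
move=> zn; have [e1 e2] := pf_out zn.
have -> : wfun h gh z = - (dramp delta (m - Q z) * Q z + ramp delta (m - Q z)).
  by rewrite /wfun /h /gh e1 e2 (_ : Jm 0 = 0) ?addr0 ?ipZl ?ip_az; [field | rewrite /Jm /= oppr0].
by rewrite oppr_le0 addr_ge0 ?ramp_ge0 // mulr_ge0 ?dramp_ge0.
Qed.

Let rho_out : R := 2 * (m + delta) / am + 1.

Let far_Q z : ~ box rho_out z -> m + delta <= Q z.
Proof.
move=> /existsNP [b /existsNP [i /negP]]; rewrite -ltNge => zi.
have r1 : 1 <= rho_out by rewrite lerDr divr_ge0 ?mulr_ge0 ?addr_ge0 // ltW.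
have : rho_out <= pcoord z b i ^+ 2.
  rewrite -real_normK ?num_real //; apply: (@le_trans _ _ (rho_out ^+ 2)).
    by rewrite expr2 ler_peMl // (le_trans ler01).
  by rewrite lerXn2r ?nnegrE ?(ltW zi) // (le_trans ler01).
move=> h1; have h2 : am * rho_out <= a i * pcoord z b i ^+ 2.
  by apply: ler_pM => //; [exact: ltW | exact: (le_trans ler01)].
have h3 : am * rho_out = 2 * (m + delta) + am by rewrite /rho_out mulrDr mulr1 mulrC divfK ?gt_eqF.
have h4 : a i * pcoord z b i ^+ 2 <= \sum_b \sum_i a i * pcoord z b i ^+ 2.
  have nn b' i' : 0 <= a i' * pcoord z b' i' ^+ 2 by rewrite mulr_ge0 ?sqr_ge0 // ltW.
  by rewrite (bigD1 b) //= (bigD1 i) //= -addrA lerDl addr_ge0 // ?sumr_ge0 // => b' _; rewrite sumr_ge0.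
by rewrite /Q; have := am0; lra.
Qed.

Let h_cont : continuous h.
Proof.
apply: cont_sub; last exact: pf_cont.
apply: (@cont_comp E R R (ramp delta) (fun z => m - Q z)); last exact: cont_ramp.
by apply: cont_sub; [exact: cst_continuous | exact: Q_cont].
Qed.

Let gh_cont : continuous gh.
Proof.
move=> z; apply: cvgD.
  apply: cvgZ; last exact: az_cont.
  have cd : continuous (fun z => dramp delta (m - Q z)).
    apply: (@cont_comp E R R (dramp delta) (fun z => m - Q z)); last exact: cont_dramp.
    by apply: cont_sub; [exact: cst_continuous | exact: Q_cont].
  by apply: cvgN; exact: cd.
apply: (@continuous_comp E E E pF (@Jm R n.+1)); [exact: pF_cont | exact: Jm_continuous].
Qed.

Let pf_bounds z : 0 <= pf z <= m.
Proof.
have [[y Ky <-]|zn] := pselect ((phi @` Kp p B D) z); last first.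
  by have [-> _] := pf_out zn; rewrite lexx ltW.
by rewrite pf_in // /kfun /kap profile_bounds.
Qed.

Let ham_in y : Kp p B D y -> ham a h (phi y) = m - kfun p c m B D y.
Proof.
move=> Ky; have dQ : delta <= m - Q (phi y) by have := Q_in Ky; lra.
by rewrite /ham -/(Q (phi y)) /h pf_in // ramp_high //; ring.
Qed.

Let Kp0 : Kp p B D 0. Proof. by rewrite KpE //= gauge0. Qed.

Let near_center : exists2 e : R, 0 < e & forall z, sq (z - phi 0) <= e ^+ 2 -> ham a h z = 0.
Proof.
have [e0 e0P] : exists2 e : R, 0 < e & forall y, `|gauge p B D y| `^ (2 / p) <= profile_gap c m -> True.
  by exists 1.
pose V := [set y : E | gauge p B D y < 1 /\ `|gauge p B D y| `^ (2 / p) <= profile_gap c m].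
have V0 : nbhs (0 : E) V.
  have cg := @gauge_continuous R n.+1 p B D hp 0.
  apply: filterI; first by apply: (cvgr_lt _ cg); rewrite gauge0.
  have h0 : `|gauge p B D 0| `^ (2 / p) < profile_gap c m.
    by rewrite gauge0 // normr0 powR0 ?profile_gap_gt0 // gt_eqF // divr_gt0 // (p_gt0 hp).
  exact: (cg _ (near_small hp h0)).
have O0 : O 0 by exact: KO.
have := embedding_open oO dphi sphi psiK O0 V0 => /nbhs_box [e e0' eP].
exists e => // z ze.
have [|y [[y1 ysmall] Oy] <-] := eP z.
  move=> b i; rewrite -ler_sqr ?nnegrE ?(ltW e0') // real_normK ?num_real //.
  apply: le_trans ze; rewrite /sq (bigD1 b) //= (bigD1 i) //= -addrA lerDl.
  by rewrite addr_ge0 // !sumr_ge0 // => *; rewrite ?sumr_ge0 // => *; exact: sqr_ge0.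
have Ky : Kp p B D y by rewrite KpE //= ltW.
have [k1 _] := profile_low m0 mc ysmall.
by rewrite ham_in // /kfun /kap k1 subrr.
Qed.

Let ham_ge z : 0 <= ham a h z.
Proof.
have [[y Ky <-]|zn] := pselect ((phi @` Kp p B D) z).
  by rewrite ham_in // subr_ge0 /kfun /kap; have /andP[] := profile_bounds m0 mc (`|gauge p B D y| `^ (2 / p)).
have [e1 _] := pf_out zn.
by rewrite /ham -/(Q z) /h e1 subr0 addr_ge0 // ramp_ge0.
Qed.

Let ham_quadratic (e : R) : 0 < e -> (forall z, sq (z - phi 0) <= e ^+ 2 -> ham a h z = 0) ->
  exists2 C1 : R, 0 < C1 & forall z, ham a h z <= C1 * sq (z - phi 0).
Proof.
move=> e0 eP; pose k := 8 * sq (phi 0) + (m + delta).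
have sq0 z : 0 <= sq z :> R by apply: sumr_ge0 => b _; apply: sumr_ge0 => i _; exact: sqr_ge0.
have k0 : 0 < k by rewrite ltr_wpDl ?mulr_ge0 // addr_gt0.
have e20 : 0 < e ^+ 2 by exact: exprn_gt0.
(* [Q] is at most [4 sq], which recentring doubles; the constants are absorbed because only points
   with [sq (z - phi 0)] above [e^2] remain. *)
exists (8 + k / e ^+ 2); first by rewrite addr_gt0 // divr_gt0.
move=> z; have [ze|ze] := leP (sq (z - phi 0)) (e ^+ 2).
  by rewrite eP // mulr_ge0 // addr_ge0 // divr_ge0 // ltW.
have h1 : ham a h z <= 4 * sq z + m.
  rewrite /ham -/(Q z) /h; have /andP[f0 _] := pf_bounds z.
  have qz : Q z <= 4 * sq z.
    rewrite /Q (_ : 4 * sq z = 2^-1 * (8 * sq z)); last by field.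
    rewrite ler_pM2l ?invr_gt0 // /sq mulr_sumr; apply: ler_sum => b _.
    by rewrite mulr_sumr; apply: ler_sum => i _; apply: ler_wpM2r => //; exact: sqr_ge0.
  have st : m - Q z <= m by have := Q_ge0 z; lra.
  have /andP[r2 _] := ramp_incr delta0 st.
  rewrite (ramp_high delta0 (s := m)) in r2; last by rewrite /m /delta; have := gap0; have := kappa0; lra.
  by lra.
have h2 : sq z <= 2 * sq (z - phi 0) + 2 * sq (phi 0).
  rewrite /sq !mulr_sumr -big_split; apply: ler_sum => b _; rewrite !mulr_sumr -big_split.
  apply: ler_sum => i _; rewrite pcoordB /=.
  by have := sqr_ge0 (pcoord z b i - 2 * pcoord (phi 0) b i); rewrite !expr2; lra.
have h3 : k <= k / e ^+ 2 * sq (z - phi 0).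
  by rewrite -mulrA ler_peMr ?(ltW k0) // mulrC ler_pdivlMr // mul1r ltW.
rewrite mulrDl; have := delta0; move: h1 h2 h3; rewrite /k.
move: (_ / e ^+ 2 * _) => X; lra.
Qed.

Let orbit : exists X : R -> E,
  [/\ forall t, X (t + 1) = X t,
      forall (t : R) b i, is_derive t (1 : R) (fun s => pcoord (X s) b i) (vel (gham a gh) (X t) b i) &
      0 < wfun h gh (X 0)].
Proof.
have [e e0 eP] := near_center; have [C1 C10 C1P] := ham_quadratic e0 eP.
have [rs rs0 rsP] := compact_box (image_support_compact dphi Kc KO).
pose rr := rho_out + rs.
have r1 : 0 <= rho_out by rewrite addr_ge0 // divr_ge0 ?mulr_ge0 ?addr_ge0 // ltW.
have out z : ~ box rr z -> [/\ ~ (phi @` Kp p B D) z, ramp delta (m - Q z) = 0 & dramp delta (m - Q z) = 0].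
  move=> zb.
  have b1 : ~ box rho_out z by move=> h1; apply: zb => b i; apply: (le_trans (h1 b i)); rewrite lerDl ltW.
  have qz := far_Q b1.
  have mq : m - Q z <= - delta by lra.
  split; [|exact: ramp_low|exact: dramp_low].
  by move=> /rsP h1; apply: zb => b i; apply: (le_trans (h1 b i)); rewrite lerDr.
apply: (@hamiltonian_orbit R n.+1 ord0 a h gh (phi 0) am e C1 rr) => //.
- by move=> z /out [/pf_out[e1 _] e2 _]; rewrite /h e1 e2 subr0.
- by move=> z /out [/pf_out[_ e1] _ e2]; rewrite /gh e1 e2 oppr0 scale0r add0r /Jm /= oppr0.
Qed.

Let vel_in y b i : Kp p B D y -> vel (gham a gh) (phi y) b i = pcoord (- 'd phi y (kfield p c m B D y)) b i.
Proof.
move=> Ky; have dQ : delta <= m - Q (phi y) by have := Q_in Ky; lra.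
have ghE b' i' : gham a gh (phi y) b' i' = pcoord (Jm ('d phi y (kfield p c m B D y))) b' i'.
  rewrite /gham /gh pF_in // dramp_high // scaleN1r pcoordD pcoordN pcoord_az; ring.
rewrite /vel; case: b; rewrite ghE pcoord_Jm pcoordN //.
Qed.

Let field_nz y : Kp p B D y -> 0 < wfun h gh (phi y) -> kfield p c m B D y != 0.
Proof.
move=> Ky; apply: contraTneq => kz; rewrite -leNgt.
have dQ : delta <= m - Q (phi y) by have := Q_in Ky; lra.
have d0 : 'd phi y (0 : E) = 0 by exact: linear0.
have /andP[_ k1] := profile_bounds m0 mc (`|gauge p B D y| `^ (2 / p)).
rewrite /wfun /h /gh pF_in // kz d0 (_ : Jm 0 = 0) ?addr0; last by rewrite /Jm /= oppr0.
rewrite ipZl ip_az ramp_high // dramp_high // pf_in // /kfun /kap.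
rewrite (_ : _ - _ = profile c m (`|gauge p B D y| `^ (2 / p)) - m) ?subr_le0 //.
by field.
Qed.

(** At time 0 the orbit is in the image of a level [s0 < 1] of the gauge. The times spent in the
    image of this level form an open set, because the gauge is conserved, and a closed one, because
    the level is compact; by connectedness they are all times. The pulled-back orbit contradicts
    [no_slow_orbit]. *)
Lemma nonsqueezing_parameters : False.
Proof.
have [X [X1 dXc W0]] := orbit.
have dX (t : R) : is_derive t (1 : R) X ((\col_i vel (gham a gh) (X t) false i, \col_i vel (gham a gh) (X t) true i) : E).
  apply: is_derive_phase => b i.
  rewrite (_ : pcoord (_, _) b i = vel (gham a gh) (X t) b i); first exact: dXc.
  by case: b; rewrite /pcoord /= mxE.
have cX : continuous X.
  by move=> t; apply: differentiable_continuous; apply/derivable1_diffP; have [] := dX t.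
have [y0 Ky0 y0E] : (phi @` Kp p B D) (X 0).
  by apply: contrapT => /h_out; rewrite leNgt W0.
have nz0 : kfield p c m B D y0 != 0 by have := field_nz Ky0; rewrite y0E => /(_ W0).
pose s0 := gauge p B D y0.
(* At the level 1 the profile is flat and the field would vanish. *)
have s01 : s0 < 1.
  rewrite ltNge; apply/negP => h1; move/eqP: nz0; apply.
  have : 1 - profile_gap c m <= `|gauge p B D y0| `^ (2 / p).
    have s1 : s0 = 1 by apply/eqP; rewrite eq_le h1 andbT; move: Ky0; rewrite KpE.
    by rewrite -/s0 s1 normr1 powR1 gerBl ltW // profile_gap_gt0.
  by move=> /(profile_high m0 mc) [_ e2]; rewrite /kfield /dkap e2 mul0r scale0r.
pose L := [set y : E | gauge p B D y = s0].
have LK : L `<=` Kp p B D by move=> y yL; rewrite KpE //= yL ltW.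
have velE (t : R) y : Kp p B D y -> X t = phi y -> is_derive t (1 : R) X (- 'd phi y (kfield p c m B D y)).
  move=> Ky Xt; apply: is_derive_phase => b i; rewrite -(vel_in b i Ky) -Xt; exact: dXc.
have dy (t : R) y : Kp p B D y -> X t = phi y -> is_derive t (1 : R) (fun s => psi (X s)) (- kfield p c m B D y).
  move=> Ky Xt; apply: (inverse_curve oO dphi sphi psiK (KO Ky) Xt (velE t y Ky Xt)).
  exact: linearN.
have all_t : [set t : R | (phi @` L) (X t)] = [set: R].
  have cR : connected [set: R] by apply/connected_intervalP.
  apply: cR.
  - by exists 0; exists y0.
  - exists [set t : R | (phi @` L) (X t)]; last by rewrite setTI.
    rewrite openE => t [y1 Ly1 Xt].
    pose V := [set y : E | gauge p B D y < 1].
    have V1 : nbhs y1 V.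
      by apply: (cvgr_lt _ (@gauge_continuous R n.+1 p B D hp y1)); rewrite Ly1.
    have nV := embedding_open oO dphi sphi psiK (KO (LK _ Ly1)) V1.
    have nX : nbhs t (fun s => (phi @` (V `&` O)) (X s)) by apply: cX; rewrite -Xt.
    move: nX => /nbhs_ballP [eta /= eta0 etaP].
    have inV s : `|t - s| < eta -> exists y, [/\ gauge p B D y < 1, Kp p B D y, X s = phi y & psi (X s) = y].
      move=> ts; have [y [Vy Oy] yE] := etaP s ts; exists y.
      by split; [exact: Vy | rewrite KpE //; exact: ltW | exact: esym | rewrite -yE; exact: psiK].
    pose g s := gauge p B D (psi (X s)).
    have dg (s : R) : `|t - s| < eta -> is_derive s (1 : R) g 0.
      move=> /inV [y [_ Ky Xs ys]].
      have := chain_derive (gauge_differentiable B D hp (psi (X s))) (dy s y Ky Xs).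
      rewrite ys diff_gauge // (_ : ip _ _ = 0) //.
      rewrite /kfield -scalerN -scaleN1r scalerA ipZr -omega_Jm.
      have := omega_antisym (Jm (grad_gauge p B D y)) (Jm (grad_gauge p B D y)); set o := omega _ _ => oo.
      by have -> : o = 0 by [lra]; rewrite mulr0.
    have gt : g t = s0 by rewrite /g -Xt (psiK (KO (LK _ Ly1))).
    have const s : `|t - s| < eta -> g s = s0.
      move=> ts; rewrite -gt; apply/eqP; rewrite -subr_eq0; apply/eqP.
      have seg u v : u <= v -> `|t - u| < eta -> `|t - v| < eta -> g v - g u = 0.
        move=> uv tu tv; have inuv x : u <= x <= v -> `|t - x| < eta.
          by move: tu tv; rewrite !ltr_norml; lra.
        have [||z _ ->] := @MVT_segment R g (fun=> 0) u v uv; last by rewrite mul0r.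
          by move=> x; rewrite in_itv /= => xx; apply: dg; apply: inuv; case/andP: xx => /ltW -> /ltW.
        by apply: derivable_within_continuous => x; rewrite in_itv /= => xx; have [] := dg x (inuv x xx).
      have tt : `|t - t| < eta by rewrite subrr normr0.
      have [st|/ltW st] := leP t s; first exact: seg.
      by apply: oppr_inj; rewrite opprB oppr0; exact: seg.
    apply/nbhs_ballP; exists eta => // s ts /=.
    have [y [_ Ky Xs ys]] := inV s ts; exists y; last exact: esym.
    by rewrite /L /= -ys; exact: const.
  - exists [set t : R | (phi @` L) (X t)]; last by rewrite setTI.
    have cL : compact (phi @` L).
      apply: continuous_compact.
        apply: continuous_in_subspaceT => y; rewrite inE => Ly.
        by apply: differentiable_continuous; apply: dphi; exact: (KO (LK _ Ly)).
      apply: (@subclosed_compact _ L (Kp p B D)) => //.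
      apply: (@preimage_closed E R (gauge p B D) [set x | x = s0]); last exact: closed_eq.
      by move=> w _; exact: gauge_continuous.
    apply: (@preimage_closed R E X (phi @` L)); first by move=> w _; exact: cX.
    by apply: compact_closed cL; exact: norm_hausdorff.
have inL t : exists2 y, L y & X t = phi y.
  have : [set: R] t by []. by rewrite -all_t => -[y Ly yE]; exists y; [exact: Ly | exact: esym].
have psiL t : L (psi (X t)) /\ X t = phi (psi (X t)).
  by have [y Ly Xt] := inL t; rewrite Xt (psiK (KO (LK _ Ly))).
apply: (@no_slow_orbit R n.+1 p q B D M hp hq uB uD M0 bC bCT c m m0 mc cM (fun t => psi (X t)) s0).
- by move=> t; rewrite X1.
- by move=> t; have [] := psiL t.
- by move=> t; have [Ly Xt] := psiL t; exact: (dy t _ (LK _ Ly) Xt).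
- by rewrite -y0E (psiK (KO Ky0)).
Qed.
End NonSqueezing.

Theorem nonsqueezing {R : realType} {n : nat} (p q : R) (B D : 'M[R]_n.+1) (M r : R)
    (O : set (phase R n.+1)) (phi : phase R n.+1 -> phase R n.+1) :
  2 <= p -> q = p / (p - 1) -> B \in unitmx -> D \in unitmx -> 0 < M ->
  lp_bound p q M (B *m D^T) -> lp_bound p q M (B *m D^T)^T ->
  symplectic_embedding O phi -> Kp p B D `<=` O -> phi @` O `<=` cylinder r -> 0 < r ->
  2 * half_area p / M <= pi * r ^+ 2.
Proof.
move=> hp hq uB uD M0 bC bCT [oO smo sph [psi [psiK _]]] KO cyl r0.
rewrite leNgt; apply/negP => lt.
have r20 : 0 < r ^+ 2 by exact: exprn_gt0.
have pi4 : pi * r ^+ 2 < 4 * r ^+ 2 by rewrite ltr_pM2r //; have := @pihalf_lt2 R; lra.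
(* The room above [pi r^2] is limited by the isoperimetric bound and by the requirement that
   [a ord0] be less than 8. It is cut into four parts [gap], with [kappa], [m] and [c] at the three
   interior points. *)
pose top := Num.min (2 * half_area p / M) (4 * r ^+ 2).
have top_gt : pi * r ^+ 2 < top by rewrite lt_min lt pi4.
have top1 : top <= 2 * half_area p / M by rewrite ge_min lexx.
have top2 : top <= 4 * r ^+ 2 by rewrite ge_min lexx orbT.
pose gap := (top - pi * r ^+ 2) / 4.
have gap0 : 0 < gap by rewrite divr_gt0 // subr_gt0.
have dphi z : O z -> differentiable phi z by have [h _] := smo 1%N; exact: h.
have cdphi v z : O z -> {for z, continuous (fun y => 'd phi y v)}.
  by have [_ h] := smo 1%N; exact: h.
have [rho rho0 rhoP] := compact_box (image_support_compact dphi (Kp_compact hp uB uD) KO).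
pose S : R := \sum_(b : bool) \sum_(i < n.+1) rho ^+ 2 + 1.
have S0 : 0 < S.
  by rewrite ltr_wpDl // sumr_ge0 // => b _; rewrite sumr_ge0 // => i _; exact: sqr_ge0.
(* [S] exceeds the sum of squares of the coordinates on the compact image, so the small form adds at
   most [gap / 2] to [Q] there. *)
pose am := Num.min 1 (gap / S).
have am0 : 0 < am by rewrite lt_min ltr01 divr_gt0.
apply: (@nonsqueezing_parameters R n p q B D M O phi psi r hp hq uB uD M0 bC bCT oO dphi cdphi
  (fun z Oz => sph z Oz) psiK KO r0 _ (pi * r ^+ 2 + gap) gap am gap0 _ _ _ am0 _ _).
- move=> y Ky; have : cylinder r (phi y) by apply: cyl; exists y => //; exact: KO.
  exact: ltW.
- by rewrite ltrDl.
- by rewrite /gap; lra.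
- by rewrite -ltr_pdivlMr //; rewrite /gap; lra.
- by rewrite ge_min lexx.
- move=> y Ky; rewrite mulrC; apply: ler_wpM2r; first by rewrite invr_ge0.
  apply: (@le_trans _ _ (gap / S * S)); last by rewrite divfK ?gt_eqF.
  apply: ler_pM; first exact: ltW.
  - by rewrite sumr_ge0 // => b _; rewrite sumr_ge0 // => i _; exact: sqr_ge0.
  - by rewrite ge_min lexx orbT.
  - rewrite /S; apply: ler_wpDr => //; apply: ler_sum => b _; apply: ler_sum => i _.
    rewrite -real_normK ?num_real // lerXn2r ?nnegrE ?(ltW rho0) //.
    by apply: (rhoP (phi y)); exists y.
Qed.

(** * The operator norm *)

Section OperatorNorm.
Context {R : realType} {n : nat}.
Variables (p q : R) (C : 'M[R]_n.+1).
Hypotheses (hp : 2 <= p) (hq : q = p / (p - 1)) (uC : C \in unitmx).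

Let p0 : 0 < p := p_gt0 hp.
Let q0 : 0 < q := q_gt0 hp hq.

Lemma lpnorm_ge0 (s : R) (v : 'cV[R]_n.+1) : 0 <= lpnorm s v.
Proof. exact: powR_ge0. Qed.

Lemma lpnorm_pow (s : R) (v : 'cV[R]_n.+1) : 0 < s -> lpnorm s v `^ s = \sum_i `|v i ord0| `^ s.
Proof.
move=> s0; rewrite /lpnorm -powRrM mulVf ?gt_eqF // powRr1 // sumr_ge0 // => i _; exact: powR_ge0.
Qed.

Lemma lpnorm_eq0 (s : R) (v : 'cV[R]_n.+1) : 0 < s -> lpnorm s v = 0 -> v = 0.
Proof.
move=> s0 h; apply/colP => i; rewrite mxE; apply/normr0_eq0/(@powR_eq0_eq0 _ _ s).
have : \sum_i `|v i ord0| `^ s = 0 by rewrite -lpnorm_pow // h powR0 // gt_eqF.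
move=> /eqP; rewrite psumr_eq0 => [/allP /(_ i (mem_index_enum _)) /= /eqP //|j _]; exact: powR_ge0.
Qed.

Lemma lpnormZ (s a : R) (v : 'cV[R]_n.+1) : 0 < s -> lpnorm s (a *: v) = `|a| * lpnorm s v.
Proof.
move=> s0; rewrite /lpnorm (eq_bigr (fun i => `|a| `^ s * `|v i ord0| `^ s)) => [|i _]; last first.
  by rewrite mxE normrM powRM.
rewrite -mulr_sumr powRM ?powR_ge0 //; last by rewrite sumr_ge0 // => i _; exact: powR_ge0.
by rewrite -powRrM mulfV ?gt_eqF // powRr1.
Qed.

Lemma lpnorm_cont (s : R) (T : topologicalType) (f : T -> 'cV[R]_n.+1) : 0 < s ->
  (forall i, continuous (fun x => f x i ord0)) -> continuous (fun x => lpnorm s (f x)).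
Proof.
move=> s0 cf; apply: cont_powR; first by rewrite invr_gt0.
  by move=> x; rewrite sumr_ge0 // => i _; exact: powR_ge0.
apply: cont_sum => i; exact: (cont_comp (cf i) (cont_powabs s0)).
Qed.

Let M := opnorm q p C.

Lemma opnorm_attained :
  [/\ 0 < M, forall v, lpnorm p (C *m v) <= M * lpnorm q v &
      exists xi, lpnorm q xi = 1 /\ lpnorm p (C *m xi) = M].
Proof.
pose A := [set w : 'rV[R]_n.+1 | lpnorm q w^T = 1].
have cq : continuous (fun w : 'rV[R]_n.+1 => lpnorm q w^T).
  apply: lpnorm_cont => // i.
  rewrite (_ : (fun x => _) = (fun w : 'rV[R]_n.+1 => w ord0 i)); first exact: coord_continuous.
  by apply/funext => w; rewrite mxE.
have cp : continuous (fun w : 'rV[R]_n.+1 => lpnorm p (C *m w^T)).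
  apply: lpnorm_cont => // i.
  rewrite (_ : (fun x => _) = (fun w : 'rV[R]_n.+1 => \sum_j C i j * w ord0 j)).
    by apply: cont_sum => j; apply: cont_mul; [exact: cst_continuous | exact: coord_continuous].
  by apply/funext => w; rewrite mxE; apply: eq_bigr => j _; rewrite mxE.
have cA : compact A.
  have cB : compact [set v : 'rV[R]_n.+1 | forall i, v ord0 i \in `[-1, 1]].
    exact (@rV_compact R n.+1 (fun=> `[-1, 1]%classic) (fun=> @segment_compact R (-1) 1)).
  apply: (@subclosed_compact _ A _ _ cB).
    apply: (@preimage_closed _ R (fun w : 'rV[R]_n.+1 => lpnorm q w^T) [set x | x = 1]); last exact: closed_eq.
    by move=> w _; exact: cq.
  move=> w; rewrite /A /= => w1 i; rewrite in_itv /= -ler_norml leNgt; apply/negP => h.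
  have : 1 `^ q < `|w ord0 i| `^ q by rewrite gt0_ltr_powR ?nnegrE.
  rewrite powR1 ltNge => /negP; apply.
  have : \sum_i `|w^T i ord0| `^ q = 1 by rewrite -lpnorm_pow // w1 powR1.
  move=> <-; rewrite (bigD1 i) //= mxE lerDl sumr_ge0 // => j _; exact: powR_ge0.
have norm1 (v : 'cV[R]_n.+1) : v != 0 -> lpnorm q ((lpnorm q v)^-1 *: v) = 1.
  move=> v0; have nv : 0 < lpnorm q v.
    rewrite lt_neqAle lpnorm_ge0 andbT eq_sym; apply: contra v0 => /eqP h.
    by rewrite (lpnorm_eq0 q0 h).
  by rewrite lpnormZ // gtr0_norm ?invr_gt0 // mulVf // gt_eqF.
have A0 : A !=set0.
  exists ((lpnorm q (const_mx 1 : 'cV[R]_n.+1))^-1 *: const_mx 1)^T; rewrite /A /= trmxK norm1 //.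
  by apply/eqP => /matrixP /(_ ord0 ord0); rewrite !mxE => /eqP; rewrite oner_eq0.
have cps : {within A, continuous (fun w : 'rV[R]_n.+1 => lpnorm p (C *m w^T))}.
  exact: continuous_subspaceT.
have [w0 Aw0 wmax] := EVT_max_rV A0 cA cps.
rewrite inE /A /= in Aw0.
have bound v : lpnorm p (C *m v) <= lpnorm p (C *m w0^T) * lpnorm q v.
  have [->|v0] := eqVneq v 0.
    have l0 s : 0 < s -> lpnorm s (0 : 'cV[R]_n.+1) = 0.
      by move=> s0; rewrite -(scale0r 0) lpnormZ // normr0 mul0r.
    by rewrite mulmx0 !l0 // mulr0.
  have nv : 0 < lpnorm q v.
    rewrite lt_neqAle lpnorm_ge0 andbT eq_sym; apply: contra v0 => /eqP h.
    by rewrite (lpnorm_eq0 q0 h).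
  have := wmax ((lpnorm q v)^-1 *: v)^T; rewrite inE /A /= trmxK norm1 // => /(_ erefl).
  have e : lpnorm p (C *m ((lpnorm q v)^-1 *: v)) = (lpnorm q v)^-1 * lpnorm p (C *m v).
    rewrite -scalemxAr (lpnormZ _ _ p0); congr (_ * _).
    by apply: gtr0_norm; rewrite invr_gt0.
  move=> h; rewrite e in h; rewrite (ler_pdivrMl _ _ nv) in h.
  by rewrite [leRHS]mulrC; exact: h.
have ME : M = lpnorm p (C *m w0^T).
  apply/eqP; rewrite eq_le; apply/andP; split.
    apply: ge_sup.
      by exists (lpnorm p (C *m w0^T) / lpnorm q w0^T); exists w0^T => //=; apply/eqP => h;
        move: Aw0; rewrite h -(scale0r 0) lpnormZ // normr0 mul0r => /esym/eqP; rewrite oner_eq0.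
    move=> _ [v /= v0 <-]; have nv : 0 < lpnorm q v.
      rewrite lt_neqAle lpnorm_ge0 andbT eq_sym; apply: contra v0 => /eqP h.
      by rewrite (lpnorm_eq0 q0 h).
    by rewrite ler_pdivrMr.
  apply: ub_le_sup.
    exists (lpnorm p (C *m w0^T)) => _ [v /= v0 <-]; have nv : 0 < lpnorm q v.
      rewrite lt_neqAle lpnorm_ge0 andbT eq_sym; apply: contra v0 => /eqP h.
      by rewrite (lpnorm_eq0 q0 h).
    by rewrite ler_pdivrMr.
  exists w0^T; last by rewrite Aw0 divr1.
  by apply/eqP => h; move: Aw0; rewrite h -(scale0r 0) lpnormZ // normr0 mul0r => /esym/eqP; rewrite oner_eq0.
split; last by exists w0^T.
- rewrite ME lt_neqAle lpnorm_ge0 andbT eq_sym; apply/eqP => /(lpnorm_eq0 p0) h.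
  have : w0^T = 0 by rewrite -(mulKmx uC w0^T) h mulmx0.
  by move=> h2; move: Aw0; rewrite h2 -(scale0r 0) lpnormZ // normr0 mul0r => /esym/eqP; rewrite oner_eq0.
- by rewrite ME.
Qed.

Lemma opnorm_lp_bound : lp_bound p q M C.
Proof.
have [M0 bd _] := opnorm_attained; move=> w; have := bd (\col_j w j).
have e1 : \sum_i `|\sum_j C i j * w j| `^ p = lpnorm p (C *m \col_j w j) `^ p.
  rewrite lpnorm_pow //; apply: eq_bigr => i _; rewrite mxE; congr (`|_| `^ _).
  by apply: eq_bigr => j _; rewrite mxE.
have e2 : (\sum_j `|w j| `^ q) `^ q^-1 = lpnorm q (\col_j w j).
  by rewrite /lpnorm; congr (_ `^ _); apply: eq_bigr => j _; rewrite mxE.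
have mono (x y : R) : 0 <= x -> 0 <= y -> x <= y -> x `^ p <= y `^ p.
  by move=> x0 y0 xy; rewrite ge0_ler_powR ?nnegrE ?(ltW p0).
rewrite e1 e2 => h; apply: (mono _ _ _ _ h); first exact: lpnorm_ge0.
by apply: mulr_ge0; [exact: ltW | exact: lpnorm_ge0].
Qed.

(** Duality: [C^T w] is paired with its own [dpow], which attains its norm, and [C] is moved to the
    other factor, where the known bound applies. *)
Lemma lp_bound_tr : lp_bound p q M C^T.
Proof.
have [M0 _ _] := opnorm_attained; have bd := opnorm_lp_bound; move=> w.
pose z j := \sum_i C^T j i * w i; pose N := \sum_j `|z j| `^ p.
rewrite -/(z _) -/N; set W := (\sum_j `|w j| `^ q) `^ q^-1.
have N0 : 0 <= N by rewrite sumr_ge0 // => j _; exact: powR_ge0.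
have W0 : 0 <= W by exact: powR_ge0.
have [->|Nn] := eqVneq N 0; first exact: powR_ge0.
have Np : 0 < N by rewrite lt_neqAle eq_sym Nn.
have E : N = \sum_i (\sum_j C i j * dpow p (z j)) * w i.
  rewrite /N (eq_bigr (fun j => \sum_i C i j * dpow p (z j) * w i)) => [|j _]; last first.
    rewrite -(mul_dpow hp) {1}/z mulr_suml; apply: eq_bigr => i _; rewrite mxE; ring.
  by rewrite exchange_big; apply: eq_bigr => i _; rewrite mulr_suml.
have h1 := hoelder_sum (fun i => \sum_j C i j * dpow p (z j)) w p0 q0 (conj_pq hp hq).
rewrite -E -/W in h1.
have h2 := bd (fun j => dpow p (z j)).
have eN : \sum_j `|dpow p (z j)| `^ q = N by apply: eq_bigr => j _; rewrite dpow_norm_q.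
rewrite eN in h2.
have h3 : (\sum_i `|\sum_j C i j * dpow p (z j)| `^ p) `^ p^-1 <= M * N `^ q^-1.
  have MN : 0 <= M * N `^ q^-1 by rewrite mulr_ge0 ?powR_ge0 // ltW.
  have e : M * N `^ q^-1 = ((M * N `^ q^-1) `^ p) `^ p^-1.
    by rewrite -[RHS]powRrM mulfV ?gt_eqF // powRr1.
  rewrite [leRHS]e.
  rewrite ge0_ler_powR ?nnegrE ?invr_ge0 ?(ltW p0) ?powR_ge0 //.
  by rewrite sumr_ge0 // => i _; exact: powR_ge0.
have h4 : N <= M * N `^ q^-1 * W by apply: (le_trans h1); apply: ler_wpM2r.
have NE : N = N `^ p^-1 * N `^ q^-1.
  by rewrite -powRD ?Nn ?implybT // (conj_pq hp hq) powRr1.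
have h5 : N `^ p^-1 <= M * W.
  rewrite -(ler_pM2r (powR_gt0 q^-1 Np)) -NE; apply: (le_trans h4).
  by rewrite le_eqVlt; apply/orP; left; apply/eqP; ring.
have -> : N = (N `^ p^-1) `^ p by rewrite -powRrM mulVf ?gt_eqF // powRr1.
by rewrite ge0_ler_powR ?nnegrE ?powR_ge0 ?(ltW p0) ?mulr_ge0 // ltW.
Qed.

(** For a maximiser [xi] and [u = C xi / M], the vector [w = C^T dpow u] gives equality in Hoelder's
    inequality against [xi]. The equality case is settled by calculus: in each coordinate the defect
    [g] is nonnegative and vanishes at 0, and its zero derivative reads [dpow w = M^(p-1) xi]. So
    [v = w / M] has [dpow v = xi]. *)
Lemma dual_maximisers : exists u v xi : 'I_n.+1 -> R,
  [/\ \sum_i `|u i| `^ p = 1, \sum_i `|v i| `^ p = 1,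
      forall i, \sum_j C i j * dpow p (v j) = M * u i,
      forall j, \sum_i C i j * dpow p (u i) = M * v j &
      forall i, dpow p (v i) = xi i].
Proof.
have [M0 _ [xi [xi1 Cxi]]] := opnorm_attained.
pose u i := (C *m xi) i ord0 / M; pose w j := \sum_i C i j * dpow p (u i).
have u1 : \sum_i `|u i| `^ p = 1.
  rewrite (eq_bigr (fun i => `|(C *m xi) i ord0| `^ p / M `^ p)) => [|i _].
    by rewrite -mulr_suml -lpnorm_pow // Cxi divff // gt_eqF // powR_gt0.
  by rewrite /u normrM normfV (gtr0_norm M0) powR_div.
have xiq : \sum_i `|xi i ord0| `^ q = 1 by rewrite -lpnorm_pow // xi1 powR1.
pose br (z : 'I_n.+1 -> R) := \sum_i z i * xi i ord0.
have br_le z : `|br z| `^ p <= \sum_i `|z i| `^ p.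
  have S0 : 0 <= \sum_i `|z i| `^ p by rewrite sumr_ge0 // => i _; exact: powR_ge0.
  have h (z' : 'I_n.+1 -> R) : br z' <= (\sum_i `|z' i| `^ p) `^ p^-1.
    by have := hoelder_sum z' (fun i => xi i ord0) p0 q0 (conj_pq hp hq); rewrite xiq powR1 mulr1.
  have h' : `|br z| <= (\sum_i `|z i| `^ p) `^ p^-1.
    rewrite ler_norml h andbT lerNl; have := h (fun i => - z i).
    rewrite /br (eq_bigr (fun i => - (z i * xi i ord0))) => [|i _]; last by rewrite mulNr.
    have e : \sum_i `|- z i| `^ p = \sum_i `|z i| `^ p by apply: eq_bigr => i _; rewrite normrN.
    by rewrite sumrN e.
  have -> : \sum_i `|z i| `^ p = ((\sum_i `|z i| `^ p) `^ p^-1) `^ p.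
    by rewrite -powRrM mulVf ?gt_eqF // powRr1.
  by rewrite ge0_ler_powR ?nnegrE ?powR_ge0 ?(ltW p0).
have brw : br w = M.
  rewrite /br /w (eq_bigr (fun j => \sum_i dpow p (u i) * (C i j * xi j ord0))) => [|j _]; last first.
    by rewrite mulr_suml; apply: eq_bigr => i _; ring.
  rewrite exchange_big (eq_bigr (fun i => M * `|u i| `^ p)) => [|i _].
    by rewrite -mulr_sumr u1 mulr1.
  rewrite -(mul_dpow hp) -mulr_sumr /u mxE; set S := \sum_(j < _) _.
  by field; rewrite gt_eqF.
have wp : \sum_j `|w j| `^ p = M `^ p.
  apply/eqP; rewrite eq_le; apply/andP; split; last by have := br_le w; rewrite brw gtr0_norm.
  have := lp_bound_tr (fun i => dpow p (u i)).
  have -> : \sum_i `|dpow p (u i)| `^ q = 1 by rewrite -u1; apply: eq_bigr => i _; rewrite dpow_norm_q.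
  rewrite powR1 mulr1; congr (_ <= _); apply: eq_bigr => j _; congr (`|_| `^ _).
  by apply: eq_bigr => i _; rewrite mxE.
have crit i0 : dpow p (w i0) = M `^ (p - 1) * xi i0 ord0.
  pose wt (e : R) i := w i + e * (i == i0)%:R.
  pose g e := \sum_i `|wt e i| `^ p - `|br (wt e)| `^ p.
  have brE e : br (wt e) = M + e * xi i0 ord0.
    rewrite -brw /br /wt (bigD1 i0) //= [in RHS](bigD1 i0) //= eqxx mulr1.
    rewrite (eq_bigr (fun i => w i * xi i ord0)) => [|i /negPf ni]; first by ring.
    by rewrite ni mulr0 addr0.
  have dwt (e : R) i : is_derive e (1 : R) (fun e => wt e i) (i == i0)%:R.
    by apply: is_derive_eq; rewrite /GRing.scale /=; ring.
  have dg (e : R) : is_derive e (1 : R) g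
      (\sum_i p * dpow p (wt e i) * (i == i0)%:R - p * dpow p (M + e * xi i0 ord0) * xi i0 ord0).
    have -> : g = (\sum_i (fun e => `|wt e i| `^ p)) - (fun e => `|M + e * xi i0 ord0| `^ p).
      by apply/funext => x; rewrite /g brE -[in RHS]/(_ + _) !fctE fct_sumE.
    apply: is_deriveB.
      apply: is_derive_bigsum => i.
      exact: (@is_derive1_comp R (fun s => `|s| `^ p) (fun e => wt e i) e _ _ (is_derive_powabs _ hp) (dwt e i)).
    have dl : is_derive e (1 : R) (fun e : R => M + e * xi i0 ord0) (xi i0 ord0).
      by apply: is_derive_eq; rewrite /GRing.scale /=; ring.
    exact: (@is_derive1_comp R (fun s => `|s| `^ p) (fun e => M + e * xi i0 ord0) e _ _ (is_derive_powabs _ hp) dl).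
  have wt0 i : wt 0 i = w i by rewrite /wt mul0r addr0.
  have g0 : g 0 = 0.
    rewrite /g brE mul0r addr0 (gtr0_norm M0) (eq_bigr (fun i => `|w i| `^ p)) => [|i _]; last by rewrite wt0.
    by rewrite wp subrr.
  have d0 : is_derive (0 : R) (1 : R) g 0.
    apply: (@derive1_at_min R g (-1) 1 0).
    - by apply: (le_trans (lerN10 R)); exact: ler01.
    - by move=> t _; have [] := dg t.
    - by rewrite in_itv /= ltrN10 ltr01.
    - by move=> t _; rewrite g0 /g subr_ge0; exact: br_le.
  have := @derive_val _ _ _ _ _ _ _ d0; rewrite (@derive_val _ _ _ _ _ _ _ (dg 0)) mul0r addr0.
  rewrite (bigD1 i0) //= eqxx mulr1 big1 ?addr0 => [|i /negPf ->]; last by rewrite mulr0.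
  rewrite wt0 => /eqP; rewrite subr_eq0 -mulrA => /eqP /(mulfI (lt0r_neq0 p0)) ->.
  by congr (_ * _); rewrite /dpow gtr0_sg // mul1r gtr0_norm.
pose v i := w i / M.
have vxi i : dpow p (v i) = xi i ord0.
  rewrite /v mulrC dpowZ ?invr_ge0 ?(ltW M0) // crit mulrA -powRM ?invr_ge0 ?(ltW M0) //.
  by rewrite mulVf ?gt_eqF // powR1 mul1r.
exists u, v, (fun i => xi i ord0); split => //.
- rewrite (eq_bigr (fun i => `|w i| `^ p / M `^ p)) => [|i _].
    by rewrite -mulr_suml wp divff // gt_eqF // powR_gt0.
  by rewrite /v normrM normfV (gtr0_norm M0) powR_div.
- move=> i; rewrite (eq_bigr (fun j => C i j * xi j ord0)) => [|j _]; last by rewrite vxi.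
  by rewrite /u mulrC divfK ?gt_eqF // mxE.
- by move=> j; rewrite /v mulrC divfK ?gt_eqF.
Qed.
End OperatorNorm.

(** * Closed characteristics *)

Section Boundary.
Context {R : realType} {n : nat}.
Local Notation E := (phase R n).
Variables (p : R) (B D : 'M[R]_n).
Hypotheses (hp : 2 <= p) (uB : B \in unitmx) (uD : D \in unitmx).
Local Notation F := (gauge p B D).
Local Notation dF := (grad_gauge p B D).
Local Notation K := (Kp p B D).

Let p0 : 0 < p := p_gt0 hp.

Lemma line_near (z w : E) (P : set E) : nbhs z P -> \forall s \near (0 : R), P (z + s *: w).
Proof.
move=> zP; have := @line_continuous R n z w 0; rewrite /continuous_at scale0r addr0 => h.
exact: (h P zP).
Qed.

Lemma boundaryE : boundary K = [set z | F z = 1].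
Proof.
have cK : closed K by apply: compact_closed (Kp_compact hp uB uD); exact: norm_hausdorff.
rewrite /boundary -((closure_id K).1 cK); apply/seteqP; split => z /=.
  move=> [Kz nK]; apply/eqP; rewrite eq_le; move: (Kz); rewrite KpE //= => -> /=.
  rewrite leNgt; apply/negP => z1; apply: nK.
  have : nbhs z [set w | F w < 1] by apply: (cvgr_lt _ (@gauge_continuous R n p B D hp z)); exact: z1.
  by apply: filterS => w w1; rewrite KpE //=; exact: ltW.
move=> z1; split; first by rewrite KpE //= z1.
move=> Kz; have : \forall s \near (0 : R), K (z + s *: z) by exact: line_near.
move=> /nbhs_ballP [e /= e0 eP].
have : K (z + (e / 2) *: z).
  apply: eP; rewrite /ball /= sub0r normrN gtr0_norm ?divr_gt0 //.
  by rewrite ltr_pdivrMr // ltr_pMr // ltr1n.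
rewrite KpE //= -{1}(scale1r z) -scalerDl gaugeZ z1 mulr1 leNgt => /negP; apply.
have e2 : 0 < e / 2 by rewrite divr_gt0.
have h : 1 `^ p < (1 + e / 2) `^ p by rewrite gt0_ltr_powR ?nnegrE ?ltrDl // addr_ge0 // ltW.
by rewrite powR1 in h; rewrite gtr0_norm // addr_gt0.
Qed.

Lemma gauge_curve (c : R -> E) (t : R) v : is_derive t (1 : R) c v ->
  is_derive t (1 : R) (fun s => F (c s)) (ip (dF (c t)) v).
Proof.
move=> dc; have := chain_derive (gauge_differentiable B D hp (c t)) dc.
by rewrite diff_gauge.
Qed.

(** Conversely, a vector orthogonal to the gradient is the velocity of the line through [z]
    projected radially to the level 1: the projection factor is 1 with derivative 0 at time 0. *)
Lemma tangentE (z : E) : F z = 1 -> tangent_space (boundary K) z = [set v | ip (dF z) v = 0].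
Proof.
move=> z1; rewrite boundaryE; apply/seteqP; split => v /=.
  move=> [c [c0 cn dc]]; have dg := gauge_curve dc; rewrite c0 in dg.
  have nq : \forall t \near (0 : R), F (c t) = cst 1 t by exact: cn.
  have d1 := near_eq_is_derive nq dg.
  have d2 : is_derive (0 : R) (1 : R) (cst (1 : R)) 0 by exact: is_derive_cst.
  by rewrite -(@derive_val _ _ _ _ _ _ _ d1) (@derive_val _ _ _ _ _ _ _ d2).
move=> v0; pose g (t : R) := F (z + t *: v).
have dg : is_derive (0 : R) (1 : R) g 0.
  have h := gauge_curve (is_derive_line z v 0).
  have e : ip (dF (z + (0 : R) *: v)) v = 0 by rewrite scale0r addr0.
  by rewrite e in h.
have g0 : g 0 = 1 by rewrite /g scale0r addr0.
pose f (t : R) := g t `^ (- p^-1).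
have df : is_derive (0 : R) (1 : R) f 0.
  have gp : 0 < g 0 by rewrite g0.
  have := @is_derive1_comp R ((@powR R)^~ (- p^-1)) g 0 _ _ (is_derive1_powR (- p^-1) gp) dg.
  by rewrite mulr0.
have f0 : f 0 = 1 by rewrite /f g0 powR1.
exists (fun t => f t *: (z + t *: v)); split.
- by rewrite f0 scale1r scale0r addr0.
- have : \forall t \near (0 : R), 0 < g t.
    have cg : {for 0, continuous g} by apply: differentiable_continuous; apply/derivable1_diffP; have [] := dg.
    by apply: (cvgr_gt _ cg); rewrite g0.
  apply: filterS => t gt /=; rewrite gaugeZ -/(g t) /f ger0_norm ?powR_ge0 // -powRrM mulNr mulVf ?gt_eqF //.
  by rewrite powRN powRr1 ?(ltW gt) // mulVf // gt_eqF.
- apply: is_derive_phase => b i.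
  have dl := is_derive_pcoord b i (is_derive_line z v 0).
  rewrite (_ : (fun s => _) = (fun s => f s * pcoord (z + s *: v) b i)); last first.
    by apply/funext => s; rewrite pcoordZ.
  have -> : pcoord v b i = f 0 *: pcoord v b i + pcoord (z + (0 : R) *: v) b i *: 0.
    by rewrite f0 scale1r scaler0 addr0.
  exact: is_deriveM.
Qed.

Lemma omega_self (u : E) : omega u u = 0.
Proof. by have := omega_antisym u u; lra. Qed.

(** By Euler's identity [z] is transverse to the tangent space, so any [w] becomes tangent after
    subtraction of a multiple of [z]. The kernel condition then fixes [omega v w] for all [w], and
    [omega] is nondegenerate. *)
Lemma kernelE (z : E) : F z = 1 ->
  omega_kernel (boundary K) z = range (fun s : R => s *: Jm (dF z)).
Proof.
move=> z1; rewrite /omega_kernel tangentE //; apply/seteqP; split => v /=.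
  move=> [_ vw]; exists (omega v z / p) => //.
  apply/eqP; rewrite eq_sym -subr_eq0; apply/eqP; apply: omega_nondeg => w.
  have zF : ip (dF z) z = p by rewrite euler_gauge // z1 mulr1.
  pose w' := w + (- (ip (dF z) w / p)) *: z.
  have w'0 : ip (dF z) w' = 0.
    by rewrite /w' ipDr ipZr zF mulNr divfK ?gt_eqF // subrr.
  have := vw w' w'0; rewrite /w' omegaDr omegaZr => e.
  rewrite -scaleN1r omegaDl !omegaZl omega_Jm.
  rewrite (_ : _ / p * _ = ip (dF z) w / p * omega v z); last by ring.
  by move: e; rewrite mulNr => /eqP; rewrite subr_eq0 => /eqP ->; ring.
move=> [s _ <-]; split.
  by rewrite ipZr -omega_Jm omega_self mulr0.
by move=> w w0; rewrite omegaZl omega_Jm w0 mulr0.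
Qed.

Lemma Jm_grad_neq0 z : F z = 1 -> Jm (dF z) != 0.
Proof.
move=> z1; apply/eqP => h; have : omega (Jm (dF z)) z = p by rewrite omega_Jm euler_gauge // z1 mulr1.
by rewrite h -(scale0r (0 : E)) omegaZl mul0r => /esym/eqP; rewrite gt_eqF.
Qed.
End Boundary.

Lemma continuous_sign {R : realType} (l : R -> R) : continuous l -> (forall t, l t != 0) ->
  (forall t, 0 < l t) \/ (forall t, l t < 0).
Proof.
move=> cl lnz; apply: contrapT => /not_orP[/existsNP[a /negP na] /existsNP[b /negP nb]].
rewrite -leNgt le_eqVlt (negPf (lnz a)) /= in na.
rewrite -leNgt le_eqVlt eq_sym (negPf (lnz b)) /= in nb.
have cw u v : {within `[u, v], continuous l} by exact: continuous_subspaceT.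
have [ab|/ltW ba] := leP a b.
  have [|c _ c0] := @IVT R l a b 0 ab (cw a b); last by have := lnz c; rewrite c0 eqxx.
  by rewrite ge_min le_max (ltW na) (ltW nb) orbT.
have [|c _ c0] := @IVT R l b a 0 ba (cw b a); last by have := lnz c; rewrite c0 eqxx.
by rewrite ge_min le_max (ltW na) (ltW nb) !orbT.
Qed.

(** * Lower bound for the action of closed characteristics *)

Section Characteristics.
Context {R : realType} {n : nat}.
Local Notation E := (phase R n.+1).
Notation mu := (@lebesgue_measure R).
Variables (p q : R) (B D : 'M[R]_n.+1).
Hypotheses (hp : 2 <= p) (hq : q = p / (p - 1)) (uB : B \in unitmx) (uD : D \in unitmx).
Local Notation F := (gauge p B D).
Local Notation dF := (grad_gauge p B D).
Local Notation K := (Kp p B D).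
Local Notation C := (B *m D^T).
Local Notation M := (opnorm q p C).

Let p0 : 0 < p := p_gt0 hp.
Let uC : C \in unitmx. Proof. by rewrite unitmx_mul uB unitmx_tr. Qed.
Let M0 : 0 < M. Proof. by have [] := opnorm_attained hp hq uC. Qed.

Lemma omega_field (z : E) s : F z = 1 -> omega z (s *: Jm (dF z)) = - (s * p).
Proof. by move=> z1; rewrite omegaZr omega_antisym omega_Jm euler_gauge // z1 mulr1 mulrN. Qed.

(** An antisymplectic reflection that preserves the gauge; it turns a curve that runs against the
    Hamiltonian field into one that follows it. *)
Definition flip (z : E) : E := (z.1, - z.2).

Lemma gauge_flip z : F (flip z) = F z.
Proof.
apply: eq_bigr => b _; apply: eq_bigr => i _; case: b => //=.
by rewrite /lpform /flip /= mulmxN mxE normrN.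
Qed.

Lemma field_flip z : Jm (dF (flip z)) = - flip (Jm (dF z)).
Proof.
have dv (v : 'cV[R]_n.+1) : dpowv p (- v) = - dpowv p v.
  by apply/colP => i; rewrite !mxE /dpow sgrN normrN mulNr.
by rewrite /flip /Jm /grad_gauge /= mulmxN dv mulmxN scalerN; congr pair; rewrite opprK.
Qed.

Lemma flip_lin a z : flip (a *: z) = a *: flip z.
Proof.
apply: phase_ext => b i; rewrite !pcoordZ /pcoord /flip.
by case: b => /=; rewrite !mxE ?mulrN.
Qed.

Lemma is_derive_flip (y : R -> E) (t : R) v :
  is_derive t (1 : R) y v -> is_derive t (1 : R) (fun s => flip (y s)) (flip v).
Proof.
move=> dy; apply: is_derive_phase => b i; have d := is_derive_pcoord b i dy.
case: b d => d.
  rewrite (_ : (fun s => _) = - (fun s => pcoord (y s) true i)); last first.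
    by apply/funext => s; rewrite /pcoord /flip /= mxE.
  rewrite (_ : pcoord _ _ _ = - pcoord v true i); last by rewrite /pcoord /flip /= mxE.
  exact: is_deriveN.
exact: d.
Qed.

Lemma characteristic_action_ge (g : R -> E) (T : R) : closed_characteristic K g T ->
  2 * half_area p / M <= `|action g T|.
Proof.
move=> [[T0 gT] [gd gc] gb gk].
have g1 t : F (g t) = 1 by have := gb t; rewrite boundaryE.
have dg (t : R) : is_derive t (1 : R) g (derive1 g t).
  by rewrite derive1E; apply: derivableP; exact: gd.
(* Euler's identity recovers in this way the factor between the velocity and the field, in a form
   whose continuity is evident. *)
pose l t := - (omega (g t) (derive1 g t) / p).
have lE t : derive1 g t = l t *: Jm (dF (g t)).
  have [_ kE] := gk t; have : range (fun s : R => s *: derive1 g t) (derive1 g t).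
    by exists 1; rewrite ?scale1r.
  rewrite -kE kernelE // => -[s _ sE].
  by rewrite /l -sE omega_field // mulNr opprK mulfK ?gt_eqF.
have cg : continuous g.
  by move=> t; apply: differentiable_continuous; apply/derivable1_diffP; exact: gd.
have cl : continuous l.
  have c1 : continuous (fun t => omega (g t) (derive1 g t)).
    have cJ : continuous (fun t => Jm (g t)) by exact: (cont_comp cg (@Jm_continuous R n.+1)).
    rewrite (_ : (fun t => _) = (fun t => - ip (Jm (g t)) (derive1 g t))).
      by move=> t; apply: cvgN; exact: (cont_ip cJ gc).
    by apply/funext => t; rewrite omegaE.
  have c2 : continuous (fun t => omega (g t) (derive1 g t) / p).
    by apply: cont_mul c1 _; exact: cst_continuous.
  by move=> t; apply: cvgN; exact: c2.
have dT t : derive1 g (t + T) = derive1 g t.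
  have s : is_derive t (1 : R) (fun x : R => x + T) 1 by apply: is_derive_eq; rewrite addr0.
  have h := chain_derive (f := g) (c := fun x : R => x + T) (t := t) (v := 1).
  have dd : differentiable g (t + T) by apply/derivable1_diffP; exact: gd.
  have := h dd s; rewrite (_ : (fun s => g (s + T)) = g); last by apply/funext => x; rewrite gT.
  move=> h2; rewrite derive1E [RHS]derive1E (@derive_val _ _ _ _ _ _ _ h2).
  by rewrite deriveE.
have lT t : l (t + T) = l t by rewrite /l gT dT.
have lnz t : l t != 0.
  by have [+ _] := gk t; rewrite lE; apply: contra => /eqP ->; rewrite scale0r.
have act : action g T = - (2^-1 * (p * \int[mu]_(t in `[0, T]) l t)).
  rewrite /action -mulrN; congr (_ * _); rewrite -(period_scale T0 p cl).
  rewrite -mulN1r -(period_scale T0 (-1)); last by apply: cont_mul => //; exact: cst_continuous.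
  apply: eq_Rintegral => t _; rewrite lE omega_field //; ring.
have half (l' : R -> R) (y : R -> E) : continuous l' -> (forall t, 0 < l' t) -> (forall t, l' (t + T) = l' t) ->
    (forall t, y (t + T) = y t) -> (forall t, F (y t) = 1) ->
    (forall t : R, is_derive t (1 : R) y (l' t *: Jm (dF (y t)))) ->
    2 * half_area p / M <= 2^-1 * (p * \int[mu]_(t in `[0, T]) l' t).
  move=> cl' l'0 l'T yT y1 dy.
  have := level_orbit_bound hp hq uB uD M0 (opnorm_lp_bound hp hq uC) (lp_bound_tr hp hq uC) T0 l'T cl' l'0 yT y1 dy.
  rewrite ler_pdivrMr // mulrC => h; rewrite -(ler_pM2l (x := 2)) //.
  by move: (p * _) M h => I N h; lra.
rewrite act; have [l0|l0] := continuous_sign cl lnz.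
  apply: (le_trans (half l g cl l0 lT gT g1 _)); first by move=> t; rewrite -lE; exact: dg.
  by rewrite normrN; exact: ler_norm.
have clN : continuous (fun t => - l t) by move=> t; apply: cvgN; exact: cl.
apply: (@le_trans _ _ (2^-1 * (p * \int[mu]_(t in `[0, T]) (- l t)))).
  apply: (half (fun t => - l t) (fun t => flip (g t)) clN).
  - by move=> t; rewrite oppr_gt0.
  - by move=> t; rewrite lT.
  - by move=> t; rewrite gT.
  - by move=> t; rewrite gauge_flip.
  - move=> t; have -> : - l t *: Jm (dF (flip (g t))) = flip (derive1 g t).
      by rewrite field_flip lE flip_lin scaleNr scalerN opprK.
    exact: is_derive_flip (dg t).
have eN : \int[mu]_(t in `[0, T]) (- l t) = - \int[mu]_(t in `[0, T]) l t.
  rewrite -mulN1r -(period_scale T0 (-1) cl); apply: eq_Rintegral => t _; by rewrite mulN1r.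
by rewrite eN !mulrN; exact: ler_norm.
Qed.
End Characteristics.

Lemma derive_as {R : realType} (f : R -> R) (t df df' : R) :
  is_derive t (1 : R) f df -> df = df' -> is_derive t (1 : R) f df'.
Proof. by move=> ? <-. Qed.

(** * Trigonometry of the [l_p] circle *)

Section LpCircle.
Context {R : realType}.
Notation mu := (@lebesgue_measure R).
Variable p : R.
Hypothesis hp : 2 <= p.
Let p0 : 0 < p := p_gt0 hp.

Definition lpS (t : R) : R := `|cos t| `^ p + `|sin t| `^ p.
Definition lpcos (t : R) : R := cos t * lpS t `^ (- p^-1).
Definition lpsin (t : R) : R := sin t * lpS t `^ (- p^-1).
(** The speed of the radially projected circle [(lpcos, lpsin)] relative to the flow
    [x' = - dpow p y], [y' = dpow p x]; it is also the density [x y' - y x'] of twice the swept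
    area. *)
Definition lprate (t : R) : R := lpS t `^ (- (2 / p)).

Lemma lpS_gt0 t : 0 < lpS t.
Proof.
rewrite lt_neqAle addr_ge0 ?powR_ge0 // andbT eq_sym; apply/eqP => /eqP.
rewrite paddr_eq0 ?powR_ge0 // => /andP[/eqP /powR_eq0_eq0 /normr0_eq0 c0 /eqP /powR_eq0_eq0 /normr0_eq0 s0].
by have := cos2Dsin2 t; rewrite c0 s0 expr0n addr0 => /eqP; rewrite eq_sym oner_eq0.
Qed.

Lemma lprate_gt0 t : 0 < lprate t. Proof. by rewrite powR_gt0 // lpS_gt0. Qed.

Lemma is_derive_lpS (t : R) :
  is_derive t (1 : R) lpS (p * (- (dpow p (cos t) * sin t) + dpow p (sin t) * cos t)).
Proof.
have h1 := @is_derive1_comp R (fun s => `|s| `^ p) cos t _ _ (is_derive_powabs _ hp) (is_derive_cos t).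
have h2 := @is_derive1_comp R (fun s => `|s| `^ p) sin t _ _ (is_derive_powabs _ hp) (is_derive_sin t).
have h := is_deriveD h1 h2.
by apply: (derive_as h); ring.
Qed.

Lemma is_derive_lpSpow (a t : R) : is_derive t (1 : R) (fun t => lpS t `^ a)
  (a * lpS t `^ (a - 1) * (p * (- (dpow p (cos t) * sin t) + dpow p (sin t) * cos t))).
Proof.
exact: (@is_derive1_comp R ((@powR R)^~ a) lpS t _ _ (is_derive1_powR a (lpS_gt0 t)) (is_derive_lpS t)).
Qed.

Let powS t a b : lpS t `^ a * lpS t `^ b = lpS t `^ (a + b).
Proof. by rewrite -powRD // (gt_eqF (lpS_gt0 t)) implybT. Qed.

Let lpSE t : lpS t = cos t * dpow p (cos t) + sin t * dpow p (sin t).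
Proof. by rewrite /lpS -!(mul_dpow hp). Qed.

Let dpow_scaled t s : dpow p (s * lpS t `^ (- p^-1)) * lprate t = dpow p s * lpS t `^ (- p^-1 - 1).
Proof.
rewrite [s * _]mulrC dpowZ ?powR_ge0 // -powRrM /lprate mulrAC powS mulrC.
by congr (_ * _ `^ _); field; rewrite gt_eqF.
Qed.

Lemma is_derive_lpcos (t : R) : is_derive t (1 : R) lpcos (- (dpow p (lpsin t) * lprate t)).
Proof.
have h := is_deriveM (is_derive_cos t) (is_derive_lpSpow (- p^-1) t).
apply: (derive_as h).
rewrite /lpsin dpow_scaled /GRing.scale /=.
have e : lpS t `^ (- p^-1) = lpS t `^ (- p^-1 - 1) * lpS t.
  by rewrite -{3}(powRr1 (ltW (lpS_gt0 t))) powS subrK.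
rewrite e; move: (lpS t `^ (- p^-1 - 1)) => X; rewrite lpSE.
have cs := cos2Dsin2 t; move: (cos t) (sin t) (dpow p (cos t)) (dpow p (sin t)) cs => c s a b cs.
have -> : - (b * X) = - (b * X) * (c ^+ 2 + s ^+ 2) by rewrite cs mulr1.
by rewrite !expr2; field; rewrite gt_eqF.
Qed.

Lemma is_derive_lpsin (t : R) : is_derive t (1 : R) lpsin (dpow p (lpcos t) * lprate t).
Proof.
have h := is_deriveM (is_derive_sin t) (is_derive_lpSpow (- p^-1) t).
apply: (derive_as h).
rewrite /lpcos dpow_scaled /GRing.scale /=.
have e : lpS t `^ (- p^-1) = lpS t `^ (- p^-1 - 1) * lpS t.
  by rewrite -{3}(powRr1 (ltW (lpS_gt0 t))) powS subrK.
rewrite e; move: (lpS t `^ (- p^-1 - 1)) => X; rewrite lpSE.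
have cs := cos2Dsin2 t; move: (cos t) (sin t) (dpow p (cos t)) (dpow p (sin t)) cs => c s a b cs.
have -> : a * X = a * X * (c ^+ 2 + s ^+ 2) by rewrite cs mulr1.
by rewrite !expr2; field; rewrite gt_eqF.
Qed.

Lemma lp_circle t : `|lpcos t| `^ p + `|lpsin t| `^ p = 1.
Proof.
rewrite !normrM !powRM // (ger0_norm (powR_ge0 _ _)) -mulrDl -powRrM mulNr mulVf ?gt_eqF //.
by rewrite powRN powRr1 ?(ltW (lpS_gt0 t)) // mulfV // gt_eqF // lpS_gt0.
Qed.

Let tau : R := pi *+ 2.

Lemma lpS_period t : lpS (t + tau) = lpS t.
Proof. by rewrite /lpS cosD2pi sinD2pi. Qed.

Lemma lpcos_period t : lpcos (t + tau) = lpcos t.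
Proof. by rewrite /lpcos cosD2pi lpS_period. Qed.

Lemma lpsin_period t : lpsin (t + tau) = lpsin t.
Proof. by rewrite /lpsin sinD2pi lpS_period. Qed.

Lemma cont_lprate : continuous lprate.
Proof. exact: derive_cont (is_derive_lpSpow (- (2 / p))). Qed.

Let wcirc_lpcos t : wcirc p (lpcos t) = `|lpsin t|.
Proof.
have h := lp_circle t; rewrite /wcirc max_r; last by have := powR_ge0 `|lpsin t| p; lra.
by rewrite (_ : 1 - _ = `|lpsin t| `^ p); [rewrite -powRrM mulfV ?gt_eqF // powRr1 | lra].
Qed.

(** On each half turn [x y - 2 e W x] is a primitive of [x y' - y x']: with [e] the sign of [lpsin],
    [e] times the arc function at [x] is [y]. The end values of the two halves combine to twice the
    area of the disc. *)
Lemma integral_lprate : \int[mu]_(t in `[0, tau]) lprate t = 4 * half_area p.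
Proof.
have tau0 : 0 < tau by rewrite mulrn_wgt0 // pi_gt0.
have [A dA] := primitive_ex cont_lprate.
have [W dW] := primitive_ex (cont_wcirc hp).
have WE : W 1 - W (-1) = half_area p.
  by rewrite /half_area (primitive_Rintegral (cont_wcirc hp) _ dW) //; lra.
rewrite (primitive_Rintegral cont_lprate tau0 dA).
pose G e t := lpcos t * lpsin t - e * (2 * W (lpcos t)).
have dG e (t : R) : is_derive t (1 : R) (G e)
    (lprate t + 2 * dpow p (lpsin t) * lprate t * (e * wcirc p (lpcos t) - lpsin t)).
  have h1 := is_deriveM (is_derive_lpcos t) (is_derive_lpsin t).
  have h2 := @is_derive1_comp R W lpcos t _ _ (dW (lpcos t)) (is_derive_lpcos t).
  have h3 := is_deriveB h1 (is_deriveZ (e * 2) h2).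
  rewrite (_ : G e = lpcos * lpsin - (e * 2) \*: (W \o lpcos)); last first.
    by apply/funext => x; rewrite /G /= !fctE /=; congr (_ - _); rewrite mulrA.
  apply: (derive_as h3).
  have e1 : lprate t = lprate t * (lpcos t * dpow p (lpcos t) + lpsin t * dpow p (lpsin t)).
    by rewrite !(mul_dpow hp) lp_circle mulr1.
  rewrite [X in _ = X + _]e1 /GRing.scale /=; ring.
have half e a b : a <= b -> `|e| = 1 -> (forall t, a <= t <= b -> 0 <= e * sin t) ->
    A b - A a = G e b - G e a.
  move=> ab e1 es.
  have eq t : a <= t <= b -> lprate t + 2 * dpow p (lpsin t) * lprate t * (e * wcirc p (lpcos t) - lpsin t) = lprate t.
    move=> /es st; have st' : 0 <= e * lpsin t by rewrite mulrA mulr_ge0 ?powR_ge0.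
    have -> : wcirc p (lpcos t) = e * lpsin t.
      by rewrite wcirc_lpcos -(ger0_norm st') normrM e1 mul1r.
    have ee : e * e = 1 by have := real_normK (num_real e); rewrite e1 expr1n expr2.
    by rewrite mulrA ee mul1r subrr mulr0 addr0.
  apply/eqP; rewrite eq_le; apply/andP; split.
    by apply: (primitive_le ab dA (dG e)) => t ht; rewrite eq.
  by apply: (primitive_le ab (dG e) dA) => t ht; rewrite eq.
have pi0 : (0 : R) <= pi by exact: pi_ge0.
have tauE : tau = pi + pi by rewrite /tau mulr2n.
have pitau : pi <= tau by rewrite tauE lerDl.
have S0 : lpS 0 = 1 by rewrite /lpS cos0 sin0 normr1 normr0 powR1 powR0 ?addr0 // gt_eqF.
have Spi : lpS pi = 1 by rewrite /lpS cospi sinpi normrN normr1 normr0 powR1 powR0 ?addr0 // gt_eqF.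
have c0 : lpcos 0 = 1 by rewrite /lpcos S0 cos0 powR1 mulr1.
have s0 : lpsin 0 = 0 by rewrite /lpsin sin0 mul0r.
have cpi : lpcos pi = -1 by rewrite /lpcos Spi cospi powR1 mulr1.
have spi : lpsin pi = 0 by rewrite /lpsin sinpi mul0r.
have ct : lpcos tau = 1 by rewrite -[tau]add0r lpcos_period c0.
have st : lpsin tau = 0 by rewrite -[tau]add0r lpsin_period s0.
have h1 : A pi - A 0 = G 1 pi - G 1 0.
  by apply: half; rewrite ?normr1 // => t ht; rewrite mul1r; exact: sin_ge0_pi.
have h2 : A tau - A pi = G (-1) tau - G (-1) pi.
  apply: half; rewrite ?normrN ?normr1 // => t ht; rewrite mulN1r.
  have -> : - sin t = sin (t - pi) by rewrite -{1}(subrK pi t) sinDpi opprK.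
  rewrite tauE in ht; apply: sin_ge0_pi; case/andP: ht => ht1 ht2.
  by rewrite subr_ge0 ht1 lerBlDr.
have -> : A tau - A 0 = (A tau - A pi) + (A pi - A 0) by ring.
by rewrite h1 h2 /G c0 s0 cpi spi ct st -WE; ring.
Qed.
End LpCircle.

Section Extremal.
Context {R : realType} {n : nat}.
Local Notation E := (phase R n.+1).
Notation mu := (@lebesgue_measure R).
Variables (p q : R) (B D : 'M[R]_n.+1).
Hypotheses (hp : 2 <= p) (hq : q = p / (p - 1)) (uB : B \in unitmx) (uD : D \in unitmx).
Local Notation F := (gauge p B D).
Local Notation dF := (grad_gauge p B D).
Local Notation K := (Kp p B D).
Local Notation C := (B *m D^T).
Local Notation M := (opnorm q p C).

Let p0 : 0 < p := p_gt0 hp.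
Let uC : C \in unitmx. Proof. by rewrite unitmx_mul uB unitmx_tr. Qed.
Let M0 : 0 < M. Proof. by have [] := opnorm_attained hp hq uC. Qed.

(** In the plane of a maximising pair the system reduces to the scalar one, solved by the [l_p]
    circle. The factor [l] is negative because this parametrisation runs against the Hamiltonian
    field. *)
Lemma extremal_characteristic : exists (g : R -> E) (T : R),
  closed_characteristic K g T /\ `|action g T| = 2 * half_area p / M.
Proof.
have [u [v [_ [u1 v1 Cv Cu _]]]] := dual_maximisers hp hq uC.
pose U := \col_i u i; pose V := \col_i v i.
have EC : C *m dpowv p V = M *: U.
  apply/colP => i; rewrite !mxE -Cv; apply: eq_bigr => j _; by rewrite !mxE.
have ECt : C^T *m dpowv p U = M *: V.
  apply/colP => i; rewrite !mxE -Cu; apply: eq_bigr => j _; by rewrite !mxE.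
have DV : D^T *m dpowv p V = M *: (invmx B *m U).
  by rewrite scalemxAr -EC -mulmxA mulKmx.
have BU : B^T *m dpowv p U = M *: (invmx D *m V).
  by rewrite scalemxAr -ECt trmx_mul trmxK -mulmxA mulKmx.
pose g (t : R) : E := (lpcos p t *: (invmx B *m U), lpsin p t *: (invmx D *m V)).
pose T : R := pi *+ 2.
pose l (t : R) := - (lprate p t / (p * M)).
have dv s (w : 'cV[R]_n.+1) : dpowv p (s *: w) = dpow p s *: dpowv p w.
  apply/colP => i; rewrite !mxE /dpow sgrM normrM powRM //; ring.
have g1 t : F (g t) = 1.
  rewrite /gauge big_bool /lpform /g /=.
  rewrite [X in X + _](eq_bigr (fun i => `|lpsin p t| `^ p * `|v i| `^ p)) => [|i _]; last first.
    by rewrite -scalemxAr mulKVmx // !mxE normrM powRM.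
  rewrite [X in _ + X](eq_bigr (fun i => `|lpcos p t| `^ p * `|u i| `^ p)) => [|i _]; last first.
    by rewrite -scalemxAr mulKVmx // !mxE normrM powRM.
  by rewrite -!mulr_sumr u1 v1 !mulr1 addrC lp_circle.
have fieldE t : l t *: Jm (dF (g t)) =
    (- (dpow p (lpsin p t) * lprate p t) *: (invmx B *m U), dpow p (lpcos p t) * lprate p t *: (invmx D *m V)) :> E.
  rewrite /Jm /grad_gauge /g /= -!scalemxAr !mulKVmx // !dv -!scalemxAr DV BU.
  have e x : l t * (p * (x * M)) = - (x * lprate p t) by rewrite /l; field; rewrite !gt_eqF.
  have e1 x (w : 'cV[R]_n.+1) : l t *: (p *: (x *: (M *: w))) = - (x * lprate p t) *: w.
    by rewrite !scalerA -e !mulrA.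
  by congr pair; rewrite /= ?scalerN e1 ?scaleNr ?opprK.
have dg (t : R) : is_derive t (1 : R) g (l t *: Jm (dF (g t))).
  rewrite fieldE; apply: is_derive_phase => b i; case: b.
    rewrite (_ : (fun s => _) = (fun s => lpsin p s * (invmx D *m V) i ord0)); last first.
      by apply/funext => s; rewrite /pcoord /g /= mxE.
    rewrite [X in is_derive _ _ _ X](_ : _ = dpow p (lpcos p t) * lprate p t * (invmx D *m V) i ord0); last first.
      by rewrite /pcoord /= mxE.
    have h := is_derive_lpsin hp t.
    by apply: is_derive_eq; rewrite /GRing.scale /=; ring.
  rewrite (_ : (fun s => _) = (fun s => lpcos p s * (invmx B *m U) i ord0)); last first.
    by apply/funext => s; rewrite /pcoord /g /= mxE.
  rewrite [X in is_derive _ _ _ X](_ : _ = - (dpow p (lpsin p t) * lprate p t) * (invmx B *m U) i ord0); last first.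
    by rewrite /pcoord /= mxE.
  have h := is_derive_lpcos hp t.
  by apply: is_derive_eq; rewrite /GRing.scale /=; ring.
have dgE t : derive1 g t = l t *: Jm (dF (g t)).
  by rewrite derive1E; exact: (@derive_val _ _ _ _ _ _ _ (dg t)).
have cl : continuous l.
  have c1 : continuous (fun t => lprate p t / (p * M)).
    by apply: cont_mul (cont_lprate hp) _; exact: cst_continuous.
  by move=> t; apply: cvgN; exact: c1.
have cg : continuous g.
  by move=> t; apply: differentiable_continuous; apply/derivable1_diffP; have [] := dg t.
have l0 t : l t != 0.
  by rewrite oppr_eq0 mulf_neq0 // ?invr_eq0 ?mulf_neq0 ?gt_eqF // lprate_gt0.
have T0 : 0 < T by rewrite mulrn_wgt0 // pi_gt0.
exists g, T; split.
  split.
  - by split; [exact: T0 | move=> t; rewrite /g lpcos_period lpsin_period].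
  - split; first by move=> t; have [] := dg t.
    have -> : derive1 g = (fun t => l t *: Jm (dF (g t))) by apply/funext.
    move=> t; apply: cvgZ; first exact: cl.
    have c1 : continuous (fun t => dF (g t)) by exact: (@cont_comp R E E dF g cg (@grad_gauge_continuous R n.+1 p B D hp)).
    exact: (@cont_comp R E E (@Jm R n.+1) (fun t => dF (g t)) c1 (@Jm_continuous R n.+1)).
  - by move=> t; rewrite boundaryE.
  - move=> t; rewrite dgE; split.
      by rewrite scaler_eq0 negb_or l0 /=; exact: (Jm_grad_neq0 hp (g1 t)).
    rewrite kernelE //; apply/seteqP; split => w /= [s _ <-].
      by exists (s / l t) => //; rewrite scalerA divfK.
    by exists (s * l t) => //; rewrite scalerA.
have act : action g T = 2 * half_area p / M.
  have e : (fun t => omega (g t) (derive1 g t)) = (fun t => M^-1 * lprate p t).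
    by apply/funext => t; rewrite dgE omega_field // /l; field; rewrite !gt_eqF.
  rewrite /action e (period_scale T0 _ (cont_lprate hp)) integral_lprate //.
  by field; rewrite gt_eqF.
by rewrite act ger0_norm // divr_ge0 ?(ltW M0) // mulr_ge0 //; apply: Rintegral_ge0 => s _; exact: wcirc_ge0.
Qed.

Lemma characteristic_cEHZ :
  characteristic_actions K (cEHZ K) /\ cEHZ K = (2 * half_area p / M)%:E.
Proof.
have [g [T [gc act]]] := extremal_characteristic.
have mem : characteristic_actions K (2 * half_area p / M)%:E.
  by exists g, T; rewrite act.
have e : cEHZ K = (2 * half_area p / M)%:E.
  apply/eqP; rewrite eq_le; apply/andP; split; first exact: ereal_inf_lbound.
  apply: le_ereal_inf_tmp => _ [g' [T' [gc' ->]]]; rewrite lee_fin.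
  exact: (characteristic_action_ge hp hq uB uD gc').
by rewrite e.
Qed.
End Extremal.

(** * The area of the planar body *)

Section Lebesgue2.
Context {R : realType}.
Notation mu := (@lebesgue_measure R).

(** The product measure under a name of its own, to carry the sigma-finite structure that
    [layer_cake] asks for. *)
Definition lebesgue2 : set (measurableTypeR R * measurableTypeR R) -> \bar R := (mu \x mu)%E.

HB.instance Definition _ := Measure.on lebesgue2.

Let lebesgue2_sigma_finite : sigma_finite setT lebesgue2.
Proof.
have /sigma_finiteP[F [TF ndF Foo]] := @sigma_finiteT _ _ _ mu.
exists (fun n => F n `*` F n).
  apply/seteqP; split => // -[x y] _.
  have : [set: R] x by []; have : [set: R] y by []; rewrite TF => -[k _ Fy] [m _ Fx].
  by exists (maxn m k) => //; split => /=; [move: Fx | move: Fy]; apply/subsetPset/ndF; rewrite ?leq_maxl ?leq_maxr.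
move=> k; have [mF Fk] := Foo k; split; first exact: measurableX.
by rewrite /lebesgue2 product_measure1E // lte_mul_pinfty // ge0_fin_numE.
Qed.

HB.instance Definition _ := Measure_isSigmaFinite.Build _ _ _ lebesgue2 lebesgue2_sigma_finite.

End Lebesgue2.

Section Area.
Context {R : realType}.
Notation mu := (@lebesgue_measure R).

Lemma integral_exp_tail (c a : R) : 0 < c ->
  (\int[mu]_(x in `[a, +oo[) (expR (- (c * x)))%:E = (c^-1 * expR (- (c * a)))%:E)%E.
Proof.
move=> c0; pose F (x : R) := - (c^-1 * expR (- (c * x))).
have dF (x : R) : is_derive x (1 : R) F (expR (- (c * x))).
  have h : is_derive x (1 : R) (fun x => - (c * x)) (- c).
    by apply: is_derive_eq; rewrite /GRing.scale /=; ring.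
  have h2 := @is_derive1_comp R expR (fun x => - (c * x)) x _ _ (is_derive_expR _) h.
  rewrite (_ : F = (- c^-1) \*: (expR \o (fun x => - (c * x)))); last first.
    by apply/funext => y; rewrite /F /= -mulNr.
  rewrite (_ : expR (- (c * x)) = (- c^-1) *: (expR (- (c * x)) * - c)); first exact: is_deriveZ.
  by rewrite /GRing.scale /=; field; rewrite gt_eqF.
have cexp : continuous (fun x => expR (- (c * x))).
  apply: (@cont_comp R R R expR (fun x => - (c * x))); last exact: continuous_expR.
  by move=> x; apply: cvgN; apply: cvgM; [exact: cvg_cst | exact: cvg_id].
have cF : continuous F by exact: derive_cont dF.
rewrite (@ge0_continuous_FTC2y R (fun x => expR (- (c * x))) F a 0) //.
- by rewrite /F -EFinN opprK add0e.
- exact: continuous_subspaceT.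
- rewrite -oppr0; apply: cvgN; rewrite -(mulr0 c^-1); apply: cvgM; first exact: cvg_cst.
  rewrite (_ : (fun x => expR (- (c * x))) = (fun z => expR (- z)) \o (fun z => c * z)) //.
  apply: (@cvg_comp _ _ _ _ _ _ (pinfty_nbhs R)); last exact: cvgr_expR.
  exact: gt0_cvgMry.
- by apply: cvg_at_right_filter; exact: cF.
- by move=> x _; rewrite derive1E; exact: (@derive_val _ _ _ _ _ _ _ (dF x)).
Qed.

(** Gamma at [1 + a], kept in the extended reals so that integrals can be exchanged before
    finiteness is known. *)
Definition Gammae (a : R) : \bar R := (\int[mu]_(r in `]0%R, +oo[) (r `^ a * expR (- r))%:E)%E.

Let mGamma (a : R) (D : set R) : measurable_fun D (fun r : R => r `^ a * expR (- r)).
Proof.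
apply: (@measurable_funS _ _ _ _ setT) => //; apply: measurable_funM.
  exact: measurable_powR.
apply: continuous_measurable_fun.
apply: (@cont_comp R R R expR -%R); last exact: continuous_expR.
by move=> x; exact: opp_continuous.
Qed.

Let mexp (c : R) (D : set R) : measurable_fun D (fun r : R => expR (- (c * r))).
Proof.
apply: (@measurable_funS _ _ _ _ setT) => //; apply: continuous_measurable_fun.
apply: (@cont_comp R R R expR (fun x => - (c * x))); last exact: continuous_expR.
by move=> x; apply: cvgN; apply: cvgM; [exact: cvg_cst | exact: cvg_id].
Qed.

(** For such [a], [r^a <= 1 + r <= 2 exp (r / 2)], which leaves an integrable exponential. *)
Lemma Gammae_fin (a : R) : 0 <= a <= 1 -> Gammae a \is a fin_num.
Proof.
move=> /andP[a0 a1].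
have G0 : (0 <= Gammae a)%E by apply: integral_ge0 => r _; rewrite lee_fin mulr_ge0 ?powR_ge0 ?expR_ge0.
rewrite ge0_fin_numE //.
have hlt : (\int[mu]_(r in `[0%R, +oo[) (expR (- (2^-1 * r)))%:E < +oo)%E.
  by rewrite integral_exp_tail // ltry.
apply: (@le_lt_trans _ _ (\int[mu]_(r in `]0%R, +oo[) (2 * expR (- (2^-1 * r)))%:E)%E).
  apply: ge0_le_integral => //.
  - by move=> r _; rewrite lee_fin mulr_ge0 ?powR_ge0 ?expR_ge0.
  - by apply/measurable_EFinP; exact: mGamma.
  - by apply/measurable_EFinP; apply: measurable_funM => //; exact: mexp.
  - move=> r; rewrite /= in_itv /= andbT => r0; rewrite lee_fin.
    have h1 : r `^ a <= 1 + r.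
      have [r1|r1] := leP r 1.
        have : r `^ a <= 1 `^ a by rewrite ge0_ler_powR ?nnegrE // ltW.
        by rewrite powR1 => /le_trans; apply; rewrite lerDl ltW.
      apply: (@le_trans _ _ (r `^ 1)); last by rewrite powRr1 ?lerDr // ltW.
      by apply: ler_powR => //; exact: ltW.
    have h2 : 1 + r / 2 <= expR (r / 2) by exact: expR_ge1Dx.
    have h3 : expR (- r) = expR (- (2^-1 * r)) * expR (- (2^-1 * r)) by rewrite -expRD; congr expR; field.
    have h4 : expR (r / 2) * expR (- (2^-1 * r)) = 1 by rewrite -expRD -(expR0 R); congr expR; field.
    rewrite h3 mulrA; apply: ler_wpM2r; first exact: expR_ge0.
    apply: (@le_trans _ _ (2 * expR (r / 2) * expR (- (2^-1 * r)))).
      by apply: ler_wpM2r; [exact: expR_ge0 | lra].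
    by rewrite -mulrA h4 mulr1.
under eq_integral do rewrite EFinM.
rewrite ge0_integralZl_EFin //; last by apply/measurable_EFinP; exact: mexp.
rewrite lte_mul_pinfty ?lee_fin //; apply: le_lt_trans hlt.
apply: ge0_subset_integral => //.
- by apply/measurable_EFinP; exact: mexp.
- by move=> r /=; rewrite !in_itv /= !andbT => /ltW.
Qed.

Lemma Gammae_gt0 (a : R) : 0 <= a -> (0 < Gammae a)%E.
Proof.
move=> a0; apply: (@lt_le_trans _ _ (\int[mu]_(r in `[1%R, 2%R]) (cst (expR (- 2))%:E) r)%E).
  have E : (\int[mu]_(r in `[1%R, 2%R]) (cst (expR (- 2))%:E) r = (expR (- 2))%:E * 1)%E.
    rewrite integral_cst //; congr (_ * _)%E; apply: etrans (lebesgue_measure_itv _) _.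
    by rewrite /= lte_fin ltr1n /= -EFinB; congr EFin; ring.
  by rewrite E mule1 lte_fin expR_gt0.
apply: (@le_trans _ _ (\int[mu]_(r in `[1%R, 2%R]) (r `^ a * expR (- r))%:E)%E).
  apply: ge0_le_integral => //.
  - by move=> r _; rewrite lee_fin expR_ge0.
  - by apply/measurable_EFinP; exact: mGamma.
  - move=> r; rewrite /= in_itv /= => /andP[r1 r2]; rewrite lee_fin -[leLHS]mul1r.
    apply: ler_pM; rewrite ?expR_ge0 //.
      have : 1 `^ a <= r `^ a by rewrite ge0_ler_powR ?nnegrE // (le_trans ler01).
      by rewrite powR1.
    by rewrite ler_expR lerN2.
apply: ge0_subset_integral => //.
- by apply/measurable_EFinP; exact: mGamma.
- by move=> r _; rewrite lee_fin mulr_ge0 ?powR_ge0 ?expR_ge0.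
- by move=> r /=; rewrite !in_itv /= => /andP[r1 _]; rewrite andbT (lt_le_trans ltr01).
Qed.

(** [exp (- f x)] is the integral of [exp (- r)] over [r >= f x]; exchanging the integrals leaves
    the measures of the sublevel sets. *)
Lemma layer_cake d (X : measurableType d) (m : {sigma_finite_measure set X -> \bar R}) (f : X -> R)
    (k a : R) : measurable_fun setT f -> (forall x, 0 <= f x) -> 0 <= k ->
  (forall r, 0 < r -> m [set x : X | (f x <= r)%R] = (k * r `^ a)%:E) ->
  (m [set x : X | (f x <= 0)%R] = 0)%E ->
  (\int[m]_x (expR (- f x))%:E = k%:E * Gammae a)%E.
Proof.
move=> mf f0 k0 mr m0.
pose Y := measurableTypeR R.
pose A : set (X * Y) := [set z : X * Y | f z.1 <= z.2].
have mA : measurable A.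
  rewrite -[A]setTI; apply: measurable_fun_le => //.
  exact: (measurableT_comp mf (@measurable_fst _ _ X Y)).
pose g (z : X * Y) : \bar R := (expR (- z.2) * \1_A z)%:E.
have mg : measurable_fun setT g.
  apply/measurable_EFinP; apply: measurable_funM; last exact: measurable_indic.
  apply: (@measurableT_comp _ _ _ _ _ _ (fun r : Y => expR (- r))); last exact: (@measurable_snd _ _ X Y).
  apply: continuous_measurable_fun.
  apply: (@cont_comp R R R expR -%R); last exact: continuous_expR.
  by move=> x; exact: opp_continuous.
have g0 z : (0 <= g z)%E by rewrite lee_fin mulr_ge0 ?expR_ge0.
have E1 x : (\int[mu]_r g (x, r) = (expR (- f x))%:E)%E.
  transitivity (\int[mu]_(r in `[f x, +oo[) (expR (- (1 * r)))%:E)%E.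
    rewrite [RHS]integral_mkcond; apply: eq_integral => r _.
    rewrite /g /= indicE patchE mul1r.
    have -> : ((x, r) \in A) = (r \in `[f x, +oo[%classic).
      by apply/idP/idP; rewrite !inE /A /= in_itv /= andbT.
    by case: ifPn => _; rewrite ?mulr1 ?mulr0.
  by rewrite integral_exp_tail // invr1 !mul1r.
have E2 r : (\int[m]_x g (x, r) = (expR (- r))%:E * m [set x : X | (f x <= r)%R])%E.
  transitivity (\int[m]_x ((expR (- r))%:E * (\1_[set x : X | (f x <= r)%R] x)%:E))%E.
    by apply: eq_integral => x _; rewrite -EFinM /g /= !indicE.
  have mS : measurable [set x : X | (f x <= r)%R].
    by rewrite -[X in measurable X]setTI; apply: measurable_fun_le.
  rewrite ge0_integralZl_EFin //; last by apply/measurable_EFinP; exact: measurable_indic.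
  by rewrite integral_indic // setIT.
rewrite (eq_integral (fun x => \int[mu]_r g (x, r))%E); last by move=> x _; rewrite E1.
rewrite (@fubini_tonelli _ _ _ _ _ m mu g mg g0).
under eq_integral do rewrite E2.
transitivity (\int[mu]_(r in `]0%R, +oo[) (k%:E * (r `^ a * expR (- r))%:E))%E.
  rewrite [RHS]integral_mkcond; apply: eq_integral => r _; rewrite patchE.
  have [r0|r0] := ltP 0 r.
    have -> : r \in `]0%R, +oo[%classic by rewrite inE /= in_itv /= r0.
    by rewrite mr // -!EFinM; congr EFin; ring.
  rewrite ifF; last by apply/negbTE; rewrite notin_setE /= in_itv /= andbT; apply/negP; rewrite -leNgt.
  rewrite (_ : m _ = 0%E) ?mule0 //; apply/eqP; rewrite eq_le measure_ge0 andbT -m0.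
  apply: le_measure; rewrite ?inE.
  - by rewrite -[X in measurable X]setTI; apply: measurable_fun_le.
  - by rewrite -[X in measurable X]setTI; apply: measurable_fun_le.
  - by move=> x /= /le_trans; apply.
rewrite ge0_integralZl //; last by move=> r _; rewrite lee_fin mulr_ge0 ?powR_ge0 ?expR_ge0.
by apply/measurable_EFinP; exact: mGamma.
Qed.

Variable p : R.
Hypothesis hp : 2 <= p.
Let p0 : 0 < p := p_gt0 hp.

Let abs_le (t a : R) : 0 <= a -> (`|t| `^ p <= a) = (`|t| <= a `^ p^-1).
Proof.
move=> a0; have e : a = (a `^ p^-1) `^ p by rewrite -powRrM mulVf ?gt_eqF // powRr1.
apply/idP/idP => h; last by rewrite e ge0_ler_powR ?nnegrE ?powR_ge0 ?(ltW p0).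
rewrite leNgt; apply/negP => h2.
have : (a `^ p^-1) `^ p < `|t| `^ p by rewrite gt0_ltr_powR ?nnegrE ?powR_ge0.
by rewrite -e ltNge h.
Qed.

Lemma lp_interval (a : R) : mu [set t : R | `|t| `^ p <= a] = (2 * (Num.max 0 a) `^ p^-1)%:E.
Proof.
have [a0|a0] := leP 0 a.
  have -> : [set t : R | `|t| `^ p <= a] = `[- (a `^ p^-1), a `^ p^-1]%classic.
    by apply/seteqP; split => t /=; rewrite in_itv /= abs_le // ler_norml.
  rewrite lebesgue_measure_itv /= lte_fin.
  case: ifPn => h; first by rewrite -EFinB opprK; congr EFin; ring.
  have : a `^ p^-1 <= 0.
    by move: h; rewrite -leNgt; have := powR_ge0 a p^-1; lra.
  move=> h1; have -> : a `^ p^-1 = 0 by apply: le_anti; rewrite h1 powR_ge0.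
  by rewrite mulr0.
have -> : [set t : R | `|t| `^ p <= a] = set0.
  apply/seteqP; split => t //=; by rewrite leNgt (lt_le_trans a0) ?powR_ge0.
by rewrite measure0 powR0 ?mulr0 // invr_eq0 gt_eqF.
Qed.

Lemma lp_region (r : R) : 0 <= r ->
  ((mu \x mu) [set st : R * R | (`|st.1| `^ p + `|st.2| `^ p <= r)%R])%E = (2 * half_area p * r `^ (2 / p))%:E.
Proof.
move=> r0; rewrite /product_measure1.
transitivity (\int[mu]_s (2 * (Num.max 0 (r - `|s| `^ p)) `^ p^-1)%:E)%E.
  apply: eq_integral => s _; rewrite -lp_interval; congr (mu _).
  by apply/seteqP; split => t /=; rewrite /xsection /= inE /= lerBrDl.
pose rho := r `^ p^-1.
have rhop : rho `^ p = r by rewrite /rho -powRrM mulVf ?gt_eqF // powRr1.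
have rho0 : 0 <= rho by exact: powR_ge0.
have [rz|rn] := eqVneq r 0.
  rewrite rz powR0 ?mulr0; last by rewrite mulf_neq0 ?invr_eq0 ?gt_eqF.
  rewrite integral0_eq // => s _; rewrite max_l; last by rewrite sub0r oppr_le0 powR_ge0.
  by rewrite powR0 ?mulr0 // invr_eq0 gt_eqF.
have rp : 0 < r by rewrite lt_neqAle eq_sym rn.
have rhopos : 0 < rho by exact: powR_gt0.
transitivity (\int[mu]_(s in `[(- rho)%R, rho]) (2 * rho * wcirc p (s / rho))%:E)%E.
  rewrite [RHS]integral_mkcond; apply: eq_integral => s _; rewrite patchE; case: ifPn => sin; last first.
    rewrite notin_setE /= in_itv /= -ler_norml in sin.
    rewrite max_l ?powR0 ?mulr0 ?invr_eq0 ?gt_eqF // subr_le0 leNgt; apply/negP => /ltW.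
    by rewrite abs_le.
  rewrite inE /= in_itv /= -ler_norml in sin.
  have h1 : 0 <= r - `|s| `^ p by rewrite subr_ge0 abs_le.
  have e1 : `|s / rho| `^ p = `|s| `^ p / r.
    by rewrite normrM normfV (gtr0_norm rhopos) powR_div // rhop.
  rewrite max_r // /wcirc e1 max_r; last by rewrite subr_ge0 ler_pdivrMr // mul1r -subr_ge0.
  congr EFin; rewrite -mulrA; congr (_ * _); rewrite {1}/rho -powRM //; last first.
    by rewrite subr_ge0 ler_pdivrMr // mul1r -subr_ge0.
  by congr (_ `^ _); field; rewrite gt_eqF.
have [W dW] := primitive_ex (cont_wcirc hp).
have WE : W 1 - W (-1) = half_area p.
  by rewrite /half_area (primitive_Rintegral (cont_wcirc hp) _ dW) //; lra.
have cw : continuous (fun s : R => 2 * rho * wcirc p (s / rho)).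
  apply: cont_mul; first exact: cst_continuous.
  apply: (@cont_comp R R R (wcirc p) (fun s : R => s / rho)); last exact: cont_wcirc.
  by move=> x; apply: cvgM; [exact: cvg_id | exact: cvg_cst].
have dG (s : R) : is_derive s (1 : R) (fun s : R => 2 * rho ^+ 2 * W (s / rho)) (2 * rho * wcirc p (s / rho)).
  have h1 : is_derive s (1 : R) (fun s : R => s / rho) (rho^-1).
    by apply: is_derive_eq; rewrite /GRing.scale /=; ring.
  have h2 := @is_derive1_comp R W (fun s : R => s / rho) s _ _ (dW _) h1.
  have h3 := is_deriveZ (2 * rho ^+ 2) h2.
  rewrite (_ : 2 * rho * wcirc p (s / rho) = 2 * rho ^+ 2 *: (wcirc p (s / rho) * rho^-1)) //.
  by rewrite /GRing.scale /=; field; rewrite gt_eqF.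
have lt1 : - rho < rho by lra.
have := primitive_Rintegral cw lt1 dG; rewrite /Rintegral.
have fi := continuous_integrable (- rho) rho cw.
have /fineK <- : (\int[mu]_(x in `[(- rho)%R, rho]) (2 * rho * wcirc p (x / rho))%:E)%E \is a fin_num.
  by apply: integrable_fin_num => //; exact: fi.
move=> /= ->; rewrite divff ?gt_eqF // mulNr divff ?gt_eqF //; congr EFin.
have -> : r `^ (2 / p) = rho ^+ 2 by rewrite /rho -powR_mulrn ?powR_ge0 // -powRrM; congr (_ `^ _); ring.
by rewrite -WE; ring.
Qed.

Lemma c0E : c0 p = 2 * half_area p.
Proof. by rewrite /c0 /lp_disc lp_region // powR1 mulr1. Qed.

(** The sublevel sets have length [2 r^(1/p)] on the line and area [c0 r^(2/p)] in the plane, and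
    the layer formula turns these powers into the two Gamma values. *)
Lemma c0_Gamma : 0 < Gamma (1 + 2 / p) /\ c0 p * Gamma (1 + 2 / p) = 4 * Gamma (1 + 1 / p) ^+ 2.
Proof.
have GE (a : R) : Gamma (1 + a) = fine (Gammae a) by rewrite /Gamma /Gammae /Rintegral addrAC subrr add0r.
have ip0 : 0 <= 1 / p <= 1 by rewrite divr_ge0 ?(ltW p0) //= ler_pdivrMr // mul1r; have := hp; lra.
have tp0 : 0 <= 2 / p <= 1 by rewrite divr_ge0 ?(ltW p0) //= ler_pdivrMr // mul1r.
have F1 := Gammae_fin ip0; have F2 := Gammae_fin tp0.
have cabs : continuous (fun s : R => `|s| `^ p) := cont_powabs p0.
have mabs : measurable_fun setT (fun s : R => `|s| `^ p) by exact: continuous_measurable_fun.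
have I1 : (\int[mu]_s (expR (- (`|s| `^ p)))%:E = 2%:E * Gammae (1 / p))%E.
  apply: layer_cake => //.
  - by move=> r r0; apply: etrans (lp_interval _) _; rewrite max_r ?(ltW r0) // mul1r.
  - by apply: etrans (lp_interval _) _; rewrite max_l // powR0 ?mulr0 // invr_eq0 gt_eqF.
have k0 : 0 <= half_area p by apply: Rintegral_ge0 => s _; exact: wcirc_ge0.
have m2 : measurable_fun setT (fun st : measurableTypeR R * measurableTypeR R => `|st.1| `^ p + `|st.2| `^ p).
  apply: measurable_funD.
    by apply: (@measurableT_comp _ _ _ _ _ _ (fun s : R => `|s| `^ p)) => //; exact: measurable_fst.
  by apply: (@measurableT_comp _ _ _ _ _ _ (fun s : R => `|s| `^ p)) => //; exact: measurable_snd.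
have I2 : (\int[(mu \x mu)]_st (expR (- (`|st.1| `^ p + `|st.2| `^ p)))%:E = (2 * half_area p)%:E * Gammae (2 / p))%E.
  apply: (@layer_cake _ _ (@lebesgue2 R) (fun st => `|st.1| `^ p + `|st.2| `^ p) (2 * half_area p) (2 / p) m2).
  - by move=> x; rewrite addr_ge0 ?powR_ge0.
  - by rewrite mulr_ge0.
  - by move=> r r0; apply: lp_region; exact: ltW.
  - by apply: etrans (lp_region _) _; rewrite // powR0 ?mulr0 // mulf_neq0 ?invr_eq0 ?gt_eqF.
have mexp2 : measurable_fun setT (fun s : R => expR (- (`|s| `^ p))).
  apply: continuous_measurable_fun.
  apply: (@cont_comp R R R expR (fun s => - (`|s| `^ p))); last exact: continuous_expR.
  by move=> x; apply: cvgN; exact: cabs.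
have I3 : (\int[(mu \x mu)]_st (expR (- (`|st.1| `^ p + `|st.2| `^ p)))%:E =
    (2%:E * Gammae (1 / p)) * (2%:E * Gammae (1 / p)))%E.
  rewrite fubini_tonelli1; last 2 first.
  - apply/measurable_EFinP; apply: (@measurableT_comp _ _ _ _ _ _ (fun r : R => expR (- r))) => //.
    apply: continuous_measurable_fun; apply: (@cont_comp R R R expR -%R); last exact: continuous_expR.
    by move=> x; exact: opp_continuous.
  - by move=> x; rewrite lee_fin expR_ge0.
  rewrite /fubini_F -{1}I1 -ge0_integralZr //; last 2 first.
  - by apply/measurable_EFinP; exact: mexp2.
  - by rewrite -I1 integral_ge0 // => x _; rewrite lee_fin expR_ge0.
  apply: eq_integral => s _; rewrite -I1 -ge0_integralZl //; last by apply/measurable_EFinP; exact: mexp2.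
  by apply: eq_integral => t _; rewrite /= opprD expRD EFinM.
have G2 : 0 < Gamma (1 + 2 / p).
  rewrite GE fine_gt0 // Gammae_gt0 /=; last by case/andP: tp0.
  by rewrite -ge0_fin_numE // ltW // Gammae_gt0 //; case/andP: tp0.
split => //; move: I2; rewrite I3 -(fineK F1) -(fineK F2) -!GE -!EFinM => -[] h.
by rewrite c0E -h; ring.
Qed.
End Area.

(** * Symplectic embeddings of planar regions into discs *)

Section Profile.
Context {R : realType}.
Variables (p M e d : R).
Hypotheses (hp : 2 <= p) (M0 : 0 < M) (e0 : 0 < e) (d0 : 0 < d).
Let p0 : 0 < p := p_gt0 hp.

(** For general [p] the [p]-th power of the absolute value is not smooth at 0; the shift by [d]
    removes the singularity and [e] compensates for it. [height] is the upper boundary of the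
    enlarged planar region. *)
Definition height_arg (x : R) : R := 1 + e - (x ^+ 2 + d) `^ (p / 2).
Definition height (x : R) : R := Num.max 0 (height_arg x) `^ p^-1 / M.
Definition height_rad : R := (1 + e) `^ p^-1.

Let sq_abs (x : R) : (x ^+ 2) `^ (p / 2) = `|x| `^ p.
Proof.
rewrite -(real_normK (num_real x)) -powR_mulrn ?normr_ge0 // -powRrM.
by congr (_ `^ _); field.
Qed.

Lemma height_arg_le x : height_arg x <= 1 + e - `|x| `^ p.
Proof.
have := p0; move=> pp; rewrite /height_arg lerD2l lerN2 -sq_abs ge0_ler_powR ?nnegrE ?sqr_ge0 //.
- by rewrite divr_ge0 // ltW.
- by rewrite addr_ge0 ?sqr_ge0 // ltW.
- by rewrite lerDl ltW.
Qed.

Lemma cont_profile_arg : continuous height_arg.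
Proof.
apply: cont_sub; first exact: cst_continuous.
apply: cont_powR; first by rewrite divr_gt0.
  by move=> x; rewrite addr_ge0 ?sqr_ge0 // ltW.
apply: cont_add; last exact: cst_continuous.
by move=> x; apply: cvgM; exact: cvg_id.
Qed.

Lemma cont_profile : continuous height.
Proof.
apply: cont_mul; last exact: cst_continuous.
apply: cont_powR; first by rewrite invr_gt0.
  by move=> x; rewrite le_max lexx.
by move=> x; apply: continuous_max; [exact: cst_continuous | exact: cont_profile_arg].
Qed.

Lemma height_ge0 x : 0 <= height x.
Proof. by rewrite divr_ge0 ?powR_ge0 // ltW. Qed.

Lemma height_gt0 x : (0 < height x) = (0 < height_arg x).
Proof.
rewrite /height; have [h|h] := leP (height_arg x) 0.
  by rewrite powR0 ?mul0r ?ltxx // ?invr_eq0 gt_eqF.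
by rewrite divr_gt0 ?powR_gt0.
Qed.

Lemma height_pos x : 0 < height_arg x -> height x = height_arg x `^ p^-1 / M.
Proof. by move=> h; rewrite /height max_r // ltW. Qed.

Lemma height_gt0_between x y c : 0 < height x -> 0 < height y -> x <= c <= y -> 0 < height c.
Proof.
have E a : (0 < height a) = ((a ^+ 2 + d) `^ (p / 2) < 1 + e) by rewrite height_gt0 /height_arg subr_gt0.
have E1 a : 0 < height a -> (a ^+ 2 + d) `^ (p / 2) < 1 + e by rewrite E.
have E2 a : (a ^+ 2 + d) `^ (p / 2) < 1 + e -> 0 < height a by rewrite E.
move=> /E1 hx /E1 hy /andP[xc cy]; apply: E2.
 have mono (a : R) : `|c| <= `|a| -> (a ^+ 2 + d) `^ (p / 2) < 1 + e -> (c ^+ 2 + d) `^ (p / 2) < 1 + e.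
  move=> ca; apply: le_lt_trans; rewrite ge0_ler_powR ?nnegrE ?addr_ge0 ?sqr_ge0 ?(ltW d0) //.
    by rewrite divr_ge0 // ltW.
  by rewrite lerD2r -[c ^+ 2]real_normK ?num_real // -[a ^+ 2]real_normK ?num_real // lerXn2r ?nnegrE.
have [c0|c0] := leP 0 c.
  by apply: (mono y) => //; rewrite !ger0_norm // (le_trans c0).
by apply: (mono x) => //; rewrite !ltr0_norm ?lerN2 // (le_lt_trans xc).
Qed.

Lemma height_rad_gt0 : 0 < height_rad.
Proof. by rewrite powR_gt0 // ltr_wpDl. Qed.

Let radp : height_rad `^ p = 1 + e.
Proof. by rewrite /height_rad -powRrM mulVf ?gt_eqF // powRr1 // addr_ge0 // ltW. Qed.

Lemma height_le x : height x <= height_rad / M * wcirc p (x / height_rad).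
Proof.
have r0 := height_rad_gt0; have e1 : 0 < 1 + e by rewrite addr_gt0.
have E : `|x / height_rad| `^ p = `|x| `^ p / (1 + e).
  by rewrite normrM normfV (gtr0_norm r0) powR_div // radp.
rewrite /height /wcirc E mulrAC ler_pM2r ?invr_gt0 // {1}/height_rad -powRM; last 2 first.
- exact: ltW.
- by rewrite le_max lexx.
rewrite ge0_ler_powR ?nnegrE ?le_max ?lexx ?invr_ge0 ?(ltW p0) //.
  by rewrite mulr_ge0 ?le_max ?lexx // ltW.
rewrite maxr_pMr ?(ltW e1) // mulr0 mulrBr mulr1 mulrCA divff ?gt_eqF // mulr1.
rewrite ge_max le_max lexx /= le_max; apply/orP; right; exact: height_arg_le.
Qed.

Lemma height_lt_rad x : 0 < height x -> `|x| < height_rad.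
Proof.
rewrite height_gt0 => h; have := lt_le_trans h (height_arg_le x); rewrite subr_gt0 -radp => h2.
rewrite ltNge; apply/negP => h3.
have : height_rad `^ p <= `|x| `^ p by rewrite ge0_ler_powR ?nnegrE ?(ltW p0) ?(ltW height_rad_gt0).
by rewrite leNgt h2.
Qed.

Lemma height_area (W : R -> R) : (forall x, is_derive x (1 : R) W (height x)) ->
  W height_rad - W (- height_rad) <= height_rad ^+ 2 * half_area p / M.
Proof.
move=> dW; have r0 := height_rad_gt0; have le := height_le.
have [V dV] := primitive_ex (cont_wcirc hp).
have VE : V 1 - V (-1) = half_area p.
  by rewrite /half_area (primitive_Rintegral (cont_wcirc hp) _ dV) //; lra.
move: (height_rad) r0 le => rho r0 le.
have dG (s : R) : is_derive s (1 : R) (fun s : R => rho ^+ 2 / M * V (s / rho)) (rho / M * wcirc p (s / rho)).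
  have h1 : is_derive s (1 : R) (fun s : R => s / rho) (rho^-1).
    by apply: is_derive_eq; rewrite /GRing.scale /=; ring.
  have h2 := @is_derive1_comp R V (fun s : R => s / rho) s _ _ (dV _) h1.
  apply: (derive_as (is_deriveZ (rho ^+ 2 / M) h2)).
  by rewrite /GRing.scale /=; field; rewrite !gt_eqF.
have rr : - rho <= rho by rewrite ge0_cp // ltW.
apply: (le_trans (primitive_le rr dW dG (fun x _ => le x))).
rewrite divff ?gt_eqF // mulNr divff ?gt_eqF // -mulrBr VE.
by rewrite mulrAC.
Qed.

End Profile.

(** The mean value theorem for the power [p / 2], between [x^2] and [x^2 + d] and thus within
    [[0, 2]], bounds the loss by [d k < e]. *)
Lemma height_smoothing {R : realType} (p e : R) : 2 <= p -> 0 < e ->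
  exists2 d, 0 < d & forall x : R, `|x| <= 1 -> 1 - `|x| `^ p < height_arg p e d x.
Proof.
move=> hp e0; pose m := p / 2; have m1 : 1 <= m by rewrite /m; lra.
have m0 : 0 < m by lra.
pose k := m * 2 `^ (m - 1); have k0 : 0 < k by rewrite mulr_gt0 // powR_gt0.
exists (Num.min 1 (e / (2 * k))); first by rewrite lt_min ltr01 divr_gt0 // mulr_gt0.
set d := Num.min _ _ => x x1.
have d0 : 0 < d by rewrite lt_min ltr01 divr_gt0 // mulr_gt0.
have d1 : d <= 1 by rewrite ge_min lexx.
have d2 : d * k < e.
  have : d <= e / (2 * k) by rewrite ge_min lexx orbT.
  have k2 : 0 < 2 * k by rewrite mulr_gt0.
  rewrite ler_pdivlMr // => h; apply: le_lt_trans (_ : e / 2 < e); last by rewrite ltr_pdivrMr // ltr_pMr // ltr1n.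
  by rewrite ler_pdivlMr // -mulrA (mulrC k).
have t0 : 0 <= x ^+ 2 by exact: sqr_ge0.
have t1 : x ^+ 2 <= 1 by rewrite -[x ^+ 2]real_normK ?num_real // expr_le1.
have -> : `|x| `^ p = (x ^+ 2) `^ m.
  rewrite -[x ^+ 2]real_normK ?num_real // -powR_mulrn ?normr_ge0 // -powRrM.
  by congr (_ `^ _); rewrite /m; field.
rewrite /height_arg -/m; move: (x ^+ 2) t0 t1 => t t0 t1.
have td : t < t + d by rewrite ltrDl.
have [| |c] := @MVT R (fun s => `|s| `^ m) (fun s => m * s `^ (m - 1)) t (t + d) td.
- move=> s; rewrite in_itv /= => /andP[ts _]; have s0 : 0 < s by exact: le_lt_trans ts.
  apply: near_eq_is_derive (is_derive1_powR m s0).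
  near=> u; rewrite ger0_norm //; apply: ltW; near: u; exact: lt_nbhsr.
- by apply: continuous_subspaceT; exact: cont_powabs.
rewrite in_itv /= => /andP[tc ctd] E.
have : c `^ (m - 1) <= 2 `^ (m - 1).
  by rewrite ge0_ler_powR ?nnegrE //; lra.
move=> h; have : (t + d) `^ m - t `^ m <= d * k.
  rewrite ger0_norm ?addr_ge0 ?(ltW d0) // ger0_norm // in E.
  by rewrite E (addrC t) addrK mulrC ler_pM2l // /k ler_pM2l.
by move: (_ `^ m) (_ `^ m) (d * k) d2 => a b u *; lra.
Unshelve. all: by end_near.
Qed.

Section Angle.
Context {R : realType}.
Variables (r rho : R) (h W : R -> R).
Hypothesis r0 : 0 < r.
Hypothesis h0 : forall x, 0 <= h x.
Hypothesis h_rho : forall x, 0 < h x -> `|x| < rho.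
Hypothesis h_between : forall x y c, 0 < h x -> 0 < h y -> x <= c <= y -> 0 < h c.
Hypothesis dW : forall x, is_derive x (1 : R) W (h x).
Hypothesis area : W rho - W (- rho) < pi * r ^+ 2 / 2.

(** The area of the upper half disc of radius [r] to the left of [r sin t], up to a constant that
    makes [G] odd; [H] is the centred area under [h]. The angle solves [G (th x) = H x]. *)
Let G (t : R) := r ^+ 2 / 4 * (2 * t + sin (2 * t)).
Let H (x : R) := W x - (W rho + W (- rho)) / 2.

Let dG (t : R) : is_derive t (1 : R) G (r ^+ 2 * cos t ^+ 2).
Proof.
have h2 : is_derive t (1 : R) (fun t : R => 2 * t) 2.
  by apply: is_derive_eq; rewrite /GRing.scale /=; ring.
have h3 := @is_derive1_comp R sin (fun t : R => 2 * t) t _ _ (is_derive_sin _) h2.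
apply: (derive_as (is_deriveZ (r ^+ 2 / 4) (is_deriveD h2 h3))).
by rewrite /GRing.scale /= mulr_natl cosD -!expr2 (sin2cos2 t); field.
Qed.

Let cG : continuous G := derive_cont dG.

Let G_mono (s t : R) : - (pi / 2) < s -> s < t -> t < pi / 2 -> G s < G t.
Proof.
move=> hs st ht.
have [|c] := @MVT R G (fun s => r ^+ 2 * cos s ^+ 2) s t st (fun x _ => dG x).
  exact: continuous_subspaceT.
rewrite in_itv /= => /andP[sc ct] E.
rewrite -subr_gt0 E mulr_gt0 ?subr_gt0 // mulr_gt0 ?exprn_gt0 // cos_gt0_pihalf //.
by rewrite (lt_trans hs sc) (lt_trans ct ht).
Qed.

Let G_inj (s t : R) : - (pi / 2) < s < pi / 2 -> - (pi / 2) < t < pi / 2 -> G s = G t -> s = t.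
Proof.
move=> /andP[s1 s2] /andP[t1 t2] E; have [st|ts|//] := ltgtP s t.
  by have := G_mono s1 st t2; rewrite E ltxx.
by have := G_mono t1 ts s2; rewrite E ltxx.
Qed.

Let G_surj (y : R) : `|y| < pi * r ^+ 2 / 4 -> exists2 t, - (pi / 2) < t < pi / 2 & G t = y.
Proof.
have pi0 := @pi_gt0 R; move=> hy.
have Gp : G (pi / 2) = pi * r ^+ 2 / 4.
  by rewrite /G (_ : 2 * (pi / 2) = pi) ?sinpi; [field | field].
have Gm : G (- (pi / 2)) = - (pi * r ^+ 2 / 4).
  by rewrite /G (_ : 2 * (- (pi / 2)) = - pi) ?sinN ?sinpi; [field | field].
have le : - (pi / 2) <= pi / 2 :> R by rewrite ge0_cp // divr_ge0 // ltW.
have [| |t] := @IVT R G (- (pi / 2)) (pi / 2) y le.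
- exact: continuous_subspaceT.
- move: hy; rewrite ltr_norml Gp Gm => /andP[y1 y2].
  by rewrite ge_min le_max (ltW y1) (ltW y2) orbT.
rewrite in_itv /= => /andP[t1 t2] E; exists t => //.
rewrite !lt_neqAle t1 t2 !andbT; apply/andP; split; apply/eqP => tE.
  by move: hy; rewrite -E -tE Gm normrN ltr_norml ltxx andbF.
by move: hy; rewrite -E tE Gp ltr_norml ltxx andbF.
Qed.

Let W_mono (x y : R) : x <= y -> W x <= W y.
Proof.
move=> xy; have := primitive_le xy (fun x => is_derive_cst (0 : R) x (1 : R)) dW (fun x _ => h0 x).
by rewrite subrr subr_ge0.
Qed.

Let H_lt (x : R) : `|x| < rho -> `|H x| < pi * r ^+ 2 / 4.
Proof.
rewrite ltr_norml => /andP[/ltW/W_mono x1 /ltW/W_mono x2].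
rewrite ltr_norml /H; have := area; move: (W x) (W rho) (W (- rho)) (pi * r ^+ 2) x1 x2 => a b c u.
by move=> *; apply/andP; split; lra.
Qed.

(** The strict inequality of areas keeps the angle in the open interval, where [cos] is positive and
    [G] has a differentiable inverse. *)
Lemma angle_ex : exists th : R -> R,
  (forall x, 0 < h x -> - (pi / 2) < th x < pi / 2 /\
     is_derive x (1 : R) th (h x / (r ^+ 2 * cos (th x) ^+ 2))) /\
  (forall x y, 0 < h x -> 0 < h y -> th x = th y -> x = y).
Proof.
pose g y := xget 0 [set t | - (pi / 2) < t < pi / 2 /\ G t = y].
have gP y : `|y| < pi * r ^+ 2 / 4 -> - (pi / 2) < g y < pi / 2 /\ G (g y) = y.
  move=> /G_surj [t t1 t2]; rewrite /g; case: xgetP => [s _ []//|/(_ t)]; case; split => //.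
have gK t : - (pi / 2) < t < pi / 2 -> g (G t) = t.
  move=> ht; rewrite /g; case: xgetP => [s _ [s1 s2]|/(_ t)]; first exact: G_inj.
  by case; split.
have HP x : 0 < h x -> - (pi / 2) < g (H x) < pi / 2 /\ G (g (H x)) = H x.
  by move=> /h_rho /H_lt; exact: gP.
have dH x : is_derive x (1 : R) H (h x).
  by apply: (derive_as (is_deriveB (dW x) (is_derive_cst _ x (1 : R)))); rewrite subr0.
exists (g \o H); split=> [x hx|x y hx hy E].
  have [t1 t2] := HP x hx; split => //.
  have c0 : 0 < cos (g (H x)) by exact: cos_gt0_pihalf.
  have near_t : \forall s \near g (H x), - (pi / 2) < s < pi / 2.
    case/andP: t1 => t1 t1'; near=> s; apply/andP; split; near: s.
      exact: lt_nbhsr.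
    exact: lt_nbhsl.
  have dg : is_derive (G (g (H x))) (1 : R) g (r ^+ 2 * cos (g (H x)) ^+ 2)^-1.
    have gKn : {near g (H x), cancel G g} by apply: filterS near_t => s; exact: gK.
    have cGn : {near g (H x), continuous G} by near=> s; exact: cG.
    have l0 : r ^+ 2 * cos (g (H x)) ^+ 2 != 0 by rewrite mulf_neq0 ?expf_neq0 ?gt_eqF.
    exact: (is_derive_inverse gKn cGn (dG _) l0).
  rewrite t2 in dg.
  apply: (derive_as (@is_derive1_comp R g H x _ _ dg (dH x))).
  by rewrite /= mulrC.
have {}E : W x = W y.
  have [_ e1] := HP x hx; have [_ e2] := HP y hy; move: E; rewrite /= => E.
  by move: e2; rewrite -E e1 /H => /addIr.
wlog xy : x y hx hy E / x < y.
  move=> wl; have [xy|yx|//] := ltgtP x y; first exact: wl.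
  by apply/esym; apply: wl.
have cW : continuous W := derive_cont dW.
have [|c] := @MVT R W h x y xy (fun x _ => dW x); first exact: continuous_subspaceT.
rewrite in_itv /= => /andP[xc cy] E2.
have : 0 < h c by apply: (h_between hx hy); rewrite !ltW.
have : h c * (y - x) = 0 by rewrite -E2 E subrr.
move=> /eqP; rewrite mulf_eq0 subr_eq0 (gt_eqF xy) orbF => /eqP ->.
by rewrite ltxx.
Unshelve. all: by end_near.
Qed.

End Angle.

(** * A class of smooth maps *)

Section NearDiff.
Context {R : realType} (V W : normedModType R).

Lemma near_eq_diff (f g : V -> W) (z : V) : (\forall x \near z, f x = g x) ->
  differentiable f z -> differentiable g z /\ ('d g z = 'd f z :> (V -> W)).
Proof.
move=> fg df; have [cf Ef] := (diff_locallyP z f).1 df.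
have gz : g z = f z by exact/esym/(nbhs_singleton fg).
have Eg : g \o shift z = cst (g z) + 'd f z +o_ 0 id.
  apply/eqaddoP => e e0; have /eqaddoP/(_ e e0) := Ef.
  have nz : \forall h \near (0 : V), f (h + z) = g (h + z).
    by move: fg; rewrite (near_shift 0) /=; apply: filterS => h; rewrite subr0.
  by apply: filterS2 nz => h e1; rewrite !fctE /= e1 gz.
have E := diff_unique cf Eg.
split; last exact: E.
by apply/diff_locallyP; rewrite E; split; [exact: cf | exact: Eg].
Qed.

Lemma is_diff_scalel (k : V -> R) (dk : V -> R) (w : W) (z : V) :
  is_diff z k dk -> is_diff z (fun x => k x *: w) (fun v => dk v *: w).
Proof.
move=> [dk1 dk2]; apply: DiffDef; first exact: differentiableZl.
by rewrite diffZl // dk2.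
Qed.

End NearDiff.

Section SmoothFun.
Context {R : realType}.

(** A class of expressions that is closed under derivation on [J] as soon as it contains the
    derivative of [th]. It reduces smoothness of all orders to one induction. *)
Inductive smooth_fun (J : set R) (th : R -> R) : (R -> R) -> Prop :=
| smooth_cst c : smooth_fun J th (fun _ => c)
| smooth_id : smooth_fun J th (fun x => x)
| smooth_add u v : smooth_fun J th u -> smooth_fun J th v -> smooth_fun J th (fun x => u x + v x)
| smooth_mul u v : smooth_fun J th u -> smooth_fun J th v -> smooth_fun J th (fun x => u x * v x)
| smooth_inv u : (forall x, J x -> u x != 0) -> smooth_fun J th u -> smooth_fun J th (fun x => (u x)^-1)
| smooth_pow a u : (forall x, J x -> 0 < u x) -> smooth_fun J th u -> smooth_fun J th (fun x => u x `^ a)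
| smooth_sin : smooth_fun J th (fun x => sin (th x))
| smooth_cos : smooth_fun J th (fun x => cos (th x)).

Variables (J : set R) (th dth : R -> R).
Hypothesis sdth : smooth_fun J th dth.
Hypothesis dthP : forall x, J x -> is_derive x (1 : R) th (dth x).
Notation sf := (smooth_fun J th).

Lemma smooth_fun_derive u : sf u ->
  exists2 du, sf du & forall x, J x -> is_derive x (1 : R) u (du x).
Proof.
elim=> {u} [c||u v su [du sdu du1] sv [dv sdv dv1]|u v su [du sdu du1] sv [dv sdv dv1]|
  u u0 su [du sdu du1]|a u u0 su [du sdu du1]||].
- by exists (fun _ => 0); [exact: smooth_cst | move=> x _; exact: is_derive_cst].
- by exists (fun _ => 1); [exact: smooth_cst | move=> x _; exact: is_derive_id].
- exists (fun x => du x + dv x); first exact: smooth_add.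
  by move=> x Jx; exact: is_deriveD (du1 x Jx) (dv1 x Jx).
- exists (fun x => u x * dv x + v x * du x).
    by apply: smooth_add; apply: smooth_mul.
  by move=> x Jx; exact: is_deriveM (du1 x Jx) (dv1 x Jx).
- exists (fun x => -1 * (u x)^-1 * (u x)^-1 * du x).
    by do ![apply: smooth_mul => //]; [exact: smooth_cst | exact: smooth_inv | exact: smooth_inv].
  move=> x Jx; apply: (derive_as (is_deriveV (u0 x Jx) (du1 x Jx))).
  by rewrite /GRing.scale /= -exprVn; ring.
- exists (fun x => a * u x `^ (a - 1) * du x).
    by do ![apply: smooth_mul => //]; [exact: smooth_cst | exact: smooth_pow].
  move=> x Jx.
  exact: (@is_derive1_comp R ((@powR R)^~ a) u x _ _ (is_derive1_powR a (u0 x Jx)) (du1 x Jx)).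
- exists (fun x => cos (th x) * dth x).
    by apply: smooth_mul => //; exact: smooth_cos.
  move=> x Jx; exact: (@is_derive1_comp R sin th x _ _ (is_derive_sin _) (dthP Jx)).
- exists (fun x => -1 * sin (th x) * dth x).
    by do ![apply: smooth_mul => //]; [exact: smooth_cst | exact: smooth_sin].
  move=> x Jx; apply: (derive_as (@is_derive1_comp R cos th x _ _ (is_derive_cos _) (dthP Jx))).
  by ring.
Qed.

Variables (V W : normedModType R) (U : set V) (xt yt : V -> R) (w1 w2 : W).
Hypotheses (oU : open U) (UJ : forall z, U z -> J (xt z)).
Hypotheses (dx : forall z, is_diff z xt xt) (dy : forall z, is_diff z yt yt).

Lemma is_diff_shape (L dL : V -> W) (a b c : R -> R) (da db dc : R) z : is_diff z L dL -> 
  is_derive (xt z) (1 : R) a da -> is_derive (xt z) (1 : R) b db -> is_derive (xt z) (1 : R) c dc ->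
  is_diff z (fun z => L z + (a (xt z) *: w1 + (b (xt z) + yt z * c (xt z)) *: w2))
   (fun v => dL v + ((xt v * da) *: w1 + (xt v * db + (yt z * (xt v * dc) + yt v * c (xt z))) *: w2)).
Proof.
move=> hL ha hb hc.
have comp (u : R -> R) du : is_derive (xt z) (1 : R) u du -> is_diff z (fun z => u (xt z)) (fun v => xt v * du).
  by move=> /is_diff_of_derive d; exact: (@is_diff_comp R V R R xt _ u _ z (dx z) d).
have hy := is_diffM (dy z) (comp _ _ hc).
have h2 := is_diffD (comp _ _ hb) hy.
have h := is_diffD hL (is_diffD (is_diff_scalel w1 (comp _ _ ha)) (is_diff_scalel w2 h2)).
apply: is_diff_eq h _; apply/funext => v.
by rewrite !fctE /GRing.scale /=; congr (_ + (_ + _ *: _)); congr (_ + (_ + _)); rewrite mulrC.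
Qed.

(** A directional derivative of such a map has the same shape, with [L] replaced by a constant and
    new coefficients in the class; this is the invariant of the induction on the order. *)
Lemma smooth_shape (L : V -> W) (a b c : R -> R) : (forall z, is_diff z L L) -> sf a -> sf b -> sf c ->
  smooth U (fun z => L z + (a (xt z) *: w1 + (b (xt z) + yt z * c (xt z)) *: w2)).
Proof.
move=> dL sa sb sc k.
suff S (f : V -> W) (a' b' c' : R -> R) (L' dL' : V -> W) : (forall z, is_diff z L' dL') -> sf a' -> sf b' -> sf c' ->
    (forall z, U z -> f z = L' z + (a' (xt z) *: w1 + (b' (xt z) + yt z * c' (xt z)) *: w2)) -> Ck k U f.
  exact: S dL sa sb sc (fun _ _ => erefl).
elim: k f a' b' c' L' dL' => [|k IH] f a' b' c' L' dL' dLL sa' sb' sc' fE.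
all: have [da sda da1] := smooth_fun_derive sa'; have [db sdb db1] := smooth_fun_derive sb';
  have [dc sdc dc1] := smooth_fun_derive sc'.
all: have D z : U z -> differentiable f z /\ ('d f z = (fun v => dL' v + ((xt v * da (xt z)) *: w1 +
    (xt v * db (xt z) + (yt z * (xt v * dc (xt z)) + yt v * c' (xt z))) *: w2)) :> (V -> W)).
1, 3: move=> Uz; have Jz := UJ Uz; have [d1 d2] := is_diff_shape (dLL z) (da1 _ Jz) (db1 _ Jz) (dc1 _ Jz).
1, 2: have nf : \forall y \near z, L' y + (a' (xt y) *: w1 + (b' (xt y) + yt y * c' (xt y)) *: w2) = f y.
1, 3: by apply: filterS (open_nbhs_nbhs (conj oU Uz)) => y Uy; rewrite fE.
1, 2: by have [e1 e2] := near_eq_diff nf d1; rewrite e2 d2.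
- by move=> z Uz; apply: differentiable_continuous; have [] := D z Uz.
- split=> [z Uz|v]; first by have [] := D z Uz.
  apply: (IH _ (fun x => xt v * da x) (fun x => xt v * db x + yt v * c' x) (fun x => xt v * dc x)
    (cst (dL' v)) (fun _ => 0)).
  + by apply: smooth_mul => //; exact: smooth_cst.
  + by apply: smooth_add; apply: smooth_mul => //; exact: smooth_cst.
  + by apply: smooth_mul => //; exact: smooth_cst.
  + move=> z Uz; have [_ ->] := D z Uz; congr (_ + (_ + _ *: _)).
    by ring.
Qed.

End SmoothFun.

(** * Embedding the body into a cylinder *)

(** A completion of [c] to a basis is corrected by the shear [1 + N] with [N] of square 0: it turns
    the first covector into [b] and leaves [c] in place. *)
Lemma dual_basis (F : fieldType) n (b c : 'cV[F]_n.+1) : b^T *m c = 1%:M ->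
  exists P Q : 'M[F]_n.+1, [/\ P *m Q = 1%:M, row ord0 P = b^T & col ord0 Q = c].
Proof.
move=> bc; pose e : 'rV[F]_n.+1 := delta_mx 0 ord0.
have ee : e *m e^T = 1%:M by rewrite trmx_delta mul_delta_mx; apply/matrixP => i j; rewrite !ord1 !mxE.
have c0 : c^T != 0.
  apply/eqP => cz; have : c^T^T = 0 by rewrite cz trmx0.
  rewrite trmxK => cz'; move: bc; rewrite cz' mulmx0 => /matrixP/(_ 0 0) /eqP.
  by rewrite !mxE eq_sym oner_eq0.
have ef : e *m (e^T *m c^T) = c^T by rewrite mulmxA ee mul1mx.
have [|g ug eg] := @complete_unitmx F 1 n.+1 e (e^T *m c^T).
  by rewrite ef rank_rV c0 mxrank_delta.
rewrite ef in eg.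
have ge : g^T *m e^T = c by rewrite -trmx_mul -eg trmxK.
pose b' := b^T *m g^T; pose N := e^T *m (b' - e).
have be : b' *m e^T = 1%:M by rewrite -mulmxA ge.
have Ne : N *m e^T = 0 by rewrite -mulmxA mulmxBl be ee subrr mulmx0.
have eN : e *m N = b' - e by rewrite mulmxA ee mul1mx.
have NN : N *m N = 0 by rewrite [in X in _ *m X]/N mulmxA Ne mul0mx.
have ug' : g^T \in unitmx by rewrite unitmx_tr.
exists ((1%:M + N) *m invmx g^T), (g^T *m (1%:M - N)); split.
- rewrite -mulmxA (mulmxA (invmx _)) mulVmx // mul1mx mulmxBr mulmx1 mulmxDl mul1mx NN addr0.
  by rewrite addrK.
- by rewrite rowE -/e mulmxA mulmxDr mulmx1 eN addrC subrK -mulmxA mulmxV // mulmx1.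
- have ce : delta_mx ord0 0 = e^T :> 'cV_n.+1 by rewrite trmx_delta.
  by rewrite colE ce -mulmxA mulmxBl mul1mx Ne subr0.
Qed.

Section Linear.
Context {R : realType} {n : nat}.
Local Notation E := (phase R n.+1).
Variables (P Q : 'M[R]_n.+1).
Hypothesis PQ : P *m Q = 1%:M.

Definition lin_symp (z : E) : E := (P *m z.1, Q^T *m z.2).

Lemma pcoord_lin_symp z b i : pcoord (lin_symp z) b i = lpform P Q^T b z i.
Proof. by case: b. Qed.

Lemma omega_lin_symp u v : omega (lin_symp u) (lin_symp v) = omega u v.
Proof.
have W (u' v' : E) : omega u' v' = (u'.1^T *m v'.2) ord0 ord0 - (v'.1^T *m u'.2) ord0 ord0.
  rewrite /omega !mxE -sumrB; apply: eq_bigr => j _; rewrite !mxE; congr (_ - _).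
  by rewrite mulrC.
have QP := mulmx1C PQ.
have h (x y : 'cV[R]_n.+1) : (P *m x)^T *m (Q^T *m y) = x^T *m y.
  by rewrite trmx_mul -mulmxA (mulmxA P^T) -trmx_mul QP trmx1 mul1mx.
by rewrite !W /lin_symp /= !h.
Qed.

Lemma lin_symp_inj : injective lin_symp.
Proof.
move=> [x y] [x' y'] [e1 e2]; have QP := mulmx1C PQ; congr (_, _).
  by rewrite -(mul1mx x) -QP -mulmxA e1 mulmxA QP mul1mx.
have PQt : P^T *m Q^T = 1%:M by rewrite -trmx_mul QP trmx1.
by rewrite -(mul1mx y) -PQt -mulmxA e2 mulmxA PQt mul1mx.
Qed.

Lemma is_diff_lin_symp z : is_diff z lin_symp lin_symp.
Proof.
have lin : linear lin_symp by move=> a [x y] [x' y']; rewrite /lin_symp /= !mulmxDr -!scalemxAr.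
pose L := GRing.isLinear.Build _ _ _ _ lin_symp lin.
pose f : {linear E -> E} := HB.pack lin_symp L.
have cf : continuous f.
  apply: continuous_phase => b i; rewrite (_ : (fun _ => _) = fun z => lpform P Q^T b z i).
    exact: lpform_continuous.
  by apply/funext => w; rewrite pcoord_lin_symp.
apply: DiffDef; first exact: (linear_differentiable z cf).
exact: (diff_lin z cf).
Qed.

Let w1 : E := eb false ord0.
Let w2 : E := eb true ord0.

Lemma omega_shear (u v : E) (a1 b1 a2 b2 : R) :
  omega (u + (a1 *: w1 + b1 *: w2)) (v + (a2 *: w1 + b2 *: w2)) = omega u v
  - a2 * pcoord u true ord0 + b2 * pcoord u false ord0
  + a1 * pcoord v true ord0 - b1 * pcoord v false ord0 + a1 * b2 - b1 * a2.
Proof.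
have e1 (z : E) : omega z w1 = - pcoord z true ord0.
  rewrite /omega (bigD1 ord0) //= big1 => [|j j0]; rewrite /w1 /eb /= !mxE ?eqxx ?(negbTE j0) /=.
    by rewrite mulr0 mulr1 addr0 sub0r.
  by rewrite !mulr0 subrr.
have e2 (z : E) : omega z w2 = pcoord z false ord0.
  rewrite /omega (bigD1 ord0) //= big1 => [|j j0]; rewrite /w2 /eb /= !mxE ?eqxx ?(negbTE j0) /=.
    by rewrite mulr0 mulr1 addr0 subr0.
  by rewrite !mulr0 subrr.
have e3 : pcoord w1 true ord0 = 0 by rewrite /pcoord /w1 /eb /= mxE.
have e4 : pcoord w1 false ord0 = 1 by rewrite /pcoord /w1 /eb /= !mxE eqxx.
have e5 : pcoord w2 true ord0 = 1 by rewrite /pcoord /w2 /eb /= !mxE eqxx.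
have e6 : pcoord w2 false ord0 = 0 by rewrite /pcoord /w2 /eb /= mxE.
have f1 (z : E) : omega w1 z = pcoord z true ord0 by rewrite omega_antisym e1 opprK.
have f2 (z : E) : omega w2 z = - pcoord z false ord0 by rewrite omega_antisym e2.
rewrite !omegaDl !omegaDr !omegaZl !omegaZr !e1 !e2 !f1 !f2 e3 e4 e5 e6.
by ring.
Qed.

Variables (p M e d r : R) (W : R -> R).
Hypotheses (hp : 2 <= p) (M0 : 0 < M) (e0 : 0 < e) (d0 : 0 < d) (r0 : 0 < r).
Let p0 : 0 < p := p_gt0 hp.
Local Notation h := (height p M e d).
Local Notation arg := (height_arg p e d).
Let J := [set x : R | 0 < h x].
Variable th : R -> R.
Hypothesis thP : forall x, 0 < h x -> - (pi / 2) < th x < pi / 2 /\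
     is_derive x (1 : R) th (h x / (r ^+ 2 * cos (th x) ^+ 2)).
Hypothesis th_inj : forall x y, 0 < h x -> 0 < h y -> th x = th y -> x = y.

Local Notation xt := (fun z : E => lpform P Q^T false z ord0).
Local Notation yt := (fun z : E => lpform P Q^T true z ord0).

(** On the domain this is [r cos (th x)] divided by [height], the reciprocal of the derivative of
    [r sin (th x)]. A power of [height_arg] is used because the maximum in [height] is outside the
    class [smooth_fun]. *)
Definition stretch (x : R) : R := r * cos (th x) * (M * arg x `^ (- p^-1)).

(** The first position becomes [r sin (th x)] and the first momentum is multiplied by [stretch]; the
    terms [-1] remove the coordinates that [lin_symp] already contributes. The layout, with its
    summand 0, matches [smooth_shape]. *)
Definition cyl_map (z : E) : E := lin_symp z +
  ((r * sin (th (xt z)) + -1 * xt z) *: w1 + (0 + yt z * (stretch (xt z) + -1)) *: w2).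

Definition cyl_dom : set E := [set z | `|yt z| < h (xt z)].

Let dom_pos z : cyl_dom z -> 0 < h (xt z).
Proof. by apply: le_lt_trans. Qed.

Let cos_pos x : 0 < h x -> 0 < cos (th x).
Proof. by move=> /thP [t _]; exact: cos_gt0_pihalf. Qed.

Let arg_pos x : 0 < h x -> 0 < arg x.
Proof. by rewrite height_gt0. Qed.

Lemma stretchE x : 0 < h x -> stretch x * h x = r * cos (th x).
Proof.
move=> hx; have a0 := arg_pos hx; rewrite (@height_pos R p M e d x a0) /stretch powRN.
by field; rewrite !gt_eqF // powR_gt0.
Qed.

Lemma stretch_gt0 x : 0 < h x -> 0 < stretch x.
Proof.
by move=> hx; rewrite !mulr_gt0 ?cos_pos ?powR_gt0 ?arg_pos.
Qed.

Lemma cyl_coord0 z : pcoord (cyl_map z) false ord0 = r * sin (th (xt z)).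
Proof.
rewrite /cyl_map !pcoordD !pcoordZ pcoord_lin_symp {2}/pcoord /w1 /w2 /eb /= !mxE eqxx /=.
by ring.
Qed.

Lemma cyl_coord1 z : pcoord (cyl_map z) true ord0 = yt z * stretch (xt z).
Proof.
rewrite /cyl_map !pcoordD !pcoordZ pcoord_lin_symp {2}/pcoord /w1 /w2 /eb /= !mxE eqxx /=.
by ring.
Qed.

Lemma cyl_dom_open : open cyl_dom.
Proof.
have cx : continuous (fun z : E => h (xt z)).
  apply: (@cont_comp E R R h xt); [exact: lpform_continuous | exact: cont_profile].
have cy : continuous (fun z : E => `|yt z|).
  by apply: (@cont_comp E R R Num.norm yt); [exact: lpform_continuous | exact: norm_continuous].
rewrite (_ : cyl_dom = (fun z => h (xt z) - `|yt z|) @^-1` [set x | 0 < x]).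
  apply: open_comp; last exact: open_gt.
  by move=> z _; exact: (cont_sub cx cy).
by apply/seteqP; split => z /=; rewrite subr_gt0.
Qed.

Lemma cyl_sub : cyl_map @` cyl_dom `<=` cylinder r.
Proof.
move=> _ [z Oz <-]; rewrite /cylinder /=; have hx := dom_pos Oz.
have -> : (cyl_map z).1 ord0 ord0 = r * sin (th (xt z)) := cyl_coord0 z.
have -> : (cyl_map z).2 ord0 ord0 = yt z * stretch (xt z) := cyl_coord1 z.
have s0 := stretch_gt0 hx.
have lt : `|yt z * stretch (xt z)| < r * cos (th (xt z)).
  by rewrite -stretchE // normrM (gtr0_norm s0) mulrC ltr_pM2l.
have : `|yt z * stretch (xt z)| ^+ 2 < (r * cos (th (xt z))) ^+ 2.
  by rewrite ltrXn2r ?nnegrE // (le_trans _ (ltW lt)).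
rewrite real_normK ?num_real // !exprMn => h1.
rewrite -[ltRHS]mulr1 -(cos2Dsin2 (th (xt z))) mulrDr addrC ltrD2r.
exact: h1.
Qed.

Lemma cyl_inj z w : cyl_dom z -> cyl_dom w -> cyl_map z = cyl_map w -> z = w.
Proof.
move=> Oz Ow eq; have hz := dom_pos Oz; have hw := dom_pos Ow.
have ex : xt z = xt w.
  apply: (th_inj hz hw); have [tz _] := thP hz; have [tw _] := thP hw.
  have := cyl_coord0 z; rewrite eq cyl_coord0 => /(mulfI (lt0r_neq0 r0)) /esym.
  by apply: sin_inj; rewrite in_itv /=; [move: tz | move: tw] => /andP[/ltW -> /ltW ->].
have e1 : yt w * stretch (xt w) = yt z * stretch (xt z).
  exact: (etrans (esym (cyl_coord1 w)) (etrans (congr1 (fun u => pcoord u true ord0) (esym eq)) (cyl_coord1 z))).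
have ey : yt z = yt w.
  apply: (mulIf (lt0r_neq0 (stretch_gt0 hw))).
  exact: (etrans (congr1 (fun x => yt z * stretch x) (esym ex)) (esym e1)).
pose F (x y : R) := (r * sin (th x) + -1 * x) *: w1 + (0 + y * (stretch x + -1)) *: w2.
have eqF : F (xt z) (yt z) = F (xt w) (yt w) := f_equal2 F ex ey.
apply: lin_symp_inj; apply: (addIr (F (xt w) (yt w))).
exact: (etrans (congr1 (+%R (lin_symp z)) (esym eqF)) eq).
Qed.

Let sf := smooth_fun J th.

Let sf_arg : sf arg.
Proof.
rewrite (_ : arg = fun x => (1 + e) + -1 * (x * x + d) `^ (p / 2)); last first.
  by apply/funext => x; rewrite /height_arg expr2 mulN1r.
apply: smooth_add; first exact: smooth_cst.
apply: smooth_mul; first exact: smooth_cst.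
apply: smooth_pow => [x _|]; first by rewrite ltr_wpDl // -expr2 sqr_ge0.
by apply: smooth_add; [apply: smooth_mul; exact: smooth_id | exact: smooth_cst].
Qed.

Let argJ x : J x -> 0 < arg x. Proof. exact: arg_pos. Qed.

Let sf_stretch : sf (fun x => stretch x + -1).
Proof.
apply: smooth_add; last exact: smooth_cst.
apply: smooth_mul; first by apply: smooth_mul; [exact: smooth_cst | exact: smooth_cos].
by apply: smooth_mul; [exact: smooth_cst | exact: smooth_pow].
Qed.

Let sf_sin : sf (fun x => r * sin (th x) + -1 * x).
Proof.
by apply: smooth_add; apply: smooth_mul; [exact: smooth_cst | exact: smooth_sin | exact: smooth_cst | exact: smooth_id].
Qed.

Let dth x := arg x `^ p^-1 * M^-1 * (r ^+ 2 * (cos (th x) * cos (th x)))^-1.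

Let sf_dth : sf dth.
Proof.
apply: smooth_mul; first by apply: smooth_mul; [exact: smooth_pow | exact: smooth_cst].
apply: smooth_inv => [x Jx|].
  by rewrite !mulf_neq0 ?expf_neq0 ?gt_eqF // cos_pos.
by apply: smooth_mul; [exact: smooth_cst | apply: smooth_mul; exact: smooth_cos].
Qed.

Let dthP x : J x -> is_derive x (1 : R) th (dth x).
Proof. by move=> Jx; have [_ D] := thP Jx; apply: (derive_as D); rewrite /dth -(expr2 (cos (th x))) (@height_pos R p M e d x (argJ Jx)). Qed.

Lemma cyl_smooth : smooth cyl_dom cyl_map.
Proof.
apply: (@smooth_shape R J th dth sf_dth dthP E E cyl_dom xt yt w1 w2 cyl_dom_open dom_pos _ _ lin_symp
  (fun x => r * sin (th x) + -1 * x) (fun _ => 0) (fun x => stretch x + -1)).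
- exact: is_diff_lpform.
- exact: is_diff_lpform.
- exact: is_diff_lin_symp.
- exact: sf_sin.
- exact: smooth_cst.
- exact: sf_stretch.
Qed.

Lemma cyl_symp z : cyl_dom z -> symp_map ('d cyl_map z).
Proof.
move=> Oz; have hx := dom_pos Oz; have [tz Dth] := thP hx; have c0 := cos_pos hx.
have [dc _ dcP] := smooth_fun_derive sf_dth dthP sf_stretch.
have Da : is_derive (xt z) (1 : R) (fun x => r * sin (th x) + -1 * x) ((stretch (xt z))^-1 - 1).
  have h1 := @is_derive1_comp R sin th (xt z) _ _ (is_derive_sin _) Dth.
  apply: (derive_as (is_deriveD (is_deriveZ r h1) (is_deriveZ (-1 : R) (is_derive_id (xt z) (1 : R))))).
  have pure (s k c : R) : 0 < s -> 0 < c -> s * k = r * c -> r * (c * (k / (r ^+ 2 * c ^+ 2))) = s^-1.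
    move=> sp cp E; have -> : k = r * c / s by rewrite -E mulrAC divff ?mul1r ?gt_eqF.
    by field; rewrite !gt_eqF.
  rewrite /GRing.scale /= mulr1; congr (_ - _).
  exact: (pure _ _ _ (stretch_gt0 hx) c0 (stretchE hx)).
have D := @is_diff_shape R E E xt yt w1 w2 (is_diff_lpform P Q^T false ord0) (is_diff_lpform P Q^T true ord0)
  lin_symp lin_symp _ (fun _ => 0) _ _ 0 _ z (is_diff_lin_symp z) Da (is_derive_cst 0 (xt z) (1 : R)) (dcP _ hx).
have [_ dE0] := D; have dE : 'd cyl_map z = _ :> (E -> E) := dE0.
move=> u v; rewrite dE omega_shear omega_lin_symp !pcoord_lin_symp.
have s0 := stretch_gt0 hx.
rewrite -[RHS]addr0 -!addrA; congr (_ + _); rewrite !addrA.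
by field; rewrite gt_eqF.
Qed.

Lemma cyl_embedding : symplectic_embedding cyl_dom cyl_map.
Proof.
pose psi w := xget 0 [set z | cyl_dom z /\ cyl_map z = w].
have psiK z : cyl_dom z -> psi (cyl_map z) = z.
  move=> Oz; rewrite /psi; case: xgetP => [x _ [Ox E]|/(_ z)]; first exact: cyl_inj.
  by case; split.
have dphi z : cyl_dom z -> differentiable cyl_map z by have [h1 _] := cyl_smooth 1; exact: h1.
split; [exact: cyl_dom_open | exact: cyl_smooth | by move=> z Oz u v; exact: cyl_symp | exists psi; split => //].
apply: continuous_in_subspaceT => w; rewrite inE => -[z Oz <-].
exact: (inverse_continuous cyl_dom_open dphi cyl_symp psiK Oz).
Qed.

End Linear.

Section CylinderCapacity.
Context {R : realType} {n : nat}.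
Local Notation E := (phase R n.+1).
Variables (p q : R) (B D : 'M[R]_n.+1).
Hypotheses (hp : 2 <= p) (hq : q = p / (p - 1)) (uB : B \in unitmx) (uD : D \in unitmx).
Let p0 : 0 < p := p_gt0 hp.
Local Notation K := (Kp p B D).
Local Notation C := (B *m D^T).
Local Notation M := (opnorm q p C).

Let uC : C \in unitmx. Proof. by rewrite unitmx_mul uB unitmx_tr. Qed.
Let M0 : 0 < M. Proof. by have [] := opnorm_attained hp hq uC. Qed.

(** The covectors [B^T dpow u] and [D^T dpow v / M] pair to 1, as conjugate coordinates require. The
    estimate is Hoelder's inequality, since [dpow u] and [dpow v] have unit [l_q] norm. *)
Lemma optimal_coordinates : exists P Q : 'M[R]_n.+1, P *m Q = 1%:M /\
  forall z, `|lpform P Q^T false z ord0| `^ p + (M * `|lpform P Q^T true z ord0|) `^ p <= gauge p B D z.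
Proof.
have [u [v [_ [u1 v1 Cv _ _]]]] := dual_maximisers hp hq uC.
pose eta : 'cV[R]_n.+1 := \col_i dpow p (u i); pose xi : 'cV[R]_n.+1 := \col_i dpow p (v i).
have q0 := q_gt0 hp hq; have pq := conj_pq hp hq.
have etaC : (eta^T *m (C *m xi)) 0 0 = M.
  rewrite mxE (eq_bigr (fun i => M * `|u i| `^ p)) => [|i _]; first by rewrite -mulr_sumr u1 mulr1.
  rewrite !mxE (_ : \sum_j _ = M * u i); last first.
    by rewrite -Cv; apply: eq_bigr => j _; rewrite !mxE.
  by rewrite mulrCA [_ * u i]mulrC mul_dpow.
have Mn : M != 0 by rewrite gt_eqF.
have bc : (B^T *m eta)^T *m (M^-1 *: (D^T *m xi)) = 1%:M.
  apply/matrixP => i j; rewrite !ord1 trmx_mul trmxK -scalemxAr [LHS]mxE -mulmxA (mulmxA B) etaC.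
  by rewrite mulVf // mxE eqxx.
have [P [Q [PQ rP cQ]]] := dual_basis bc; exists P, Q; split => // z.
have xE : lpform P Q^T false z ord0 = \sum_i (B *m z.1) i 0 * dpow p (u i).
  rewrite /lpform (_ : (P *m z.1) ord0 ord0 = (row ord0 P *m z.1) ord0 ord0); last first.
    by rewrite -row_mul [RHS]mxE.
  rewrite rP trmx_mul trmxK -mulmxA mxE; apply: eq_bigr => i _.
  by rewrite !mxE mulrC.
have yE : M * lpform P Q^T true z ord0 = \sum_i (D *m z.2) i 0 * dpow p (v i).
  rewrite /lpform (_ : (Q^T *m z.2) ord0 ord0 = ((col ord0 Q)^T *m z.2) ord0 ord0); last first.
    by rewrite tr_col -row_mul [RHS]mxE.
  rewrite cQ linearZ /= -scalemxAl [in LHS]mxE mulrA divff // mul1r trmx_mul trmxK -mulmxA mxE.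
  by apply: eq_bigr => i _; rewrite !mxE mulrC.
have bound (a w : 'I_n.+1 -> R) : \sum_i `|w i| `^ p = 1 ->
    `|\sum_i a i * dpow p (w i)| `^ p <= \sum_i `|a i| `^ p.
  move=> w1; have S0 : 0 <= \sum_i `|a i| `^ p by apply: sumr_ge0 => i _; exact: powR_ge0.
  have wq : \sum_i `|dpow p (w i)| `^ q = 1.
    by rewrite -w1; apply: eq_bigr => i _; rewrite dpow_norm_q.
  have h (b : 'I_n.+1 -> R) : (forall i, `|b i| = `|a i|) ->
      \sum_i b i * dpow p (w i) <= (\sum_i `|a i| `^ p) `^ p^-1.
    move=> ba; apply: (le_trans (hoelder_sum b (fun i => dpow p (w i)) p0 q0 pq)).
    by rewrite wq powR1 mulr1 (eq_bigr (fun i => `|a i| `^ p)) // => i _; rewrite ba.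
  have hn : `|\sum_i a i * dpow p (w i)| <= (\sum_i `|a i| `^ p) `^ p^-1.
    rewrite ler_norml h // andbT lerNl -sumrN.
    rewrite (eq_bigr (fun i => - a i * dpow p (w i))) => [|i _]; last by rewrite mulNr.
    by apply: h => i; rewrite normrN.
  apply: (@le_trans _ _ (((\sum_i `|a i| `^ p) `^ p^-1) `^ p)).
    by rewrite ge0_ler_powR ?nnegrE ?powR_ge0 ?(ltW p0).
  by rewrite -powRrM mulVf ?gt_eqF // powRr1.
rewrite /gauge big_bool addrC lerD //.
  by rewrite -{1}(gtr0_norm M0) -normrM yE; exact: bound.
by rewrite xE; exact: bound.
Qed.

Lemma cylinder_embedding (eps : R) : 0 < eps -> exists (r : R) (U : set E) (phi : E -> E),
  [/\ 0 < r, K `<=` U, symplectic_embedding U phi, phi @` U `<=` cylinder r &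
      pi * r ^+ 2 <= 2 * half_area p / M + eps].
Proof.
move=> eps0; have pi0 := @pi_gt0 R.
have k0 : 0 <= half_area p / M.
  by rewrite divr_ge0 ?(ltW M0) //; apply: Rintegral_ge0 => s _; exact: wcirc_ge0.
pose k := half_area p / M; pose e := eps / (4 * k + 1).
have k1 : 0 < 4 * k + 1 by rewrite ltr_wpDl // mulr_ge0.
have e0 : 0 < e by rewrite divr_gt0.
have ke : 4 * k * e <= eps.
  by rewrite /e mulrA ler_pdivrMr // mulrC ler_pM2l // lerDl.
(* The enlarged region has area at most [2 (1 + e) k]; the extra [eps / 2] makes the disc strictly
   larger, and [4 k e <= eps] keeps the total within [2 k + eps]. *)
pose a := 2 * (1 + e) * k + eps / 2.
have a0 : 0 < a.
  by rewrite ltr_wpDl ?divr_gt0 // mulr_ge0 // mulr_ge0 // addr_ge0 // ltW.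
pose r := Num.sqrt (a / pi); have r2 : pi * r ^+ 2 = a.
  by rewrite sqr_sqrtr ?divr_ge0 ?(ltW a0) ?(ltW pi0) // mulrC divfK // gt_eqF.
have r0 : 0 < r by rewrite sqrtr_gt0 divr_gt0.
have [d d0 dP] := height_smoothing hp e0.
have [W dW] := primitive_ex (@cont_profile R p M e d hp d0).
have area : W (height_rad p e) - W (- height_rad p e) < pi * r ^+ 2 / 2.
  rewrite r2; apply: le_lt_trans (height_area hp M0 e0 d0 dW) _.
  have rad2 : height_rad p e ^+ 2 <= 1 + e.
    have e1 : 1 <= 1 + e by rewrite lerDl ltW.
    rewrite /height_rad -powR_mulrn ?powR_ge0 // -powRrM -[leRHS]powRr1 ?(le_trans ler01) //.
    by apply: ler_powR => //; rewrite mulrC ler_pdivrMr // mul1r.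
  rewrite -mulrA -/k; have : height_rad p e ^+ 2 * k <= (1 + e) * k by rewrite ler_wpM2r.
  move=> h; apply: (le_lt_trans h).
  by rewrite (_ : a / 2 = (1 + e) * k + eps / 4) ?ltrDl ?divr_gt0 // /a; field.
have h0 x : 0 <= height p M e d x by exact: height_ge0.
have h1 x : 0 < height p M e d x -> `|x| < height_rad p e by exact: height_lt_rad.
have h2 x y c : 0 < height p M e d x -> 0 < height p M e d y -> x <= c <= y -> 0 < height p M e d c.
  exact: height_gt0_between.
have [th [thP th_inj]] := angle_ex r0 h0 h1 h2 dW area.
have [P [Q [PQ bd]]] := optimal_coordinates.
have core x y : `|x| `^ p + (M * `|y|) `^ p <= 1 -> `|y| < height p M e d x.
  move=> xy; have x1 : `|x| <= 1.
    rewrite leNgt; apply/negP => h; have : 1 `^ p < `|x| `^ p by rewrite gt0_ltr_powR ?nnegrE.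
    rewrite powR1 ltNge => /negP; apply; apply: le_trans xy; rewrite lerDl; exact: powR_ge0.
  have A := dP x x1; have A0 : 0 < height_arg p e d x.
    apply: le_lt_trans A; rewrite subr_ge0.
    have : `|x| `^ p <= 1 `^ p by rewrite ge0_ler_powR ?nnegrE ?(ltW p0).
    by rewrite powR1.
  have h : (M * `|y|) `^ p < height_arg p e d x.
    by apply: le_lt_trans A; rewrite lerBrDl.
  rewrite (height_pos M A0) ltr_pdivlMr // mulrC.
  rewrite ltNge; apply/negP => h2'.
  have : (height_arg p e d x `^ p^-1) `^ p <= (M * `|y|) `^ p.
    by rewrite ge0_ler_powR ?nnegrE ?powR_ge0 ?mulr_ge0 ?(ltW p0) ?(ltW M0).
  by rewrite -powRrM mulVf ?gt_eqF // powRr1 ?(ltW A0) // leNgt h.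
exists r, (cyl_dom P Q p M e d), (cyl_map P Q p M e d r th); split; first exact: r0.
- by rewrite (KpE _ _ hp) => z Kz; exact: core (le_trans (bd z) Kz).
- exact: cyl_embedding.
- exact: cyl_sub.
- have e1 : 2 * (1 + e) * k = 2 * k + 2^-1 * (4 * k * e) by field.
  rewrite r2 /a e1 -[2 * half_area p / M]mulrA -/k; move: (4 * k * e) ke (2 * k) => t ht s; lra.
Qed.

Lemma cZ_Kp : cZ K = (c0 p / M)%:E.
Proof.
rewrite (c0E hp); apply/eqP; rewrite eq_le; apply/andP; split.
  apply/lee_addgt0Pr => eps eps0; have [r [U [phi [r0 KU sphi im le]]]] := cylinder_embedding eps0.
  apply: (@le_trans _ _ (pi * r ^+ 2)%:E); last by rewrite -EFinD lee_fin.
  by apply: ereal_inf_lbound; exists r => //; split => //; exists U, phi; split.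
apply: le_ereal_inf_tmp => _ [r [r0 [U [phi [KU sphi im]]]] <-]; rewrite lee_fin.
exact: (nonsqueezing hp hq uB uD M0 (opnorm_lp_bound hp hq uC) (lp_bound_tr hp hq uC) sphi KU im r0).
Qed.

End CylinderCapacity.

(** * Comparison with arbitrary normalized capacities *)

Lemma capacity_cylinder_scaled (R : realType) (n : nat) (c : set (phase R n.+1) -> \bar R) (r : R) :
  normalized_capacity c -> 0 < r -> c (cylinder r) = (pi * r ^+ 2)%:E.
Proof.
move=> hc r0; have -> : cylinder r = [set r *: z | z in (cylinder 1 : set (phase R n.+1))].
  apply/seteqP; split => [z|_ [z] zc <-]; rewrite /cylinder /=.
    move=> zr; exists (r^-1 *: z); last by rewrite scalerA divff ?scale1r // gt_eqF.
    rewrite /= !mxE !exprMn -mulrDr exprVn expr1n mulrC ltr_pdivrMr ?exprn_gt0 //.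
    by rewrite mul1r.
  move: zc; rewrite /cylinder /= !mxE !exprMn -mulrDr expr1n => zc.
  by rewrite -[ltRHS]mulr1 ltr_pM2l ?exprn_gt0.
by rewrite (capacity_scale hc) // (capacity_cylinder hc) -EFinM mulrC.
Qed.

Lemma capacity_le_cZ (R : realType) (n : nat) (c : set (phase R n.+1) -> \bar R)
    (K : set (phase R n.+1)) : normalized_capacity c -> (c K <= cZ K)%E.
Proof.
move=> hc; apply: le_ereal_inf_tmp => _ [r [r0 [U [phi [KU sphi im]]]] <-].
rewrite -(capacity_cylinder_scaled hc r0); apply: (capacity_mono hc); exists U, phi; split => //.
by move=> _ [z Kz <-]; apply: im; exists z => //; exact: KU.
Qed.

Theorem theorem2 (R : realType) (n : nat) (p q : R) (B D : 'M[R]_n.+1)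
    (hp : 2 <= p) (hq : q = p / (p - 1))
    (hB : B \in unitmx) (hD : D \in unitmx) :
  [/\ characteristic_actions (Kp p B D) (cEHZ (Kp p B D)),
      cEHZ (Kp p B D) = cZ (Kp p B D),
      cZ (Kp p B D) = (c0 p / opnorm q p (B *m D^T))%:E,
      c0 p / opnorm q p (B *m D^T) =
        4 * Gamma (1 + 1 / p) ^+ 2 /
          (Gamma (1 + 2 / p) * opnorm q p (B *m D^T)) &
      forall c : set (phase R n.+1) -> \bar R, normalized_capacity c ->
        (c (Kp p B D) <= cZ (Kp p B D))%E].
Proof.
have [act cE] := characteristic_cEHZ hp hq hB hD.
have cz := cZ_Kp hp hq hB hD.
have [G0 GE] := c0_Gamma hp.
split.
- exact: act.
- by rewrite cE cz (c0E hp).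
- exact: cz.
- by rewrite -GE invfM mulrA mulfK // gt_eqF.
- by move=> c hc; exact: capacity_le_cZ.
Qed.
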